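(* There are implicit constants, independent of $T\in(0,1]$, $M_0\ge1$, $a\in[0,T)$ and all functions involved, such that the following hold for functions on $[0,T)\times\mathbb{T}^4$, with all norms $X^s,Y^s$ taken on $[0,T)$. High frequency estimate: $$\Big|\int_0^T\!\!\int_{\mathbb{T}^4}u_1u_2u_3\,g\,dx\,dt\Big|\lesssim\|u_1\|_{Y^{1}}\|u_2\|_{Y^1}\|u_3\|_{Y^1}\|g\|_{Y^{-1}}.$$ Low frequency estimate: $$\Big|\int_0^T\!\!\int_{\mathbb{T}^4}u_1(P_{\le M_0}u_2)u_3\,g\,dx\,dt\Big|\lesssim T^{\frac17}M_0^{\frac35}\|u_1\|_{Y^{1}}\|P_{\le M_0}u_2\|_{Y^1}\|u_3\|_{Y^1}\|g\|_{Y^{-1}}.$$ In other words, $$\Big\|\int_a^te^{i(t-s)\Delta}(u_1u_2u_3)(s)\,ds\Big\|_{X^{1}([0,T))}\lesssim\|u_1\|_{Y^{1}}\Big(T^{\frac17}M_0^{\frac35}\|P_{\le M_0}u_2\|_{Y^1}+\|P_{>M_0}u_2\|_{Y^1}\Big)\|u_3\|_{Y^1}$$ and $$\Big\|\int_a^te^{i(t-s)\Delta}(u_1u_2u_3)(s)\,ds\Big\|_{X^{1}([0,T))}\lesssim\|u_1\|_{Y^{1}}\|u_2\|_{Y^1}\|u_3\|_{Y^1}.$$ Moreover, if $u_j=e^{it\Delta}f_j$ for some $j$, then the $Y^s$ norm of $u_j$ in the last two estimates can be replaced by the $H^s$ norm of $f_j$ (and the norms of $P_{\le M_0}u_2$,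 $P_{>M_0}u_2$ by those of $P_{\le M_0}f_2$, $P_{>M_0}f_2$).
   Context: $P_{\le M}$, $P_{>M}=1-P_{\le M}$ are Littlewood-Paley projections on $\mathbb{T}^4$; $\langle\xi\rangle=(1+|\xi|^2)^{1/2}$. $U^2_t$ and $V^2_t$ (complex-valued functions of time, standard conventions): a $U^2$-atom is a step function $\sum_{k=1}^K\phi_{k-1}1_{[t_{k-1},t_k)}$ for a finite partition $t_0<\dots<t_K\le\infty$ with $\sum|\phi_{k}|^2=1$; $U^2$ is the atomic space of sums $\sum_j\lambda_ja_j$ with norm $\inf\sum_j|\lambda_j|$. $V^2$ consists of right-continuous functions $v$ with $v(-\infty)=0$ and finite norm $\|v\|_{V^2}=\sup(\sum_k|v(t_k)-v(t_{k-1})|^2)^{1/2}$, the supremum over finite partitions (with $v(\infty):=0$). For a time interval $[0,T)$ the norms are the corresponding restriction norms. Then $$\|u\|_{X^s([0,T))}=\Big(\sum_{\xi\in\mathbb{Z}^4}\langle\xi\rangle^{2s}\big\|\widehat{e^{-it\Delta}u(t,\cdot)}(\xi)\big\|_{U^2_t}^2\Big)^{1/2},\qquad \|u\|_{Y^s([0,T))}=\Big(\sum_{\xi\in\mathbb{Z}^4}\langle\xi\rangle^{2s}\big\|\widehat{e^{-it\Delta}u(t,\cdot)}(\xi)\big\|_{V^2_t}^2\Big)^{1/2}.$$ *)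

(* Defs.v *)
From HB Require Import structures.
From mathcomp Require Import all_boot all_order all_algebra.
From mathcomp Require Import all_classical all_reals all_analysis.
From mathcomp Require Import complex.

Set Implicit Arguments.
Unset Strict Implicit.
Unset Printing Implicit Defensive.

Import Order.TTheory GRing.Theory Num.Theory.
Import numFieldNormedType.Exports.

Local Open Scope classical_set_scope.
Local Open Scope ring_scope.
Local Open Scope complex_scope.

(* The torus is (R / 2 pi Z)^4.  A function on it is represented by its values
   on the fundamental box [0, 2 pi)^4 (values elsewhere are never used), and
   dx is Lebesgue measure on that box. *)
Notation pt4 R :=
  (measurableTypeR R * measurableTypeR R
   * measurableTypeR R * measurableTypeR R)%type.
Notation Z4 := (int * int * int * int)%type.

Section ComplexIntegral.
Context {R : realType}.

Definition expi (x : R) : R[i] := cos x +i* sin x.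

Definition cabs (z : R[i]) : R := Normc.normc z.

Definition cmeasurable (d : measure_display) (X : measurableType d)
    (D : set X) (f : X -> R[i]) : Prop :=
  measurable_fun D (fun x => complex.Re (f x)) /\
  measurable_fun D (fun x => complex.Im (f x)).

Definition cintegrable (d : measure_display) (X : measurableType d)
    (mu : {measure set X -> \bar R}) (D : set X) (f : X -> R[i]) : Prop :=
  mu.-integrable D (fun x => (complex.Re (f x))%:E) /\
  mu.-integrable D (fun x => (complex.Im (f x))%:E).

Definition cintegral (d : measure_display) (X : measurableType d)
    (mu : {measure set X -> \bar R}) (D : set X) (f : X -> R[i]) : R[i] :=
  (\int[mu]_(x in D) complex.Re (f x)) +i* (\int[mu]_(x in D) complex.Im (f x)).

(* The oriented integral from a to t, for a <= t or t < a. *)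
Definition cintegral_from_to (a t : R) (f : measurableTypeR R -> R[i]) : R[i] :=
  if a <= t then cintegral lebesgue_measure `[a, t] f
  else - cintegral lebesgue_measure `[t, a] f.

End ComplexIntegral.

Section Torus.
Context {R : realType}.

Definition box : set (pt4 R) :=
  (`[0, 2 * pi[ `*` `[0, 2 * pi[ `*` `[0, 2 * pi[ `*` `[0, 2 * pi[)%classic.

Definition dx4 : {measure set (pt4 R) -> \bar R} :=
  (((@lebesgue_measure R \x @lebesgue_measure R)
    \x @lebesgue_measure R) \x @lebesgue_measure R)%E.

Definition dxdt : {measure set (pt4 R * measurableTypeR R) -> \bar R} :=
  (dx4 \x @lebesgue_measure R)%E.

Definition slab (T : R) : set (pt4 R * measurableTypeR R) :=
  (box `*` `[0, T[)%classic.

Definition dot (x : pt4 R) (xi : Z4) : R :=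
  x.1.1.1 * xi.1.1.1%:~R + x.1.1.2 * xi.1.1.2%:~R
  + x.1.2 * xi.1.2%:~R + x.2 * xi.2%:~R.

Definition sqnorm (xi : Z4) : R :=
  (xi.1.1.1 ^+ 2 + xi.1.1.2 ^+ 2 + xi.1.2 ^+ 2 + xi.2 ^+ 2)%:~R.

Definition japanese (xi : Z4) : R := Num.sqrt (1 + sqnorm xi).

Definition fourier (f : pt4 R -> R[i]) (xi : Z4) : R[i] :=
  (((2 * pi) ^- 4)%:C) * cintegral dx4 box (fun x => f x * expi (- dot x xi)).

(* Distributions on the torus are handled through their Fourier coefficients
   Z4 -> R[i]; [trig w] is the function with coefficients w, for finitely
   supported w. *)
Definition trig (w : Z4 -> R[i]) (x : pt4 R) : R[i] :=
  \sum_(xi \in [set: Z4]) w xi * expi (dot x xi).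

(* Standard smooth profile defining the Littlewood-Paley projections. *)
Definition lp_profile (psi : R -> R) : Prop :=
  [/\ (forall n x, derivable (derive1n n psi) x 1),
      (forall x, psi (- x) = psi x),
      (forall x, 0 <= psi x <= 1),
      (forall x, `|x| <= 1 -> psi x = 1) &
      (forall x, 2 <= `|x| -> psi x = 0)].

Definition Ple (psi : R -> R) (M : R) (w : Z4 -> R[i]) (xi : Z4) : R[i] :=
  (psi (Num.sqrt (sqnorm xi) / M))%:C * w xi.

Definition Pgt (psi : R -> R) (M : R) (w : Z4 -> R[i]) (xi : Z4) : R[i] :=
  w xi - Ple psi M w xi.

Definition Ple_fun (psi : R -> R) (M : R) (f : pt4 R -> R[i]) : pt4 R -> R[i] :=
  trig (Ple psi M (fourier f)).

(* e^{i t Delta} on Fourier coefficients *)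
Definition schrodinger (t : R) (w : Z4 -> R[i]) (xi : Z4) : R[i] :=
  expi (- (t * sqnorm xi)) * w xi.

End Torus.

Section UVSpaces.
Context {R : realType}.

(* t 0 < ... < t K is a partition with t 0 finite and t K <= +oo. *)
Definition is_partition (K : nat) (t : nat -> \bar R) : Prop :=
  [/\ (0 < K)%N, (-oo < t 0%N)%E &
      forall k, (k < K)%N -> (t k < t k.+1)%E].

Definition U2_atom (a : R -> R[i]) : Prop :=
  exists (K : nat) (t : nat -> \bar R) (phi : nat -> R[i]),
    [/\ is_partition K t,
        \sum_(0 <= k < K) cabs (phi k) ^+ 2 = 1 &
        forall s, a s = \sum_(0 <= k < K)
          if ((t k <= s%:E) && (s%:E < t k.+1))%E then phi k else 0].

Definition U2_norm (u : R -> R[i]) : \bar R :=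
  ereal_inf [set c | exists (lam : nat -> R[i]) (a : nat -> R -> R[i]),
    [/\ (forall j, U2_atom (a j)),
        (forall s, cabs (u s - \sum_(0 <= j < n) lam j * a j s)
                     @[n --> \oo] --> (0 : R)) &
        c = (\sum_(0 <= j <oo) (cabs (lam j))%:E)%E]].

Definition ext_oo (v : R -> R[i]) (t : \bar R) : R[i] :=
  if t is s%:E then v s else 0.

Definition V2_norm (v : R -> R[i]) : \bar R :=
  ereal_sup [set c | exists (K : nat) (t : nat -> \bar R),
    is_partition K t /\
    c = (Num.sqrt (\sum_(0 <= k < K)
           cabs (ext_oo v (t k.+1) - ext_oo v (t k)) ^+ 2))%:E].

Definition V2 (v : R -> R[i]) : Prop :=
  [/\ (forall t, cabs (v s - v t) @[s --> t^'+] --> (0 : R)),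
      cabs (v s) @[s --> -oo] --> (0 : R) &
      (V2_norm v < +oo)%E].

(* Restriction norms on [0, T); the value is +oo if there is no extension. *)
Definition U2_norm_on (T : R) (u : R -> R[i]) : \bar R :=
  ereal_inf [set U2_norm v | v in
    [set v | forall t, 0 <= t < T -> v t = u t]].

Definition V2_norm_on (T : R) (u : R -> R[i]) : \bar R :=
  ereal_inf [set V2_norm v | v in
    [set v | V2 v /\ forall t, 0 <= t < T -> v t = u t]].

End UVSpaces.

Section XYSpaces.
Context {R : realType}.
Local Open Scope ereal_scope.

Definition H_norm (s : R) (w : Z4 -> R[i]) : \bar R :=
  (\esum_(xi in [set: Z4])
     ((japanese xi `^ (2 * s))%:E * (cabs (w xi) ^+ 2)%:E)) `^ 2^-1.

Definition X_norm (s T : R) (w : R -> Z4 -> R[i]) : \bar R :=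
  (\esum_(xi in [set: Z4])
     ((japanese xi `^ (2 * s))%:E
      * U2_norm_on T (fun t => schrodinger (- t) (w t) xi) ^+ 2)) `^ 2^-1.

Definition Y_norm (s T : R) (w : R -> Z4 -> R[i]) : \bar R :=
  (\esum_(xi in [set: Z4])
     ((japanese xi `^ (2 * s))%:E
      * V2_norm_on T (fun t => schrodinger (- t) (w t) xi) ^+ 2)) `^ 2^-1.

End XYSpaces.

Section SpaceTime.
Context {R : realType}.

Definition hat (u : R -> pt4 R -> R[i]) : R -> Z4 -> R[i] :=
  fun t => fourier (u t).

Definition spacetime_fun (T : R) (u : R -> pt4 R -> R[i]) : Prop :=
  cmeasurable (slab T) (fun p => u p.2 p.1) /\
  forall t, 0 <= t < T -> cintegrable dx4 box (u t).

Definition spacetime_L2 (T : R) (g : R -> pt4 R -> R[i]) : Prop :=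
  dxdt.-integrable (slab T) (fun p => (cabs (g p.2 p.1) ^+ 2)%:E).

Definition spacetime_integral (T : R) (F : R -> pt4 R -> R[i]) : R[i] :=
  cintegral dxdt (slab T) (fun p => F p.2 p.1).

Definition mul3 (u1 u2 u3 : R -> pt4 R -> R[i]) : R -> pt4 R -> R[i] :=
  fun t x => u1 t x * u2 t x * u3 t x.

(* An element g of Y^{-1} is in general only distribution-valued, so the
   integral of F g is given its two meanings separately:
   - for g given by Fourier coefficients, l is the integral of F g if it is the
     limit of the Lebesgue integrals of F (P_{<= M} g) as M -> +oo;
   - for g an honest square integrable function, l is the Lebesgue integral,
     which is required to converge absolutely. *)
Definition is_pairing (psi : R -> R) (T : R) (F : R -> pt4 R -> R[i])
    (g : R -> Z4 -> R[i]) (l : R[i]) : Prop :=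
  (\forall M \near +oo, cintegrable dxdt (slab T)
     (fun p => F p.2 p.1 * trig (Ple psi M (g p.2)) p.1)) /\
  cabs (spacetime_integral T (fun t x => F t x * trig (Ple psi M (g t)) x) - l)
    @[M --> +oo] --> (0 : R).

Definition is_integral (T : R) (F g : R -> pt4 R -> R[i]) (l : R[i]) : Prop :=
  cintegrable dxdt (slab T) (fun p => F p.2 p.1 * g p.2 p.1) /\
  spacetime_integral T (fun t x => F t x * g t x) = l.

(* Bound B for the integral of F g over [0, T) x torus, for all g in Y^{-1};
   B is multiplied by the Y^{-1} norm of g. *)
Definition dual_bound (psi : R -> R) (T : R) (F : R -> pt4 R -> R[i])
    (B : \bar R) : Prop :=
  (forall g : R -> Z4 -> R[i], (Y_norm (-1) T g < +oo)%E ->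
     exists2 l, is_pairing psi T F g l &
       ((cabs l)%:E <= B * Y_norm (-1) T g)%E) /\
  (forall g : R -> pt4 R -> R[i],
     spacetime_fun T g -> spacetime_L2 T g ->
     (Y_norm (-1) T (hat g) < +oo)%E ->
     exists2 l, is_integral T F g l &
       ((cabs l)%:E <= B * Y_norm (-1) T (hat g))%E).

(* Fourier coefficients of \int_a^t e^{i (t - s) Delta} F(s) ds *)
Definition duhamel (a : R) (F : R -> pt4 R -> R[i]) : R -> Z4 -> R[i] :=
  fun t xi => cintegral_from_to a t (fun s => schrodinger (t - s) (hat F s) xi).

(* u = e^{i t Delta} f on [0, T), with f in H^1 *)
Definition free_solution (T : R) (f : pt4 R -> R[i]) (u : R -> pt4 R -> R[i]) :
    Prop :=
  [/\ cintegrable dx4 box f, (H_norm 1 (fourier f) < +oo)%E &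
      forall t, 0 <= t < T -> hat u t = schrodinger t (fourier f)].

(* [None] : u is measured in Y^1; [Some f] : u = e^{i t Delta} f is measured by
   the H^1 norm of f.  [P] is a projection applied before taking the norm. *)
Definition allowed (T : R) (u : R -> pt4 R -> R[i])
    (d : option (pt4 R -> R[i])) : Prop :=
  if d is Some f then free_solution T f u else (Y_norm 1 T (hat u) < +oo)%E.

Definition size_of (T : R) (u : R -> pt4 R -> R[i])
    (d : option (pt4 R -> R[i])) (P : (Z4 -> R[i]) -> (Z4 -> R[i])) : \bar R :=
  if d is Some f then H_norm 1 (P (fourier f))
  else Y_norm 1 T (fun t => P (hat u t)).

End SpaceTime.

(* Main.v *)
(* After Fourier expansion in space the integral is a limit of Riemann sums over
  the grid of J-th roots of unity in time and space. On such a grid, for J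
  divisible by enough primes, level sets of a free solution are estimated by a
  TT* argument modulo a prime q comparable to the level: Gauss sums bound the
  kernel. This gives the L^4 estimate on cubes without loss, with a gain on
  frequency slabs obtained from a weight averaged along the slab direction;
  almost orthogonality of slabs turns it into a bilinear gain for separated
  frequencies. Splitting time into pieces on which the profiles vary little
  transfers both to V^2 (through control by the cube of the increments), and
  summing dyadically over the four frequencies gives the multilinear bound; the
  low frequency factor comes from interpolation with the trivial sup bound.
  An L^6 estimate of the same kind makes the partial sums converge almost
  everywhere. For the Duhamel term, testing against step functions with values
  D / |D|^(1/2) bounds the 3/2-variation of its profiles, which embeds in U^2. *)
Require Import Defs.
From HB Require Import structures.
From mathcomp Require Import all_boot all_order all_algebra.
From mathcomp Require Import all_classical all_reals all_analysis.
From mathcomp Require Import complex.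
From mathcomp Require Import perm measurable_realfun.
From mathcomp Require Import zify ring lra.

Set Implicit Arguments.
Unset Strict Implicit.
Unset Printing Implicit Defensive.

Import Order.TTheory GRing.Theory Num.Theory.
Import numFieldNormedType.Exports.

Local Open Scope classical_set_scope.
Local Open Scope ring_scope.
Local Open Scope complex_scope.

Local Notation mR := measurableTypeR.
Local Notation o0 := (@Ordinal 4 0 isT).
Local Notation o1 := (@Ordinal 4 1 isT).
Local Notation o2 := (@Ordinal 4 2 isT).
Local Notation o3 := (@Ordinal 4 3 isT).
Local Notation pt5 R := (pt4 R * measurableTypeR R)%type.
Local Notation le_via y := (@le_trans _ _ y) (only parsing).

(** The exponent 3 of the variation control answers three constraints. It is above 2, so that V^2
    profiles are controlled; it is below 4, so that the transfer of L^4 bounds sums over the scales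
    of time; and its conjugate 3/2 is below 2, so that duality bounds the 3/2-variation of the
    Duhamel profiles, which suffices for U^2. Working modulo a prime replaces the circle method:
    every nonzero time has a kernel of exact size q^2, so there are no arcs to distinguish, and the
    level set at height lam only uses a modulus q comparable to lam. The common grid size J must
    then have a prime divisor in every dyadic range up to a bound, whence the weak form of
    Bertrand's postulate and the choice of factorials. The gain for separated frequencies must decay
    exponentially in the levels: at the scale-invariant regularity the sums over the lower
    frequencies would otherwise diverge. The grid estimates only speak of finite sums. Almost
    everywhere convergence of partial sums is what carries them to functions known through their
    Fourier coefficients alone. *)

Lemma le_of_eq d (T : porderType d) (x y : T) : x = y -> (x <= y)%O.
Proof. by move->. Qed.

Lemma sumsq_ge0 (R : realDomainType) (I : Type) (r : seq I) (P : pred I) (F : I -> R) :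
 0 <= \sum_(i <- r | P i) F i ^+ 2.
Proof. by apply: sumr_ge0 => i _; exact: sqr_ge0. Qed.

(** * Complex modulus and points of the unit circle *)

Section Toolkit.
Context {R : realType}.
Implicit Types z w : R[i].

Lemma cabsE z : `|z| = (cabs z)%:C.
Proof. by case: z. Qed.

Lemma cabs_ge0 z : 0 <= cabs z.
Proof. by case: z => a b; rewrite /cabs /= sqrtr_ge0. Qed.

Lemma cabs_sq z : cabs z ^+ 2 = complex.Re z ^+ 2 + complex.Im z ^+ 2.
Proof. by case: z => a b; rewrite /cabs /= sqr_sqrtr // addr_ge0 ?sqr_ge0. Qed.

Lemma cabs0 : cabs (0 : R[i]) = 0. Proof. exact: Normc.normc0. Qed.

Lemma cabs1 : cabs (1 : R[i]) = 1. Proof. exact: Normc.normc1. Qed.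

Lemma cabsM z w : cabs (z * w) = cabs z * cabs w.
Proof. exact: Normc.normcM. Qed.

Lemma cabs0_eq0 z : cabs z = 0 -> z = 0.
Proof. exact: Normc.eq0_normc. Qed.

Lemma cabsN z : cabs (- z) = cabs z.
Proof. by case: z => a b; rewrite /cabs /= !sqrrN. Qed.

Lemma cabsBC z w : cabs (z - w) = cabs (w - z).
Proof. by rewrite -cabsN opprB. Qed.

Lemma cabs_conj z : cabs (z^*)%C = cabs z.
Proof. by case: z => a b; rewrite /cabs /= sqrrN. Qed.

Lemma cabsD z w : cabs (z + w) <= cabs z + cabs w.
Proof. by rewrite -lecR rmorphD -!cabsE ler_normD. Qed.

Lemma cabsB z w : cabs (z - w) <= cabs z + cabs w.
Proof. by rewrite -(cabsN w) cabsD. Qed.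

Lemma cabs_sum (I : Type) (r : seq I) (P : pred I) (F : I -> R[i]) :
 cabs (\sum_(i <- r | P i) F i) <= \sum_(i <- r | P i) cabs (F i).
Proof.
elim/big_rec2: _ => [|i y x _ h]; first by rewrite cabs0.
by rewrite (le_trans (cabsD _ _)) // lerD2l.
Qed.

Lemma cabs_prod (I : Type) (r : seq I) (P : pred I) (F : I -> R[i]) :
 cabs (\prod_(i <- r | P i) F i) = \prod_(i <- r | P i) cabs (F i).
Proof.
by elim/big_rec2: _ => [|i y x _ h]; rewrite ?cabs1 // cabsM h.
Qed.

Lemma cabs_real (x : R) : cabs x%:C = `|x|.
Proof. by rewrite /cabs /= expr0n addr0 sqrtr_sqr. Qed.

Lemma cabsX z n : cabs (z ^+ n) = cabs z ^+ n.
Proof. by elim: n => [|n ih]; rewrite ?expr0 ?cabs1 // !exprS cabsM ih. Qed.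

Lemma mul_conj z : z * (z^*)%C = (cabs z ^+ 2)%:C.
Proof.
by rewrite cabs_sq; case: z => a b; simpc; congr (_ +i* _); ring.
Qed.

Lemma Re_le_cabs z : `|complex.Re z| <= cabs z.
Proof.
have := cabs_sq z; have := sqr_ge0 (complex.Im z) => h0 h.
rewrite -[leRHS]ger0_norm ?cabs_ge0 // -ler_sqr ?qualifE /= //.
by rewrite !real_normK ?num_real // h lerDl.
Qed.

Lemma Im_le_cabs z : `|complex.Im z| <= cabs z.
Proof.
have := cabs_sq z; have := sqr_ge0 (complex.Re z) => h0 h.
rewrite -[leRHS]ger0_norm ?cabs_ge0 // -ler_sqr ?qualifE /= //.
by rewrite !real_normK ?num_real // h lerDr.
Qed.

Lemma cabs_le_ReIm z : cabs z <= `|complex.Re z| + `|complex.Im z|.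
Proof.
rewrite {1}(complexE z) (le_trans (cabsD _ _)) // cabsM !cabs_real lerD2l.
by rewrite {1}/cabs /= expr0n expr1n add0r sqrtr1 mul1r.
Qed.

Lemma Re_sum (I : Type) (r : seq I) (P : pred I) (F : I -> R[i]) :
 complex.Re (\sum_(i <- r | P i) F i) = \sum_(i <- r | P i) complex.Re (F i).
Proof. by elim/big_rec2: _ => [//|i y x _ <-]; case: (F i); case: x. Qed.

Lemma conj_sum (I : Type) (r : seq I) (P : pred I) (F : I -> R[i]) :
 ((\sum_(i <- r | P i) F i)^*)%C = \sum_(i <- r | P i) ((F i)^*)%C.
Proof. exact: (raddf_sum (@conjc R)). Qed.

Lemma conjM z w : ((z * w)^*)%C = (z^*)%C * (w^*)%C.
Proof. exact: (rmorphM (@conjc R)). Qed.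

Lemma expi0 : expi (0 : R) = 1.
Proof. by rewrite /expi cos0 sin0. Qed.

Lemma expiD (x y : R) : expi (x + y) = expi x * expi y.
Proof. by rewrite /expi cosD sinD; simpc; congr (_ +i* _); rewrite addrC. Qed.

Lemma expiN (x : R) : expi (- x) = ((expi x)^*)%C.
Proof. by rewrite /expi cosN sinN. Qed.

Lemma cabs_expi (x : R) : cabs (expi x) = 1.
Proof. by rewrite /cabs /expi /= cos2Dsin2 sqrtr1. Qed.

Lemma expi_neq0 (x : R) : expi x != 0.
Proof.
apply/eqP => /(congr1 cabs); rewrite cabs_expi cabs0 => /eqP.
by rewrite oner_eq0.
Qed.

Lemma expi2pi : expi (2 * pi : R) = 1.
Proof. by rewrite /expi mulr_natl cos2pi sin2pi. Qed.

Lemma expi_nat (x : R) n : expi (n%:R * x) = expi x ^+ n.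
Proof.
elim: n => [|n ih]; first by rewrite mul0r expi0.
by rewrite -natr1 mulrDl mul1r expiD ih exprSr.
Qed.

Lemma expi_2pi_int (n : int) : expi (2 * pi * n%:~R : R) = 1.
Proof.
case: n => n; rewrite ?NegzE ?mulrNz ?mulrN ?expiN -pmulrn [_ * _%:R]mulrC
 expi_nat expi2pi expr1n //; exact: (rmorph1 (@conjc R)).
Qed.

End Toolkit.

(** * Cauchy-Schwarz and almost orthogonality *)

Section CauchySchwarz.
Context {R : realType}.

Lemma CS_real (I : Type) (r : seq I) (P : pred I) (x y : I -> R) :
 (\sum_(i <- r | P i) x i * y i) ^+ 2 <=
 (\sum_(i <- r | P i) x i ^+ 2) * (\sum_(i <- r | P i) y i ^+ 2).
Proof.
set A := \sum_(i <- r | P i) x i ^+ 2; set B := \sum_(i <- r | P i) y i ^+ 2.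
set S := \sum_(i <- r | P i) x i * y i.
have key (l m : R) : 0 <= l ^+ 2 * A - l * m * S *+ 2 + m ^+ 2 * B.
 have -> : l ^+ 2 * A - l * m * S *+ 2 + m ^+ 2 * B =
   \sum_(i <- r | P i) (l * x i - m * y i) ^+ 2.
  rewrite /A /B /S !mulr_sumr -sumrMnl -sumrN -!big_split /=.
  by apply: eq_bigr => i _; ring.
 exact: sumsq_ge0.
have B0 : 0 <= B by exact: sumsq_ge0.
have [B1|B1] := ltrP 0 B.
 have := key B S.
 have -> : B ^+ 2 * A - B * S * S *+ 2 + S ^+ 2 * B = B * (A * B - S ^+ 2).
  by ring.
 by rewrite pmulr_rge0 // subr_ge0.
have {B1 B0}B0 : B = 0 by apply/le_anti/andP.
rewrite B0 mulr0; have h l := key 1 l; rewrite B0 in h.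
have [S0|S0] := eqVneq S 0; first by rewrite S0 expr0n.
(* With [B = 0] the nonnegative quantity [key] is affine in [l]; this value of [l] would make it
   -1. *)
have := h ((A + 1) / (2 * S)).
have -> : 1 ^+ 2 * A - 1 * ((A + 1) / (2 * S)) * S *+ 2
  + ((A + 1) / (2 * S)) ^+ 2 * 0 = -1 by field.
by rewrite ler0N1.
Qed.

Lemma CS_cabs (I : Type) (r : seq I) (P : pred I) (x y : I -> R[i]) :
 cabs (\sum_(i <- r | P i) x i * y i) ^+ 2 <=
 (\sum_(i <- r | P i) cabs (x i) ^+ 2) * (\sum_(i <- r | P i) cabs (y i) ^+ 2).
Proof.
apply: le_trans (CS_real _ _ _ _); rewrite lerXn2r ?qualifE /= ?cabs_ge0 //.
 by apply: sumr_ge0 => i _; rewrite mulr_ge0 ?cabs_ge0.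
rewrite (le_trans (cabs_sum _ _ _)) //.
by apply: ler_sum => i _; rewrite cabsM.
Qed.

Lemma sqr_sum_le (I : Type) (r : seq I) (P : pred I) (x : I -> R) :
 (\sum_(i <- r | P i) x i) ^+ 2 <=
 (\sum_(i <- r | P i) 1) * (\sum_(i <- r | P i) x i ^+ 2).
Proof.
have := CS_real r P (fun=> 1) x.
under eq_bigr do rewrite mul1r.
by under [in X in _ <= X -> _]eq_bigr do rewrite expr1n.
Qed.

(** Schur's test for the Gram matrix. Entries off [near] vanish, the others are at most the mean of
    the two squared norms, and the symmetry of [near] turns that mean into the first norm alone,
    counted at most [D] times. *)
Lemma almost_orthogonal (T : finType) (I : eqType) (r : seq I)
  (near : I -> I -> bool) (h : I -> T -> R[i]) (D : R) :
 (forall i j, near i j = near j i) ->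
 (forall i, i \in r -> \sum_(j <- r | near i j) 1 <= D) ->
 (forall i j, i \in r -> j \in r -> ~~ near i j ->
   \sum_z h i z * ((h j z)^*)%C = 0) ->
 \sum_z cabs (\sum_(i <- r) h i z) ^+ 2 <=
  D * \sum_(i <- r) \sum_z cabs (h i z) ^+ 2.
Proof.
move=> nearC hD horth.
set n2 := fun i => \sum_z cabs (h i z) ^+ 2.
set ip := fun i j => \sum_z h i z * ((h j z)^*)%C.
have ipE : (\sum_z cabs (\sum_(i <- r) h i z) ^+ 2)%:C =
  \sum_(i <- r) \sum_(j <- r) ip i j.
 rewrite (raddf_sum (real_complex R)) /=.
 transitivity (\sum_z \sum_(i <- r) \sum_(j <- r) h i z * ((h j z)^*)%C).
  apply: eq_bigr => z _; rewrite -mul_conj conj_sum mulr_suml.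
  by apply: eq_bigr => i _; rewrite mulr_sumr.
 rewrite exchange_big /=; apply: eq_bigr => i _.
 by rewrite exchange_big.
have ip_le i j : cabs (ip i j) <= (n2 i + n2 j) / 2.
 rewrite (le_trans (cabs_sum _ _ _)) // /n2 -big_split /= mulr_suml.
 apply: ler_sum => z _; rewrite cabsM cabs_conj.
 have := sqr_ge0 (cabs (h i z) - cabs (h j z)).
 by move: (cabs _) (cabs _) => a b; nra.
have -> : \sum_z cabs (\sum_(i <- r) h i z) ^+ 2 =
  cabs (\sum_(i <- r) \sum_(j <- r) ip i j).
 rewrite -ipE cabs_real ger0_norm // sumr_ge0 // => z _; exact: sqr_ge0.
have n20 i : 0 <= n2 i by exact: sumsq_ge0.
apply: (@le_trans _ _
  (\sum_(i <- r) \sum_(j <- r | near i j) (n2 i + n2 j) / 2)).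
 rewrite (le_trans (cabs_sum _ _ _)) // [leLHS]big_seq [leRHS]big_seq.
 apply: ler_sum => i ir.
 rewrite (le_trans (cabs_sum _ _ _)) // [leRHS]big_mkcond [leLHS]big_seq
  [leRHS]big_seq.
 apply: ler_sum => j jr; case: ifP => [_|/negbT nij]; first exact: ip_le.
 by rewrite /ip horth // cabs0.
have E : \sum_(i <- r) \sum_(j <- r | near i j) (n2 i + n2 j) / 2 =
  \sum_(i <- r) \sum_(j <- r | near i j) n2 i.
 under eq_bigr => i _ do rewrite -mulr_suml big_split /=.
 rewrite -mulr_suml big_split /=.
 have -> : \sum_(i <- r) \sum_(j <- r | near i j) n2 j =
   \sum_(i <- r) \sum_(j <- r | near i j) n2 i.
  rewrite (exchange_big_dep xpredT) //=; apply: eq_bigr => i _.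
  by apply: eq_bigl => j; rewrite nearC.
 by lra.
rewrite E mulr_sumr [leLHS]big_seq [leRHS]big_seq; apply: ler_sum => i ir.
have -> : \sum_(j <- r | near i j) n2 i = (\sum_(j <- r | near i j) 1) * n2 i.
 by rewrite mulr_suml; apply: eq_bigr => j _; rewrite mul1r.
by rewrite ler_wpM2r // hD.
Qed.

End CauchySchwarz.

(** * Primes in dyadic ranges *)

Section PrimeBetween.
Local Open Scope nat_scope.

Lemma central_bin_step n :
 n.+1 * 'C(n.+1.*2, n.+1) = 2 * n.*2.+1 * 'C(n.*2, n).
Proof.
have h1 : n.+1 * 'C(n.+1.*2, n.+1) = n.+1.*2 * 'C(n.*2.+1, n).
 by rewrite doubleS mul_bin_diag.
have h2 : n.+1 * 'C(n.*2.+1, n.+1) = n.*2.+1 * 'C(n.*2, n).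
 by rewrite mul_bin_diag.
have h3 : 'C(n.*2.+1, n.+1) = 'C(n.*2.+1, n).
 rewrite -(bin_sub (n := n.*2.+1) (m := n)); last by lia.
 by congr ('C(_, _)); lia.
by rewrite h1 -muln2 mulnAC -h3 h2; lia.
Qed.

Lemma central_bin_ge n : 0 < n -> 4 ^ n <= n.*2 * 'C(n.*2, n).
Proof.
elim: n => [//|[|n] ih _]; first by [].
have {}ih := ih isT; rewrite expnS; have := central_bin_step n.+1.
move: ih; set a := 'C(_, _); set b := 'C(_, _); set c := 4 ^ _ => ih e.
have : 4 * c * n.+1.*2.+1 <= n.+2.*2 * b * n.+1.*2.+1.
 have -> : n.+2.*2 * b * n.+1.*2.+1 = 2 * n.+1.*2.+1 * (n.+2 * b) by lia.
 rewrite e.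
 have : 4 * c * n.+1.*2.+1 <= 4 * (n.+1.*2 * a) * n.+1.*2.+1.
  by rewrite leq_mul2r leq_mul2l ih orbT.
 nia.
by rewrite leq_pmul2r.
Qed.

(** The two middle coefficients of row 2n+1 are equal and sum to at most 2^(2n+1). *)
Lemma bin_odd_le n : 'C(n.*2.+1, n) <= 4 ^ n.
Proof.
have h : 'C(n.*2.+1, n) + 'C(n.*2.+1, n.+1) <= 2 ^ n.*2.+1.
 rewrite -[2]/(1 + 1) expnDn.
 rewrite (bigD1 (inord n)) //= (bigD1 (inord n.+1)) /=; last first.
  apply/eqP => /(congr1 val) /=; rewrite !inordK; lia.
 by rewrite !inordK ?exp1n ?muln1 ?addnA ?leq_addr //; lia.
have h3 : 'C(n.*2.+1, n.+1) = 'C(n.*2.+1, n).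
 rewrite -(bin_sub (n := n.*2.+1) (m := n)); last by lia.
 by congr ('C(_, _)); lia.
have e : 2 ^ n.*2.+1 = 2 * 4 ^ n by rewrite expnS -mul2n expnM.
by move: h; rewrite h3 e; lia.
Qed.

Lemma dvdn_prod_primes (P : pred nat) (a b m : nat) :
 (forall p, a <= p < b -> P p -> prime p && (p %| m)) ->
 \prod_(a <= p < b | P p) p %| m.
Proof.
elim: b => [|b ih] h; first by rewrite big_geq.
have [ab|ab] := leqP a b; last by rewrite big_geq // ltnW.
rewrite big_mkcond big_nat_recr //= -big_mkcond /=.
have ih' : \prod_(a <= p < b | P p) p %| m.
 by apply: ih => p /andP[ap pb]; apply: h; rewrite ap ltnW.
case: ifP => [Pb|_]; last by rewrite muln1.
have /andP[pb bm] : prime b && (b %| m) by apply: h; rewrite ?ab ?leqnn.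
rewrite Gauss_dvd ?ih' //.
rewrite coprime_sym prime_coprime //.
rewrite big_nat_cond; elim/big_ind: _ => [|x y hx hy|p].
- by rewrite dvdn1; apply: contraL pb => /eqP ->.
- by rewrite Euclid_dvdM // negb_or hx hy.
move=> /andP[/andP[ap pb'] Pp].
have /andP[pp _] : prime p && (p %| m) by apply: h => //; rewrite ap ltnW.
by rewrite dvdn_prime2 // neq_ltn pb' orbT.
Qed.

Lemma prime_dvd_fact p n : prime p -> p %| n`! -> p <= n.
Proof.
move=> pp; elim: n => [|n ih]; first by rewrite dvdn1 => /eqP e; rewrite e in pp.
by rewrite factS Euclid_dvdM // => /orP[/dvdn_leq|/ih /leqW]; [apply|].
Qed.

(** Strong induction. An even n above 2 adds no prime. For n = 2m+1 the primes from m+2 to n divide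
    C(2m+1, m), which is at most 4^m, and the induction hypothesis at m+1 covers the rest. *)
Lemma primorial_le n : \prod_(0 <= p < n.+1 | prime p) p <= 4 ^ n.
Proof.
elim/ltn_ind: n => n ih.
have [n2|n2] := ltnP n 3.
 by move: n n2 {ih} => [|[|[|//]]] _; rewrite unlock.
have [/even_halfK ne|no] := boolP (~~ odd n).
 rewrite big_mkcond big_nat_recr //= -big_mkcond /=.
 have -> : prime n = false.
  apply/negbTE/negP => pn; have := prime_oddPn pn.
  by rewrite -ne odd_double => h; have /h := isT; lia.
 rewrite muln1; case: n n2 ih {ne} => [//|n] n2 ih.
 by apply: leq_trans (ih n _) _; rewrite ?leq_exp2l.
have e := odd_double_half n; rewrite (negbNE no) add1n in e.
set m := n./2 in e.
have hm : \prod_(m.+2 <= p < n.+1 | prime p) p <= 4 ^ m.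
 apply: leq_trans (bin_odd_le m); apply: dvdn_leq; first by rewrite bin_gt0; lia.
 apply: dvdn_prod_primes => p /andP[p1 p2] pp; rewrite pp /=.
 have := bin_fact (n := m.*2.+1) (m := m) ltac:(lia).
 have -> : m.*2.+1 - m = m.+1 by lia.
 move=> hf; have : p %| (m.*2.+1)`! by rewrite dvdn_fact //; lia.
 rewrite -hf Euclid_dvdM // => /orP[//|]; rewrite Euclid_dvdM //.
 by case/orP => h; have := prime_dvd_fact pp h; lia.
rewrite (@big_cat_nat _ _ _ m.+2) //=; last by lia.
apply: leq_trans (leq_mul (ih m.+1 _) hm) _; first by lia.
by rewrite -expnD leq_exp2l //; lia.
Qed.

(** By Legendre's formula the exponent is the sum over k of floor(2n/p^k) - 2 floor(n/p^k). Each
    term is 0 or 1, and it is 0 once p^k > 2n. *)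
Lemma logn_central_bin p n : prime p -> 0 < n ->
 p ^ logn p 'C(n.*2, n) <= n.*2.
Proof.
move=> pp n0.
have hC : 0 < 'C(n.*2, n) by rewrite bin_gt0; lia.
have e : logn p (n.*2)`! = logn p 'C(n.*2, n) + (logn p n`! + logn p n`!).
 rewrite -(bin_fact (n := n.*2) (m := n)); last by lia.
 have -> : n.*2 - n = n by lia.
 by rewrite !lognM ?muln_gt0 ?fact_gt0.
set t := trunc_log p n.*2.
suff h : logn p 'C(n.*2, n) <= t.
 apply: (@leq_trans (p ^ t)); first by rewrite leq_exp2l // prime_gt1.
 by apply: trunc_logP; rewrite ?prime_gt1 // double_gt0.
have ht k : t < k -> n.*2 < p ^ k.
 move=> tk; apply: leq_trans (trunc_log_ltn _ (prime_gt1 pp)) _.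
 by rewrite leq_exp2l // prime_gt1.
have tn : t <= n.*2.
 rewrite leqNgt; apply/negP => /ltnW h.
 have := @trunc_logP p n.*2 (prime_gt1 pp); rewrite double_gt0 n0 => /(_ isT).
 have := @ltn_expl p t (prime_gt1 pp); rewrite -/t; lia.
rewrite !logn_fact // in e.
have e2 : \sum_(1 <= k < n.+1) n %/ p ^ k = \sum_(1 <= k < n.*2.+1) n %/ p ^ k.
 rewrite [RHS](@big_cat_nat _ _ _ n.+1) //=; last by lia.
 rewrite [X in _ = _ + X]big_nat_cond [X in _ = _ + X]big1 ?addn0 // => k.
 move=> /andP[/andP[k1 k2] _]; apply: divn_small.
 by apply: leq_ltn_trans (@ltn_expl p k (prime_gt1 pp)); lia.
rewrite e2 -big_split /= in e.
have : \sum_(1 <= k < n.*2.+1) n.*2 %/ p ^ k <=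
  \sum_(1 <= k < n.*2.+1) ((k <= t) + (n %/ p ^ k + n %/ p ^ k)).
 apply: leq_sum => k _; have [kt|kt] := leqP k t.
  have pk : 0 < p ^ k by rewrite expn_gt0 prime_gt0.
  have := divn_eq n (p ^ k); have := ltn_pmod n pk.
  set a := n %/ _; set b := n %% _ => h1 h2.
  rewrite -ltnS ltn_divLR // h2 /=; nia.
 by rewrite divn_small ?ht.
rewrite big_split /= e leq_add2r => /leq_trans; apply.
rewrite (@big_cat_nat _ _ _ t.+1) //=.
rewrite [X in _ + X <= _]big_nat_cond [X in _ + X <= _]big1 ?addn0; last first.
 by move=> k /andP[/andP[k1 k2] _]; rewrite leqNgt k1.
have : \sum_(1 <= k < t.+1) (k <= t) <= \sum_(1 <= k < t.+1) 1.
 by apply: leq_sum => k _; exact: leq_b1.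
by rewrite sum_nat_const_nat subn1 muln1.
Qed.

(** Along the chain 2, 5, 17, 67, 257, 1021, 1031 each prime is at most four times the preceding
    one. *)
Lemma exists_prime_small x : 0 < x < 1024 -> exists2 p, prime p & x < p <= 4 * x.
Proof.
move=> /andP[x0 x1].
have [h|h] := ltnP x 2; first by exists 2 => //; lia.
have [h1|h1] := ltnP x 5; first by exists 5 => //; lia.
have [h2|h2] := ltnP x 17; first by exists 17 => //; lia.
have [h3|h3] := ltnP x 67; first by exists 67 => //; lia.
have [h4|h4] := ltnP x 257; first by exists 257 => //; lia.
have [h5|h5] := ltnP x 1021; first by exists 1021 => //; lia.
by exists 1031 => //; lia.
Qed.

(** Erdős's argument with C(4x, 2x). Were there no prime in (x, 4x], all its prime factors would be
    at most x. Those below s = 2^(k+1), which exceeds the square root of 4x, contribute at most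
    (4x)^s; the others occur once and contribute at most the primorial of x. Comparison with the
    lower bound 4^(2x) / (4x) leaves 4^x <= (4x)^(s+1), which is false for large x. *)
Lemma exists_prime_large x : 1024 <= x -> exists2 p, prime p & x < p <= 4 * x.
Proof.
move=> x1; apply: contrapT => hno.
have no p : prime p -> p <= 4 * x -> p <= x.
 move=> pp p4; rewrite leqNgt; apply/negP => xp; apply: hno.
 by exists p; rewrite // xp.
set n := 2 * x; have n2 : n.*2 = 4 * x by rewrite /n; lia.
have hC : 0 < 'C(n.*2, n) by rewrite bin_gt0; lia.
set k := trunc_log 4 (4 * x).
have k1 : 4 ^ k <= 4 * x by apply: trunc_logP; lia.
have k2 : 4 * x < 4 ^ k.+1 by apply: trunc_log_ltn.
have k6 : 6 <= k.
 by rewrite -ltnS -(@ltn_exp2l 4) //; apply: leq_ltn_trans k2; rewrite (_ : 4 ^ 6 = 4096) //; lia.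
set s := 2 ^ k.+1.
have hs : 'C(n.*2, n) <= (4 * x) ^ s * 4 ^ x.
 rewrite [leqLHS](prod_prime_decomp hC) prime_decompE big_map /=.
 have -> : \prod_(i <- primes 'C(n.*2, n)) i ^ logn i 'C(n.*2, n) =
   (\prod_(i <- primes 'C(n.*2, n) | i < s) i ^ logn i 'C(n.*2, n)) *
   (\prod_(i <- primes 'C(n.*2, n) | s <= i) i ^ logn i 'C(n.*2, n)).
  rewrite (bigID (fun i => i < s)) /=; congr (_ * _).
  by apply: eq_bigl => i; rewrite -leqNgt.
 have hi i : i \in primes 'C(n.*2, n) -> prime i /\ i <= x.
  rewrite mem_primes => /and3P[pi _ di]; split => //.
  have := logn_central_bin (n := n) pi ltac:(lia).
  have : 0 < logn i 'C(n.*2, n) by rewrite logn_gt0 mem_primes pi hC.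
  move=> l0 l1; apply: no => //; rewrite -n2; apply: leq_trans l1.
  by rewrite -[X in X <= _]expn1 leq_exp2l // prime_gt1.
 apply: leq_mul.
  apply: (@leq_trans (\prod_(i <- primes 'C(n.*2, n) | i < s) (4 * x))).
   rewrite big_seq_cond [leqRHS]big_seq_cond.
   apply: leq_prod => i /andP[/hi[pi _] _].
   by rewrite -n2; apply: logn_central_bin => //; lia.
  rewrite big_const_seq iter_muln_1 leq_exp2l; last by lia.
  rewrite -size_filter.
  rewrite -[leqRHS](size_iota 0).
  apply: uniq_leq_size; first by rewrite filter_uniq // primes_uniq.
  by move=> i; rewrite mem_filter mem_iota => /andP[].
 apply: leq_trans (primorial_le x).
 have -> : \prod_(0 <= p < x.+1 | prime p) p =
   \prod_(p <- [seq p <- index_iota 0 x.+1 | prime p]) p by rewrite big_filter.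
 rewrite -big_filter.
 set r := [seq i <- primes _ | _].
 apply: (@leq_trans (\prod_(i <- r) i)).
  rewrite big_seq [leqRHS]big_seq; apply: leq_prod => i.
  rewrite mem_filter => /andP[si /hi[pi _]].
  have h := logn_central_bin (n := n) pi ltac:(lia).
  (* Here i >= s and s^2 > 4x, so i^2 exceeds the bound of [logn_central_bin]. *)
  suff : logn i 'C(n.*2, n) <= 1.
   by case: (logn _ _) => [|[|//]] _; rewrite ?expn0 ?expn1 // prime_gt0.
  rewrite -ltnS -(@ltn_exp2l i) ?prime_gt1 //.
  apply: leq_ltn_trans h _; rewrite n2; apply: leq_trans k2 _.
  by rewrite (_ : 4 ^ k.+1 = s ^ 2) ?leq_exp2r // /s -!expnM mulnC expnM.
 have sub : {subset r <= [seq p <- index_iota 0 x.+1 | prime p]}.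
  move=> i; rewrite !mem_filter mem_index_iota => /andP[_ /hi[-> ix]] /=.
  by rewrite ltnS.
 have ur : uniq r by rewrite filter_uniq // primes_uniq.
 have uu : uniq [seq p <- index_iota 0 x.+1 | prime p].
  by rewrite filter_uniq // iota_uniq.
 rewrite [leqRHS](bigID (mem r)) /= -[X in _ <= X * _]big_filter.
 have hr : perm_eq r [seq i <- [seq p <- index_iota 0 x.+1 | prime p] | i \in r].
  apply: uniq_perm => //; first exact: filter_uniq.
  move=> i; rewrite [RHS]mem_filter; case: (boolP (i \in r)) => //= ir.
  by rewrite (sub _ ir).
 rewrite (perm_big _ hr) /= leq_pmulr // big_seq_cond.
 elim/big_ind: _ => // [a b a0 b0|i]; first by rewrite muln_gt0 a0.
 by rewrite mem_filter => /andP[/andP[pi _] _]; rewrite prime_gt0.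
have hb := central_bin_ge (n := n) ltac:(lia).
have h1 : 4 ^ n <= (4 * x) ^ s.+1 * 4 ^ x.
 by apply: leq_trans hb _; rewrite {1}n2 expnS -[leqRHS]mulnA leq_mul2l hs orbT.
have h2 : 4 ^ x <= (4 * x) ^ s.+1.
 move: h1; rewrite (_ : n = x + x); last by rewrite /n; lia.
 by rewrite expnD leq_pmul2r // expn_gt0.
have h3 : 4 ^ x < 4 ^ (k.+1 * s.+1).
 by apply: leq_ltn_trans h2 _; rewrite expnM ltn_exp2r.
rewrite ltn_exp2l // in h3.
have h4 : 4 ^ k.-1 <= x.
 have e : 4 ^ k = 4 * 4 ^ k.-1 by rewrite -expnS prednK //; lia.
 by rewrite -(@leq_pmul2l 4) // -e.
(* The base case k = 6 reads 7 * 129 <= 4^5; this is what places the threshold at 1024. *)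
have h5 : k.+1 * (2 ^ k.+1).+1 <= 4 ^ k.-1.
 clear -k6; elim: k k6 => [//|k ih]; rewrite leq_eqVlt => /predU1P[<-//|k6].
 have {}ih := ih k6; move: ih; rewrite /= [2 ^ k.+2]expnS.
 have -> : 4 ^ k = 4 * 4 ^ k.-1 by rewrite -expnS prednK //; lia.
 by set a := 2 ^ _; nia.
by move: h3; rewrite -/s in h5; lia.
Qed.

Lemma exists_prime x : 0 < x -> exists2 p, prime p & x < p <= 4 * x.
Proof.
move=> x0; have [h|h] := ltnP x 1024; last exact: exists_prime_large.
by apply: exists_prime_small; rewrite x0.
Qed.

End PrimeBetween.

(** * Characters and Gauss sums on finite grids *)

Section Characters.
Context {R : realType}.

Definition ez n (a : 'Z_n) : R[i] := expi (2 * pi * a%:R / n%:R).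

Lemma expi_eq1 (x : R) : 0 <= x < 2 * pi -> expi x = 1 -> x = 0.
Proof.
move=> /andP[x0 x1] e; apply/eqP; rewrite eq_le x0 andbT leNgt; apply/negP => x2.
have h : 0 < sin (x / 2) by apply: sin_gt0_pi; apply/andP; split; lra.
have e1 : cos x = 1 by have := congr1 (@complex.Re R) e.
have : cos (x / 2 + x / 2) = 1 by rewrite -splitr.
rewrite cosD -!expr2 => e2; have := cos2Dsin2 (x / 2); nra.
Qed.

Variable n : nat.
Hypothesis n1 : (1 < n)%N.

Let n0 : (n%:R : R) != 0. Proof. by rewrite pnatr_eq0; case: n n1. Qed.

Lemma valZ (a : 'Z_n) : (a < n)%N.
Proof. by have := ltn_ord a; rewrite [X in (_ < X)%N](Zp_cast n1). Qed.

Lemma ez_nat (m : nat) : ez (m%:R : 'Z_n) = expi (2 * pi * m%:R / n%:R).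
Proof.
rewrite /ez val_Zp_nat // {2}(divn_eq m n) natrD natrM.
have -> : 2 * pi * ((m %/ n)%:R * n%:R + (m %% n)%:R) / n%:R =
  2 * pi * (m %/ n)%N%:Z%:~R + 2 * pi * (m %% n)%:R / n%:R :> R.
 by rewrite pmulrn; field.
by rewrite expiD expi_2pi_int mul1r.
Qed.

Lemma ezD (a b : 'Z_n) : ez (a + b) = ez a * ez b.
Proof.
have -> : a + b = (a + b)%N%:R :> 'Z_n by rewrite natrD !natr_Zp.
rewrite ez_nat natrD /ez -expiD; congr expi; by field.
Qed.

Lemma ez0 : ez (0 : 'Z_n) = 1.
Proof. by rewrite /ez /= mulr0 mul0r expi0. Qed.

Lemma cabs_ez (a : 'Z_n) : cabs (ez a) = 1. Proof. exact: cabs_expi. Qed.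

Lemma ezN (a : 'Z_n) : ez (- a) = ((ez a)^*)%C.
Proof.
have h : ez a * ez (- a) = ez a * ((ez a)^*)%C.
 by rewrite -ezD subrr ez0 mul_conj cabs_ez expr1n.
by apply: (mulfI _ h); exact: expi_neq0.
Qed.

Lemma ez_int (m : int) : ez (m%:~R : 'Z_n) = expi (2 * pi * m%:~R / n%:R).
Proof.
case: m => m; first by rewrite -pmulrn ez_nat pmulrn.
by rewrite NegzE !mulrNz ezN mulrN mulNr expiN -!pmulrn ez_nat.
Qed.

Lemma ez_eq1 (a : 'Z_n) : ez a = 1 -> a = 0.
Proof.
have np : 0 < (n%:R : R) by rewrite ltr0n; case: n n1.
move=> /expi_eq1 h; have pi0 := @pi_gt0 R.
have /h/eqP : 0 <= 2 * pi * (a%:R : R) / n%:R < 2 * pi.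
 rewrite divr_ge0 ?mulr_ge0 ?(ltW pi0) //= ltr_pdivrMr //.
 by rewrite ltr_pM2l ?mulr_gt0 // ltr_nat valZ.
rewrite !mulf_eq0 invr_eq0 (negbTE n0) (gt_eqF pi0) !pnatr_eq0 /= orbF => /eqP a0.
exact: val_inj.
Qed.

(** Translating the summation variable by 1 multiplies the sum by [ez b], which is 1 only for b =
    0. *)
Lemma sum_ez (b : 'Z_n) : \sum_(a : 'Z_n) ez (b * a) = if b == 0 then n%:R else 0.
Proof.
have [->|b0] := eqVneq b 0.
 under eq_bigr do rewrite mul0r ez0.
 by rewrite sumr_const card_ord (Zp_cast n1).
set S := \sum_a _.
have e : S * ez b = S.
 rewrite /S mulr_suml [RHS](reindex_inj (addIr 1)) /=.
 by apply: eq_bigr => a _; rewrite mulrDr mulr1 ezD.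
apply/eqP; apply/negPn/negP => S0; move/eqP: b0; apply; apply: ez_eq1.
by apply: (mulfI S0); rewrite e mulr1.
Qed.

End Characters.

(** * Free solutions on a finite space-time grid *)

Section Grid.
Context {R : realType}.

Arguments ez : simpl never.

Definition V n := {ffun 'I_4 -> 'Z_n}.
Definition grid n := ('Z_n * V n)%type.

Definition dv n (x y : V n) : 'Z_n := \sum_j x j * y j.
(** In units of 2 pi / n this is the phase k.x - t|k|^2 at time [z.1] and position [z.2], so [uu]
    below samples a free Schrödinger solution at the n-th roots of unity. *)
Definition ph n (k : V n) (z : grid n) : 'Z_n := dv k z.2 - dv k k * z.1.

Definition cmp (k : Z4) (j : 'I_4) : int :=
 nth 0 [:: k.1.1.1; k.1.1.2; k.1.2; k.2] j.

Definition zk n (k : Z4) : V n := [ffun j => (cmp k j)%:~R].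

Definition uu n (ks : seq Z4) (f : Z4 -> R[i]) (z : grid n) : R[i] :=
 \sum_(k <- ks) f k * ez (ph (zk n k) z).

Variable n : nat.
Hypothesis n1 : (1 < n)%N.

Lemma dvC (x y : V n) : dv x y = dv y x.
Proof. by apply: eq_bigr => j _; rewrite mulrC. Qed.

Lemma dvDr (k x y : V n) : dv k (x + y) = dv k x + dv k y.
Proof. by rewrite /dv -big_split; apply: eq_bigr => j _; rewrite ffunE mulrDr. Qed.

Lemma dvDl (k x y : V n) : dv (x + y) k = dv x k + dv y k.
Proof. by rewrite /dv -big_split; apply: eq_bigr => j _; rewrite ffunE mulrDl. Qed.

Lemma dvNl (x y : V n) : dv (- x) y = - dv x y.
Proof. by rewrite /dv -sumrN; apply: eq_bigr => j _; rewrite ffunE mulNr. Qed.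

Lemma dvNr (x y : V n) : dv x (- y) = - dv x y.
Proof. by rewrite /dv -sumrN; apply: eq_bigr => j _; rewrite ffunE mulrN. Qed.

Lemma phD (k : V n) z w : ph k (z + w) = ph k z + ph k w.
Proof. by rewrite /ph /= dvDr mulrDr opprD addrACA. Qed.

Lemma phN (k : V n) z : ph k (- z) = - ph k z.
Proof. by rewrite /ph /= dvNr mulrN opprD. Qed.

Lemma ez_sum (I : Type) (r : seq I) (P : pred I) (F : I -> 'Z_n) :
 ez (\sum_(i <- r | P i) F i) = \prod_(i <- r | P i) ez (F i) :> R[i].
Proof.
by elim/big_rec2: _ => [|i y x _ <-]; rewrite ?ez0 // ezD.
Qed.

Lemma sumV_prod (F : 'I_4 -> 'Z_n -> R[i]) :
 \sum_(x : V n) \prod_j F j (x j) = \prod_j \sum_(a : 'Z_n) F j a.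
Proof. by rewrite bigA_distr_bigA. Qed.

Lemma sum_ez_dv (k : V n) :
 \sum_(x : V n) ez (dv k x) = if k == 0 then n%:R ^+ 4 else 0 :> R[i].
Proof.
have -> : \sum_(x : V n) ez (dv k x) = \prod_j \sum_(a : 'Z_n) ez (k j * a) :> R[i].
 by rewrite -sumV_prod; apply: eq_bigr => x _; rewrite ez_sum.
have [->|k0] := eqVneq k 0.
 under eq_bigr => j _ do rewrite sum_ez // ffunE eqxx.
 by rewrite prodr_const card_ord.
have [j kj] : exists j, k j != 0.
 apply/existsP; rewrite -negb_forall; apply: contra k0 => /forallP h.
 by apply/eqP/ffunP => j; rewrite ffunE; apply/eqP.
by rewrite (bigD1 j) //= sum_ez // (negbTE kj) mul0r.
Qed.

Lemma card_V : #|{: V n}| = (n ^ 4)%N.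
Proof. by rewrite card_ffun !card_ord (Zp_cast n1). Qed.

Lemma parsevalV (g : V n -> R[i]) :
 \sum_(k : V n) cabs (\sum_(x : V n) g x * ez (dv k x)) ^+ 2 =
 n%:R ^+ 4 * \sum_(x : V n) cabs (g x) ^+ 2.
Proof.
apply: (@complexI R); rewrite rmorphM !rmorphXn /= rmorph_nat !(raddf_sum (real_complex R)) /=.
transitivity (\sum_(k : V n) \sum_(x : V n) \sum_(y : V n)
  g x * ((g y)^*)%C * ez (dv (x - y) k)).
 apply: eq_bigr => k _; rewrite -mul_conj conj_sum mulr_suml.
 apply: eq_bigr => x _; rewrite mulr_sumr; apply: eq_bigr => y _.
 by rewrite rmorphM /= dvDl ezD // dvNl ezN // !(dvC k) mulrACA.
rewrite exchange_big /= mulr_sumr; apply: eq_bigr => x _.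
rewrite exchange_big /= (bigD1 x) //= [X in _ + X]big1 ?addr0 => [|y yx].
 rewrite -mulr_sumr subrr sum_ez_dv eqxx mul_conj; exact: mulrC.
by rewrite -mulr_sumr sum_ez_dv subr_eq0 eq_sym (negbTE yx) mulr0.
Qed.

End Grid.

(** * Level sets by a TT* argument *)

Section TTstar.
Context {R : realType}.
Variable n : nat.
Hypothesis n1 : (1 < n)%N.

Definition kern (w : V n -> R) (z : grid n) : R[i] :=
 \sum_(k : V n) (w k)%:C * ez (ph k z).

Lemma sum_pred_uniq (T : finType) (s : seq T) (F : T -> R) :
 uniq s -> (forall x, 0 <= F x) -> \sum_(x <- s) F x <= \sum_x F x.
Proof.
move=> us F0; rewrite big_uniq //= [leRHS](bigID (mem s)) /= lerDl.
by apply: sumr_ge0.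
Qed.

(** Pair the solution with its conjugate phase on [E] and apply Cauchy-Schwarz in frequency against
    a weight [w] that dominates the indicator of the spectrum. The resulting quadratic form runs
    over pairs of times. A time difference outside [Bad] costs the kernel bound [D]; one inside
    [Bad] is handled by Parseval in space, at cost W n^4. *)
Lemma TTstar (ks : seq Z4) (f : Z4 -> R[i]) (w : V n -> R) (W D lam : R)
  (Bad : {set 'Z_n}) (E : {set grid n}) :
 uniq (map (zk n) ks) -> \sum_(k <- ks) cabs (f k) ^+ 2 <= 1 ->
 (forall k, 0 <= w k <= W) -> (forall k, k \in ks -> 1 <= w (zk n k)) ->
 (forall z, z.1 \notin Bad -> cabs (kern w z) <= D) -> 0 <= D -> 0 <= lam ->
 (forall z, z \in E -> lam <= cabs (uu ks f z)) ->
 lam ^+ 2 * #|E|%:R <= W * n%:R ^+ 4 * #|Bad|%:R + D * #|E|%:R.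
Proof.
move=> uks f1 hw wks hK D_ge0 lam0 hE.
(* Where the solution vanishes, the convention for the inverse of 0 makes [th] equal to 0. *)
pose th (z : grid n) : R[i] := if z \in E then
 ((uu ks f z)^*)%C * ((cabs (uu ks f z))^-1)%:C else 0.
pose ind (z : grid n) : R := if z \in E then 1 else 0.
have th_ind z : cabs (th z) <= ind z.
 rewrite /th /ind; case: ifP => _; last by rewrite cabs0.
 rewrite cabsM cabs_conj cabs_real ger0_norm ?invr_ge0 ?cabs_ge0 //.
 have [->|h] := eqVneq (cabs (uu ks f z)) 0; first by rewrite mul0r.
 by rewrite divff.
have th_u z : (z \in E) -> th z * uu ks f z = (cabs (uu ks f z))%:C.
 move=> zE; rewrite /th zE mulrAC [X in X * _]mulrC mul_conj -rmorphM /=; congr _%:C.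
 have [->|h] := eqVneq (cabs (uu ks f z)) 0; first by rewrite expr0n mul0r.
 by rewrite expr2 mulfK.
pose At (a : 'Z_n) (k : V n) : R[i] := \sum_(x : V n) th (a, x) * ez (ph k (a, x)).
pose A (k : V n) : R[i] := \sum_z th z * ez (ph k z).
have AE k : A k = \sum_a At a k.
 by rewrite /A /At pair_bigA /=; apply: eq_bigr => -[].
pose e (a : 'Z_n) : R := \sum_(x : V n) ind (a, x).
have eE : \sum_a e a = #|E|%:R.
 rewrite /e pair_bigA /= -sum1_card natr_sum [RHS]big_mkcond /=.
 by apply: eq_bigr => -[a x] _ /=; rewrite /ind.
have ind0 z : 0 <= ind z by rewrite /ind; case: ifP.
have e0 a : 0 <= e a by apply: sumr_ge0.
have stepA : lam * #|E|%:R <= cabs (\sum_(k <- ks) f k * A (zk n k)).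
 have -> : \sum_(k <- ks) f k * A (zk n k) = (\sum_(z in E) cabs (uu ks f z))%:C.
  rewrite (raddf_sum (real_complex R)) /=.
  rewrite (eq_bigr (fun k => \sum_z f k * (th z * ez (ph (zk n k) z)))); last first.
   by move=> k _; rewrite mulr_sumr.
  rewrite exchange_big /= [RHS]big_mkcond /=; apply: eq_bigr => z _.
  case: ifP => zE; last by rewrite big1 // => k _; rewrite /th zE mul0r mulr0.
  by rewrite -th_u // /uu mulr_sumr; apply: eq_bigr => k _; rewrite mulrCA.
 rewrite cabs_real ger0_norm; last by apply: sumr_ge0 => z _; exact: cabs_ge0.
 rewrite -sum1_card natr_sum mulr_sumr; apply: ler_sum => z zE.
 by rewrite mulr1 hE.
have stepB : (lam * #|E|%:R) ^+ 2 <= \sum_k w k * cabs (A k) ^+ 2.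
 apply: (le_via (cabs (\sum_(k <- ks) f k * A (zk n k)) ^+ 2)).
  by rewrite lerXn2r ?qualifE /= ?cabs_ge0 // mulr_ge0.
 apply: le_trans (CS_cabs _ _ _ _) _.
 apply: (le_via (\sum_(k <- ks) cabs (A (zk n k)) ^+ 2)).
  by rewrite ler_piMl // sumr_ge0 // => k _; rewrite sqr_ge0.
 apply: (le_via (\sum_(k <- map (zk n) ks) w k * cabs (A k) ^+ 2)).
  rewrite big_map big_seq [leRHS]big_seq; apply: ler_sum => k kk.
  by rewrite ler_peMl ?sqr_ge0 // wks.
 apply: sum_pred_uniq => // k; rewrite mulr_ge0 ?sqr_ge0 //.
 by have /andP[] := hw k.
pose ip a a' := \sum_k (w k)%:C * (At a k * ((At a' k)^*)%C).
have stepC : (\sum_k w k * cabs (A k) ^+ 2)%:C = \sum_a \sum_a' ip a a'.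
 rewrite (raddf_sum (real_complex R)) /=.
 transitivity (\sum_k \sum_a \sum_a' (w k)%:C * (At a k * ((At a' k)^*)%C)).
  apply: eq_bigr => k _; rewrite rmorphM /= -mul_conj AE conj_sum mulr_suml mulr_sumr.
  by apply: eq_bigr => a _; rewrite !mulr_sumr.
 by rewrite exchange_big /=; apply: eq_bigr => a _; rewrite exchange_big.
(* At a fixed time the quadratic part of the phase depends on [k] only and disappears in the
   modulus, so Parseval in space applies. *)
have At2 a : \sum_k cabs (At a k) ^+ 2 <= n%:R ^+ 4 * e a.
 have -> : \sum_k cabs (At a k) ^+ 2 =
   \sum_(k : V n) cabs (\sum_(x : V n) th (a, x) * ez (dv k x)) ^+ 2.
  apply: eq_bigr => k _; congr (_ ^+ 2).
  rewrite /At (eq_bigr (fun x => ez (- (dv k k * a)) * (th (a, x) * ez (dv k x)))).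
   by rewrite -mulr_sumr cabsM cabs_ez mul1r.
  by move=> x _; rewrite /ph /= ezD // mulrA mulrC.
 rewrite parsevalV // ler_wpM2l ?exprn_ge0 //; apply: ler_sum => x _.
 apply: (le_via (ind (a, x) ^+ 2)).
  by rewrite lerXn2r ?qualifE /= ?cabs_ge0 ?ind0 ?th_ind.
 by rewrite /ind; case: ifP => _; rewrite ?expr1n ?expr0n.
have ip_bad a a' : cabs (ip a a') <= W * n%:R ^+ 4 * ((e a + e a') / 2).
 apply: le_trans (cabs_sum _ _ _) _.
 apply: (le_via (\sum_k W * ((cabs (At a k) ^+ 2 + cabs (At a' k) ^+ 2) / 2))).
  apply: ler_sum => k _; have /andP[w0 w1] := hw k.
  rewrite !cabsM cabs_conj cabs_real ger0_norm // ler_pM ?mulr_ge0 ?cabs_ge0 //.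
  have := sqr_ge0 (cabs (At a k) - cabs (At a' k)).
  by move: (cabs _) (cabs _) => x y; nra.
 have W0 : 0 <= W by have /andP[/le_trans] := hw 0; apply.
 rewrite -mulr_sumr -mulrA ler_wpM2l // -mulr_suml big_split /= mulrA ler_wpM2r //.
 by rewrite mulrDr lerD.
(* Exchanging sums exposes [kern] at the difference of the two grid points, whose time component is
   [a - a']. *)
have ip_good a a' : a - a' \notin Bad -> cabs (ip a a') <= D * (e a * e a').
 move=> nb.
 have -> : ip a a' = \sum_(x : V n) \sum_(y : V n)
   th (a, x) * ((th (a', y))^*)%C * kern w ((a, x) - (a', y)).
  transitivity (\sum_k \sum_(x : V n) \sum_(y : V n)
   (w k)%:C * (th (a, x) * ((th (a', y))^*)%C * ez (ph k ((a, x) - (a', y))))).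
   apply: eq_bigr => k _; rewrite /At conj_sum mulr_suml mulr_sumr.
   apply: eq_bigr => x _; rewrite !mulr_sumr; apply: eq_bigr => y _.
   by rewrite phD ezD // phN ezN // rmorphM /= mulrACA.
  rewrite exchange_big /=; apply: eq_bigr => x _; rewrite exchange_big /=.
  apply: eq_bigr => y _; rewrite /kern mulr_sumr; apply: eq_bigr => k _.
  by rewrite mulrCA.
 apply: le_trans (cabs_sum _ _ _) _; rewrite /e mulr_suml mulr_sumr.
 apply: ler_sum => x _; apply: le_trans (cabs_sum _ _ _) _.
 rewrite !mulr_sumr; apply: ler_sum => y _.
 rewrite !cabsM cabs_conj mulrC ler_pM ?mulr_ge0 ?cabs_ge0 //; first exact: hK.
 by rewrite ler_pM ?cabs_ge0.
have D0 : D * #|E|%:R ^+ 2 = \sum_a \sum_a' D * (e a * e a').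
 rewrite expr2 -eE mulr_suml mulr_sumr; apply: eq_bigr => a _.
 by rewrite !mulr_sumr.
have W0 : 0 <= W by have /andP[/le_trans] := hw 0; apply.
have total : (lam * #|E|%:R) ^+ 2 <=
  W * n%:R ^+ 4 * #|Bad|%:R * #|E|%:R + D * #|E|%:R ^+ 2.
 apply: (le_trans stepB).
 rewrite -[leLHS]ger0_norm; last first.
  by apply: sumr_ge0 => k _; rewrite mulr_ge0 ?sqr_ge0 //; have /andP[] := hw k.
 rewrite -cabs_real stepC.
 apply: (le_via (\sum_a \sum_a' ((if a - a' \in Bad then
   W * n%:R ^+ 4 * ((e a + e a') / 2) else 0) +
   if a - a' \in Bad then 0 else D * (e a * e a')))).
  apply: le_trans (cabs_sum _ _ _) _; apply: ler_sum => a _.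
  apply: le_trans (cabs_sum _ _ _) _; apply: ler_sum => a' _.
  by case: ifPn => [_|/ip_good]; rewrite ?addr0 ?add0r.
 under eq_bigr do rewrite big_split /=.
 rewrite big_split /= lerD //; last first.
  rewrite D0; apply: ler_sum => a _; apply: ler_sum => a' _.
  by case: ifP => // _; rewrite !mulr_ge0.
 have cnt1 a : \sum_a' (if a - a' \in Bad then 1 else 0) = #|Bad|%:R :> R.
  rewrite (reindex_inj (subrI a)) /= -big_mkcond /= -sum1_card natr_sum.
  by apply: eq_bigl => a'; rewrite subKr.
 have cnt2 a' : \sum_a (if a - a' \in Bad then 1 else 0) = #|Bad|%:R :> R.
  rewrite (reindex_inj (addIr a')) /= -big_mkcond /= -sum1_card natr_sum.
  by apply: eq_bigl => a; rewrite addrK.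
 set c := W * n%:R ^+ 4.
 have -> : \sum_a \sum_a' (if a - a' \in Bad then c * ((e a + e a') / 2) else 0) =
   \sum_a \sum_a' (c / 2 * e a) * (if a - a' \in Bad then 1 else 0) +
   \sum_a \sum_a' (c / 2 * e a') * (if a - a' \in Bad then 1 else 0).
  rewrite -big_split; apply: eq_bigr => a _; rewrite -big_split.
  by apply: eq_bigr => a' _ /=; case: ifP => _; lra.
 rewrite [X in _ + X]exchange_big /=.
 under eq_bigr do rewrite -mulr_sumr cnt1.
 under [X in _ + X]eq_bigr do rewrite -mulr_sumr cnt2.
 by rewrite -!mulr_suml -!mulr_sumr eE; lra.
have [E0|E0] := eqVneq (#|E|%:R : R) 0.
 by rewrite E0 !mulr0 addr0 !mulr_ge0 ?exprn_ge0.
have Ep : 0 < (#|E|%:R : R) by rewrite lt_def E0 ler0n.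
rewrite -(ler_pM2r Ep); move: total; rewrite exprMn; nra.
Qed.

End TTstar.

(** * Gauss sums modulo an odd prime *)

Section Gauss.
Context {R : realType}.
Variable q : nat.
Hypothesis q2 : (2 < q)%N.
Hypothesis pq : prime q.

Let q1 : (1 < q)%N. Proof. exact: prime_gt1. Qed.

Definition gs (l y : 'Z_q) : R[i] := \sum_(m : 'Z_q) ez (m * y - m * m * l).

Lemma unitZ_prime (a : 'Z_q) : a != 0 -> a \is a GRing.unit.
Proof.
move=> a0; rewrite -(natr_Zp a) unitZpE // coprime_sym coprime_sym prime_coprime //.
apply/negP => /dvdn_leq; rewrite lt0n => /(_ a0).
by rewrite leqNgt (valZ q1 a).
Qed.

Lemma two_neq0 : (2 : 'Z_q) != 0.
Proof.
apply/eqP => /(congr1 (@nat_of_ord _)); rewrite (val_Zp_nat q1 2).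
by rewrite modn_small.
Qed.

Lemma mulZ_eq0 (a b : 'Z_q) : (a * b == 0) = (a == 0) || (b == 0).
Proof.
apply/eqP/orP => [h|[/eqP->|/eqP->]]; rewrite ?mul0r ?mulr0 //.
have [a0|/unitZ_prime ua] := eqVneq a 0; [by left|right].
by rewrite -(mulKr ua b) h mulr0.
Qed.

(** Differencing: after the shift of the first variable by the second, the remaining sum is over a
    character of slope -2hl, which kills every h except 0. *)
Lemma gauss_sq (l y : 'Z_q) : l != 0 -> cabs (gs l y) ^+ 2 = q%:R.
Proof.
move=> l0; apply: (@complexI R); rewrite -mul_conj rmorph_nat /gs conj_sum mulr_suml.
under eq_bigr do rewrite mulr_sumr.
rewrite exchange_big.
transitivity (\sum_(m : 'Z_q) \sum_(h : 'Z_q)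
  (ez (h * y - h * h * l) * ez (- (2 * h * l) * m) : R[i])).
 apply: eq_bigr => m _; rewrite (reindex_inj (addIr m)).
 apply: eq_bigr => h _. rewrite -ezN // -!ezD //; congr ez; ring.
rewrite exchange_big /= (bigD1 0) //= [X in _ + X]big1 ?addr0.
 rewrite -mulr_sumr sum_ez // (_ : - (2 * 0 * l) = 0 :> 'Z_q); last by ring.
 by rewrite eqxx (_ : 0 * y - 0 * 0 * l = 0 :> 'Z_q) ?ez0 ?mul1r //; ring.
move=> h h0; rewrite -mulr_sumr sum_ez // oppr_eq0 !mulZ_eq0.
by rewrite (negbTE two_neq0) (negbTE h0) (negbTE l0) mulr0.
Qed.

Lemma cabs_gs (l y : 'Z_q) : l != 0 -> cabs (gs l y) = Num.sqrt q%:R.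
Proof. by move=> /(gauss_sq y) <-; rewrite sqrtr_sqr ger0_norm ?cabs_ge0. Qed.

(** Completing the square with [c] the inverse of 2l; the linear parameter survives only as a
    phase. *)
Lemma gs_square (l c y : 'Z_q) : 2 * l * c = 1 ->
 gs l y = ez (l * (c * y) ^+ 2) * gs l 0.
Proof.
move=> h; rewrite /gs mulr_sumr (reindex_inj (addIr (c * y))) /=.
apply: eq_bigr => m _; rewrite -ezD //; congr ez.
have -> : (m + c * y) * y = m * y + c * y * (2 * l * c * y) by rewrite h; ring.
have -> : m * y = m * (2 * l * c * y) by rewrite h; ring.
ring.
Qed.

Lemma kern1 (z : grid q) : kern (fun=> 1 : R) z = \prod_j gs z.1 (z.2 j).
Proof.
rewrite /kern /gs -sumV_prod; apply: eq_bigr => k _.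
rewrite mul1r -ez_sum //; congr ez; rewrite /ph /dv mulr_suml -sumrB.
by [].
Qed.

(** Each of the four coordinates shows exact square root cancellation at every nonzero time, however
    that time is approximated by rationals. *)
Lemma cabs_kern1 (z : grid q) : z.1 != 0 -> cabs (kern (fun=> 1 : R) z) = q%:R ^+ 2.
Proof.
move=> z0; rewrite kern1 cabs_prod; under eq_bigr do rewrite cabs_gs //.
rewrite prodr_const card_ord -[in RHS](@sqr_sqrtr R q%:R) //; ring.
Qed.

End Gauss.

(** * From a prime grid to a multiple of it *)

Section Transfer.
Context {R : realType}.

Lemma card_grid n : (1 < n)%N -> #|{: grid n}| = (n ^ 5)%N.
Proof. by move=> n1; rewrite card_prod card_V // card_ord (Zp_cast n1) -expnS. Qed.

Definition in_cube (c : Z4) (s : nat) (k : Z4) : Prop :=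
 forall j : 'I_4, cmp c j <= cmp k j < cmp c j + s%:Z.

Lemma cmp_inj (k l : Z4) : (forall j, cmp k j = cmp l j) -> k = l.
Proof.
case: k => [[[a b] c] d]; case: l => [[[a' b'] c'] d'] h.
have h0 := h o0; have h1 := h o1.
have h2 := h o2; have h3 := h o3.
by rewrite /cmp /= in h0 h1 h2 h3; rewrite h0 h1 h2 h3.
Qed.

Lemma intZ_eq n (a b : int) : (1 < n)%N -> (a%:~R : 'Z_n) = b%:~R ->
 `|a - b| < n%:Z -> a = b.
Proof.
move=> n1 e.
have : ((a - b)%:~R : 'Z_n) = 0 by rewrite rmorphB /= e subrr.
move=> h ab; apply/eqP; rewrite -subr_eq0 -absz_eq0; apply/eqP; move: h.
have mn : (`|a - b| < n)%N by lia.
have [m [e1|e1] em] : exists2 m : nat, a - b = m%:Z \/ a - b = - m%:Z & m = `|a - b|%N.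
- by exists `|a - b|%N; [lia|].
- rewrite e1 => /(congr1 (@nat_of_ord _)); rewrite -pmulrn (val_Zp_nat n1).
 by rewrite modn_small -?em => [->//|]; rewrite em.
rewrite e1 rmorphN /= => /eqP; rewrite oppr_eq0 => /eqP.
move/(congr1 (@nat_of_ord _)); rewrite -pmulrn (val_Zp_nat n1).
by rewrite modn_small -?em => [->//|]; rewrite em.
Qed.

Lemma uniq_zk n c s (ks : seq Z4) : (1 < n)%N -> (s <= n)%N -> uniq ks ->
 (forall k, k \in ks -> in_cube c s k) -> uniq (map (zk n) ks).
Proof.
move=> n1 sn uks hc; rewrite map_inj_in_uniq // => k l /hc hk /hc hl e.
apply: cmp_inj => j; have := congr1 (fun x : V n => x j) e; rewrite !ffunE => ej.
apply: (intZ_eq n1 ej); have := hk j; have := hl j; lia.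
Qed.

Variables (q J' : nat).
Hypothesis q1 : (1 < q)%N.
Hypothesis J1 : (0 < J')%N.
Let J := (q * J')%N.
Let J_gt1 : (1 < J)%N. Proof. by rewrite /J; nia. Qed.

(** The inclusion of the q-torsion points into the grid of size J = q J'. *)
Definition shift (z : grid q) : grid J :=
 ((J' * z.1)%N%:R, [ffun j => (J' * z.2 j)%N%:R]).

Lemma ez_shift (c : int) (a : 'Z_q) :
 ez (c%:~R * (J' * a)%N%:R : 'Z_J) = ez (c%:~R * a) :> R[i].
Proof.
have -> : c%:~R * a = (c * (a : nat)%:Z)%:~R.
 by rewrite intrM -pmulrn natr_Zp.
have -> : c%:~R * (J' * a)%N%:R = (c * (J' * a)%N%:Z)%:~R :> 'Z_J.
 by rewrite intrM -pmulrn.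
rewrite !ez_int //; congr expi; rewrite !intrM -!pmulrn !natrM.
by field; rewrite !pnatr_eq0; lia.
Qed.

Lemma ez_ph_shift (k : Z4) (z : grid q) :
 ez (ph (zk J k) (shift z)) = ez (ph (zk q k) z) :> R[i].
Proof.
have h1 : ez (dv (zk J k) (shift z).2) = ez (dv (zk q k) z.2) :> R[i].
 by rewrite /dv /= !ez_sum //; apply: eq_bigr => j _; rewrite !ffunE ez_shift.
have h2 : ez (dv (zk J k) (zk J k) * (shift z).1) =
  ez (dv (zk q k) (zk q k) * z.1) :> R[i].
 rewrite /dv /= !mulr_suml !ez_sum //; apply: eq_bigr => j _.
 by rewrite !ffunE -!intrM ez_shift.
by rewrite /ph !ezD // !ezN // h1 h2.
Qed.

Lemma uu_shift ks f (z : grid J) z' :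
 uu ks f (z + shift z') = uu ks (fun k => f k * ez (ph (zk J k) z)) z' :> R[i].
Proof.
by apply: eq_bigr => k _; rewrite phD ezD // ez_ph_shift mulrA.
Qed.

(** Average over the translates of the q-torsion subgrid. On each translate the solution is a
    solution on the q-grid whose coefficients are multiplied by phases, so the density of its level
    set is at most the worst density on the q-grid. *)
Lemma level_transfer ks (f : Z4 -> R[i]) (lam B : R) :
 (forall g, \sum_(k <- ks) cabs (g k) ^+ 2 = \sum_(k <- ks) cabs (f k) ^+ 2 ->
  #|(finset (fun z : grid q => lam < cabs (uu ks g z)))|%:R <= B) ->
 q%:R ^+ 5 * #|(finset (fun z : grid J => lam < cabs (uu ks f z)))|%:R <= J%:R ^+ 5 * B.
Proof.
move=> h.
have cardE n (P : pred (grid n)) : #|finset P|%:R = \sum_z (if P z then 1 else 0) :> R.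
 by rewrite -sum1_card natr_sum big_mkcond /=; apply: eq_bigr => z _; rewrite inE.
have -> : q%:R ^+ 5 * #|(finset (fun z : grid J => lam < cabs (uu ks f z)))|%:R =
 \sum_(z : grid J) \sum_(z' : grid q)
  (if lam < cabs (uu ks f (z + shift z')) then 1 else 0) :> R.
 rewrite exchange_big /= (eq_bigr (fun=>
  #|(finset (fun z : grid J => lam < cabs (uu ks f z)))|%:R)); last first.
  by move=> z' _; rewrite cardE [RHS](reindex_inj (addIr (shift z'))).
 by rewrite sumr_const card_grid // -[RHS]mulr_natl natrX.
apply: (le_via (\sum_(z : grid J) B)); last first.
 by rewrite sumr_const card_grid // -[leLHS]mulr_natl natrX.
apply: ler_sum => z _; under eq_bigr do rewrite uu_shift.
rewrite -(cardE _ (fun z' => lam < cabs (uu ks _ z'))); apply: h.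
by apply: eq_bigr => k _; rewrite cabsM cabs_ez mulr1.
Qed.

End Transfer.

(** * The L4 estimate on cubes and slabs *)

Section StrongL4.
Context {R : realType}.

(** [TTstar] with weight 1: only the time difference 0 is bad, the kernel has size q^2 elsewhere,
    and lam^2 >= 2 q^2 absorbs it. For q comparable to lam the density of the level set is of order
    lam^-3. *)
Lemma level3 (q J : nat) ks (f : Z4 -> R[i]) (lam : R) :
 prime q -> (2 < q)%N -> (q %| J)%N -> (0 < J)%N -> 0 <= lam ->
 uniq (map (zk q) ks) -> \sum_(k <- ks) cabs (f k) ^+ 2 <= 1 ->
 2 * q%:R ^+ 2 <= lam ^+ 2 ->
 #|(finset (fun z : grid J => lam < cabs (uu ks f z)))|%:R * (q%:R * lam ^+ 2) <= 2 * J%:R ^+ 5.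
Proof.
move=> pq q2 /dvdnP[J' ->]; rewrite muln_gt0 => /andP[J0 q0] lam0 uks f1 ql.
rewrite mulnC; have q1 := prime_gt1 pq.
have qp : 0 < (q%:R : R) by rewrite ltr0n.
have l2 : 0 < lam ^+ 2 by apply: lt_le_trans ql; rewrite mulr_gt0 ?exprn_gt0.
have := @level_transfer R q J' q1 J0 ks f lam (2 * q%:R ^+ 4 / lam ^+ 2).
move=> /(_ _) h; have {h} : q%:R ^+ 5 * #|(finset (fun z : grid (q * J') => lam < cabs (uu ks f z)))|%:R
  <= (q * J')%:R ^+ 5 * (2 * q%:R ^+ 4 / lam ^+ 2).
 apply: h => g gE.
 set E := finset _.
 have hw : forall k : V q, 0 <= (1 : R) <= 1 by move=> _; rewrite ler01 lexx.
 have := @TTstar R q q1 ks g (fun=> 1) 1 (q%:R ^+ 2) lam (finset.set1 0) E uks.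
 rewrite gE f1 cards1 => /(_ isT hw) h.
 have {h} : lam ^+ 2 * #|E|%:R <= 1 * q%:R ^+ 4 * 1 + q%:R ^+ 2 * #|E|%:R.
  apply: h => //; first by move=> z; rewrite inE => z0; rewrite cabs_kern1.
  by move=> z; rewrite inE => /ltW.
 rewrite ler_pdivlMr //; move: (ler0n R #|E|) ql.
 move: (#|E|%:R) (lam ^+ 2) (q%:R : R) => N L Q; clear => N0 ql h.
 have : 0 <= N * (L - 2 * Q ^+ 2) by rewrite mulr_ge0 // subr_ge0.
 lra.
rewrite mulrA ler_pdivlMr // natrM exprMn.
set N := #|_|%:R => h.
rewrite -(@ler_pM2l _ (q%:R ^+ 4)) ?exprn_gt0 //.
rewrite (_ : _ * (N * _) = q%:R ^+ 5 * N * lam ^+ 2); last by ring.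
by apply: le_trans h _; rewrite ?natrM ?exprMn; lra.
Qed.

(** Induction on the number of shells; the top shell, where r lies in (2^n, 2^(n+1)], alone pays for
    r^4 there. *)
Lemma layer_cake (m n : nat) (r : R) : (m <= n)%N -> 0 <= r -> r <= 2 ^+ n ->
 r ^+ 4 <= (if r <= 2 ^+ m then r ^+ 4 else 0) +
  \sum_(m <= i < n) 16 * 16 ^+ i * (if 2 ^+ i < r then 1 else 0).
Proof.
move=> mn r0; move: mn; elim: n => [|n ih].
 by rewrite leqn0 => /eqP-> h; rewrite big_geq // addr0 h.
rewrite leq_eqVlt => /predU1P[<- h|mn h].
 by rewrite big_geq // addr0 h.
rewrite big_nat_recr /=; last by lia.
have s0 : 0 <= \sum_(m <= i < n) 16 * 16 ^+ i * (if 2 ^+ i < r then 1 else 0 : R).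
 by apply: sumr_ge0 => i _; rewrite !mulr_ge0 ?exprn_ge0 //; case: ifP.
case: (ltP (2 ^+ n)) => [h1|/ih]; last first.
 by move=> /(_ mn) h2; rewrite mulr0 addr0.
have : r ^+ 4 <= (2 ^+ n.+1) ^+ 4 by rewrite lerXn2r ?qualifE /= ?exprn_ge0.
have -> : (2 ^+ n.+1) ^+ 4 = 16 * 16 ^+ n :> R.
 by rewrite -exprS -exprM mulnC exprM; congr (_ ^+ _); lra.
have : 0 <= (if r <= 2 ^+ m then r ^+ 4 else 0) by case: ifP; rewrite ?exprn_ge0.
by move: (if _ then _ else _) => X; lra.
Qed.

Lemma sum1_seq (T : Type) (r : seq T) (P : pred T) :
 \sum_(i <- r | P i) (1 : R) = (count P r)%:R.
Proof. by rewrite big_const_seq iter_addr_0. Qed.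

Lemma sup_uu n ks (f : Z4 -> R[i]) (z : grid n) :
 cabs (uu ks f z) ^+ 2 <= (size ks)%:R * \sum_(k <- ks) cabs (f k) ^+ 2.
Proof.
apply: le_trans (CS_cabs _ _ _ _) _; rewrite mulrC ler_wpM2r //.
 exact: sumsq_ge0.
under eq_bigr do rewrite cabs_ez expr1n.
by rewrite sum1_seq count_predT.
Qed.

Lemma uniq_map_inj (T T' : eqType) (g : T -> T') (r : seq T) :
 uniq (map g r) -> {in r &, injective g}.
Proof.
elim: r => [//|x r ih] /= /andP[xr /ih{}ih] a b.
rewrite !inE => /predU1P[->|ar] /predU1P[->|br] // e; last exact: ih.
- by move: xr; rewrite e map_f.
- by move: xr; rewrite -e map_f.
Qed.

Lemma sum_gridE (U : nmodType) J (F : grid J -> U) :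
 \sum_(z : grid J) F z = \sum_(a : 'Z_J) \sum_(x : V J) F (a, x).
Proof. by rewrite pair_bigA; apply: eq_bigr => -[]. Qed.

(** Characters of distinct frequencies are orthogonal in space at each time: [almost_orthogonal]
    with equality as nearness. *)
Lemma bessel_time J ks (f : Z4 -> R[i]) (a : 'Z_J) : (1 < J)%N -> uniq (map (zk J) ks) ->
 \sum_(x : V J) cabs (uu ks f (a, x)) ^+ 2 <= J%:R ^+ 4 * \sum_(k <- ks) cabs (f k) ^+ 2.
Proof.
move=> J1 uks.
have := @almost_orthogonal R (V J) Z4 ks (fun i j => i == j)
 (fun k x => f k * ez (ph (zk J k) (a, x))) 1.
move=> /(_ (fun i j => eq_sym i j)) h.
apply: le_trans (h _ _) _ => {h}.
- move=> i ir; rewrite sum1_seq.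
 rewrite (eq_count (a2 := pred1 i)); last by move=> j; rewrite /= eq_sym.
 by rewrite count_uniq_mem ?(map_uniq uks) // ir.
- move=> i j ir jr ij.
 have kij : zk J i - zk J j != 0.
  rewrite subr_eq0; apply: contra ij => /eqP e; apply/eqP.
  exact: (uniq_map_inj uks).
 under eq_bigr => z _ do rewrite conjM -ezN // mulrACA -ezD //.
 rewrite -mulr_sumr.
 rewrite (eq_bigr (fun x => ez (dv (zk J i - zk J j) x) *
   ez (- (dv (zk J i) (zk J i) * a) + dv (zk J j) (zk J j) * a))).
  by rewrite -mulr_suml sum_ez_dv // (negbTE kij) mul0r mulr0.
 move=> x _; rewrite -ezD //; congr ez; rewrite /ph /= dvDl dvNl; ring.
- rewrite mul1r mulr_sumr; apply: ler_sum => k _.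
 under eq_bigr do rewrite cabsM cabs_ez mulr1.
 by rewrite sumr_const card_V // -[leLHS]mulr_natl natrX.
Qed.

Lemma bessel n ks (f : Z4 -> R[i]) : (1 < n)%N -> uniq (map (zk n) ks) ->
 \sum_(z : grid n) cabs (uu ks f z) ^+ 2 <= n%:R ^+ 5 * \sum_(k <- ks) cabs (f k) ^+ 2.
Proof.
move=> n1 uks; rewrite sum_gridE; apply: (le_via (\sum_(a : 'Z_n) n%:R ^+ 4 * \sum_(k <- ks) cabs (f k) ^+ 2)).
 by apply: ler_sum => a _; exact: bessel_time.
by rewrite sumr_const card_ord Zp_cast // -[leLHS]mulr_natl mulrA -exprS.
Qed.

Lemma homogeneous4 n ks (B : R) :
 (forall g, \sum_(k <- ks) cabs (g k) ^+ 2 <= 1 ->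
  \sum_(z : grid n) cabs (uu ks g z) ^+ 4 <= B) ->
 forall f, \sum_(z : grid n) cabs (uu ks f z) ^+ 4 <=
  B * (\sum_(k <- ks) cabs (f k) ^+ 2) ^+ 2.
Proof.
move=> h f; set S := \sum_(k <- ks) _.
have S0 : 0 <= S by exact: sumsq_ge0.
have [e|Sn] := eqVneq S 0.
 rewrite e expr0n /= mulr0 big1 // => z _.
 have : cabs (uu ks f z) ^+ 2 <= (size ks)%:R * S := sup_uu _ _ _.
 rewrite e mulr0 => h1; have /eqP : cabs (uu ks f z) ^+ 2 == 0.
  by rewrite eq_le h1 sqr_ge0.
 by rewrite (_ : _ ^+ 4 = cabs (uu ks f z) ^+ 2 * cabs (uu ks f z) ^+ 2) => [->|]; [rewrite mul0r|ring].
have Sp : 0 < S by rewrite lt_def Sn.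
have r0 : 0 < Num.sqrt S by rewrite sqrtr_gt0.
pose g k := ((Num.sqrt S)^-1)%:C * f k.
have := h g; have -> : \sum_(k <- ks) cabs (g k) ^+ 2 = 1.
 under eq_bigr do rewrite cabsM cabs_real exprMn ger0_norm ?invr_ge0 ?sqrtr_ge0 //.
 by rewrite -mulr_sumr exprVn sqr_sqrtr // mulVf.
move=> /(_ (lexx _)).
have -> : \sum_(z : grid n) cabs (uu ks g z) ^+ 4 =
  (S ^+ 2)^-1 * \sum_(z : grid n) cabs (uu ks f z) ^+ 4.
 rewrite mulr_sumr; apply: eq_bigr => z _.
 have -> : uu ks g z = ((Num.sqrt S)^-1)%:C * uu ks f z.
  by rewrite /uu mulr_sumr; apply: eq_bigr => k _; rewrite /g mulrA.
 rewrite cabsM cabs_real exprMn ger0_norm ?invr_ge0 ?sqrtr_ge0 //; congr (_ * _).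
 by rewrite exprVn (_ : 4 = (2 * 2))%N // exprM sqr_sqrtr.
by rewrite mulrC ler_pdivrMr ?exprn_gt0.
Qed.

(** A level-set bound at height lam needs a prime divisor of J of size about lam; divisibility by
    all primes up to N supplies one for every height in use. *)
Definition good (N J : nat) : Prop :=
 (N <= J)%N /\ forall p, prime p -> (p <= N)%N -> (p %| J)%N.

Lemma size_cube m c ks : (0 < m)%N -> uniq ks ->
 (forall k, k \in ks -> in_cube c (2 ^ m) k) -> (size ks <= 16 ^ m)%N.
Proof.
move=> m0 uks hc.
have n1 : (1 < 2 ^ m)%N by rewrite -{1}(expn0 2) ltn_exp2l.
have := uniq_zk n1 (leqnn _) uks hc => u.
rewrite -(size_map (zk (2 ^ m))) -(card_uniqP u).
by apply: leq_trans (max_card _) _; rewrite card_V // -expnM mulnC expnM.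
Qed.

(** The prime q is taken in (2^(i-3), 2^(i-1)]. The lower end is at least the side of the cube, so
    frequencies stay distinct modulo q; the upper end makes 2 q^2 at most the square of the height
    2^i, as [level3] asks. *)
Lemma high_level m i J c ks (f : Z4 -> R[i]) : (0 < m)%N -> (m + 3 <= i)%N ->
 good (2 ^ (i - 1)) J -> uniq ks -> (forall k, k \in ks -> in_cube c (2 ^ m) k) ->
 \sum_(k <- ks) cabs (f k) ^+ 2 <= 1 ->
 \sum_(z : grid J) 16 * 16 ^+ i * (if 2 ^+ i < cabs (uu ks f z) then 1 else 0) <=
  256 * 2 ^+ i * J%:R ^+ 5 :> R.
Proof.
move=> m0 i1 [mJ gJ] uks hc f1.
set u := fun z : grid J => cabs (uu ks f z).
have [q pq /andP[q1 q2]] := @exists_prime (2 ^ (i - 3)) ltac:(by rewrite expn_gt0).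
have q4 : (q <= 2 ^ (i - 1))%N.
 by rewrite (_ : (i - 1 = 2 + (i - 3))%N) ?expnD //; lia.
have mi : (2 ^ m <= 2 ^ (i - 3))%N by rewrite leq_exp2l //; lia.
have m2 : (1 < 2 ^ m)%N by rewrite -{1}(expn0 2) ltn_exp2l.
have mq : (2 ^ m <= q)%N by lia.
have q1' : (1 < q)%N by lia.
have uq : uniq (map (zk q) ks) by exact: (uniq_zk q1' mq uks hc).
have q2' : (2 < q)%N by lia.
have J0' : (0 < J)%N by lia.
have l0 : 0 <= 2 ^+ i :> R by rewrite exprn_ge0.
have h := level3 pq q2' (gJ _ pq q4) J0' l0 uq f1.
rewrite -mulr_sumr.
have -> : \sum_z (if 2 ^+ i < u z then 1 else 0) =
  #|(finset (fun z : grid J => 2 ^+ i < cabs (uu ks f z)))|%:R :> R.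
 by rewrite -sum1_card natr_sum [RHS]big_mkcond /=; apply: eq_bigr => z _; rewrite inE.
have qi : 2 ^+ i <= 8 * (q%:R : R).
 rewrite (_ : 2 ^+ i = 8 * 2 ^+ (i - 3) :> R).
  by rewrite ler_wpM2l // -natrX ler_nat ltnW.
 by rewrite -{1}(subnKC (_ : 3 <= i)%N) ?exprD; [lra|lia].
have q4' : 2 * q%:R ^+ 2 <= (2 ^+ i) ^+ 2 :> R.
 have : q%:R <= 2 ^+ (i - 1) :> R by rewrite -natrX ler_nat.
 rewrite (_ : 2 ^+ i = 2 * 2 ^+ (i - 1) :> R); last first.
  by rewrite -exprS; congr (_ ^+ _); lia.
 move: (2 ^+ (i - 1)) (ler0n R q) => t; nra.
have {}h := h q4'; move: h qi; set N := #|_|%:R; set t := 2 ^+ i => h qi.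
have t0 : 0 < t by rewrite exprn_gt0.
have -> : 16 ^+ i = t ^+ 4 :> R by rewrite /t -exprM mulnC exprM; congr (_ ^+ _); lra.
have N0 : 0 <= N by rewrite ler0n.
have : t ^+ 2 * N * t * t <= t ^+ 2 * N * t * (8 * q%:R).
 by rewrite ler_wpM2l // !mulr_ge0 // ltW.
have : 128 * t * (N * (q%:R * t ^+ 2)) <= 128 * t * (2 * J%:R ^+ 5).
 by rewrite ler_wpM2l // ; lra.
rewrite (_ : t ^+ 4 = t ^+ 2 * t * t); last by ring.
move: (J%:R ^+ 5) => J5; lra.
Qed.

(** The scale-invariant Strichartz estimate in L^4, without loss. For unit data, values up to
    2^(m+3) are paid for by the L^2 norm and cost 64 * 4^m. The level i above costs 256 * 2^i, and
    the levels stop before 2m+3 because a cube of side 2^m has 16^m points, so the solution is at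
    most 4^m; they add up to at most 2048 * 4^m. *)
Lemma strong_L4 m J c ks : (0 < m)%N -> good (4 * 4 ^ m) J -> uniq ks ->
 (forall k, k \in ks -> in_cube c (2 ^ m) k) ->
 forall f : Z4 -> R[i], \sum_(z : grid J) cabs (uu ks f z) ^+ 4 <=
  2112 * 4 ^+ m * J%:R ^+ 5 * (\sum_(k <- ks) cabs (f k) ^+ 2) ^+ 2.
Proof.
move=> m0 [mJ gJ] uks hc; apply: homogeneous4 => f f1.
have e4 k : 2 ^+ (2 * k) = 4 ^+ k :> R by rewrite exprM; congr (_ ^+ _); lra.
have m24 : (2 ^ m <= 4 ^ m)%N by rewrite leq_exp2r.
have m2 : (1 < 2 ^ m)%N by rewrite -{1}(expn0 2) ltn_exp2l.
have J1 : (1 < J)%N by lia.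
have J0 : 0 <= (J%:R ^+ 5 : R) by rewrite exprn_ge0.
set u := fun z : grid J => cabs (uu ks f z).
have u2 z : u z <= 2 ^+ (2 * m + 3).
 have -> : 2 ^+ (2 * m + 3) = 8 * 4 ^+ m :> R by rewrite exprD e4; lra.
 have : u z ^+ 2 <= (4 ^+ m) ^+ 2.
  apply: le_trans (sup_uu _ _ _) _.
  have h : (size ks)%:R <= (4 ^+ m) ^+ 2 :> R.
   rewrite -exprM mulnC exprM (_ : 4 ^+ 2 = 16%:R); last by lra.
   by rewrite -natrX ler_nat (size_cube m0 uks hc).
  by apply: le_trans h; rewrite ler_piMr.
 rewrite ler_sqr ?qualifE /= ?cabs_ge0 ?exprn_ge0 // => h.
 by apply: (le_trans h); rewrite ler_peMl ?exprn_ge0 //; lra.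
apply: (le_via (\sum_z (64 * 4 ^+ m * u z ^+ 2 +
  \sum_(m + 3 <= i < 2 * m + 3) 16 * 16 ^+ i * (if 2 ^+ i < u z then 1 else 0)))).
 apply: ler_sum => z _.
 have := @layer_cake (m + 3) (2 * m + 3) (u z) ltac:(lia) (cabs_ge0 _) (u2 z).
 move/le_trans; apply; rewrite lerD2r; have z0 : 0 <= u z by exact: cabs_ge0.
 case: ifP => [h|_]; last by rewrite !mulr_ge0 ?exprn_ge0.
 rewrite (_ : u z ^+ 4 = u z ^+ 2 * u z ^+ 2); last by ring.
 rewrite ler_wpM2r ?sqr_ge0 // (le_via ((2 ^+ (m + 3)) ^+ 2)) //.
  by rewrite lerXn2r ?qualifE /= ?exprn_ge0.
 by rewrite -exprM mulnC mulnDr exprD e4; lra.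
rewrite big_split /= -mulr_sumr exchange_big /=.
have p1 : 64 * 4 ^+ m * \sum_z u z ^+ 2 <= 64 * 4 ^+ m * J%:R ^+ 5.
 rewrite ler_wpM2l ?mulr_ge0 ?exprn_ge0 //; apply: (le_trans (bessel _ J1 _)).
  have mJ' : (2 ^ m <= J)%N by lia.
  exact: (uniq_zk J1 mJ' uks hc).
 by rewrite ler_piMr.
have p2 : \sum_(m + 3 <= i < 2 * m + 3)
  \sum_z 16 * 16 ^+ i * (if 2 ^+ i < u z then 1 else 0) <=
  \sum_(0 <= i < 2 * m + 3) 256 * 2 ^+ i * J%:R ^+ 5 :> R.
 rewrite [leRHS](@big_cat_nat _ _ _ (m + 3)) //=; last by lia.
 rewrite -[leLHS]add0r lerD //.
  apply: sumr_ge0 => i _; apply: mulr_ge0; last exact: exprn_ge0.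
   by apply: mulr_ge0; [exact: ler0n|exact: exprn_ge0].
 rewrite big_nat_cond [leRHS]big_nat_cond; apply: ler_sum => i /andP[/andP[i1 i2] _].
 apply: (high_level m0 i1 _ uks hc f1).
 have iN : (2 ^ (i - 1) <= 4 * 4 ^ m)%N.
  have -> : (4 * 4 ^ m = 2 ^ (2 + 2 * m))%N by rewrite expnD expnM.
  by rewrite leq_exp2l //; lia.
 by split; [lia|move=> p pp pN; apply: gJ => //; lia].
have p3 : \sum_(0 <= i < 2 * m + 3) 256 * 2 ^+ i * J%:R ^+ 5 <= 2048 * 4 ^+ m * J%:R ^+ 5 :> R.
 rewrite -mulr_suml ler_wpM2r // -mulr_sumr.
 have e n : \sum_(0 <= i < n) 2 ^+ i = 2 ^+ n - 1 :> R.
  elim: n => [|n ih]; first by rewrite big_geq // expr0 subrr.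
  by rewrite big_nat_recr //= ih exprS; lra.
 by rewrite e exprD e4; lra.
by move: p1 p2 p3; rewrite -/u; lra.
Qed.

End StrongL4.

(** * A weight averaged along a family of directions *)

Section DirectionalWeight.
Context {R : realType}.
Variables (q N : nat).
Hypothesis q2 : (2 < q)%N.
Hypothesis pq : prime q.
Hypothesis N0 : (0 < N)%N.
Variables (xi : 'I_N -> V q) (b : 'I_N -> R[i]).
Hypothesis b1 : forall i, cabs (b i) = 1.

Let q1 : (1 < q)%N. Proof. exact: prime_gt1. Qed.
Let NR : 0 < (N%:R : R). Proof. by rewrite ltr0n. Qed.

(** A squared exponential polynomial whose transform lives on the differences of the [xi i]. It is
    normalised so that a sum of modulus at least N/2 makes the weight at least 1. *)
Definition wt (k : V q) : R :=
 4 / N%:R ^+ 2 * cabs (\sum_i b i * ez (dv k (xi i))) ^+ 2.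

Lemma wt_bounds k : 0 <= wt k <= 4.
Proof.
apply/andP; split; first by rewrite mulr_ge0 ?sqr_ge0 // divr_ge0 // exprn_ge0.
rewrite /wt mulrAC -mulrA ler_piMr // ler_pdivrMr ?exprn_gt0 // mul1r.
rewrite lerXn2r ?qualifE /= ?cabs_ge0 //.
apply: le_trans (cabs_sum _ _ _) _.
under eq_bigr do rewrite cabsM b1 cabs_ez mulr1.
by rewrite sumr_const card_ord.
Qed.

Lemma wtE k : (wt k)%:C = (4 / N%:R ^+ 2)%:C * \sum_i \sum_i'
 (b i * ((b i')^*)%C) * ez (dv k (xi i - xi i')).
Proof.
rewrite /wt rmorphM /= -mul_conj conj_sum mulr_suml; congr (_ * _).
apply: eq_bigr => i _; rewrite mulr_sumr; apply: eq_bigr => i' _.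
by rewrite conjM -ezN // mulrACA -ezD // dvDr dvNr.
Qed.

(** Only the diagonal pairs survive. The mean 4/N will bound the number of frequencies on which the
    weight is at least 1. *)
Lemma sum_wt : injective xi -> \sum_k wt k = 4 * q%:R ^+ 4 / N%:R.
Proof.
move=> xi_inj; apply: (@complexI R); rewrite (raddf_sum (real_complex R)) /=.
under eq_bigr do rewrite wtE.
rewrite -mulr_sumr exchange_big /=.
transitivity ((4 / N%:R ^+ 2)%:C * \sum_(i < N) (q%:R ^+ 4 : R[i])).
 congr (_ * _); apply: eq_bigr => i _; rewrite exchange_big /= (bigD1 i) //=.
 rewrite [X in _ + X]big1 ?addr0 => [|i' ii'].
  under eq_bigr do rewrite dvC.
  by rewrite -mulr_sumr sum_ez_dv // subrr eqxx mul_conj b1 expr1n mul1r.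
 under eq_bigr do rewrite dvC.
 rewrite -mulr_sumr sum_ez_dv // subr_eq0 (inj_eq xi_inj) eq_sym (negbTE ii').
 by rewrite mulr0.
rewrite sumr_const card_ord.
have -> : (q%:R ^+ 4 : R[i]) *+ N = (q%:R ^+ 4 * N%:R : R)%:C.
 by rewrite rmorphM rmorphXn /= !rmorph_nat mulr_natr.
by rewrite -rmorphM /=; congr _%:C; field; rewrite pnatr_eq0; lia.
Qed.

(** What two applications of Cauchy-Schwarz leave of the bilinear sum below. Its trivial size is
    N^4; anything smaller is a gain for the kernel. *)
Definition SS (c : 'Z_q) : R := \sum_(i' < N) \sum_(i'' < N)
 cabs (\sum_(i < N) ez (c * dv (xi i) (xi i' - xi i''))) ^+ 2.

Lemma SS_ge0 c : 0 <= SS c.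
Proof. by apply: sumr_ge0 => i _; exact: sumsq_ge0. Qed.

(** Cauchy-Schwarz in [i] removes the coefficients [be]; expanding the square and applying
    Cauchy-Schwarz over the pairs i', i'' removes [be']. *)
Lemma double_sum_bound (c : 'Z_q) (be be' : 'I_N -> R[i]) :
 (forall i, cabs (be i) = 1) -> (forall i, cabs (be' i) = 1) ->
 cabs (\sum_i \sum_i' be i * be' i' * ez (c * dv (xi i) (xi i'))) ^+ 4 <=
  N%:R ^+ 4 * SS c.
Proof.
move=> h1 h2.
pose B := cabs (\sum_i \sum_i' be i * be' i' * ez (c * dv (xi i) (xi i'))).
pose T i : R[i] := \sum_i' be' i' * ez (c * dv (xi i) (xi i')).
have sN (F : 'I_N -> R[i]) : (forall i, cabs (F i) = 1) -> \sum_i cabs (F i) ^+ 2 = N%:R.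
 by move=> h; under eq_bigr do rewrite h expr1n; rewrite sumr_const card_ord.
have B2 : B ^+ 2 <= N%:R * \sum_i cabs (T i) ^+ 2.
 rewrite /B (eq_bigr (fun i => be i * T i)) => [|i _]; last first.
  by rewrite mulr_sumr; apply: eq_bigr => i' _; rewrite mulrA.
 by apply: le_trans (CS_cabs _ _ _ _) _; rewrite (sN _ h1).
pose U i' i'' := \sum_i ez (c * dv (xi i) (xi i' - xi i'')) : R[i].
have TU : \sum_i cabs (T i) ^+ 2 <= \sum_i' \sum_i'' cabs (U i' i'').
 have e : (\sum_i cabs (T i) ^+ 2)%:C = \sum_i' \sum_i'' (be' i' * ((be' i'')^*)%C) * U i' i''.
  rewrite (raddf_sum (real_complex R)) /=.
  rewrite (eq_bigr (fun i => \sum_i' \sum_i'' be' i' * ((be' i'')^*)%C *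
   ez (c * dv (xi i) (xi i' - xi i'')))) => [|i _].
   rewrite exchange_big /=; apply: eq_bigr => i' _; rewrite exchange_big /=.
   by apply: eq_bigr => i'' _; rewrite mulr_sumr.
  rewrite -mul_conj conj_sum mulr_suml; apply: eq_bigr => i' _.
  rewrite mulr_sumr; apply: eq_bigr => i'' _.
  by rewrite conjM -ezN // mulrACA -ezD // dvDr dvNr mulrDr mulrN.
 have T0 : 0 <= \sum_i cabs (T i) ^+ 2 by exact: sumsq_ge0.
 rewrite -[leLHS]ger0_norm // -cabs_real e.
 apply: le_trans (cabs_sum _ _ _) _; apply: ler_sum => i' _.
 apply: le_trans (cabs_sum _ _ _) _; apply: ler_sum => i'' _.
 by rewrite !cabsM cabs_conj !h2 !mul1r.
have U2 : (\sum_i' \sum_i'' cabs (U i' i'')) ^+ 2 <= N%:R ^+ 2 * SS c.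
 rewrite pair_bigA /=; apply: le_trans (sqr_sum_le _ _ _) _.
 rewrite sumr_const card_prod card_ord /SS pair_bigA /=.
 by rewrite natrM -expr2.
have B0 : 0 <= B by exact: cabs_ge0.
have s0 : 0 <= \sum_i cabs (T i) ^+ 2 by exact: sumsq_ge0.
rewrite -/B (_ : B ^+ 4 = (B ^+ 2) ^+ 2); last by ring.
apply: (le_via ((N%:R * \sum_i cabs (T i) ^+ 2) ^+ 2)).
 by rewrite lerXn2r ?qualifE /= ?sqr_ge0 // mulr_ge0.
rewrite exprMn (_ : N%:R ^+ 4 = N%:R ^+ 2 * N%:R ^+ 2); last by ring.
rewrite -mulrA ler_wpM2l ?sqr_ge0 //; apply: le_trans U2.
by rewrite lerXn2r ?qualifE /= // (le_trans s0).
Qed.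

(** The kernel of the weight superposes Gauss kernels translated by xi i - xi i'. Completing the
    square splits their phases into a part in i, a part in i' and the cross term xi i . xi i' with
    slope -1/(2 z.1), so a bilinear sum remains. *)
Lemma kern_wt (z : grid q) : z.1 != 0 ->
 cabs (kern wt z) ^+ 4 <= (4 * q%:R ^+ 2 / N%:R) ^+ 4 * SS (- (2 * z.1)^-1).
Proof.
case: z => a X /= a0.
have ua2 : 2 * a \is a GRing.unit by apply: unitZ_prime => //; rewrite mulZ_eq0 // (negbTE (two_neq0 q2 pq)).
pose cc : 'Z_q := (2 * a)^-1; have hcc : 2 * a * cc = 1 by rewrite /cc divrr.
(* Since [cc] is the inverse of 2a, [ga] is the inverse of 4a. *)
pose ga : 'Z_q := a * cc ^+ 2.
have hga : 2 * ga = cc.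
 by have -> : 2 * ga = (2 * a * cc) * cc by [rewrite /ga; ring|]; rewrite hcc mul1r.
pose be i := b i * ez (ga * (dv (xi i) (xi i) + 2 * dv X (xi i))).
pose be' i := ((b i)^*)%C * ez (ga * (dv (xi i) (xi i) - 2 * dv X (xi i))).
have -> : kern wt (a, X) = (4 / N%:R ^+ 2)%:C * (gs a 0 ^+ 4 * (ez (ga * dv X X) *
  \sum_i \sum_i' be i * be' i' * ez (- cc * dv (xi i) (xi i')))).
 rewrite /kern.
 transitivity (\sum_k (4 / N%:R ^+ 2)%:C * \sum_i \sum_i'
   (b i * ((b i')^*)%C) * ez (ph k (a, X + (xi i - xi i')))).
  apply: eq_bigr => k _; rewrite wtE -mulrA mulr_suml; congr (_ * _).
  apply: eq_bigr => i _; rewrite mulr_suml; apply: eq_bigr => i' _.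
  rewrite -mulrA -ezD //; congr (_ * ez _); rewrite /ph /= [dv k (X + _)]dvDr; ring.
 rewrite -mulr_sumr; congr (_ * _); rewrite exchange_big /= mulrA mulr_sumr.
 apply: eq_bigr => i _; rewrite exchange_big /= mulr_sumr.
 apply: eq_bigr => i' _; rewrite -mulr_sumr.
 have -> : \sum_k ez (ph k (a, X + (xi i - xi i'))) =
   kern (fun=> 1 : R) (a, X + (xi i - xi i')).
  by apply: eq_bigr => k _; rewrite mul1r.
 rewrite kern1 //=.
 under eq_bigr => j _ do rewrite (gs_square pq _ hcc).
 rewrite big_split /= prodr_const card_ord -ez_sum //.
 have -> : \sum_j a * (cc * (X + (xi i - xi i')) j) ^+ 2 =
   ga * dv X X + (ga * (dv (xi i) (xi i) + 2 * dv X (xi i)) +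
   ga * (dv (xi i') (xi i') - 2 * dv X (xi i')) + - cc * dv (xi i) (xi i')).
  have -> : \sum_j a * (cc * (X + (xi i - xi i')) j) ^+ 2 =
    ga * dv (X + (xi i - xi i')) (X + (xi i - xi i')).
   rewrite /dv mulr_sumr; apply: eq_bigr => j _; rewrite /ga; ring.
  rewrite !dvDr !dvDl !dvNr !dvNl -!(dvC X) (dvC (xi i') (xi i)) -hga; ring.
 rewrite !ezD // /be /be'; ring.
have g1 : cabs (gs a 0 ^+ 4 : R[i]) = q%:R ^+ 2.
 rewrite cabsX (_ : _ ^+ 4 = (cabs (gs a 0) ^+ 2) ^+ 2); last by ring.
 by rewrite gauss_sq.
rewrite cabsM [cabs (gs _ _ ^+ 4 * _)]cabsM g1 [cabs (ez _ * _)]cabsM cabs_ez mul1r.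
rewrite cabs_real ger0_norm; last first.
 by rewrite divr_ge0 // exprn_ge0.
have := @double_sum_bound (- cc) be be'; set B := cabs _ => h.
have {}h : B ^+ 4 <= N%:R ^+ 4 * SS (- cc).
 by apply: h => i; rewrite cabsM ?cabs_conj b1 cabs_ez mulr1.
have -> : (4 / N%:R ^+ 2 * (q%:R ^+ 2 * B)) ^+ 4 =
  (4 * q%:R ^+ 2 / N%:R ^+ 2) ^+ 4 * B ^+ 4 by field; rewrite pnatr_eq0; lia.
have -> : (4 * q%:R ^+ 2 / N%:R) ^+ 4 * SS (- cc) =
  (4 * q%:R ^+ 2 / N%:R ^+ 2) ^+ 4 * (N%:R ^+ 4 * SS (- cc)).
 by field; rewrite pnatr_eq0; lia.
by rewrite ler_wpM2l // exprn_ge0 // divr_ge0 ?mulr_ge0 ?exprn_ge0.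
Qed.

(** Averaging over all slopes turns exponential sums into a count of solutions. *)
Lemma sum_SS : \sum_c SS c = q%:R * \sum_(i < N) \sum_(j < N) \sum_(i' < N) \sum_(i'' < N)
 (if dv (xi i - xi j) (xi i' - xi i'') == 0 then 1 else 0).
Proof.
apply: (@complexI R); rewrite (raddf_sum (real_complex R)) /=.
transitivity (\sum_c \sum_i' \sum_i'' \sum_i \sum_j
  (ez (c * dv (xi i - xi j) (xi i' - xi i'')) : R[i])).
 apply: eq_bigr => c _; rewrite /SS (raddf_sum (real_complex R)) /=.
 apply: eq_bigr => i' _; rewrite (raddf_sum (real_complex R)) /=.
 apply: eq_bigr => i'' _; rewrite -mul_conj conj_sum mulr_suml.
 apply: eq_bigr => i _; rewrite mulr_sumr; apply: eq_bigr => j _.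
 by rewrite -ezN // -ezD // dvDl dvNl mulrDr mulrN.
rewrite exchange_big /= rmorphM /= rmorph_nat.
transitivity (\sum_i' \sum_i'' \sum_i \sum_j
  (q%:R * (if dv (xi i - xi j) (xi i' - xi i'') == 0 then 1 else 0) : R[i])).
 apply: eq_bigr => i' _; rewrite exchange_big /=; apply: eq_bigr => i'' _.
 rewrite exchange_big /=; apply: eq_bigr => i _.
 rewrite exchange_big /=; apply: eq_bigr => j _.
 under eq_bigr do rewrite mulrC.
 by rewrite sum_ez //; case: ifP; rewrite ?mulr1 ?mulr0.
rewrite (eq_bigr (fun i' => \sum_i \sum_i'' \sum_j
  (q%:R * (if dv (xi i - xi j) (xi i' - xi i'') == 0 then 1 else 0) : R[i]))); last first.
 by move=> i' _; rewrite exchange_big.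
rewrite exchange_big /= (raddf_sum (real_complex R)) /= mulr_sumr.
apply: eq_bigr => i _.
rewrite (eq_bigr (fun i' => \sum_j \sum_i''
  (q%:R * (if dv (xi i - xi j) (xi i' - xi i'') == 0 then 1 else 0) : R[i]))); last first.
 by move=> i' _; rewrite exchange_big.
rewrite exchange_big /= (raddf_sum (real_complex R)) /= mulr_sumr.
apply: eq_bigr => j _; rewrite (raddf_sum (real_complex R)) /= mulr_sumr.
apply: eq_bigr => i' _; rewrite (raddf_sum (real_complex R)) /= mulr_sumr.
by apply: eq_bigr => i'' _; case: ifP.
Qed.

End DirectionalWeight.

(** The main term p p' |c|^2 is at least |p||p'| C^2. The error vanishes in coordinate [j0] and is
    at most C^2 (|p| + |p'| + 1) in each of the other three, and PP' > 3 (P + P' + 1) as soon as P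
    and P' are at least 7. *)
Lemma near_collinear (C p p' : int) (c e e' : 'I_4 -> int) (j0 : 'I_4) :
 0 < C -> (forall l, `|c l| <= C) -> `|c j0| = C ->
 (forall l, `|e l| <= C) -> (forall l, `|e' l| <= C) -> e j0 = 0 -> e' j0 = 0 ->
 7 <= `|p| -> 7 <= `|p'| ->
 \sum_l (p * c l + e l) * (p' * c l + e' l) != 0.
Proof.
move=> C0 cC c0 eC eC' e0 e0' p7 p7'; apply/eqP => s0.
pose err l := c l * (p * e' l + p' * e l) + e l * e' l.
have h1 : \sum_l err l = - (p * p' * \sum_l c l ^+ 2).
 apply/eqP; rewrite -subr_eq0 opprK mulr_sumr -big_split /= -[X in _ == X]s0.
 by apply/eqP/eq_bigr => l _; rewrite /err; ring.
have errb l : `|err l| <= C ^+ 2 * (`|p| + `|p'| + 1).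
 have h a b : `|a| <= C -> `|b| <= C -> `|a * b| <= C ^+ 2.
  by move=> ha hb; rewrite normrM expr2 ler_pM.
 have -> : err l = p * (c l * e' l) + p' * (c l * e l) + e l * e' l by rewrite /err; ring.
 apply: le_trans (ler_normD _ _) _; rewrite mulrDr mulr1 lerD ?h //.
 apply: le_trans (ler_normD _ _) _; rewrite !normrM -!normrM mulrDr.
 by rewrite lerD // mulrC normrM ler_wpM2r ?h.
have err0 : err j0 = 0 by rewrite /err e0 e0'; ring.
have : `|p| * `|p'| * C ^+ 2 <= `|\sum_l err l|.
 rewrite h1 normrN !normrM ler_wpM2l ?mulr_ge0 //.
 rewrite ger0_norm; last by exact: sumsq_ge0.
 rewrite (bigD1 j0) //= -[c j0 ^+ 2]real_normK ?num_real // c0 lerDl.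
 exact: sumsq_ge0.
have : `|\sum_l err l| <= 3 * (C ^+ 2 * (`|p| + `|p'| + 1)).
 rewrite (bigD1 j0) //= err0 add0r; apply: le_trans (ler_norm_sum _ _ _) _.
 apply: (le_via (\sum_(i < 4 | i != j0) C ^+ 2 * (`|p| + `|p'| + 1))).
  exact: ler_sum.
 by rewrite sumr_const cardC1 card_ord -[X in X <= _]mulr_natl.
move=> h2 h3; have := le_trans h3 h2.
have C2 : 0 < C ^+ 2 by rewrite exprn_gt0.
rewrite (_ : 3 * _ = 3 * (`|p| + `|p'| + 1) * C ^+ 2); last by ring.
rewrite ler_pM2r //; move: p7 p7'.
by move: `|p| `|p'| => P P' P7 P7'; nia.
Qed.

Lemma cos_ge_half (R : realType) (x : R) : `|x| <= pi / 4 -> 2^-1 <= cos x.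
Proof.
move=> hx; have pi0 := @pi_gt0 R.
have x1 : cos x = cos `|x|.
 by have [x0|x0] := leP 0 x; [rewrite ger0_norm|rewrite ltr0_norm // cosN].
have h4 : 0 < cos (pi / 4 : R).
 by apply: cos_gt0_pihalf; apply/andP; split; lra.
have e : cos (pi / 4 : R) ^+ 2 = 2^-1.
 have : cos (pi / 4 + pi / 4 : R) = 0.
  by rewrite (_ : pi / 4 + pi / 4 = pi / 2) ?cos_pihalf //; lra.
 by rewrite cosD -!expr2; have := cos2Dsin2 (pi / 4 : R); lra.
have h5 : 2^-1 <= cos (pi / 4 : R) by have := cos_le1 (pi / 4 : R); nra.
apply: (le_trans h5); rewrite x1 le_eqVlt.
move: hx; rewrite le_eqVlt => /predU1P[->|hx]; first by rewrite eqxx.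
by rewrite ltr_cos ?hx ?orbT // in_itv /=; apply/andP; split; have := normr_ge0 x; lra.
Qed.

(** * Lattice directions normal to a slab *)

Section SlabGeometry.
Context {R : realType}.
Variables (q N M : nat) (c cc : Z4) (j0 : 'I_4) (s : int).
Let C := `|cmp c j0|%N.
Hypothesis C0 : (0 < C)%N.
Hypothesis cC : forall j, (`|cmp c j| <= C)%N.
Hypothesis N0 : (0 < N)%N.
Hypothesis M0 : (0 < M)%N.
Hypothesis pq : prime q.
Hypothesis qM : (64 * M < q)%N.
Hypothesis NM : (4 * N ^ 2 <= 16 * M)%N.

Let q1 : (1 < q)%N. Proof. exact: prime_gt1. Qed.

(** The vector i c / C rounded down to the lattice. Dividing by the largest coordinate makes
    coordinate [j0] exact, equal to i up to sign. *)
Definition dirv (i : nat) (j : 'I_4) : int := (i%:Z * cmp c j %/ C%:Z)%Z.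
Definition dirq (i : 'I_N) : V q := [ffun j => (dirv i j)%:~R].

Definition relpos (k : Z4) : int := \sum_j cmp c j * (cmp k j - cmp cc j).

(** Phases that bring all terms of the sum in [wt] close to 1 on the slab with parameter [s]. *)
Definition dirb (i : 'I_N) : R[i] :=
 expi (- (2 * pi * (i%:R * s%:~R / (C%:R * N%:R)) / q%:R)) * ez (- dv (zk q cc) (dirq i)).

Lemma cabs_dirb i : cabs (dirb i) = 1.
Proof. by rewrite /dirb cabsM cabs_expi cabs_ez mul1r. Qed.

Definition dirm (i : nat) (j : 'I_4) : int := (i%:Z * cmp c j %% C%:Z)%Z.

Lemma dirmP i j : C%:Z * dirv i j = i%:Z * cmp c j - dirm i j.
Proof. by rewrite {1}(divz_eq (i%:Z * cmp c j) C) mulrC addrK. Qed.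

Lemma dirm_bd i j : 0 <= dirm i j < C%:Z.
Proof.
by rewrite modz_ge0 ?ltz_pmod //; lia.
Qed.

Lemma dirm_j0 i : dirm i j0 = 0.
Proof.
by rewrite /dirm /C modz_abs modzMl.
Qed.

Lemma dirv_j0 i : `|dirv i j0| = i%:Z.
Proof.
have := dirmP i j0; rewrite dirm_j0 subr0 => /(congr1 (@Num.norm int int)).
by rewrite !normrM => h; apply: (@mulfI _ C%:Z); [lia|]; rewrite /C in h *; lia.
Qed.

Lemma dirq_inj : injective dirq.
Proof.
move=> i i' /(congr1 (fun x : V q => x j0)); rewrite !ffunE => e.
have := ltn_ord i; have := ltn_ord i' => h h'.
have h1 := dirv_j0 i; have h2 := dirv_j0 i'.
have m1 := dirmP i j0; have m2 := dirmP i' j0.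
rewrite !dirm_j0 !subr0 in m1 m2.
have Nq : (N < q)%N by nia.
have e2 : dirv i j0 = dirv i' j0.
 apply: (intZ_eq q1 e).
 have [c0|c0] := leP 0 (cmp c j0).
  have v1 : 0 <= dirv i j0 by nia.
  have v2 : 0 <= dirv i' j0 by nia.
  by lia.
 have v1 : dirv i j0 <= 0 by nia.
 have v2 : dirv i' j0 <= 0 by nia.
 by lia.
by apply: val_inj => /=; move: h1; rewrite e2 h2; lia.
Qed.

Lemma wt_ge1 k : in_cube cc M k ->
 s <= N%:Z * relpos k < s + 4 * C%:Z * M%:Z ->
 1 <= wt dirq dirb (zk q k).
Proof.
move=> hk hs; rewrite /wt.
pose n (i : 'I_N) : int := \sum_j (cmp k j - cmp cc j) * dirv i j.
pose th (i : 'I_N) : R := (n i)%:~R - i%:R * s%:~R / (C%:R * N%:R).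
have Cp : 0 < (C%:R : R) by rewrite ltr0n.
have Np : 0 < (N%:R : R) by rewrite ltr0n.
have qp : 0 < (q%:R : R) by rewrite ltr0n; lia.
have e i : dirb i * ez (dv (zk q k) (dirq i)) = expi (2 * pi * th i / q%:R).
 rewrite /dirb -mulrA -ezD //.
 have -> : - dv (zk q cc) (dirq i) + dv (zk q k) (dirq i) = (n i)%:~R.
  rewrite /n rmorph_sum /= -dvNl -dvDl; apply: eq_bigr => j _.
  by rewrite !ffunE intrM intrB addrC.
 rewrite ez_int // -expiD; congr expi; rewrite /th; field.
 by rewrite !pnatr_eq0; lia.
have thb i : `|th i| <= 4 * M%:R.
 have nE : C%:Z * n i = i%:Z * relpos k - \sum_j (cmp k j - cmp cc j) * dirm i j.
  rewrite /n /relpos !mulr_sumr -sumrB; apply: eq_bigr => j _.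
  by rewrite mulrCA dirmP; ring.
 have mb : 0 <= \sum_j (cmp k j - cmp cc j) * dirm i j <= 4 * C%:Z * M%:Z.
  have hj j : 0 <= (cmp k j - cmp cc j) * dirm i j <= C%:Z * M%:Z.
   have := hk j; have := dirm_bd i j; move: (dirm i j) => d; nia.
  apply/andP; split; first by apply: sumr_ge0 => j _; have /andP[] := hj j.
  apply: (le_via (\sum_(j < 4) C%:Z * M%:Z)).
   by apply: ler_sum => j _; have /andP[] := hj j.
  by rewrite sumr_const card_ord -[leLHS]mulr_natl; lia.
 have iN := ltn_ord i.
 (* The position in the slab and the rounding remainder both range over [0, 4CMN] and enter with
    opposite signs. *)
 have key : - (4 * C%:Z * M%:Z) * N%:Z <= N%:Z * (C%:Z * n i) - i%:Z * s <= 4 * C%:Z * M%:Z * N%:Z.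
  rewrite nE; move: mb hs; move: (\sum_j _) (relpos k) => D r mb hs.
  have -> : N%:Z * (i%:Z * r - D) - i%:Z * s = i%:Z * (N%:Z * r - s) - N%:Z * D by ring.
  have a1 : 0 <= i%:Z * (N%:Z * r - s) <= N%:Z * (4 * C%:Z * M%:Z).
   apply/andP; split; first by apply: mulr_ge0; lia.
   by apply: ler_pM; lia.
  have a2 : 0 <= N%:Z * D <= N%:Z * (4 * C%:Z * M%:Z).
   by apply/andP; split; [apply: mulr_ge0|apply: ler_wpM2l]; lia.
  by lia.
 have thE : th i = (N%:Z * (C%:Z * n i) - i%:Z * s)%:~R / (C%:R * N%:R).
  rewrite /th intrB !intrM -!pmulrn; field.
  by rewrite !pnatr_eq0; lia.
 have key2 : `|(N%:Z * (C%:Z * n i) - i%:Z * s)%:~R : R| <= 4 * C%:R * M%:R * N%:R.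
  have : (`|N%:Z * (C%:Z * n i) - i%:Z * s|)%:~R <= (4 * C%:Z * M%:Z * N%:Z)%:~R :> R.
   by rewrite ler_int; lia.
  by rewrite intr_norm 3!intrM -!pmulrn.
 rewrite thE normrM normfV ler_pdivrMr ?normr_gt0 ?mulf_neq0 ?gt_eqF //.
 rewrite [`|C%:R * N%:R|]ger0_norm ?mulr_ge0 // (le_trans key2) //.
 by apply: le_of_eq; ring.
have Re1 i : 2^-1 <= complex.Re (expi (2 * pi * th i / q%:R)).
 rewrite /expi /=; apply: cos_ge_half.
 have pi0 := @pi_gt0 R.
 rewrite !normrM normfV ![`|_%:R|]ger0_norm // [`|pi|]gtr0_norm //.
 have qM' : 64 * (M%:R : R) <= q%:R by rewrite -natrM ler_nat ltnW.
 rewrite ler_pdivrMr //; have := thb i; move: `|th i| (ler0n R M) => t M0' tM; nra.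
have : N%:R / 2 <= cabs (\sum_i dirb i * ez (dv (zk q k) (dirq i))).
 under eq_bigr do rewrite e.
 apply: le_trans (Re_le_cabs _); rewrite Re_sum; apply: le_trans (ler_norm _).
 apply: (le_via (\sum_(i < N) 2^-1)).
  by rewrite sumr_const card_ord -[leRHS]mulr_natl.
 by apply: ler_sum.
set B := cabs _ => hB.
rewrite mulrAC ler_pdivlMr ?exprn_gt0 // mul1r.
have : (N%:R / 2) ^+ 2 <= B ^+ 2.
 by rewrite lerXn2r ?qualifE /= ?cabs_ge0 // divr_ge0.
by rewrite expr_div_n; lra.
Qed.

Lemma count_close : \sum_(i < N) \sum_(j < N)
 (if `|i%:Z - j%:Z| <= 6 then 1 else 0) <= 13 * N%:R :> R.
Proof.
rewrite -[N in leRHS]card_ord mulrC -[X in X%:R * _]sum1_card natr_sum mulr_suml.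
apply: ler_sum => i _; rewrite mul1r -big_mkcond /= sum1_seq ler_nat.
rewrite -size_filter -(size_map (@nat_of_ord N)).
apply: (@leq_trans (size (iota (i - 6) 13))); last by rewrite size_iota.
apply: uniq_leq_size.
 by rewrite map_inj_uniq ?filter_uniq ?index_enum_uniq //; exact: val_inj.
move=> x /mapP[j]; rewrite mem_filter => /andP[hj _] ->; rewrite mem_iota.
by move: hj; lia.
Qed.

(** The inner product counted by [sum_SS] is at most 4N^2 < q in modulus, so vanishing modulo q
    means vanishing in the integers. By [near_collinear] this forces |i - j| <= 6 or |i' - i''| <=
    6, and each alternative has at most 13 N^3 quadruples. *)
Lemma sum_SS_dir : \sum_a SS (R := R) dirq a <= 26 * q%:R * N%:R ^+ 3.
Proof.
rewrite sum_SS //.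
have qp : 0 <= (q%:R : R) by [].
apply: (le_via (q%:R * (26 * N%:R ^+ 3))); last first.
 by apply: le_of_eq; ring.
rewrite ler_wpM2l //.
pose I (i j : 'I_N) : R := if `|i%:Z - j%:Z| <= 6 then 1 else 0.
have I0 i j : 0 <= I i j by rewrite /I; case: ifP.
apply: (le_via (\sum_(i < N) \sum_(j < N) \sum_(i' < N) \sum_(i'' < N)
  (I i j + I i' i''))).
 apply: ler_sum => i _; apply: ler_sum => j _; apply: ler_sum => i' _.
 apply: ler_sum => i'' _; case: ifP => [/eqP h|_]; last exact: addr_ge0.
 pose D : int := \sum_l (dirv i l - dirv j l) * (dirv i' l - dirv i'' l).
 have hD : dv (dirq i - dirq j) (dirq i' - dirq i'') = D%:~R.
  rewrite /dv /D rmorph_sum /=; apply: eq_bigr => l _.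
  by rewrite !ffunE intrM !intrB.
 pose e (a b : 'I_N) (l : 'I_4) : int := dirm b l - dirm a l.
 have eb a b l : `|e a b l| <= C%:Z.
  by rewrite /e; have := dirm_bd a l; have := dirm_bd b l; lia.
 have dv_e (a b : 'I_N) l : C%:Z * (dirv a l - dirv b l) = (a%:Z - b%:Z) * cmp c l + e a b l.
  by rewrite mulrBr !dirmP /e; ring.
 have db (a b : 'I_N) l : `|dirv a l - dirv b l| <= N%:Z.
  have ha := ltn_ord a; have hb := ltn_ord b.
  have h1 := dv_e a b l; have h2 := eb a b l.
  have h3 : `|cmp c l| <= C%:Z by have := cC l; lia.
  have h4 : C%:Z * `|dirv a l - dirv b l| < C%:Z * (N%:Z + 1).
   have -> : C%:Z * `|dirv a l - dirv b l| = `|C%:Z * (dirv a l - dirv b l)|.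
    by rewrite normrM ger0_norm.
   rewrite h1; apply: le_lt_trans (ler_normD _ _) _; rewrite normrM.
   have h5 : `|a%:Z - b%:Z| <= N%:Z - 1 by lia.
   have : `|a%:Z - b%:Z| * `|cmp c l| <= (N%:Z - 1) * C%:Z by rewrite ler_pM.
   move: h2; move: (`|a%:Z - b%:Z| * _) => X; nia.
  by rewrite ltr_pM2l in h4; lia.
 have D0 : D = 0.
  apply: (intZ_eq q1); first by rewrite -hD h.
  rewrite subr0; apply: (@le_lt_trans _ _ (4 * N%:Z ^+ 2)).
   apply: le_trans (ler_norm_sum _ _ _) _.
   apply: (le_via (\sum_(l < 4) N%:Z ^+ 2)).
    by apply: ler_sum => l _; rewrite normrM expr2 ler_pM.
   by rewrite sumr_const card_ord -[leLHS]mulr_natl.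
  by lia.
 have [p7|p7] := leP `|i%:Z - j%:Z| 6; first by rewrite {1}/I p7 lerDl I0.
 have [p7'|p7'] := leP `|i'%:Z - i''%:Z| 6; first by rewrite {2}/I p7' lerDr I0.
 exfalso.
 have := @near_collinear C%:Z (i%:Z - j%:Z) (i'%:Z - i''%:Z) (cmp c) (e i j) (e i' i'') j0.
 move=> /(_ ltac:(lia)) h9; have : (C%:Z * C%:Z) * D != 0.
  rewrite /D mulr_sumr; under eq_bigr => l _ do rewrite mulrACA !dv_e.
  apply: h9 => [l||l|l|||//|//]; [by have := cC l; lia|by []|exact: eb|exact: eb|..].
   by rewrite /e !dirm_j0.
  by rewrite /e !dirm_j0.
 by rewrite D0 mulr0 eqxx.
have -> : \sum_(i < N) \sum_(j < N) \sum_(i' < N) \sum_(i'' < N) (I i j + I i' i'') =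
  2 * N%:R ^+ 2 * \sum_(i < N) \sum_(j < N) I i j.
 have cN (x : R) : \sum_(i < N) x = N%:R * x by rewrite sumr_const card_ord -[LHS]mulr_natl.
 set T := \sum_(i < N) \sum_(j < N) I i j.
 transitivity (\sum_(i < N) \sum_(j < N) (N%:R ^+ 2 * I i j + T)).
  apply: eq_bigr => i _; apply: eq_bigr => j _.
  under eq_bigr do rewrite big_split /=.
  rewrite big_split /= -/T; congr (_ + _).
  by rewrite !cN expr2 mulrA.
 under eq_bigr do rewrite big_split /= -mulr_sumr cN.
 by rewrite big_split /= -mulr_sumr -/T cN; ring.
have := count_close; rewrite -/I => h.
apply: (le_via (2 * N%:R ^+ 2 * (13 * N%:R))).
 by rewrite ler_wpM2l // mulr_ge0 ?exprn_ge0.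
by apply: le_of_eq; ring.
Qed.

End SlabGeometry.

(** * The gain on a frequency slab *)

Section SlabL4.
Context {R : realType}.
Variables (m rho J : nat) (c cc : Z4) (j0 : 'I_4) (s : int) (ks : seq Z4).
Hypothesis m0 : (0 < m)%N.
Hypothesis rm : (16 * rho <= m + 2)%N.
Hypothesis gJ : good (2 ^ 17 * 4 ^ m) J.
Let C := `|cmp c j0|%N.
Hypothesis C0 : (0 < C)%N.
Hypothesis cC : forall j, (`|cmp c j| <= C)%N.
Hypothesis uks : uniq ks.
Hypothesis hc : forall k, k \in ks -> in_cube cc (2 ^ m) k.
Hypothesis hs : forall k, k \in ks ->
 s <= (2 ^ (8 * rho))%:Z * relpos c cc k < s + 4 * C%:Z * (2 ^ m)%:Z.

Let N := (2 ^ (8 * rho))%N.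
Let N0 : (0 < N)%N. Proof. by rewrite expn_gt0. Qed.
Let M0 : (0 < 2 ^ m)%N. Proof. by rewrite expn_gt0. Qed.
Let NM : (4 * N ^ 2 <= 16 * 2 ^ m)%N.
Proof.
have -> : (4 * N ^ 2 = 2 ^ (2 + 16 * rho))%N.
 by rewrite expnD /N -expnM; congr (_ * 2 ^ _)%N; lia.
have -> : (16 * 2 ^ m = 2 ^ (4 + m))%N by rewrite expnD.
by rewrite leq_exp2l //; lia.
Qed.

Variable q : nat.
Hypothesis pq : prime q.
Hypothesis q64 : (64 * 2 ^ m < q)%N.
Hypothesis q256 : (q <= 256 * 2 ^ m)%N.

Let q2 : (2 < q)%N. Proof. lia. Qed.
Let q1 : (1 < q)%N. Proof. lia. Qed.
Let r : R := 2 ^+ rho.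
Let r1 : 1 <= r. Proof. by rewrite /r exprn_ege1 //; lra. Qed.
Let r0 : 0 < r. Proof. by apply: lt_le_trans r1. Qed.
Let qp : 0 < (q%:R : R). Proof. by rewrite ltr0n; lia. Qed.
Let NE : N%:R = r ^+ 8 :> R. Proof. by rewrite /N /r natrX mulnC exprM. Qed.

Let w : V q -> R := wt (@dirq q N c j0) (@dirb R q N c cc j0 s).

(** Time differences without gain. With N = r^8 the trivial size of [SS] is r^32, so the threshold
    r^28 saves r^4. *)
Definition badset : {set 'Z_q} :=
 finset (fun a => (a == 0) || (r ^+ 28 < SS (R := R) (@dirq q N c j0) (- (2 * a)^-1))).

(** Chebyshev's inequality against the mean bound 26 q N^3 = 26 q r^24; the 1 accounts for the time
    difference 0. *)
Lemma badset_bound : #|badset|%:R <= 1 + 26 * q%:R / r ^+ 4 :> R.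
Proof.
set F := fun a : 'Z_q => SS (R := R) (@dirq q N c j0) (- (2 * a)^-1).
have F0 a : 0 <= F a by exact: SS_ge0.
have cnt : r ^+ 28 * \sum_a (if r ^+ 28 < F a then 1 else 0) <= 26 * q%:R * r ^+ 24.
 have e : \sum_a F a <= 26 * q%:R * N%:R ^+ 3.
  apply: le_trans (sum_SS_dir C0 cC N0 M0 pq q64 NM).
  (* The substitution a -> -1/(2a) is injective, also at 0, whose inverse is 0 by convention. *)
  rewrite [leRHS](reindex_inj (h := fun a : 'Z_q => - (2 * a)^-1)) //=.
  move=> a a' /oppr_inj/invr_inj h.
  have : 2 * (a - a') == 0 by rewrite mulrBr h subrr.
  by rewrite mulZ_eq0 // (negbTE (two_neq0 q2 pq)) subr_eq0 => /eqP.
 rewrite (_ : r ^+ 24 = N%:R ^+ 3); last by rewrite NE -exprM.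
 apply: le_trans e; rewrite mulr_sumr; apply: ler_sum => a _.
 by case: ifP => [/ltW|_]; rewrite ?mulr1 ?mulr0.
have -> : #|badset|%:R = \sum_a (if a \in badset then 1 else 0) :> R.
 by rewrite -sum1_card natr_sum big_mkcond.
apply: (le_via (\sum_(a : 'Z_q) ((if a == 0 then 1 else 0) +
  (if r ^+ 28 < F a then 1 else 0)))).
 apply: ler_sum => a _; rewrite inE -/(F a).
 by case: (a == 0); case: ifP => //= _; lra.
rewrite big_split /= -big_mkcond /= (big_pred1 0) // lerD2l.
rewrite ler_pdivlMr ?exprn_gt0 //.
rewrite -(ler_pM2r (exprn_gt0 24 r0)) -mulrA -exprD mulrC.
by rewrite [X in _ <= X]mulrAC; apply: le_trans cnt _; rewrite mulrAC.
Qed.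

(** In fourth powers [kern_wt] gives (4 q^2)^4 r^28 / r^32, hence one factor r is gained over weight
    1. *)
Lemma kern_off_bad z : z.1 \notin badset -> cabs (kern w z) <= 4 * q%:R ^+ 2 / r.
Proof.
rewrite inE negb_or -leNgt => /andP[z0 hz].
have D0 : 0 <= 4 * q%:R ^+ 2 / r by rewrite divr_ge0 ?mulr_ge0 ?exprn_ge0 // ltW.
rewrite -(@ler_pXn2r _ 4) ?qualifE /= ?cabs_ge0 //.
have hk := kern_wt q2 pq N0 (@dirq q N c j0) (@cabs_dirb R q N c cc j0 s) z0.
apply: (le_trans hk).
rewrite NE; apply: (le_via ((4 * q%:R ^+ 2 / r ^+ 8) ^+ 4 * r ^+ 28)).
 by rewrite ler_wpM2l // exprn_ge0 // divr_ge0 ?mulr_ge0 ?exprn_ge0 // ltW.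
apply: le_of_eq; field; exact: lt0r_neq0.
Qed.

(** The weight is at least 1 at every frequency of the slab, so their number is at most its total
    mass 4 q^4 / N. *)
Lemma size_slab : (size ks)%:R <= (2 ^+ (17 + 2 * m - 4 * rho)) ^+ 2 :> R.
Proof.
have uz : uniq (map (zk q) ks).
 by apply: (uniq_zk q1 _ uks hc); lia.
have wb := wt_bounds N0 (@dirq q N c j0) (@cabs_dirb R q N c cc j0 s).
apply: (le_via (4 * q%:R ^+ 4 / N%:R)).
 rewrite -(sum_wt q2 pq N0 (@cabs_dirb R q N c cc j0 s) (dirq_inj C0 N0 M0 pq q64 NM)).
 apply: le_trans (sum_pred_uniq uz _); last by move=> x; have /andP[] := wb x.
 rewrite big_map -(count_predT ks) -(sum1_seq (R := R)) big_seq [leRHS]big_seq.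
 apply: ler_sum => k kk; apply: (wt_ge1 C0 N0 M0 pq q64 NM); [exact: hc|exact: hs].
rewrite NE ler_pdivrMr ?exprn_gt0 // /r -!exprM -exprD.
apply: (le_via (4 * (256 * 2 ^+ m) ^+ 4)).
 rewrite ler_wpM2l // lerXn2r ?qualifE /= ?mulr_ge0 ?ler0n ?exprn_ge0 //.
 by rewrite -natrX -natrM ler_nat.
have -> : ((17 + 2 * m - 4 * rho) * 2 + rho * 8 = m * 4 + 34)%N by lia.
by rewrite exprMn exprD exprM; lra.
Qed.

(** The height is chosen with lam^2 equal to twice the kernel bound off the bad set, so [TTstar]
    absorbs the kernel term. *)
Lemma mid_level (f : Z4 -> R[i]) (lam : R) : \sum_(k <- ks) cabs (f k) ^+ 2 <= 1 ->
 0 <= lam -> lam ^+ 2 = 8 * q%:R ^+ 2 / r ->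
 \sum_(z : grid J) (if lam < cabs (uu ks f z) then 1 else 0) * q%:R ^+ 3 <=
  J%:R ^+ 5 * r * (1 + 26 * q%:R / r ^+ 4).
Proof.
move=> f1 lam0 lamE.
have [JN /(_ _ pq) dJ] := gJ.
have : (q %| J)%N.
 apply: dJ; apply: (leq_trans q256); rewrite (_ : 256 = 2 ^ 8)%N // -[4%N]/(2 ^ 2)%N.
 by rewrite -expnM -!expnD leq_exp2l //; lia.
move=> /dvdnP[J']; rewrite mulnC => JE; rewrite JE.
have J'0 : (0 < J')%N.
 move: JE JN; case: J' => [|//]; rewrite muln0 => ->; rewrite leqn0 muln_eq0 !expn_eq0.
 by [].
have uz : uniq (map (zk q) ks).
 by apply: (uniq_zk q1 _ uks hc); lia.
have wb := wt_bounds N0 (@dirq q N c j0) (@cabs_dirb R q N c cc j0 s).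
have := @level_transfer R q J' q1 J'0 ks f lam (q%:R ^+ 2 * r * (1 + 26 * q%:R / r ^+ 4)).
move=> /(_ _) h.
have {}h : q%:R ^+ 5 * #|finset (fun z : grid (q * J') => lam < cabs (uu ks f z))|%:R <=
  (q * J')%:R ^+ 5 * (q%:R ^+ 2 * r * (1 + 26 * q%:R / r ^+ 4)).
 apply: h => g gE; set E := finset _.
 have := @TTstar R q q1 ks g w 4 (4 * q%:R ^+ 2 / r) lam badset E uz.
 rewrite gE f1 => /(_ isT wb) h; have {h} :
  lam ^+ 2 * #|E|%:R <= 4 * q%:R ^+ 4 * #|badset|%:R + 4 * q%:R ^+ 2 / r * #|E|%:R.
  apply: h => //.
  - by move=> k kk; apply: (wt_ge1 C0 N0 M0 pq q64 NM); [exact: hc|exact: hs].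
  - by move=> z; exact: kern_off_bad.
  - by rewrite divr_ge0 ?mulr_ge0 ?exprn_ge0 // ltW.
  - by move=> z; rewrite inE => /ltW.
 have := badset_bound; rewrite lamE.
 move: #|E|%:R #|badset|%:R (1 + _) => e B b hB h.
 have {}h : 4 * q%:R ^+ 2 / r * e <= 4 * q%:R ^+ 4 * B by lra.
 have : 4 * q%:R ^+ 2 / r * e <= 4 * q%:R ^+ 2 / r * (q%:R ^+ 2 * r * b).
  apply: (le_trans h); rewrite (_ : _ * (_ * b) = 4 * q%:R ^+ 4 * b); last first.
   by field; exact: lt0r_neq0.
  by rewrite ler_wpM2l // mulr_ge0 ?exprn_ge0 // ltW.
 by rewrite ler_pM2l // divr_gt0 ?mulr_gt0 ?exprn_gt0.
rewrite -mulr_suml.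
have -> : \sum_(z : grid (q * J')) (if lam < cabs (uu ks f z) then 1 else 0) =
  #|finset (fun z : grid (q * J') => lam < cabs (uu ks f z))|%:R :> R.
 by rewrite -sum1_card natr_sum [RHS]big_mkcond /=; apply: eq_bigr => z _; rewrite inE.
rewrite -(@ler_pM2l _ (q%:R ^+ 2)) ?exprn_gt0 //.
rewrite (_ : q%:R ^+ 2 * (_ * _ ^+ 3) = q%:R ^+ 5 *
 #|finset (fun z : grid (q * J') => lam < cabs (uu ks f z))|%:R); last by ring.
by apply: (le_trans h); apply: le_of_eq; ring.
Qed.

(** Three ranges of values. Below [lam] the L^2 norm pays lam^2. From [lam] to 2^(m+3) the bound
    [mid_level] replaces the L^2 norm. Above, the levels are treated as in [strong_L4], but stop at
    2^(17 + 2m - 4 rho) because a slab has fewer frequencies than the cube. *)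
Lemma slab_L4_q (f : Z4 -> R[i]) : \sum_(k <- ks) cabs (f k) ^+ 2 <= 1 ->
 \sum_(z : grid J) cabs (uu ks f z) ^+ 4 <= 2 ^+ 26 * 4 ^+ m / r * J%:R ^+ 5.
Proof.
move=> f1; have hr : (rho * 2 <= m)%N by clear -rm; lia.
have hn : (17 + 2 * m - 4 * rho + rho <= 17 + m * 2)%N by clear -rm; lia.
have [JN dJ] := gJ.
pose lam := Num.sqrt (8 * q%:R ^+ 2 / r : R).
have lam0 : 0 <= lam by exact: sqrtr_ge0.
have lamE : lam ^+ 2 = 8 * q%:R ^+ 2 / r.
 by rewrite sqr_sqrtr // divr_ge0 ?mulr_ge0 ?exprn_ge0 // ltW.
set n := (17 + 2 * m - 4 * rho)%N.
have n3 : (m + 3 <= n)%N by rewrite /n; lia.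
have J1 : (1 < J)%N.
 by apply: leq_trans JN; apply: (@leq_trans (2 * 1)%N) => //; apply: leq_mul; rewrite ?expn_gt0.
have mJ : (2 ^ m <= J)%N.
 apply: leq_trans JN; rewrite -[4%N]/(2 ^ 2)%N -expnM -expnD leq_exp2l //; lia.
set u := fun z : grid J => cabs (uu ks f z).
have u0 z : 0 <= u z by exact: cabs_ge0.
have un z : u z <= 2 ^+ n.
 rewrite -(@ler_pXn2r _ 2) ?qualifE /= ?exprn_ge0 //.
 apply: le_trans size_slab; apply: le_trans (sup_uu _ _ _) _.
 by rewrite ler_piMr.
have pt z : u z ^+ 4 <= lam ^+ 2 * u z ^+ 2 +
  2 ^+ 12 * 16 ^+ m * (if lam < u z then 1 else 0) +
  \sum_(m + 3 <= i < n) 16 * 16 ^+ i * (if 2 ^+ i < u z then 1 else 0).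
 apply: le_trans (layer_cake n3 (u0 z) (un z)) _; rewrite lerD2r.
 have p1 : 0 <= lam ^+ 2 * u z ^+ 2 by rewrite mulr_ge0 ?sqr_ge0.
 have p2 : 0 <= 2 ^+ 12 * 16 ^+ m :> R by rewrite mulr_ge0 ?exprn_ge0.
 case: ifP => [h|_]; last by apply: addr_ge0 => //; case: ifP; rewrite ?mulr1 ?mulr0.
 case: ltP => [_|h2]; last first.
  rewrite mulr0 addr0 (_ : u z ^+ 4 = u z ^+ 2 * u z ^+ 2); last by ring.
  by rewrite ler_wpM2r ?sqr_ge0 // lerXn2r ?qualifE /=.
 rewrite mulr1 -[leLHS]add0r lerD //.
 apply: (le_via ((2 ^+ (m + 3)) ^+ 4)); first by rewrite lerXn2r ?qualifE /= ?exprn_ge0.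
 rewrite -exprM mulnDl exprD exprM mulrC exprAC (_ : 2 ^+ 4 = 16 :> R); last by lra.
 by rewrite ler_wpM2r ?exprn_ge0 //; lra.
apply: (le_trans (ler_sum _ (fun z _ => pt z))).
rewrite !big_split /= -!mulr_sumr exchange_big /=.
have J5 : 0 <= (J%:R : R) ^+ 5 by rewrite exprn_ge0.
have Q1 : 64 * 2 ^+ m <= (q%:R : R) by rewrite -natrX -natrM ler_nat ltnW.
have Q2 : (q%:R : R) <= 256 * 2 ^+ m by rewrite -natrX -natrM ler_nat.
have e4 : 4 ^+ m = (2 ^+ m) ^+ 2 :> R by rewrite exprAC; congr (_ ^+ _); lra.
have e16 : 16 ^+ m = (2 ^+ m) ^+ 4 :> R by rewrite exprAC; congr (_ ^+ _); lra.
have M1 : 0 < 2 ^+ m :> R by rewrite exprn_gt0.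
have q3 : 0 < (q%:R : R) ^+ 3 by rewrite exprn_gt0.
have rM : r ^+ 2 <= 2 ^+ m by rewrite /r -exprM ler_eXn2l ?ltr1n.
have P1 : lam ^+ 2 * \sum_z u z ^+ 2 <= 2 ^+ 19 * 4 ^+ m / r * J%:R ^+ 5.
 apply: (le_via (lam ^+ 2 * J%:R ^+ 5)).
  rewrite ler_wpM2l ?sqr_ge0 //; apply: (le_trans (bessel _ J1 _)).
   exact: (uniq_zk J1 mJ uks hc).
  by rewrite ler_piMr.
 rewrite ler_wpM2r // lamE ler_wpM2r ?invr_ge0 ?(ltW r0) //.
 have : q%:R ^+ 2 <= (256 * 2 ^+ m) ^+ 2 :> R by rewrite lerXn2r ?qualifE /= ?(ltW qp) ?mulr_ge0 ?ler0n ?(ltW M1).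
 by rewrite exprMn e4; lra.
have P2 : 2 ^+ 12 * 16 ^+ m * \sum_z (if lam < u z then 1 else 0) <=
  27 * 4 ^+ m / r * J%:R ^+ 5.
 have := mid_level f1 lam0 lamE; rewrite -mulr_suml -/u.
 set S := \sum_z _ => hS.
 rewrite -(ler_pM2r q3) -[leLHS]mulrA.
 apply: (le_via (2 ^+ 12 * 16 ^+ m * (J%:R ^+ 5 * r * (1 + 26 * q%:R / r ^+ 4)))).
  by rewrite ler_wpM2l // mulr_ge0 ?exprn_ge0.
 rewrite e16 e4.
 rewrite [leLHS](_ : _ = J%:R ^+ 5 * (2 ^+ 12 * (2 ^+ m) ^+ 4 * r * (1 + 26 * q%:R / r ^+ 4))); last by ring.
 rewrite [leRHS](_ : _ = J%:R ^+ 5 * (27 * (2 ^+ m) ^+ 2 / r * q%:R ^+ 3)); last by ring.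
 rewrite ler_wpM2l //.
 move: (2 ^+ m) (q%:R : R) Q1 M1 qp rM => M Q Q1 M1 Qp rM.
 (* This is the contribution of the time difference 0; it uses r^2 <= 2^m, a consequence of 16 rho
    <= m + 2. *)
 have h1 : 2 ^+ 12 * M ^+ 4 * r <= M ^+ 2 / r * Q ^+ 3.
  have : (64 * M) ^+ 3 <= Q ^+ 3 by rewrite lerXn2r ?qualifE /= ?mulr_ge0 ?(ltW M1) ?(ltW Qp).
  rewrite exprMn => h.
  rewrite [leRHS]mulrAC ler_pdivlMr //.
  have a1 : M ^+ 4 * r ^+ 2 <= M ^+ 4 * M by rewrite ler_wpM2l ?exprn_ge0 ?(ltW M1).
  have a2 : M ^+ 2 * (64 ^+ 3 * M ^+ 3) <= M ^+ 2 * Q ^+ 3 by rewrite ler_wpM2l ?exprn_ge0 ?(ltW M1).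
  have : 0 <= M ^+ 5 by rewrite exprn_ge0 ?(ltW M1).
  by lra.
 have h2 : 2 ^+ 12 * M ^+ 4 * r * (26 * Q / r ^+ 4) <= 26 * (M ^+ 2 / r) * Q ^+ 3.
  have : (64 * M) ^+ 2 <= Q ^+ 2 by rewrite lerXn2r ?qualifE /= ?mulr_ge0 ?(ltW M1) ?(ltW Qp).
  rewrite exprMn => h.
  rewrite [leLHS](_ : _ = 26 * (M ^+ 2 / r) * (Q * (2 ^+ 12 * M ^+ 2) / r ^+ 2)); last first.
   by field; exact: lt0r_neq0.
  rewrite ler_wpM2l ?mulr_ge0 ?invr_ge0 ?(ltW r0) ?(ltW M1) //.
  rewrite ler_pdivrMr ?exprn_gt0 //.
  have a1 : Q * (2 ^+ 12 * M ^+ 2) <= Q ^+ 3.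
   by rewrite [leRHS]exprS ler_wpM2l ?(ltW Qp) //; lra.
  apply: (le_trans a1); rewrite ler_peMr ?exprn_ge0 ?(ltW Qp) //.
  by rewrite exprn_ege1.
 by rewrite mulrDr mulr1; lra.
have P3 : \sum_(m + 3 <= i < n) \sum_z 16 * 16 ^+ i * (if 2 ^+ i < u z then 1 else 0) <=
  2 ^+ 25 * 4 ^+ m / r * J%:R ^+ 5.
 apply: (le_via (\sum_(0 <= i < n) 256 * 2 ^+ i * J%:R ^+ 5)).
  rewrite [leRHS](@big_cat_nat _ _ _ (m + 3)) //=.
  rewrite -[leLHS]add0r lerD //.
   apply: sumr_ge0 => i _; apply: mulr_ge0; last exact: exprn_ge0.
   by apply: mulr_ge0; [exact: ler0n|exact: exprn_ge0].
  rewrite big_nat_cond [leRHS]big_nat_cond; apply: ler_sum => i /andP[/andP[i1 i2] _].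
  apply: (high_level m0 i1 _ uks hc f1).
  have iN : (2 ^ (i - 1) <= 2 ^ 17 * 4 ^ m)%N.
   rewrite -[4%N]/(2 ^ 2)%N -expnM -expnD leq_exp2l //.
   by move: i2; rewrite /n; clear; lia.
  split; first exact: leq_trans iN JN.
  by move=> p pp pN; apply: dJ => //; exact: leq_trans pN iN.
 rewrite -mulr_suml ler_wpM2r // -mulr_sumr.
 have e k : \sum_(0 <= i < k) 2 ^+ i <= 2 ^+ k :> R.
  elim: k => [|k ih]; first by rewrite big_geq.
  by rewrite big_nat_recr //= exprS; lra.
 apply: (le_via (256 * 2 ^+ n)); first by rewrite ler_wpM2l ?ler0n.
 rewrite ler_pdivlMr // e4.
 have : 2 ^+ n * r <= 2 ^+ 17 * (2 ^+ m) ^+ 2.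
  by rewrite /r -exprM -!exprD ler_eXn2l ?ltr1n.
 by lra.
have : 0 <= 4 ^+ m / r * J%:R ^+ 5 by rewrite mulr_ge0 ?divr_ge0 ?exprn_ge0 // ltW.
by move: P1 P2 P3; rewrite -!mulrA; move: (4 ^+ m * _) => X; lra.
Qed.

End SlabL4.

Lemma slab_L4 (R : realType) (m rho J : nat) (c cc : Z4) (j0 : 'I_4) (s : int) ks :
 (0 < m)%N -> (16 * rho <= m + 2)%N -> good (2 ^ 17 * 4 ^ m) J ->
 (0 < `|cmp c j0|)%N -> (forall j, (`|cmp c j| <= `|cmp c j0|)%N) ->
 uniq ks -> (forall k, k \in ks -> in_cube cc (2 ^ m) k) ->
 (forall k, k \in ks ->
  s <= (2 ^ (8 * rho))%:Z * relpos c cc k < s + 4 * `|cmp c j0|%:Z * (2 ^ m)%:Z) ->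
 forall f : Z4 -> R[i], \sum_(z : grid J) cabs (uu ks f z) ^+ 4 <=
  2 ^+ 26 * 4 ^+ m / 2 ^+ rho * J%:R ^+ 5 * (\sum_(k <- ks) cabs (f k) ^+ 2) ^+ 2.
Proof.
move=> m0 rm gJ C0 cC uks hc hs; apply: homogeneous4 => f f1.
have [q pq /andP[q1 q2]] := @exists_prime (64 * 2 ^ m) ltac:(by rewrite muln_gt0 expn_gt0).
apply: (slab_L4_q m0 rm gJ C0 cC uks hc hs pq q1 _ f1).
by rewrite (_ : 256 = 4 * 64)%N // -mulnA.
Qed.

(** * The bilinear estimate *)

Section Fibers.
Context {R : realType}.

(** Partition of a sum by the value of an index function; slabs, cubes and dyadic pieces are all cut
    out this way. *)
Lemma sum_fibers (T I : eqType) (V' : nmodType) (ks : seq T) (jx : T -> I) (F : T -> V') :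
 \sum_(k <- ks) F k =
 \sum_(i <- undup (map jx ks)) \sum_(k <- [seq k <- ks | jx k == i]) F k.
Proof.
under [RHS]eq_bigr do rewrite big_filter big_mkcond /=.
rewrite exchange_big /=; apply: eq_big_seq => k kk.
rewrite (bigD1_seq (jx k)) ?undup_uniq ?mem_undup ?map_f //= eqxx.
by rewrite big1 ?addr0 // => i; rewrite eq_sym => /negbTE ->.
Qed.

Lemma uu_fibers n (I : eqType) ks (jx : Z4 -> I) (f : Z4 -> R[i]) (z : grid n) :
 uu ks f z = \sum_(i <- undup (map jx ks)) uu [seq k <- ks | jx k == i] f z.
Proof. exact: sum_fibers. Qed.

Lemma sum_grid0 n (k : V n) (c : 'Z_n) : (1 < n)%N -> (k != 0) || (c != 0) ->
 \sum_(z : grid n) ez (dv k z.2 + c * z.1) = 0 :> R[i].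
Proof.
move=> n1 h.
transitivity (\sum_(a : 'Z_n) \sum_(x : V n) (ez (c * a) * ez (dv k x) : R[i])).
 by rewrite pair_bigA; apply: eq_bigr => z _; rewrite ezD // mulrC.
under eq_bigr do rewrite -mulr_sumr sum_ez_dv //.
rewrite -mulr_suml sum_ez //; case: eqVneq h => [_|_ _]; last by rewrite mulr0.
by case: eqVneq => //= _ _; rewrite mul0r.
Qed.

Lemma count_near (r : seq int) (i : int) (w : nat) : uniq r ->
 (count (fun j => (`|i - j| <= w%:Z)%R) r <= 2 * w + 1)%N.
Proof.
move=> ur; rewrite -size_filter -(size_iota 0 (2 * w + 1)).
rewrite -(size_map (fun x : nat => i - w%:Z + x%:Z)).
apply: uniq_leq_size; first exact: filter_uniq.
move=> j; rewrite mem_filter => /andP[h _]; apply/mapP.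
by exists (absz ((j : int) - i + w%:Z)); [rewrite mem_iota|]; move: (j : int) h => j'; lia.
Qed.

Lemma sum4 (T : Type) (ra rb rc rd : seq T) (a b c d : T -> R[i]) :
 (\sum_(k <- ra) a k) * (\sum_(l <- rc) c l) *
 ((\sum_(k' <- rb) b k') * (\sum_(l' <- rd) d l')) =
 \sum_(k <- ra) \sum_(k' <- rb) \sum_(l <- rc) \sum_(l' <- rd)
  a k * c l * (b k' * d l').
Proof.
rewrite [(\sum_(k <- ra) a k) * _]mulr_suml [LHS]mulr_suml.
apply: eq_bigr => k _; rewrite mulrACA.
rewrite mulr_sumr mulr_suml; apply: eq_bigr => k' _.
rewrite mulr_suml mulr_sumr; apply: eq_bigr => l _.
rewrite !mulr_sumr; apply: eq_bigr => l' _; ring.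
Qed.

End Fibers.

Section BilinearFree.
Context {R : realType}.

Definition sqz (k : Z4) : int := \sum_j cmp k j ^+ 2.

Lemma ph_pair n (k l k' l' : Z4) (z : grid n) :
 ph (zk n k) z + ph (zk n l) z - (ph (zk n k') z + ph (zk n l') z) =
 dv (zk n k + zk n l - (zk n k' + zk n l')) z.2 +
 (sqz k' + sqz l' - (sqz k + sqz l))%:~R * z.1.
Proof.
have e k0 : dv (zk n k0) (zk n k0) = (sqz k0)%:~R.
 by rewrite /dv /sqz rmorph_sum; apply: eq_bigr => j _ /=; rewrite ffunE expr2 intrM.
by rewrite /ph !e !dvDl !dvNl !dvDl intrB !intrD; ring.
Qed.

(** The size bounds turn the congruences modulo J into the exact resonance relations for frequency
    and energy, one of which fails. *)
Lemma pair_orth J (k l k' l' : Z4) : (1 < J)%N ->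
 (forall j, `|cmp k j + cmp l j - (cmp k' j + cmp l' j)| < J%:Z) ->
 `|sqz k' + sqz l' - (sqz k + sqz l)| < J%:Z ->
 ~ ((forall j, cmp k j + cmp l j = cmp k' j + cmp l' j) /\
   sqz k + sqz l = sqz k' + sqz l') ->
 \sum_(z : grid J) ez (ph (zk J k) z) * ez (ph (zk J l) z) *
   ((ez (ph (zk J k') z) * ez (ph (zk J l') z))^*)%C = 0 :> R[i].
Proof.
move=> J1 h1 h2 h3.
under eq_bigr do rewrite conjM -!ezN // -!ezD // -opprD ph_pair.
apply: sum_grid0 => //; apply/norP => -[/negPn/eqP e1 /negPn/eqP e2]; apply: h3.
split=> [j|].
 have := congr1 (fun x : V J => x j) e1; rewrite !ffunE -!intrD => /eqP.
 rewrite subr_eq0 => /eqP e; exact: (intZ_eq J1 e (h1 j)).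
have : sqz k' + sqz l' - (sqz k + sqz l) = 0.
 by apply: (intZ_eq J1); rewrite ?subr0 //.
by move/eqP; rewrite subr_eq0 => /eqP.
Qed.

Lemma good_le N' N J : (N' <= N)%N -> good N J -> good N' J.
Proof.
move=> h [h1 h2]; split; first exact: leq_trans h h1.
by move=> p pp pN; apply: h2 => //; exact: leq_trans pN h.
Qed.

Definition z4c (a : int) : Z4 := (a, a, a, a).

Lemma cmp_z4c a j : cmp (z4c a) j = a.
Proof. by case: j => -[|[|[|[|//]]]] ?. Qed.

(** Expanding |k|^2 around cc shows that the energy is affine in [relpos], up to the term |k -
    cc|^2, which lies between 0 and 4M^2 on the cube. *)
Lemma sqz_rel (C M : nat) (cc k k' : Z4) :
 (forall j, (`|cmp cc j| <= C)%N) -> in_cube cc M k -> in_cube cc M k' ->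
 `|relpos cc cc k' - relpos cc cc k| <= 4 * C%:Z * M%:Z /\
 `|sqz k' - sqz k - 2 * (relpos cc cc k' - relpos cc cc k)| <= 4 * M%:Z ^+ 2.
Proof.
move=> cC hk hk'; split.
 have -> : relpos cc cc k' - relpos cc cc k = \sum_j cmp cc j * (cmp k' j - cmp k j).
  by rewrite /relpos -sumrB; apply: eq_bigr => j _; ring.
 apply: le_trans (ler_norm_sum _ _ _) _.
 apply: (le_via (\sum_(j < 4) C%:Z * M%:Z)).
  apply: ler_sum => j _; rewrite normrM ler_pM //; first by have := cC j; lia.
  by have := hk j; have := hk' j; lia.
 by rewrite sumr_const card_ord -[leLHS]mulr_natl mulrA.
have -> : sqz k' - sqz k - 2 * (relpos cc cc k' - relpos cc cc k) =
  \sum_j ((cmp k' j - cmp cc j) ^+ 2 - (cmp k j - cmp cc j) ^+ 2).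
 rewrite /sqz /relpos mulrBr !mulr_sumr -!sumrB.
 by apply: eq_bigr => j _; ring.
apply: le_trans (ler_norm_sum _ _ _) _.
apply: (le_via (\sum_(j < 4) M%:Z ^+ 2)).
 apply: ler_sum => j _; have := hk j; have := hk' j.
 move: (cmp _ _) (cmp _ _) (cmp _ _) => a b c h h'.
 have h1 : 0 <= (b - c) ^+ 2 <= M%:Z ^+ 2 by nia.
 have h2 : 0 <= (a - c) ^+ 2 <= M%:Z ^+ 2 by nia.
 by lia.
by rewrite sumr_const card_ord -[leLHS]mulr_natl.
Qed.

Lemma sqz_small (M : nat) (l : Z4) : (forall j, `|cmp l j| <= M%:Z) ->
 0 <= sqz l <= 4 * M%:Z ^+ 2.
Proof.
move=> h; apply/andP; split; first by exact: sumsq_ge0.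
apply: (le_via (\sum_(j < 4) M%:Z ^+ 2)).
 by apply: ler_sum => j _; have := h j; nia.
by rewrite sumr_const card_ord -[leLHS]mulr_natl.
Qed.

(** Slabs in direction [cc] are almost level sets of the energy |k|^2. Between slabs that are not
    adjacent the energy differs by more than the low factor can compensate, so the products are
    orthogonal in space-time. On one slab Cauchy-Schwarz combines [slab_L4] with [strong_L4]; the
    resulting square root is the reason for taking rho = 2 sg. *)
Lemma bilinear_free (m sg J : nat) (cc : Z4) (j0 : 'I_4) (ks ls : seq Z4)
  (f g : Z4 -> R[i]) :
 (0 < m)%N -> (32 * sg <= m + 2)%N -> good (2 ^ 17 * 4 ^ m) J ->
 let C := `|cmp cc j0|%N in
 (forall j, (`|cmp cc j| <= C)%N) -> (4 * 2 ^ (16 * sg) * 2 ^ m <= C)%N ->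
 (16 * C * 2 ^ m < J)%N ->
 uniq ks -> uniq ls -> (forall k, k \in ks -> in_cube cc (2 ^ m) k) ->
 (forall l, l \in ls -> forall j, `|cmp l j| <= (2 ^ m)%:Z) ->
 \sum_(z : grid J) cabs (uu ks f z * uu ls g z) ^+ 2 <=
  2 ^+ 23 * 4 ^+ m / 2 ^+ sg * J%:R ^+ 5 * (\sum_(k <- ks) cabs (f k) ^+ 2) *
  (\sum_(l <- ls) cabs (g l) ^+ 2).
Proof.
move=> m0 sgm gJ C cC Cbig CJ uks uls hks hls.
have M0 : (0 < 2 ^ m)%N by rewrite expn_gt0.
have N0 : (0 < 2 ^ (16 * sg))%N by rewrite expn_gt0.
set M := (2 ^ m)%N in M0 Cbig CJ hks hls *; set N := (2 ^ (16 * sg))%N in N0 Cbig.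
have C0 : (0 < C)%N by move: Cbig N0 M0; clear; nia.
have MC : (4 * N * M <= C)%N by [].
have J1 : (1 < J)%N by move: CJ C0 M0; clear; nia.
pose P : int := 4 * C%:Z * M%:Z.
have P0 : 0 < P by move: C0 M0; rewrite /P; clear; nia.
(* [relpos] varies by at most [P] over the cube, so this cuts the cube into about N slabs. *)
pose jx (k : Z4) : int := (N%:Z * relpos cc cc k %/ P)%Z.
have jxP k : jx k * P <= N%:Z * relpos cc cc k < jx k * P + P.
 rewrite /jx lez_floor ?gt_eqF //=; have := ltz_ceil (N%:Z * relpos cc cc k) P0.
 by rewrite mulrDl mul1r.
set v := fun z : grid J => uu ls g z.
pose near (i j : int) := `|i - j| <= 1%N%:Z.
have step1 : \sum_(z : grid J) cabs (uu ks f z * v z) ^+ 2 <=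
  3 * \sum_(i <- undup (map jx ks))
   \sum_(z : grid J) cabs (uu [seq k <- ks | jx k == i] f z * v z) ^+ 2.
 have := @almost_orthogonal R (grid J) int (undup (map jx ks)) near
  (fun i z => uu [seq k <- ks | jx k == i] f z * v z) 3.
 move=> /(_ _ _ _) h; under eq_bigr do rewrite (uu_fibers ks jx) mulr_suml.
 apply: h.
 - by move=> i j; rewrite /near distrC.
 - move=> i _; rewrite sum1_seq (ler_nat R _ 3).
  rewrite /near (_ : 3 = 2 * 1 + 1)%N //; apply: count_near; exact: undup_uniq.
 move=> i i' _ _ nij.
 transitivity (\sum_z \sum_(k <- [seq k <- ks | jx k == i])
  \sum_(k' <- [seq k <- ks | jx k == i']) \sum_(l <- ls) \sum_(l' <- ls)
   f k * g l * (((f k')^*)%C * ((g l')^*)%C) *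
   (ez (ph (zk J k) z) * ez (ph (zk J l) z) *
   ((ez (ph (zk J k') z) * ez (ph (zk J l') z))^*)%C)).
  apply: eq_bigr => z _; rewrite conjM /uu /v /uu !conj_sum sum4.
  apply: eq_bigr => k _; apply: eq_bigr => k' _; apply: eq_bigr => l _.
  apply: eq_bigr => l' _; rewrite !conjM; ring.
 rewrite exchange_big /= big1_seq // => k /andP[_]; rewrite mem_filter => /andP[/eqP ki kk].
 rewrite exchange_big /= big1_seq // => k' /andP[_]; rewrite mem_filter => /andP[/eqP ki' kk'].
 rewrite exchange_big /= big1_seq // => l /andP[_ ll].
 rewrite exchange_big /= big1_seq // => l' /andP[_ ll'].
 rewrite -mulr_sumr pair_orth ?mulr0 //.
 - move=> j; have := hks _ kk j; have := hks _ kk' j; have := hls _ ll j.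
  have := hls _ ll' j; move: CJ MC N0 C0; clear.
  by move: (cmp _ _) (cmp _ _) (cmp _ _) (cmp _ _) (cmp _ _) => *; nia.
 - have [d1 d2] := sqz_rel cC (hks _ kk) (hks _ kk').
  have := sqz_small (hls _ ll); have := sqz_small (hls _ ll').
  move: d1 d2 CJ MC N0 C0 M0; clear.
  move: (relpos _ _ _) (relpos _ _ _) (sqz _) (sqz _) (sqz _) (sqz _).
  move=> r' r a b c d d1 d2 CJ MC N0 C0 M0.
  have : (M * M <= C * M)%N by rewrite leq_pmul2r //; nia.
  by nia.
 - move=> [_ e]; have [d1 d2] := sqz_rel cC (hks _ kk) (hks _ kk').
  have := sqz_small (hls _ ll); have := sqz_small (hls _ ll').
  have := jxP k; have := jxP k'; rewrite ki ki'.
  move: nij; rewrite /near -ltNge; move: d1 d2 CJ MC N0 C0 M0 e; rewrite /P; clear.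
  move: (relpos _ _ _) (relpos _ _ _) (sqz _) (sqz _) (sqz _) (sqz _).
  move=> r' r a b c d d1 d2 CJ MC N0 C0 M0 e ii p1 p2 s1 s2.
  have h1 : `|r' - r| <= 4 * M%:Z ^+ 2 by lia.
  have h2 : N%:Z * `|r' - r| <= C%:Z * M%:Z.
   apply: (le_via (N%:Z * (4 * M%:Z ^+ 2))); first by rewrite ler_wpM2l.
   have : (4 * N * M * M <= C * M)%N by rewrite leq_mul2r MC orbT.
   by lia.
  have CM : 0 < C%:Z * M%:Z by nia.
  have [h3|h3] := leP 0 (i - i').
   have h4 : 2 <= i - i' by lia.
   have : 2 * (4 * (C%:Z * M%:Z)) <= (i - i') * (4 * (C%:Z * M%:Z)) by nia.
   have : N%:Z * (r - r') <= N%:Z * `|r' - r| by rewrite ler_wpM2l //; lia.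
   by lia.
  have h4 : 2 <= i' - i by lia.
  have : 2 * (4 * (C%:Z * M%:Z)) <= (i' - i) * (4 * (C%:Z * M%:Z)) by nia.
  have : N%:Z * (r' - r) <= N%:Z * `|r' - r| by rewrite ler_wpM2l //; lia.
  by lia.
apply: (le_trans step1).
have step2 i : \sum_(z : grid J) cabs (uu [seq k <- ks | jx k == i] f z * v z) ^+ 2 <=
  2 ^+ 21 * 4 ^+ m / 2 ^+ sg * J%:R ^+ 5 *
  (\sum_(k <- [seq k <- ks | jx k == i]) cabs (f k) ^+ 2) *
  (\sum_(l <- ls) cabs (g l) ^+ 2).
 set ki := [seq k <- ks | jx k == i].
 have ki_in k : k \in ki -> jx k = i /\ k \in ks.
  by rewrite mem_filter => /andP[/eqP].
 have A1 := @slab_L4 R m (2 * sg) J cc cc j0 (i * P) ki m0.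
 have {}A1 := A1 ltac:(clear -sgm; lia) gJ C0 cC (filter_uniq _ uks).
 have {}A1 := A1 (fun k kk => hks _ (ki_in k kk).2).
 have {A1} : forall f : Z4 -> R[i], \sum_(z : grid J) cabs (uu ki f z) ^+ 4 <=
  2 ^+ 26 * 4 ^+ m / 2 ^+ (2 * sg) * J%:R ^+ 5 * (\sum_(k <- ki) cabs (f k) ^+ 2) ^+ 2.
  apply: A1 => k /ki_in[<- kk].
  by rewrite (_ : 8 * (2 * sg) = 16 * sg)%N ?mulnA //; exact: jxP.
 move=> /(_ f) A1.
 (* The box of |l_j| <= M fits into a cube of side 4M = 2^(m+2). *)
 have A2 := @strong_L4 R (m + 2) J (z4c (- M%:Z)) ls.
 have {}A2 := A2 ltac:(clear; lia) (good_le _ gJ) uls.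
 have {}A2 : forall f : Z4 -> R[i], \sum_(z : grid J) cabs (uu ls f z) ^+ 4 <=
  2112 * 4 ^+ (m + 2) * J%:R ^+ 5 * (\sum_(k <- ls) cabs (f k) ^+ 2) ^+ 2.
  apply: A2; first by rewrite expnD mulnCA mulnC leq_mul2r; apply/orP; right.
  move=> l ll j; rewrite cmp_z4c; have := hls _ ll j.
  by rewrite expnD -/M; move: M0; clear; lia.
 have {}A2 := A2 g.
 set F := \sum_(k <- ki) _ in A1 *; set G := \sum_(l <- ls) _ in A2 *.
 have F0 : 0 <= F by exact: sumsq_ge0.
 have G0 : 0 <= G by exact: sumsq_ge0.
 set S := \sum_z _.
 have S0 : 0 <= S by exact: sumsq_ge0.
 have J0 : 0 <= (J%:R ^+ 5 : R) by rewrite exprn_ge0.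
 set B := _ * G.
 have B0 : 0 <= B by rewrite !mulr_ge0 ?invr_ge0 ?exprn_ge0.
 rewrite -(@ler_pXn2r _ 2) ?qualifE /= //.
 have : S ^+ 2 <= (\sum_(z : grid J) cabs (uu ki f z) ^+ 4) * (\sum_(z : grid J) cabs (v z) ^+ 4).
  have := CS_real (index_enum (grid J)) xpredT (fun z => cabs (uu ki f z) ^+ 2) (fun z => cabs (v z) ^+ 2).
  under eq_bigr do rewrite -exprMn -cabsM.
  move/le_trans; apply; apply: le_of_eq.
  by congr (_ * _); apply: eq_bigr => z _; rewrite -exprM.
 move/le_trans; apply.
 apply: le_trans (ler_pM _ _ A1 A2) _.
 - by apply: sumr_ge0 => z _; rewrite exprn_ge0 ?cabs_ge0.
 - by apply: sumr_ge0 => z _; rewrite exprn_ge0 ?cabs_ge0.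
 have sp : 2 ^+ sg != 0 :> R by rewrite expf_neq0.
 have -> : B ^+ 2 = 2 ^+ 42 * ((4 ^+ m / 2 ^+ sg * J%:R ^+ 5 * F * G) ^+ 2).
  by rewrite /B !exprMn -exprM; ring.
 have -> : 2 ^+ 26 * 4 ^+ m / 2 ^+ (2 * sg) * J%:R ^+ 5 * F ^+ 2 *
   (2112 * 4 ^+ (m + 2) * J%:R ^+ 5 * G ^+ 2) =
   2 ^+ 26 * 2112 * 16 * ((4 ^+ m / 2 ^+ sg * J%:R ^+ 5 * F * G) ^+ 2).
  rewrite exprD [(2 * sg)%N]mulnC exprM !exprMn exprVn; ring.
 rewrite ler_wpM2r ?sqr_ge0 //; lra.
apply: (le_via (3 * \sum_(i <- undup (map jx ks)) 2 ^+ 21 * 4 ^+ m / 2 ^+ sg * J%:R ^+ 5 *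
  (\sum_(k <- [seq k <- ks | jx k == i]) cabs (f k) ^+ 2) *
  (\sum_(l <- ls) cabs (g l) ^+ 2))).
 by rewrite ler_wpM2l //; apply: ler_sum => i _.
rewrite -mulr_suml -mulr_sumr -(sum_fibers ks jx (fun k => cabs (f k) ^+ 2)).
set F := \sum_(k <- ks) _; set G := \sum_(l <- ls) _.
have F0 : 0 <= F by exact: sumsq_ge0.
have G0 : 0 <= G by exact: sumsq_ge0.
have : 0 <= 4 ^+ m / 2 ^+ sg * J%:R ^+ 5 * F * G.
 by rewrite !mulr_ge0 ?invr_ge0 ?exprn_ge0.
rewrite -!mulrA; move: (4 ^+ m * _) => X; lra.
Qed.

End BilinearFree.

(** * Transference to functions of bounded variation *)

Section Decomposition.
Context {R : realType}.

(** Bounded 3-variation with values in l^2, through a control function that dominates the cubes of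
    the increments. Both sides of the increment bound are squared, so that no square root of the l^2
    sum appears. *)
Definition vctl (ks : seq Z4) (w : nat -> Z4 -> R[i]) (A : R) : Prop :=
 0 <= A /\ exists om : nat -> R,
 [/\ forall s t, (s <= t)%N -> om s <= om t,
   forall t, 0 <= om t <= A ^+ 3,
   forall s t, (s <= t)%N ->
    (\sum_(k <- ks) cabs (w t k - w s k) ^+ 2) ^+ 3 <= (om t - om s) ^+ 2 &
   forall t, \sum_(k <- ks) cabs (w t k) ^+ 2 <= A ^+ 2].

(** Cut the range of the normalised control function into cells of length 2^(-24n) and freeze [w] at
    the first time of each cell: within a cell it moves by at most A 2^(-8n). The layers are the
    differences of consecutive scales, and the factor 2^9 covers the shift from scale n to scale n -
    1. *)
Lemma step_decomposition ks w A (J : nat) : vctl ks w A ->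
 exists (N : nat) (c : nat -> nat -> nat) (g : nat -> nat -> Z4 -> R[i]),
 [/\ forall t k, (t < J)%N -> k \in ks -> w t k = \sum_(0 <= n < N) g n (c n t) k,
   forall n t, (t < J)%N -> (c n t < 2 * 2 ^ (24 * n))%N &
   forall n i, \sum_(k <- ks) cabs (g n i k) ^+ 2 <= (2 ^+ 9 * A / 2 ^+ (8 * n)) ^+ 2].
Proof.
move=> [A0 [om [om_mono om_bd om_ctl w_bd]]].
have [N JN] : exists N, (J <= 2 ^ (24 * N))%N.
 exists J; apply: (leq_trans (ltnW (ltn_expl J (isT : 1 < 2)%N))).
 by rewrite leq_exp2l //; lia.
pose x t : R := om t / A ^+ 3.
have x0 t : 0 <= x t by rewrite divr_ge0 ?exprn_ge0 //; have /andP[] := om_bd t.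
have x1 t : x t <= 1.
 have /andP[h0 h1] := om_bd t; have [e|An] := eqVneq A 0.
  by rewrite /x e expr0n /= invr0 mulr0.
 by rewrite ler_pdivrMr ?mul1r // exprn_gt0 // lt_def An.
pose cl n t : nat := Num.truncn (x t * 2 ^+ (24 * n)).
have clP n t : (cl n t)%:R <= x t * 2 ^+ (24 * n) < (cl n t).+1%:R.
 by rewrite /cl; apply: truncn_itv; rewrite mulr_ge0 ?exprn_ge0.
have cl_lt n t : (cl n t < 2 * 2 ^ (24 * n))%N.
 have /andP[h _] := clP n t; have : (cl n t)%:R <= (2 ^ (24 * n))%:R :> R.
  by apply: (le_trans h); rewrite natrX ler_piMl ?exprn_ge0.
 by rewrite ler_nat => /leq_ltn_trans; apply; rewrite ltn_Pmull // expn_gt0.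
have cl_nest n t t' : cl n.+1 t = cl n.+1 t' -> cl n t = cl n t'.
 have h s : cl n s = (cl n.+1 s %/ 2 ^ 24)%N.
  have /andP[a b] := clP n.+1 s.
  have y0 : 0 <= x s * 2 ^+ (24 * n) by apply: mulr_ge0; rewrite ?exprn_ge0.
  apply/eqP; rewrite /cl truncn_eq // -/(cl n.+1 s).
  have e : 2 ^+ (24 * n.+1) = 2 ^+ (24 * n) * (2 ^ 24)%N%:R :> R.
   by rewrite natrX -exprD; congr (_ ^+ _); lia.
  rewrite e mulrA in a b.
  have p0 : 0 < ((2 ^ 24)%N%:R : R) by rewrite ltr0n expn_gt0.
  rewrite -(ler_pM2r p0) -[X in _ && X](ltr_pM2r p0) -!natrM.
  apply/andP; split.
   by apply: le_trans a; rewrite ler_nat leq_trunc_div.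
  by apply: (lt_le_trans b); rewrite ler_nat ltn_ceil // expn_gt0.
 by rewrite !h => ->.
(* The first time in the same cell. It depends on the cell alone, which makes each layer a function
   of the cell number. *)
pose rep n t : nat := find (fun s => cl n s == cl n t) (iota 0 t.+1).
have repP n t : (rep n t <= t)%N /\ cl n (rep n t) = cl n t.
 have h : has (fun s => cl n s == cl n t) (iota 0 t.+1).
  by apply/hasP; exists t; rewrite ?mem_iota ?leqnn.
 have := nth_find 0 h; have := h; rewrite has_find size_iota -/(rep n t) => rt.
 by rewrite nth_iota // add0n => /eqP.
have rep_eq n t t' : cl n t = cl n t' -> rep n t = rep n t'.
 wlog tt : t t' / (t <= t')%N => [h e|e].
  by case/orP: (leq_total t t') => tt; [exact: h|apply/esym/h].
 rewrite /rep -e -(subnKC (_ : t.+1 <= t'.+1)%N) // iotaD find_cat.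
 case: ifP => // /negP[]; apply/hasP; exists t; rewrite ?mem_iota ?leqnn //.

have close n t s : (s <= t)%N -> cl n s = cl n t ->
  \sum_(k <- ks) cabs (w t k - w s k) ^+ 2 <= (A / 2 ^+ (8 * n)) ^+ 2.
 move=> st e; set S := \sum_(k <- ks) _.
 have S0 : 0 <= S by exact: sumsq_ge0.
 have := om_ctl _ _ st; rewrite -/S => h.
 have d : om t - om s <= (A / 2 ^+ (8 * n)) ^+ 3.
  rewrite expr_div_n -exprM (_ : 8 * n * 3 = 24 * n)%N; last by lia.
  have /andP[a1 a2] := om_bd t; have /andP[b1 b2] := om_bd s.
  have p0 : 0 < 2 ^+ (24 * n) :> R by rewrite exprn_gt0.
  have [e0|An] := eqVneq A 0.
   rewrite e0 expr0n /= mul0r; rewrite e0 expr0n /= in a2; lra.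
  have Ap : 0 < A ^+ 3 by rewrite exprn_gt0 // lt_def An.
  have /andP[_ c1] := clP n t; have /andP[c2 _] := clP n s.
  rewrite e in c2; rewrite -natr1 in c1.
  have : (x t - x s) * 2 ^+ (24 * n) <= 1 by rewrite mulrBl; lra.
  rewrite -ler_pdivlMr // mul1r => h1.
  have -> : om t - om s = (x t - x s) * A ^+ 3.
   by rewrite /x mulrBl !divfK // gt_eqF.
  by rewrite mulrC ler_wpM2l // ltW.
 have d0 : 0 <= om t - om s by rewrite subr_ge0 om_mono.
 rewrite -(@ler_pXn2r _ 3) ?qualifE /= ?sqr_ge0 //.
 apply: (le_trans h); rewrite exprAC ler_sqr ?qualifE /= //.
 exact: le_trans d.
pose d n t k : R[i] := if n is n'.+1 then
 (if n == N then w t k else w (rep n t) k) - w (rep n' t) k else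
 (if n == N then w t k else w (rep n t) k).
(* At the last scale the cell is the time itself, so the decomposition has no remainder; J <=
   2^(24N) keeps the count of pieces. *)
pose c n t := if n == N then t else cl n t.
have d_sum M t k : (M <= N)%N -> \sum_(0 <= n < M.+1) d n t k =
  if M == N then w t k else w (rep M t) k.
 elim: M => [|M ih] MN; first by rewrite big_nat1.
 rewrite big_nat_recr //= ih; last exact: ltnW.
 by rewrite (ltn_eqF MN) addrC subrK.
have d_c n t t' k : c n t = c n t' -> (n <= N)%N -> d n t k = d n t' k.
 rewrite /c /d; case: n => [|n]; case: eqP => [_ -> //|_] e nN; rewrite (rep_eq _ _ _ e) //.
 by rewrite (rep_eq n t t') //; exact: cl_nest.
have d_bd n t : \sum_(k <- ks) cabs (d n t k) ^+ 2 <= (2 ^+ 9 * A / 2 ^+ (8 * n)) ^+ 2.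
 have w512 s : \sum_(k <- ks) cabs (w s k) ^+ 2 <= (2 ^+ 9 * A / 2 ^+ (8 * 0)) ^+ 2.
  apply: (le_trans (w_bd s)); rewrite muln0 expr0 divr1.
  have h : A <= 2 ^+ 9 * A by rewrite ler_peMl // exprn_ege1 // ler1n.
  by rewrite lerXn2r ?qualifE /= // (le_trans A0 h).
 have c512 n' s s' : (s <= s')%N -> cl n' s = cl n' s' ->
   \sum_(k <- ks) cabs (w s' k - w s k) ^+ 2 <= (2 ^+ 9 * A / 2 ^+ (8 * n'.+1)) ^+ 2.
  move=> ss e; apply: (le_trans (close _ _ _ ss e)).
  have p : 0 < 2 ^+ (8 * n') :> R by rewrite exprn_gt0.
  rewrite mulnS exprD; move: (2 ^+ (8 * n')) p => X p.
  have -> : 2 ^+ 9 * A / (2 ^+ 8 * X) = 2 * (A / X) by field; exact: lt0r_neq0.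
  have h0 : 0 <= A / X by rewrite divr_ge0 // ltW.
  by rewrite exprMn; have := sqr_ge0 (A / X); lra.
 rewrite /d; case: n => [|n]; first by case: eqP => _; exact: w512.
 case: eqP => _; first by have [h1 h2] := repP n t; exact: c512.
 have [h1 h2] := repP n.+1 t; have h3 := cl_nest _ _ _ h2.
 have [h4 h5] := repP n (rep n.+1 t); rewrite (rep_eq _ _ _ h3) in h4 h5.
 exact: c512.
pose ti n i := find (fun t => c n t == i) (iota 0 J).
exists N.+1, c, (fun n i k => if (n <= N)%N && (ti n i < J)%N then d n (ti n i) k else 0); split.
- move=> t k tJ kk; have := d_sum N t k (leqnn _); rewrite eqxx => <-.
 rewrite big_nat_cond [RHS]big_nat_cond; apply: eq_bigr => n /andP[/andP[_ nN] _].
 have h : has (fun t' => c n t' == c n t) (iota 0 J).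
  by apply/hasP; exists t; rewrite ?mem_iota.
 have := nth_find 0 h; have := h; rewrite has_find size_iota -/(ti n (c n t)) => tiJ.
 rewrite nth_iota // add0n -ltnS nN tiJ /= => /eqP e.
 by apply: d_c => //; rewrite e.
- move=> n t tJ; rewrite /c; case: eqP => [->|_]; last exact: cl_lt.
 by apply: (leq_trans tJ); apply: (leq_trans JN); rewrite leq_pmull.
- move=> n i; case: (_ && _); first exact: d_bd.
 by rewrite big1 ?sqr_ge0 // => k _; rewrite cabs0 expr0n.
Qed.

(** Cauchy-Schwarz with the weights 2^-n, whose sum is at most 2. *)
Lemma sqr_sum_geo N (a : nat -> R) :
 (\sum_(0 <= n < N) a n) ^+ 2 <= 2 * \sum_(0 <= n < N) 2 ^+ n * a n ^+ 2.
Proof.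
have p n : 0 < 2 ^+ n :> R by rewrite exprn_gt0.
have s n : Num.sqrt (2 ^+ n : R) ^+ 2 = 2 ^+ n by rewrite sqr_sqrtr // ltW.
have sn n : Num.sqrt (2 ^+ n : R) != 0 by rewrite sqrtr_eq0 -ltNge.
have := CS_real (index_iota 0 N) xpredT (fun n => (Num.sqrt (2 ^+ n))^-1)
 (fun n => Num.sqrt (2 ^+ n) * a n).
under eq_bigr do rewrite mulrA mulVf // mul1r.
move/le_trans; apply; apply: ler_pM.
- exact: sumsq_ge0.
- exact: sumsq_ge0.
- under eq_bigr do rewrite exprVn s.
 have -> : \sum_(0 <= n < N) (2 ^+ n)^-1 = 2 - 2 / 2 ^+ N :> R.
  elim: N => [|N ih]; first by rewrite big_geq // expr0 divr1 subrr.
  rewrite big_nat_recr //= ih exprS; field; exact: lt0r_neq0.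
 by rewrite gerBl divr_ge0 // ltW.
- by apply: ler_sum => n _; rewrite exprMn s.
Qed.

Lemma exp4_sum_geo N (a : nat -> R) :
 (\sum_(0 <= n < N) a n) ^+ 4 <= 8 * \sum_(0 <= n < N) 8 ^+ n * a n ^+ 4.
Proof.
rewrite [leLHS](_ : _ = ((\sum_(0 <= n < N) a n) ^+ 2) ^+ 2); last by rewrite -exprM.
apply: (le_via ((2 * \sum_(0 <= n < N) 2 ^+ n * a n ^+ 2) ^+ 2)).
 rewrite lerXn2r ?qualifE /= ?sqr_ge0 ?sqr_sum_geo //.
 apply: mulr_ge0 => //; apply: sumr_ge0 => n _; by apply: mulr_ge0; [exact: exprn_ge0|exact: sqr_ge0].
rewrite exprMn; have := sqr_sum_geo N (fun n => 2 ^+ n * a n ^+ 2).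
have -> : \sum_(0 <= n < N) 2 ^+ n * (2 ^+ n * a n ^+ 2) ^+ 2 =
  \sum_(0 <= n < N) 8 ^+ n * a n ^+ 4.
 apply: eq_bigr => n _; rewrite exprMn -!exprM [(n * 2)%N]mulnC exprM mulrA.
 by rewrite -exprMn; congr (_ ^+ _ * _); lra.
lra.
Qed.

End Decomposition.

Section Transference.
Context {R : realType}.
Variable J : nat.
Hypothesis J1 : (1 < J)%N.

Definition tm (z : grid J) : nat := z.1.

Definition uw ks (w : nat -> Z4 -> R[i]) (z : grid J) : R[i] := uu ks (w (tm z)) z.

Lemma zlt (z : grid J) : (tm z < J)%N.
Proof. exact: valZ. Qed.

(** A function that switches between P pieces costs at most P times one piece, since all pieces may
    be summed over the whole grid. *)
Lemma sum_step (P : nat) (c : nat -> nat) (F : nat -> grid J -> R) (B : R) :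
 (forall t, (t < J)%N -> (c t < P)%N) -> (forall i z, 0 <= F i z) ->
 (forall i, \sum_(z : grid J) F i z <= B) -> \sum_(z : grid J) F (c (tm z)) z <= P%:R * B.
Proof.
move=> cP F0 hF.
apply: (le_via (\sum_(z : grid J) \sum_(i < P) F i z)).
 apply: ler_sum => z _; rewrite (bigD1 (Ordinal (cP _ (zlt z)))) //= lerDl.
 by apply: sumr_ge0.
rewrite exchange_big /=; apply: (le_via (\sum_(i < P) B)); first exact: ler_sum.
by rewrite sumr_const card_ord -[leLHS]mulr_natl.
Qed.

Definition free4 (ks : seq Z4) (B : R) := forall f : Z4 -> R[i],
 \sum_(z : grid J) cabs (uu ks f z) ^+ 4 <= B * (\sum_(k <- ks) cabs (f k) ^+ 2) ^+ 2.

Definition free22 (ks ls : seq Z4) (B : R) := forall f g : Z4 -> R[i],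
 \sum_(z : grid J) cabs (uu ks f z * uu ls g z) ^+ 2 <=
  B * (\sum_(k <- ks) cabs (f k) ^+ 2) * (\sum_(k <- ls) cabs (g k) ^+ 2).

Lemma uw_steps ks w N (c : nat -> nat -> nat) (g : nat -> nat -> Z4 -> R[i]) :
 (forall t k, (t < J)%N -> k \in ks -> w t k = \sum_(0 <= n < N) g n (c n t) k) ->
 forall z, uw ks w z = \sum_(0 <= n < N) uu ks (g n (c n (tm z))) z.
Proof.
move=> h z; rewrite /uw /uu exchange_big /=; apply: eq_big_seq => k kk.
by rewrite (h _ _ (zlt z) kk) mulr_suml.
Qed.

Lemma step4 ks B P (c : nat -> nat) (g : nat -> Z4 -> R[i]) (e : R) :
 free4 ks B -> 0 <= B ->
 (forall t, (t < J)%N -> (c t < P)%N) ->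
 (forall i, \sum_(k <- ks) cabs (g i k) ^+ 2 <= e ^+ 2) ->
 \sum_(z : grid J) cabs (uu ks (g (c (tm z))) z) ^+ 4 <= P%:R * (B * e ^+ 4).
Proof.
move=> hB B0 cP ge.
apply: (sum_step (F := fun i z => cabs (uu ks (g i) z) ^+ 4) cP) => [i z|i].
 by rewrite exprn_ge0 ?cabs_ge0.
apply: (le_trans (hB _)); rewrite ler_wpM2l //.
rewrite [leRHS](_ : _ = (e ^+ 2) ^+ 2); last by rewrite -exprM.
rewrite ler_sqr ?qualifE /= ?sqr_ge0 ?ge //.
exact: sumsq_ge0.
Qed.

Lemma step22 ks ls B P P' (c c' : nat -> nat) (g g' : nat -> Z4 -> R[i]) (e e' : R) :
 free22 ks ls B -> 0 <= B ->
 (forall t, (t < J)%N -> (c t < P)%N) -> (forall t, (t < J)%N -> (c' t < P')%N) ->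
 (forall i, \sum_(k <- ks) cabs (g i k) ^+ 2 <= e ^+ 2) ->
 (forall i, \sum_(k <- ls) cabs (g' i k) ^+ 2 <= e' ^+ 2) ->
 \sum_(z : grid J) cabs (uu ks (g (c (tm z))) z * uu ls (g' (c' (tm z))) z) ^+ 2 <=
  P%:R * (P'%:R * (B * e ^+ 2 * e' ^+ 2)).
Proof.
move=> hB B0 cP cP' ge ge'.
apply: (sum_step (F := fun i z =>
 cabs (uu ks (g i) z * uu ls (g' (c' (tm z))) z) ^+ 2) cP) => [i z|i].
 exact: sqr_ge0.
apply: (sum_step (F := fun i' z => cabs (uu ks (g i) z * uu ls (g' i') z) ^+ 2) cP').
 by move=> i' z; exact: sqr_ge0.
move=> i'; apply: (le_trans (hB _ _)); apply: ler_pM => //.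
- by rewrite mulr_ge0 // sumr_ge0 // => k _; exact: sqr_ge0.
- exact: sumsq_ge0.
- by rewrite ler_wpM2l.
Qed.

Lemma sum_geo_le2 N : \sum_(0 <= n < N) (2 ^+ n)^-1 <= 2 :> R.
Proof.
have -> : \sum_(0 <= n < N) (2 ^+ n)^-1 = 2 - 2 / 2 ^+ N :> R.
 elim: N => [|N ih]; first by rewrite big_geq // expr0 divr1 subrr.
 by rewrite big_nat_recr //= ih exprS; field; rewrite expf_neq0.
by rewrite gerBl divr_ge0 // exprn_ge0.
Qed.

(** Layer n has about 2^(24n) pieces of size 2^(-8n), so its fourth power is 2^(-8n), and the
    summation weight 8^n leaves 2^(-5n). Convergence here is the place where the variation exponent
    3 has to be below 4. *)
Lemma transfer4 ks B w A : free4 ks B -> 0 <= B -> vctl ks w A ->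
 \sum_(z : grid J) cabs (uw ks w z) ^+ 4 <= 2 ^+ 41 * B * A ^+ 4.
Proof.
move=> hB B0 hw; have A0 := hw.1.
have [N [c [g [wE cP gb]]]] := step_decomposition J hw.
apply: (le_via (\sum_(z : grid J) 8 * \sum_(0 <= n < N)
  8 ^+ n * cabs (uu ks (g n (c n (tm z))) z) ^+ 4)).
 apply: ler_sum => z _; rewrite (uw_steps wE).
 apply: le_trans (exp4_sum_geo _ _).
 by rewrite lerXn2r ?qualifE /= ?cabs_ge0 ?cabs_sum // sumr_ge0 // => n _; exact: cabs_ge0.
rewrite -mulr_sumr exchange_big /=.
apply: (le_via (8 * \sum_(0 <= n < N) (2 ^+ 37 * B * A ^+ 4) * (2 ^+ n)^-1)).
 rewrite ler_wpM2l //; apply: ler_sum => n _; rewrite -mulr_sumr.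
 have h := step4 hB B0 (cP n) (gb n).
 apply: (le_via (8 ^+ n * ((2 * 2 ^ (24 * n))%N%:R * (B * (2 ^+ 9 * A / 2 ^+ (8 * n)) ^+ 4)))).
  by rewrite ler_wpM2l // exprn_ge0.
 have x0 : 2 ^+ n != 0 :> R by rewrite expf_neq0.
 rewrite natrM natrX.
 have -> : 8 ^+ n = (2 ^+ n) ^+ 3 :> R by rewrite exprAC; congr (_ ^+ _); lra.
 rewrite [(24 * n)%N]mulnC [(8 * n)%N]mulnC !(exprM _ n).
 have x1 : 1 <= 2 ^+ n :> R by rewrite exprn_ege1 // ler1n.
 move: (2 ^+ n) x0 x1 => x x0 x1.
 have -> : x ^+ 3 * (2 * x ^+ 24 * (B * (2 ^+ 9 * A / x ^+ 8) ^+ 4)) =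
   2 ^+ 37 * B * A ^+ 4 * x ^- 5 by field.
 rewrite ler_wpM2l ?mulr_ge0 ?exprn_ge0 //.
 rewrite lef_pV2 ?posrE ?exprn_gt0 //; try lra.
 by rewrite -[leLHS]expr1 ler_weXn2l.
rewrite -mulr_sumr.
have h : 0 <= B * A ^+ 4 by rewrite mulr_ge0 ?exprn_ge0.
have := sum_geo_le2 N; set S := \sum_(_ <= _ < _) _ => hS.
have : 2 ^+ 37 * (B * A ^+ 4) * S <= 2 ^+ 37 * (B * A ^+ 4) * 2.
 by rewrite ler_wpM2l // mulr_ge0 ?exprn_ge0.
by rewrite -!mulrA; move: (B * _) (A ^+ 4 * S) => X Y; lra.
Qed.

(** For layers n, n' put x = 2^(n + n'). The two L^4 bounds give x^-4; the bilinear bound, paid for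
    all pairs of pieces, gives x^8 2^(-6 tau). The first is at most x^-2 2^(-tau) when 2^tau <= x^2,
    the second otherwise. This is why the gain enters with exponent 6 tau and leaves with tau. *)
Lemma transfer22 ks ls B (tau : nat) w w' A A' : free4 ks B -> free4 ls B ->
 free22 ks ls (B / 2 ^+ (6 * tau)) \/ tau = 0%N ->
 0 <= B -> vctl ks w A -> vctl ls w' A' ->
 \sum_(z : grid J) cabs (uw ks w z * uw ls w' z) ^+ 2 <= 2 ^+ 42 * B * A ^+ 2 * A' ^+ 2 / 2 ^+ tau.
Proof.
move=> hB hB' hBB B0 hw hw'; have A0 := hw.1; have A0' := hw'.1.
have [N [c [g [wE cP gb]]]] := step_decomposition J hw.
have [N' [c' [g' [wE' cP' gb']]]] := step_decomposition J hw'.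
pose a n (z : grid J) := cabs (uu ks (g n (c n (tm z))) z).
pose a' n (z : grid J) := cabs (uu ls (g' n (c' n (tm z))) z).
apply: (le_via (\sum_(z : grid J) (2 * \sum_(0 <= n < N) 2 ^+ n * a n z ^+ 2) *
  (2 * \sum_(0 <= n < N') 2 ^+ n * a' n z ^+ 2))).
 apply: ler_sum => z _; rewrite cabsM exprMn (uw_steps wE) (uw_steps wE').
 have h M (F : nat -> R[i]) : cabs (\sum_(0 <= n < M) F n) ^+ 2 <=
   2 * \sum_(0 <= n < M) 2 ^+ n * cabs (F n) ^+ 2.
  apply: le_trans (sqr_sum_geo _ _).
  by rewrite lerXn2r ?qualifE /= ?cabs_ge0 ?cabs_sum // sumr_ge0 // => n _; exact: cabs_ge0.
 by apply: ler_pM; rewrite ?sqr_ge0 ?h.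
pose T n n' := \sum_(z : grid J) (a n z * a' n' z) ^+ 2.
have -> : \sum_(z : grid J) (2 * \sum_(0 <= n < N) 2 ^+ n * a n z ^+ 2) *
  (2 * \sum_(0 <= n < N') 2 ^+ n * a' n z ^+ 2) =
  4 * \sum_(0 <= n < N) \sum_(0 <= n' < N') 2 ^+ n * 2 ^+ n' * T n n'.
 rewrite /T [in RHS]mulr_sumr; under [RHS]eq_bigr => n _.
  rewrite mulr_sumr; under eq_bigr => n' _ do rewrite 2!mulr_sumr.
  rewrite exchange_big /=; over.
 rewrite exchange_big /=; apply: eq_bigr => z _.
 rewrite mulrACA mulr_suml mulr_sumr; apply: eq_bigr => n _.
 rewrite mulr_sumr mulr_sumr; apply: eq_bigr => n' _; ring.
have T0 n n' : 0 <= T n n' by exact: sumsq_ge0.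
have Tb n n' : T n n' <= 2 ^+ 38 * B * A ^+ 2 * A' ^+ 2 / ((2 ^+ n * 2 ^+ n') ^+ 2 * 2 ^+ tau).
 pose x : R := 2 ^+ n * 2 ^+ n'.
 have x1 : 1 <= x.
  by rewrite /x -exprD exprn_ege1 // ler1n.
 have x0 : x != 0 by rewrite gt_eqF //; lra.
 have t1 : 1 <= 2 ^+ tau :> R by rewrite exprn_ege1 // ler1n.
 have t0 : 2 ^+ tau != 0 :> R by rewrite expf_neq0.
 have p0 : 2 ^+ n != 0 :> R by rewrite expf_neq0.
 have p0' : 2 ^+ n' != 0 :> R by rewrite expf_neq0.
 have E24 k : ((2 * 2 ^ (24 * k))%N%:R : R) = 2 * (2 ^+ k) ^+ 24.
  by rewrite natrM natrX mulnC exprM.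
 have E8 k : 2 ^+ (8 * k) = (2 ^+ k) ^+ 8 :> R by rewrite mulnC exprM.
 have Y0 : 0 <= B * A ^+ 2 * A' ^+ 2 by rewrite !mulr_ge0 ?exprn_ge0.
 have YE : 2 ^+ 38 * B * A ^+ 2 * A' ^+ 2 / ((2 ^+ n * 2 ^+ n') ^+ 2 * 2 ^+ tau) =
   2 ^+ 38 * (B * A ^+ 2 * A' ^+ 2) / (x ^+ 2 * 2 ^+ tau) by rewrite !mulrA.
 have b1 : T n n' <= 2 ^+ 37 * B * A ^+ 2 * A' ^+ 2 / x ^+ 4.
  have b0 : 0 <= 2 ^+ 37 * B * A ^+ 2 * A' ^+ 2 / x ^+ 4.
   by rewrite !mulr_ge0 ?invr_ge0 ?exprn_ge0 //; lra.
  rewrite -ler_sqr ?qualifE /= //.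
  apply: (le_via ((\sum_(z : grid J) a n z ^+ 4) * (\sum_(z : grid J) a' n' z ^+ 4))).
   have := CS_real (index_enum (grid J)) xpredT (fun z => a n z ^+ 2) (fun z => a' n' z ^+ 2).
   rewrite /T; under eq_bigr do rewrite -exprMn.
   move/le_trans; apply; apply: le_of_eq.
   by congr (_ * _); apply: eq_bigr => z _; rewrite -exprM.
  have h1 := step4 hB B0 (cP n) (gb n); have h2 := step4 hB' B0 (cP' n') (gb' n').
  apply: le_trans (ler_pM _ _ h1 h2) _.
  - by apply: sumr_ge0 => z _; rewrite exprn_ge0 ?cabs_ge0.
  - by apply: sumr_ge0 => z _; rewrite exprn_ge0 ?cabs_ge0.
  rewrite !E24 !E8 /x; apply: le_of_eq.
  by move: (2 ^+ n) (2 ^+ n') p0 p0' => p p' p0 p0'; field; rewrite p0 p0'.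
 have [tx|xt] := leP (2 ^+ tau) (x ^+ 2).
  apply: (le_trans b1).
  apply: (le_via (2 ^+ 37 * (B * A ^+ 2 * A' ^+ 2) / (x ^+ 2 * 2 ^+ tau))).
   rewrite !mulrA ler_wpM2l ?mulr_ge0 ?exprn_ge0 //.
   rewrite lef_pV2 ?posrE ?mulr_gt0 ?exprn_gt0 //; try lra.
   rewrite (_ : x ^+ 4 = x ^+ 2 * x ^+ 2); last by ring.
   by rewrite ler_wpM2l // sqr_ge0.
  rewrite YE ler_wpM2r ?invr_ge0 ?mulr_ge0 ?exprn_ge0 //; try lra.
 (* For tau = 0 the present range x^2 < 1 is empty. *)
 case: hBB => [hBB|e0]; last first.
  by move: xt; rewrite e0 expr0 ltNge exprn_ege1.
 have B60 : 0 <= B / 2 ^+ (6 * tau) by rewrite mulr_ge0 ?invr_ge0 ?exprn_ge0.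
 have h := step22 hBB B60 (cP n) (cP' n') (gb n) (gb' n').
 have {}h : T n n' <= 2 ^+ 38 * (B * A ^+ 2 * A' ^+ 2) * x ^+ 8 / (2 ^+ tau) ^+ 6.
  apply: le_trans (_ : _ <= \sum_(z : grid J) cabs (uu ks (g n (c n (tm z))) z *
    uu ls (g' n' (c' n' (tm z))) z) ^+ 2) _.
   by apply/le_of_eq/eq_bigr => z _; rewrite cabsM.
  apply: (le_trans h); rewrite !E24 !E8 /x [(6 * tau)%N]mulnC exprM.
  apply: le_of_eq.
  move: (2 ^+ n) (2 ^+ n') (2 ^+ tau) p0 p0' t0 => p p' t p0 p0' t0.
  by field; rewrite p0 p0' t0.
 apply: (le_trans h); rewrite YE -!(mulrA (2 ^+ 38 * _)).
 rewrite ler_wpM2l ?mulr_ge0 ?exprn_ge0 // -[leRHS]mul1r.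
 move: (2 ^+ tau) t1 t0 xt => t t1 t0 xt.
 have tp : 0 < t by lra.
 have xp : 0 < x by lra.
 rewrite ler_pdivlMr ?mulr_gt0 ?exprn_gt0 // mulrAC ler_pdivrMr ?exprn_gt0 // mul1r.
 have -> : x ^+ 8 * (x ^+ 2 * t) = (x ^+ 2) ^+ 5 * t by ring.
 rewrite [leRHS]exprSr ler_wpM2r ?(ltW tp) // lerXn2r ?qualifE /= ?sqr_ge0 ?(ltW tp) //.
 exact: ltW.
set Y := 2 ^+ 38 * B * A ^+ 2 * A' ^+ 2 / 2 ^+ tau.
have Y0 : 0 <= Y by rewrite !mulr_ge0 ?invr_ge0 ?exprn_ge0.
apply: (le_via (4 * \sum_(0 <= n < N) \sum_(0 <= n' < N') Y * ((2 ^+ n)^-1 * (2 ^+ n')^-1))).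
 rewrite ler_wpM2l //; apply: ler_sum => n _; apply: ler_sum => n' _.
 apply: (le_via (2 ^+ n * 2 ^+ n' * (2 ^+ 38 * B * A ^+ 2 * A' ^+ 2 /
    ((2 ^+ n * 2 ^+ n') ^+ 2 * 2 ^+ tau)))).
  by rewrite ler_wpM2l // mulr_ge0 ?exprn_ge0.
 apply: le_of_eq; rewrite /Y; field.
 by rewrite !expf_neq0.
have -> : \sum_(0 <= n < N) \sum_(0 <= n' < N') Y * ((2 ^+ n)^-1 * (2 ^+ n')^-1) =
  Y * ((\sum_(0 <= n < N) (2 ^+ n)^-1) * (\sum_(0 <= n' < N') (2 ^+ n')^-1)).
 rewrite mulr_suml mulr_sumr; apply: eq_bigr => n _; rewrite !mulr_sumr.
 by apply: eq_bigr => n' _.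
have -> : 2 ^+ 42 * B * A ^+ 2 * A' ^+ 2 / 2 ^+ tau = 4 * (Y * (2 * 2)) by rewrite /Y; ring.
rewrite ler_wpM2l // ler_wpM2l //; apply: ler_pM; rewrite ?sum_geo_le2 //.
 by apply: sumr_ge0 => n _; rewrite invr_ge0 exprn_ge0.
by apply: sumr_ge0 => n _; rewrite invr_ge0 exprn_ge0.
Qed.

End Transference.

(** * From scalar control to control in l^2 *)

Section ScalarControl.
Context {R : realType}.

Definition sctl (v : nat -> R[i]) (A : R) : Prop :=
 0 <= A /\ exists om : nat -> R,
 [/\ forall s t, (s <= t)%N -> om s <= om t,
   forall t, 0 <= om t <= A ^+ 3,
   forall s t, (s <= t)%N -> cabs (v t - v s) ^+ 3 <= om t - om s &
   forall t, cabs (v t) <= A].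

(* Hoelder with exponents 3/2 and 3 by two applications of Cauchy-Schwarz. *)
Lemma holder_ctl (ks : seq Z4) (x a : Z4 -> R) :
 (forall k, 0 <= x k) -> (forall k, 0 <= a k) -> (forall k, a k = 0 -> x k = 0) ->
 (\sum_(k <- ks) x k ^+ 2) ^+ 3 <=
 (\sum_(k <- ks) a k ^+ 2) * (\sum_(k <- ks) x k ^+ 3 / a k) ^+ 2.
Proof.
move=> x0 a0 ax; set X := \sum_(k <- ks) x k ^+ 2; set Y := \sum_(k <- ks) x k ^+ 3 / a k.
set A := \sum_(k <- ks) a k ^+ 2; set Z := \sum_(k <- ks) x k * a k.
have X0 : 0 <= X by exact: sumsq_ge0.
have y0 k : 0 <= x k ^+ 3 / a k by rewrite divr_ge0 ?exprn_ge0.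
have Y0 : 0 <= Y by apply: sumr_ge0.
have h1 : X ^+ 2 <= Y * Z.
 have := CS_real ks xpredT (fun k => Num.sqrt (x k ^+ 3 / a k)) (fun k => Num.sqrt (x k * a k)).
 have -> : \sum_(k <- ks) Num.sqrt (x k ^+ 3 / a k) * Num.sqrt (x k * a k) = X.
  apply: eq_bigr => k _; rewrite -sqrtrM //.
  have [e|an] := eqVneq (a k) 0; first by rewrite e (ax _ e) mul0r mulr0 sqrtr0 expr0n.
  by rewrite (_ : x k ^+ 3 / a k * (x k * a k) = (x k ^+ 2) ^+ 2) ?sqrtr_sqr ?ger0_norm ?sqr_ge0 //; field.
 move/le_trans; apply; apply: le_of_eq; congr (_ * _).
  by apply: eq_bigr => k _; rewrite sqr_sqrtr.
 by apply: eq_bigr => k _; rewrite sqr_sqrtr ?mulr_ge0.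
have h2 : Z ^+ 2 <= X * A by exact: CS_real.
have [e|Xn] := eqVneq X 0.
 by rewrite e expr0n /= mulr_ge0 ?sqr_ge0 // sumr_ge0 // => k _; exact: sqr_ge0.
have Xp : 0 < X by rewrite lt_def Xn.
rewrite -(ler_pM2r Xp).
have : (X ^+ 2) ^+ 2 <= Y ^+ 2 * Z ^+ 2.
 rewrite -exprMn lerXn2r ?qualifE /= ?sqr_ge0 //.
 by apply: le_trans h1; exact: sqr_ge0.
have : Y ^+ 2 * Z ^+ 2 <= Y ^+ 2 * (X * A) by rewrite ler_wpM2l ?sqr_ge0.
rewrite (_ : (X ^+ 2) ^+ 2 = X ^+ 3 * X); last by ring.
rewrite (_ : Y ^+ 2 * (X * A) = A * Y ^+ 2 * X); last by ring.
by move=> p q; apply: le_trans q p.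
Qed.

(** The scalar control functions are added with weights A / a k; [holder_ctl] shows that this
    dominates the cubed l^2 increments. A coordinate with a k = 0 vanishes identically, in agreement
    with division by 0 giving 0. *)
Lemma vctl_scalar (ks : seq Z4) (w : nat -> Z4 -> R[i]) (a : Z4 -> R) :
 (forall k, sctl (w^~ k) (a k)) ->
 vctl ks w (Num.sqrt (\sum_(k <- ks) a k ^+ 2)).
Proof.
move=> hw; set A := Num.sqrt _.
have S0 : 0 <= \sum_(k <- ks) a k ^+ 2 by exact: sumsq_ge0.
have A2 : A ^+ 2 = \sum_(k <- ks) a k ^+ 2 by rewrite sqr_sqrtr.
have A0 : 0 <= A by exact: sqrtr_ge0.
have a0 k : 0 <= a k by exact: (hw k).1.
pose om k := xget (fun=> 0) [set om : nat -> R |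
 [/\ forall s t, (s <= t)%N -> om s <= om t,
   forall t, 0 <= om t <= a k ^+ 3,
   forall s t, (s <= t)%N -> cabs (w t k - w s k) ^+ 3 <= om t - om s &
   forall t, cabs (w t k) <= a k]].
have omP k : [/\ forall s t, (s <= t)%N -> om k s <= om k t,
   forall t, 0 <= om k t <= a k ^+ 3,
   forall s t, (s <= t)%N -> cabs (w t k - w s k) ^+ 3 <= om k t - om k s &
   forall t, cabs (w t k) <= a k].
 by have [_ h] := hw k; exact: (xgetPex _ h).
split=> //; exists (fun t => A * \sum_(k <- ks) om k t / a k); split.
- move=> s t st; rewrite ler_wpM2l //; apply: ler_sum => k _.
 by rewrite ler_wpM2r ?invr_ge0 //; have [h _ _ _] := omP k; exact: h.
- move=> t; apply/andP; split.
  rewrite mulr_ge0 // sumr_ge0 // => k _; rewrite divr_ge0 //.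
  by have [_ h _ _] := omP k; have /andP[] := h t.
 rewrite exprS ler_wpM2l // A2; apply: ler_sum => k _.
 have [_ h _ _] := omP k; have /andP[h1 h2] := h t.
 have [e|an] := eqVneq (a k) 0; first by rewrite e invr0 mulr0 expr0n.
 have ap : 0 < a k by rewrite lt_def an a0.
 by rewrite ler_pdivrMr // -exprSr.
- move=> s t st; have := @holder_ctl ks (fun k => cabs (w t k - w s k)) a
  (fun k => cabs_ge0 _) a0 _.
 have h0 k : a k = 0 -> cabs (w t k - w s k) = 0.
  move=> e; have [_ _ _ h] := omP k; have := h t; have := h s; rewrite e => h1 h2.
  have z1 : w t k = 0 by apply/cabs0_eq0/le_anti; rewrite h2 cabs_ge0.
  have z2 : w s k = 0 by apply/cabs0_eq0/le_anti; rewrite h1 cabs_ge0.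
  by rewrite z1 z2 subrr cabs0.
 move=> /(_ h0)/le_trans; apply.
 rewrite -mulrBr exprMn A2 ler_wpM2l // -sumrB.
 have p0 k : 0 <= cabs (w t k - w s k) ^+ 3 / a k by rewrite divr_ge0 ?exprn_ge0 ?cabs_ge0.
 have pq : \sum_(k <- ks) cabs (w t k - w s k) ^+ 3 / a k <=
   \sum_(k <- ks) (om k t / a k - om k s / a k).
  apply: ler_sum => k _; rewrite -mulrBl ler_wpM2r ?invr_ge0 //.
  by have [_ _ h _] := omP k; exact: h.
 have P0 : 0 <= \sum_(k <- ks) cabs (w t k - w s k) ^+ 3 / a k by apply: sumr_ge0.
 by rewrite ler_sqr ?qualifE /= // (le_trans P0).
- move=> t; rewrite A2; apply: ler_sum => k _.
 by have [_ _ _ h] := omP k; rewrite ler_sqr ?qualifE /= ?cabs_ge0.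
Qed.

End ScalarControl.

(** * Dyadic levels and localisation to cubes *)

Section DyadicPairs.
Context {R : realType}.

Definition sup4 (k : Z4) : nat := \max_(j < 4) `|cmp k j|%N.
(** The zero frequency has level 0, like the frequencies of sup norm 1. *)
Definition lev (k : Z4) : nat := trunc_log 2 (sup4 k).

Lemma cmp_le_sup k j : (`|cmp k j| <= sup4 k)%N.
Proof. by rewrite /sup4 (bigD1 j) //= leq_maxl. Qed.

Lemma sup4_lt_lev k : (sup4 k < 2 ^ (lev k).+1)%N.
Proof. exact: trunc_log_ltn. Qed.

Lemma lev_sup4 k : (0 < lev k)%N -> (2 ^ lev k <= sup4 k)%N.
Proof.
move=> h; apply: trunc_logP => //; rewrite lt0n; apply/negP => /eqP e.
by move: h; rewrite /lev e trunc_log0.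
Qed.

Lemma sup4_ex k : exists j, sup4 k = `|cmp k j|%N.
Proof.
have [//|j e] := @bigop.eq_bigmax 'I_4 (fun j : 'I_4 => `|cmp k j|%N); first by rewrite card_ord.
by exists j.
Qed.

(** The tau for which [bilinear_free] applies to levels n, m with sg = 6 tau. The first term is the
    separation 96 tau <= n - m - 4, the second is 32 sg <= m + 3 for cubes of side 2^(m+1).
    Truncated subtraction makes it 0 when the levels are close. *)
Definition gtau (n m : nat) : nat := minn ((n - m - 4) %/ 96) ((m + 3) %/ 192).

Lemma divz_bd (x : int) (M : nat) : (0 < M)%N ->
 (x %/ M%:Z)%Z * M%:Z <= x < (x %/ M%:Z)%Z * M%:Z + M%:Z.
Proof.
move=> M0; rewrite lez_floor ?gt_eqF //; last by lia.
Qed.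

Definition cubeix (M : nat) (k : Z4) : Z4 :=
 ((cmp k o0 %/ M%:Z)%Z, (cmp k o1 %/ M%:Z)%Z,
  (cmp k o2 %/ M%:Z)%Z, (cmp k o3 %/ M%:Z)%Z).

Lemma cmp_cubeix M k j : cmp (cubeix M k) j = (cmp k j %/ M%:Z)%Z.
Proof.
case: j => -[|[|[|[|//]]]] i; rewrite /cubeix [LHS]/cmp /=; congr (divz (cmp k _) _); exact: val_inj.
Qed.

Definition z4s (a : int) (k : Z4) : Z4 :=
 (a * k.1.1.1, a * k.1.1.2, a * k.1.2, a * k.2).

Lemma cmp_z4s a k j : cmp (z4s a k) j = a * cmp k j.
Proof. by case: j => -[|[|[|[|//]]]]. Qed.

Variable J : nat.
Hypothesis J1 : (1 < J)%N.

Lemma sumV_ez2 (k l k' l' : Z4) (a : 'Z_J) :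
 (exists j, `|cmp k j + cmp l j - (cmp k' j + cmp l' j)| < J%:Z /\
   cmp k j + cmp l j != cmp k' j + cmp l' j) ->
 \sum_(x : V J) ez (ph (zk J k) (a, x)) * ez (ph (zk J l) (a, x)) *
   ((ez (ph (zk J k') (a, x)) * ez (ph (zk J l') (a, x)))^*)%C = 0 :> R[i].
Proof.
move=> [j [h1 h2]].
under eq_bigr do rewrite conjM -!ezN // -!ezD // -opprD ph_pair ezD //=.
rewrite -mulr_suml sum_ez_dv //; case: eqP => [e|_]; last by rewrite mul0r.
have := congr1 (fun x : V J => x j) e; rewrite !ffunE -!intrD => /eqP.
rewrite subr_eq0 => /eqP e1; exfalso; move/eqP: h2; apply.
exact: (intZ_eq J1 e1 h1).
Qed.

(** The low factor moves a frequency by at most M per coordinate, so cubes whose indices differ by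
    more than 2 give products orthogonal in space; 625 = 5^4 cubes remain near a given one.
    Orthogonality is used at each fixed time, which allows arbitrary time profiles. *)
Lemma cube_orth (M : nat) ks ls (w w' : nat -> Z4 -> R[i]) : (0 < M)%N ->
 (forall k l k' l', k \in ks -> l \in ls -> k' \in ks -> l' \in ls ->
   forall j, `|cmp k j + cmp l j - (cmp k' j + cmp l' j)| < J%:Z) ->
 (forall l, l \in ls -> forall j, `|cmp l j| <= M%:Z) ->
 \sum_(z : grid J) cabs (uw ks w z * uw ls w' z) ^+ 2 <=
  625 * \sum_(Q <- undup (map (cubeix M) ks))
   \sum_(z : grid J) cabs (uw [seq k <- ks | cubeix M k == Q] w z * uw ls w' z) ^+ 2.
Proof.
move=> M0 hJ hl.
pose near (P Q : Z4) := [forall j, `|cmp P j - cmp Q j| <= 2].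
have := @almost_orthogonal R (grid J) Z4 (undup (map (cubeix M) ks)) near
 (fun Q z => uw [seq k <- ks | cubeix M k == Q] w z * uw ls w' z) 625.
move=> /(_ _ _ _) h; under eq_bigr do rewrite {1}/uw (uu_fibers ks (cubeix M)) mulr_suml.
apply: h.
- by move=> P Q; apply: eq_forallb => j; rewrite distrC.
- move=> P _; rewrite sum1_seq (ler_nat R _ 625) -size_filter.
 pose sh (Q : Z4) : {ffun 'I_4 -> 'I_5} := [ffun j => inord (absz (cmp Q j - cmp P j + 2))].
 apply: (@leq_trans #|{ffun 'I_4 -> 'I_5}|); last by rewrite card_ffun !card_ord.
 rewrite -(size_map sh); have us : uniq (map sh [seq Q <- undup (map (cubeix M) ks) | near P Q]).
  rewrite map_inj_in_uniq ?filter_uniq ?undup_uniq // => Q Q'.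
  rewrite !mem_filter => /andP[/forallP hQ _] /andP[/forallP hQ' _] e.
  apply: cmp_inj => j; have := congr1 (fun f : {ffun 'I_4 -> 'I_5} => f j : nat) e.
  rewrite /sh !ffunE; move: (hQ j) (hQ' j); move: (cmp P j) (cmp Q j) (cmp Q' j) => x y y' h h'.
  by rewrite !inordK; lia.
 by rewrite -(card_uniqP us) max_card.
move=> P Q _ _ nPQ; have [j hj] : exists j, ~~ (`|cmp P j - cmp Q j| <= 2).
 by move: nPQ; rewrite negb_forall => /existsP.
rewrite sum_gridE big1 // => a _.
transitivity (\sum_(x : V J) \sum_(k <- [seq k <- ks | cubeix M k == P])
  \sum_(k' <- [seq k <- ks | cubeix M k == Q]) \sum_(l <- ls) \sum_(l' <- ls)
   w a k * w' a l * (((w a k')^*)%C * ((w' a l')^*)%C) *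
   (ez (ph (zk J k) (a, x)) * ez (ph (zk J l) (a, x)) *
   ((ez (ph (zk J k') (a, x)) * ez (ph (zk J l') (a, x)))^*)%C)).
 apply: eq_bigr => x _; rewrite conjM /uw /uu !conj_sum sum4.
 apply: eq_bigr => k _; apply: eq_bigr => k' _; apply: eq_bigr => l _.
 apply: eq_bigr => l' _; rewrite !conjM /tm /=; ring.
rewrite exchange_big /= big1_seq // => k /andP[_]; rewrite mem_filter => /andP[/eqP ki kk].
rewrite exchange_big /= big1_seq // => k' /andP[_]; rewrite mem_filter => /andP[/eqP ki' kk'].
rewrite exchange_big /= big1_seq // => l /andP[_ ll].
rewrite exchange_big /= big1_seq // => l' /andP[_ ll'].
rewrite -mulr_sumr sumV_ez2 ?mulr0 //; exists j; split; first exact: hJ.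
have := hl _ ll j; have := hl _ ll' j; have := divz_bd (cmp k j) M0.
have := divz_bd (cmp k' j) M0; rewrite -!cmp_cubeix ki ki'; move: hj; rewrite -ltNge.
move: (cmp _ _) (cmp _ _) (cmp _ _) (cmp _ _) (cmp _ _) (cmp _ _) M0; clear.
move=> p q lj l'j kj k'j M0 h1 h2 h3 h4 h5; apply/eqP => e.
have [pq|pq] := leP q p; nia.
Qed.

End DyadicPairs.

(** Geometric mean of the two bounds with weights 5/7 and 2/7. The first still leaves more than one
    power of t. As x is a squared norm, the second, linear in th, contributes the power 1/7 of the
    time length to the norm itself. *)
Lemma interp7 (R : realType) (x P h th q t K : R) :
 0 <= x -> 0 <= P -> 0 <= h -> 0 <= th -> 0 <= q -> 1 <= t -> 0 <= K ->
 x <= K * P / t ^+ 2 -> x <= K * th * q * P -> th ^+ 2 * q ^+ 2 <= h ^+ 14 ->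
 x <= K * h ^+ 2 * P / t.
Proof.
move=> x0 P0 h0 th0 q0 t1 K0 A B H; have tp : 0 < t by lra.
have r0 : 0 <= K * h ^+ 2 * P / t by rewrite !mulr_ge0 ?invr_ge0 ?(ltW tp).
rewrite -(@ler_pXn2r _ 7) ?qualifE /= //.
apply: (le_via ((K * th * q * P) ^+ 2 * (K * P / t ^+ 2) ^+ 5)).
 rewrite (_ : x ^+ 7 = x ^+ 2 * x ^+ 5); last by rewrite -exprD.
 by apply: ler_pM; rewrite ?exprn_ge0 // lerXn2r ?qualifE /= // ?(le_trans x0 A) ?(le_trans x0 B).
rewrite [leLHS](_ : _ = K ^+ 7 * P ^+ 7 * (th ^+ 2 * q ^+ 2) / t ^+ 10); last by field; lra.
rewrite [leRHS](_ : _ = K ^+ 7 * P ^+ 7 * h ^+ 14 / t ^+ 7); last by field; lra.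
have KP : 0 <= K ^+ 7 * P ^+ 7 by apply: mulr_ge0; exact: exprn_ge0.
apply: ler_pM.
- by apply: mulr_ge0 => //; apply: mulr_ge0; exact: exprn_ge0.
- by rewrite invr_ge0 exprn_ge0 // ltW.
- by rewrite ler_wpM2l.
- by rewrite lef_pV2 ?posrE ?exprn_gt0 // ler_weXn2l.
Qed.

(** * Bilinear bounds for two dyadic levels *)

Section PairBound.
Context {R : realType}.
Variable J : nat.
Hypothesis J1 : (1 < J)%N.

(** The higher frequencies are localised to cubes as large as the lower ones. When [gtau] is
    positive, the corner of such a cube has size about 2^n, far beyond its side, which is the
    separation [bilinear_free] requires. *)
Lemma cube_bilinear (n m : nat) ks ls (w w' : nat -> Z4 -> R[i]) (a a' : Z4 -> R) :
 (m <= n)%N -> good (2 ^ (30 + 2 * n)) J -> uniq ks -> uniq ls ->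
 (forall k, k \in ks -> lev k = n) -> (forall l, l \in ls -> lev l = m) ->
 (forall k, sctl (w^~ k) (a k)) -> (forall k, sctl (w'^~ k) (a' k)) ->
 \sum_(z : grid J) cabs (uw ks w z * uw ls w' z) ^+ 2 <=
  2 ^+ 77 * 4 ^+ m * J%:R ^+ 5 / 2 ^+ gtau n m *
  (\sum_(k <- ks) a k ^+ 2) * (\sum_(k <- ls) a' k ^+ 2).
Proof.
move=> mn gJ uks uls lk ll hw hw'.
set M := (2 ^ m.+1)%N; have M0 : (0 < M)%N by rewrite expn_gt0.
have supk k : k \in ks -> (sup4 k < 2 ^ n.+1)%N by move=> /lk <-; exact: sup4_lt_lev.
have supl l : l \in ls -> (sup4 l < M)%N.
 by move=> h; have := sup4_lt_lev l; rewrite (ll _ h).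
have Mn : (M <= 2 ^ n.+1)%N by rewrite leq_exp2l.
have JB p : (p <= 30 + 2 * n)%N -> (2 ^ p <= J)%N.
 by move=> h; apply: leq_trans gJ.1; rewrite leq_exp2l.
have J4 : (4 * 2 ^ n.+1 <= J)%N.
 have -> : (4 * 2 ^ n.+1 = 2 ^ (2 + n.+1))%N by rewrite expnD.
 by apply: JB; clear; lia.
have hl l j : l \in ls -> `|cmp l j| <= M%:Z.
 by move=> /supl h; have := cmp_le_sup l j; lia.
apply: le_trans (cube_orth J1 w w' M0 _ (fun l ll' j => hl l j ll')) _.
 move=> k l k' l' /supk hk hl1 /supk hk' hl2 j.
 have := cmp_le_sup k j; have := cmp_le_sup k' j; have := hl _ j hl1; have := hl _ j hl2.
 move: (cmp _ _) (cmp _ _) (cmp _ _) (cmp _ _) => *; lia.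
set tau := gtau n m; set S' := \sum_(k <- ls) a' k ^+ 2.
pose B : R := 2 ^+ 23 * 4 ^+ m.+1 * J%:R ^+ 5.
have B0 : 0 <= B by rewrite !mulr_ge0 ?exprn_ge0.
have J50 : 0 <= (J%:R : R) ^+ 5 by rewrite exprn_ge0.
have s0 (T : seq Z4) (c : Z4 -> R) : 0 <= \sum_(k <- T) c k ^+ 2.
 exact: sumsq_ge0.
have f4ls : free4 (R := R) J ls B.
 move=> f; have := @strong_L4 R (m.+1 + 2) J (z4c (- M%:Z)) ls.
 move=> /(_ ltac:(lia) _ uls _ f) h; apply: (le_trans (h _ _)).
 - apply: good_le gJ; rewrite (_ : 4 * 4 ^ (m.+1 + 2) = 2 ^ (2 + 2 * (m.+1 + 2)))%N.
   by rewrite leq_exp2l //; move: mn; clear; lia.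
  by rewrite (expnD 2 2) expnM.
 - by move=> l lls j; rewrite cmp_z4c; have := hl _ j lls; rewrite expnD -/M; move: M0; clear; lia.
 - rewrite ler_wpM2r ?sqr_ge0 // /B ler_wpM2r // exprD mulrCA mulrC ler_wpM2r ?exprn_ge0 //.
  by lra.
have key Q : Q \in undup (map (cubeix M) ks) ->
  \sum_(z : grid J) cabs (uw [seq k <- ks | cubeix M k == Q] w z * uw ls w' z) ^+ 2 <=
  2 ^+ 42 * B / 2 ^+ tau * (\sum_(k <- [seq k <- ks | cubeix M k == Q]) a k ^+ 2) * S'.
 rewrite mem_undup => /mapP[k0 k0s QE].
 set kQ := [seq k <- ks | _].
 have kQs k : k \in kQ -> cubeix M k = Q /\ k \in ks by rewrite mem_filter => /andP[/eqP].
 have cubeQ k : k \in kQ -> in_cube (z4s M%:Z Q) M k.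
  move=> /kQs[<- _] j; rewrite cmp_z4s cmp_cubeix mulrC.
  exact: divz_bd.
 have f4 : free4 (R := R) J kQ B.
  move=> f; have := @strong_L4 R m.+1 J (z4s M%:Z Q) kQ.
  move=> /(_ ltac:(lia) _ (filter_uniq _ uks) cubeQ f) h; apply: (le_trans (h _)).
   apply: good_le gJ; rewrite (_ : 4 * 4 ^ m.+1 = 2 ^ (2 + 2 * m.+1))%N.
    by rewrite leq_exp2l //; move: mn; clear; lia.
   by rewrite expnD expnM.
  rewrite ler_wpM2r ?sqr_ge0 // /B ler_wpM2r // ler_wpM2r ?exprn_ge0 //; lra.
 have f22 : free22 (R := R) J kQ ls (B / 2 ^+ (6 * tau)) \/ tau = 0%N.
  have [t0|tp] := posnP tau; [by right|left].
  have t1 : (96 * tau <= n - m - 4)%N.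
   have : (tau <= (n - m - 4) %/ 96)%N by rewrite /tau /gtau geq_minl.
   by rewrite leq_divRL // mulnC.
  have t2 : (192 * tau <= m + 3)%N.
   have : (tau <= (m + 3) %/ 192)%N by rewrite /tau /gtau geq_minr.
   by rewrite leq_divRL // mulnC.
  have [j0 j0E] := sup4_ex (z4s M%:Z Q).
  have cC j : (`|cmp (z4s M%:Z Q) j| <= `|cmp (z4s M%:Z Q) j0|)%N.
   by rewrite -j0E cmp_le_sup.
  have QM j : `|M%:Z * cmp Q j - cmp k0 j| <= M%:Z.
   by rewrite QE cmp_cubeix mulrC; have := divz_bd (cmp k0 j) M0; lia.
  (* Some coordinate of k0 is at least 2^n, and passing to the corner of its cube moves it by at
     most M <= 2^(n-1). *)
  have Clow : (2 ^ n.-1 <= `|cmp (z4s M%:Z Q) j0|)%N.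
   have [j1 j1E] := sup4_ex k0.
   have h1 : (2 ^ n <= sup4 k0)%N by rewrite -(lk _ k0s) lev_sup4 // lk //; lia.
   have h2 := cC j1; have := QM j1; rewrite cmp_z4s in h2.
   have h3 : (M <= 2 ^ n.-1)%N by rewrite leq_exp2l //; lia.
   have h4 : (2 ^ n = 2 ^ n.-1 + 2 ^ n.-1)%N by rewrite addnn -mul2n -expnS prednK //; lia.
   rewrite j1E in h1; move: h1 h2 h3 h4; clear.
   move: (absz (cmp (z4s _ _) _)) (cmp k0 j1) (M%:Z * cmp Q j1) (2 ^ n)%N (2 ^ n.-1)%N => *; lia.
  have Chigh : (`|cmp (z4s M%:Z Q) j0| <= 2 ^ n.+2)%N.
   rewrite cmp_z4s; have := QM j0; have := supk _ k0s; have := cmp_le_sup k0 j0.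
   have : (2 ^ n.+2 = 2 * 2 ^ n.+1)%N by rewrite -expnS.
   by move: Mn; clear; lia.
  have h : forall f g : Z4 -> R[i], \sum_(z : grid J) cabs (uu kQ f z * uu ls g z) ^+ 2 <=
    2 ^+ 23 * 4 ^+ m.+1 / 2 ^+ (6 * tau) * J%:R ^+ 5 * (\sum_(k <- kQ) cabs (f k) ^+ 2) *
    (\sum_(l <- ls) cabs (g l) ^+ 2).
   move=> f g; apply: (@bilinear_free R m.+1 (6 * tau) J (z4s M%:Z Q) j0) => //.
   - by move: t2; clear; lia.
   - apply: good_le gJ; rewrite (_ : 2 ^ 17 * 4 ^ m.+1 = 2 ^ (17 + 2 * m.+1))%N.
     by rewrite leq_exp2l //; move: mn; clear; lia.
    by rewrite expnD expnM.
   - apply: leq_trans Clow.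
    rewrite (_ : 4 * 2 ^ (16 * (6 * tau)) * 2 ^ m.+1 = 2 ^ (2 + 96 * tau + m.+1))%N.
     by rewrite leq_exp2l //; move: t1 tp; clear; lia.
    by rewrite (mulnA 16) -[4%N]/(2 ^ 2)%N -!expnD.
   - apply: (@leq_ltn_trans (16 * 2 ^ n.+2 * 2 ^ m.+1)%N).
     by rewrite leq_mul2r leq_mul2l Chigh !orbT.
    apply: (@leq_trans (2 ^ (4 + n.+2 + m.+1).+1)%N).
     by rewrite (_ : 16 * 2 ^ n.+2 * 2 ^ m.+1 = 2 ^ (4 + n.+2 + m.+1))%N ?ltn_exp2l ?expnD.
    by apply: JB; move: mn; clear; lia.
   - exact: filter_uniq.
   - by move=> l lls j; exact: hl.
  move=> f g; apply: (le_trans (h f g)); apply: le_of_eq.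
  by rewrite /B; ring.
 have vQ := vctl_scalar kQ hw; have vl := vctl_scalar ls hw'.
 apply: (le_trans (transfer22 J1 f4 f4ls f22 B0 vQ vl)).
 rewrite !sqr_sqrtr //; apply: le_of_eq.
 by rewrite -/S'; ring.
apply: (le_via (625 * \sum_(Q <- undup (map (cubeix M) ks))
  2 ^+ 42 * B / 2 ^+ tau * (\sum_(k <- [seq k <- ks | cubeix M k == Q]) a k ^+ 2) * S')).
 rewrite ler_wpM2l ?ler0n // big_seq [leRHS]big_seq; apply: ler_sum => Q; exact: key.
rewrite -mulr_suml -mulr_sumr -(sum_fibers ks (cubeix M) (fun k => a k ^+ 2)).
set S := \sum_(k <- ks) _.
have X0 : 0 <= 4 ^+ m * J%:R ^+ 5 / 2 ^+ tau * S * S'.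
 by rewrite !mulr_ge0 ?invr_ge0 ?exprn_ge0 ?s0.
rewrite [leLHS](_ : _ = 625 * 2 ^+ 67 * (4 ^+ m * J%:R ^+ 5 / 2 ^+ tau * S * S')); last first.
 by rewrite /B [4 ^+ m.+1]exprS; ring.
rewrite [leRHS](_ : _ = 2 ^+ 77 * (4 ^+ m * J%:R ^+ 5 / 2 ^+ tau * S * S')); last by ring.
by rewrite ler_wpM2r //; lra.
Qed.

(** The trivial bound on a short time interval: the low factor in sup norm by Cauchy-Schwarz over
    its frequencies, the other in L^2 at each of the L times. *)
Lemma time_bilinear (m L : nat) ks ls (w w' : nat -> Z4 -> R[i]) (a a' : Z4 -> R) :
 uniq (map (zk J) ks) -> uniq ls -> (forall l, l \in ls -> lev l = m) ->
 (forall t, \sum_(k <- ks) cabs (w t k) ^+ 2 <= \sum_(k <- ks) a k ^+ 2) ->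
 (forall t, \sum_(k <- ls) cabs (w' t k) ^+ 2 <= \sum_(k <- ls) a' k ^+ 2) ->
 \sum_(z : grid J | (tm z < L)%N) cabs (uw ks w z * uw ls w' z) ^+ 2 <=
  L%:R * 2 ^+ 8 * 16 ^+ m * J%:R ^+ 4 *
  (\sum_(k <- ks) a k ^+ 2) * (\sum_(k <- ls) a' k ^+ 2).
Proof.
move=> uks uls ll hw hw'.
set S := \sum_(k <- ks) _; set S' := \sum_(k <- ls) _.
have S0 : 0 <= S by exact: sumsq_ge0.
have S0' : 0 <= S' by exact: sumsq_ge0.
have szl : (size ls)%:R <= 2 ^+ 8 * 16 ^+ m :> R.
 have h : (size ls <= 16 ^ (m.+1 + 1))%N.
  apply: (@size_cube (m.+1 + 1) (z4c (- (2 ^ m.+1)%:Z))) => //.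
  move=> l lls j; rewrite cmp_z4c; have := sup4_lt_lev l; have := cmp_le_sup l j.
  by rewrite (ll _ lls) expnD; lia.
 have : (size ls)%:R <= (16 ^ (m.+1 + 1))%N%:R :> R by rewrite ler_nat.
 rewrite natrX addn1 !exprS; move: (16 ^+ m) => X; lra.
rewrite big_mkcond /=.
have -> : \sum_(z : grid J) (if (tm z < L)%N then cabs (uw ks w z * uw ls w' z) ^+ 2 else 0) =
 \sum_(a0 : 'Z_J) \sum_(x : V J) (if ((a0 : nat) < L)%N then
   cabs (uu ks (w a0) (a0, x) * uu ls (w' a0) (a0, x)) ^+ 2 else 0).
 by rewrite pair_bigA /=; apply: eq_bigr => -[].
apply: (le_via (\sum_(a0 : 'Z_J) (if ((a0 : nat) < L)%N then
  2 ^+ 8 * 16 ^+ m * S' * (J%:R ^+ 4 * S) else 0))).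
 apply: ler_sum => a0 _; case: ifP => _; last by rewrite big1.
 apply: (le_via (\sum_(x : V J) (2 ^+ 8 * 16 ^+ m * S') * cabs (uu ks (w a0) (a0, x)) ^+ 2)).
  apply: ler_sum => x _; rewrite cabsM exprMn mulrC ler_wpM2r ?sqr_ge0 //.
  apply: (le_trans (sup_uu _ _ _)); apply: ler_pM => //.
  exact: sumsq_ge0.
 rewrite -mulr_sumr ler_wpM2l ?mulr_ge0 ?exprn_ge0 //.
 by apply: (le_trans (bessel_time _ _ J1 uks)); rewrite ler_wpM2l ?exprn_ge0.
rewrite -big_mkcond /= sumr_const.
have h : (#|[pred i : 'Z_J | (i < L)%N]| <= L)%N.
 rewrite cardE -(size_map (@nat_of_ord _)) -[leqRHS](size_iota 0).
 apply: uniq_leq_size; first by rewrite map_inj_uniq ?enum_uniq //; exact: val_inj.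
 by move=> x /mapP[j]; rewrite mem_enum inE mem_iota => hj ->.
rewrite -[leLHS]mulr_natl.
apply: (le_via (L%:R * (2 ^+ 8 * 16 ^+ m * S' * (J%:R ^+ 4 * S)))).
 by rewrite ler_wpM2r ?ler_nat // !mulr_ge0 ?exprn_ge0.
by apply: le_of_eq; ring.
Qed.

(** Only a quarter of [gtau] is kept, so that the square of 4^(gtau/4) is still at most 2^gtau; the
    excess is what [interp7] consumes in the second alternative for [h]. *)
Lemma pair_bound (n m L : nat) ks ls (w w' : nat -> Z4 -> R[i]) (a a' : Z4 -> R) (h : R) :
 (m <= n)%N -> good (2 ^ (30 + 2 * n)) J -> uniq ks -> uniq ls ->
 (forall k, k \in ks -> lev k = n) -> (forall l, l \in ls -> lev l = m) ->
 (forall k, sctl (w^~ k) (a k)) -> (forall k, sctl (w'^~ k) (a' k)) ->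
 0 <= h -> 1 <= h \/ (L%:R / J%:R) ^+ 2 * 16 ^+ m <= h ^+ 14 ->
 \sum_(z : grid J | (tm z < L)%N) cabs (uw ks w z * uw ls w' z) ^+ 2 <=
  2 ^+ 80 * h ^+ 2 * 4 ^+ m * J%:R ^+ 5 / 4 ^+ (gtau n m %/ 4) *
  (\sum_(k <- ks) a k ^+ 2) * (\sum_(k <- ls) a' k ^+ 2).
Proof.
move=> mn gJ uks uls lk ll hw hw' h0 hh.
have A := cube_bilinear mn gJ uks uls lk ll hw hw'.
have Jp : 0 < (J%:R : R) by rewrite ltr0n; lia.
have uz : uniq (map (zk J) ks).
 apply: (@uniq_zk _ (z4c (- (2 ^ n.+1)%:Z)) (2 ^ (n.+1 + 1))) => //.
  by apply: leq_trans gJ.1; rewrite leq_exp2l //; lia.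
 move=> k kks j; rewrite cmp_z4c; have := sup4_lt_lev k; have := cmp_le_sup k j.
 by rewrite (lk _ kks) expnD; lia.
have vS (rs : seq Z4) (v : nat -> Z4 -> R[i]) (b : Z4 -> R) t : (forall k, sctl (v^~ k) (b k)) ->
  \sum_(k <- rs) cabs (v t k) ^+ 2 <= \sum_(k <- rs) b k ^+ 2.
 move=> hv; apply: ler_sum => k _; have [b0 [om [_ _ _ hb]]] := hv k.
 by rewrite ler_sqr ?qualifE /= ?cabs_ge0.
have B := @time_bilinear m L ks ls w w' a a' uz uls ll (fun t => vS _ _ _ t hw) (fun t => vS _ _ _ t hw').
set S := \sum_(k <- ks) _ in A B *; set S' := \sum_(k <- ls) _ in A B *.
have S0 : 0 <= S by exact: sumsq_ge0.
have S0' : 0 <= S' by exact: sumsq_ge0.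
set x := \sum_(z | _) _ in B *.
have {A} A : x <= 2 ^+ 77 * 4 ^+ m * J%:R ^+ 5 / 2 ^+ gtau n m * S * S'.
 apply: le_trans A; rewrite /x big_mkcond /=; apply: ler_sum => z _.
 by case: ifP => _ //; exact: sqr_ge0.
have x0 : 0 <= x by exact: sumsq_ge0.
set g := gtau n m in A *; set g4 := (g %/ 4)%N.
have g44 : (4 * g4 <= g)%N by rewrite mulnC leq_trunc_div.
have two_g : (4 ^+ g4) ^+ 2 <= 2 ^+ g :> R.
 have -> : 4 ^+ g4 = 2 ^+ (2 * g4) :> R by rewrite exprM; congr (_ ^+ _); lra.
 by rewrite -exprM ler_eXn2l ?ltr1n //; move: g44; clear; lia.
pose t : R := 4 ^+ g4.
have t1 : 1 <= t by rewrite exprn_ege1 // ler1n.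
have tp : 0 < t by lra.
have P0 : 0 <= 4 ^+ m * J%:R ^+ 5 * S * S' by rewrite !mulr_ge0 ?exprn_ge0.
have A' : x <= 2 ^+ 77 * (4 ^+ m * J%:R ^+ 5 * S * S') / t ^+ 2.
 apply: (le_trans A); rewrite [leLHS](_ : _ = 2 ^+ 77 * (4 ^+ m * J%:R ^+ 5 * S * S') / 2 ^+ g).
  rewrite ler_wpM2l ?mulr_ge0 ?exprn_ge0 //.
  by rewrite lef_pV2 ?posrE ?exprn_gt0.
 by ring.
rewrite [leRHS](_ : _ = 2 ^+ 80 * h ^+ 2 * (4 ^+ m * J%:R ^+ 5 * S * S') / t); last by rewrite /t; ring.
case: hh => hh.
 apply: (le_trans A'); apply: ler_pM; rewrite ?mulr_ge0 ?invr_ge0 ?sqr_ge0 ?exprn_ge0 //.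
  rewrite ler_wpM2r //; have : 1 <= h ^+ 2 by rewrite exprn_ege1.
  by move: (h ^+ 2) => X; lra.
 by rewrite lef_pV2 ?posrE ?exprn_gt0 // -[leLHS]expr1 ler_weXn2l.
have B' : x <= 2 ^+ 8 * (L%:R / J%:R) * 4 ^+ m * (4 ^+ m * J%:R ^+ 5 * S * S').
 apply: (le_trans B); apply: le_of_eq.
 rewrite (_ : 16 ^+ m = 4 ^+ m * 4 ^+ m :> R); last by rewrite -exprMn; congr (_ ^+ _); lra.
 field; exact: lt0r_neq0.
set P := 4 ^+ m * J%:R ^+ 5 * S * S' in P0 A' B' *.
set th := L%:R / J%:R in hh B'.
have th0 : 0 <= th by rewrite divr_ge0.
have le80 k : (k <= 80)%N -> 2 ^+ k <= 2 ^+ 80 :> R by move=> h80; rewrite ler_eXn2l ?ltr1n.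
apply: (@interp7 R x P h th (4 ^+ m) t (2 ^+ 80)) => //.
- apply: (le_trans A'); rewrite ler_wpM2r ?invr_ge0 ?sqr_ge0 // ler_wpM2r // le80 //.
- apply: (le_trans B'); rewrite ler_wpM2r // ler_wpM2r ?exprn_ge0 // ler_wpM2r // le80 //.
- by rewrite (_ : (4 ^+ m) ^+ 2 = 16 ^+ m :> R) // exprAC; congr (_ ^+ _); lra.
Qed.

End PairBound.

(** * The dyadic sum over four frequencies *)

Section GainSums.
Context {R : realType}.

(** The square root of the factor gained in [pair_bound]. *)
Definition gain (n m : nat) : R := (2 ^+ (gtau n m %/ 4))^-1.

Lemma gain_ge0 n m : 0 <= gain n m. Proof. by rewrite invr_ge0 exprn_ge0. Qed.

Lemma sum_pow_div D N : (0 < D)%N ->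
 \sum_(0 <= j < N) (2 ^+ (j %/ D))^-1 <= 2 * D%:R :> R.
Proof.
move=> D0; have p j : 0 <= (2 ^+ (j %/ D))^-1 :> R by rewrite invr_ge0 exprn_ge0.
apply: (le_via (\sum_(0 <= j < D * N) (2 ^+ (j %/ D))^-1)).
 rewrite [leRHS](@big_cat_nat _ _ _ N) //=; last by rewrite leq_pmull.
 by rewrite lerDl; apply: sumr_ge0.
have e K : \sum_(0 <= j < D * K) (2 ^+ (j %/ D))^-1 = D%:R * \sum_(0 <= i < K) (2 ^+ i)^-1 :> R.
 elim: K => [|K ih]; first by rewrite muln0 !big_geq // mulr0.
 rewrite (@big_cat_nat _ _ _ (D * K)) //=; last by rewrite leq_mul2l leqnSn orbT.
 rewrite ih big_nat_recr //= mulrDr; congr (_ + _).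
 rewrite big_nat_cond (eq_bigr (fun=> (2 ^+ K)^-1)) => [|j /andP[/andP[j1 j2] _]].
  by rewrite -big_nat_cond sumr_const_nat mulnS addnK -[LHS]mulr_natl.
 congr (2 ^+ _)^-1; apply/eqP; rewrite eqn_leq -ltnS ltn_divLR // leq_divRL //.
 by rewrite mulnC [in X in _ && X]mulnC j2 j1.
by rewrite e mulrC ler_wpM2r // sum_geo_le2.
Qed.

(** 384 and 768 are four times the denominators in [gtau]; the gain is bounded by a geometric term
    in n - m plus one in m, and both are summable with a bound independent of n. *)
Lemma gain_sum n N : (n < N)%N -> \sum_(0 <= m < N | (m <= n)%N) gain n m <= 2 ^+ 12.
Proof.
move=> nN.
have gb m : gain n m <= (2 ^+ ((n - m - 4) %/ 384))^-1 + (2 ^+ ((m + 3) %/ 768))^-1.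
 have p k : 0 <= (2 ^+ k)^-1 :> R by rewrite invr_ge0 exprn_ge0.
 rewrite /gain /gtau; case: leqP => _.
  by rewrite -divnMA lerDl.
 by rewrite -divnMA lerDr.
have m2 k k' : (k' <= k)%N -> (2 ^+ k)^-1 <= (2 ^+ k')^-1 :> R.
 by move=> h; rewrite lef_pV2 ?posrE ?exprn_gt0 // ler_eXn2l ?ltr1n.
apply: (le_via (\sum_(0 <= m < N | (m <= n)%N) (2 * (2 ^+ ((n - m) %/ 384))^-1 +
  (2 ^+ (m %/ 768))^-1))).
 apply: ler_sum => m mn; apply: (le_trans (gb m)); apply: lerD; last first.
  by apply: m2; apply: leq_div2r; lia.
 apply: (le_via ((2 ^+ ((n - m) %/ 384 - 1))^-1)).
  apply: m2; rewrite leq_divRL // mulnBl; have := leq_trunc_div (n - m) 384; lia.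
 case: ((n - m) %/ 384)%N => [|k]; first by rewrite expr0 invr1; lra.
 rewrite subSS subn0 exprS invfM mulrA divff ?mul1r //; lra.
rewrite big_split /= -mulr_sumr.
have s1 : \sum_(0 <= m < N | (m <= n)%N) (2 ^+ ((n - m) %/ 384))^-1 <= 2 * 384%:R :> R.
 apply: le_trans (sum_pow_div n.+1 (isT : 0 < 384)%N).
 rewrite [leRHS]big_nat_rev /= add0n [leLHS]big_mkcond /=.
 rewrite [leLHS](@big_cat_nat _ _ _ n.+1) //= [X in _ + X]big_nat_cond.
 rewrite [X in _ + X]big1 ?addr0 => [|m /andP[/andP[m1 m2'] _]]; last by rewrite leqNgt m1.
 rewrite big_nat_cond [leRHS]big_nat_cond; apply: ler_sum => m /andP[/andP[_ m1] _].
 by rewrite -ltnS m1 subSS.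
have s2 : \sum_(0 <= m < N | (m <= n)%N) (2 ^+ (m %/ 768))^-1 <= 2 * 768%:R :> R.
 apply: le_trans (sum_pow_div N (isT : 0 < 768)%N).
 by rewrite big_mkcond /=; apply: ler_sum => m _; case: ifP.
apply: (le_via (2 * (2 * 384%:R) + 2 * 768%:R)); last by rewrite !exprS expr0; lra.
by apply: lerD => //; rewrite ler_wpM2l.
Qed.

End GainSums.

(** * Vanishing when one frequency dominates *)

Section Vanishing.
Context {R : realType}.
Variable J : nat.
Hypothesis J1 : (1 < J)%N.

Definition xspec (n : nat) (F : V J -> R[i]) : Prop :=
 exists (r : seq Z4) (c : Z4 -> R[i]), (forall k, k \in r -> lev k = n) /\
  forall x, F x = \sum_(k <- r) c k * ez (dv (zk J k) x).

Lemma zk_opp k : zk J (z4s (-1) k) = - zk J k.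
Proof. by apply/ffunP => j; rewrite !ffunE cmp_z4s mulN1r rmorphN. Qed.

Lemma lev_opp k : lev (z4s (-1) k) = lev k.
Proof. by congr trunc_log; apply: eq_bigr => j _; rewrite cmp_z4s mulN1r abszN. Qed.

Lemma z4sK : involutive (z4s (-1)).
Proof. by move=> k; apply: cmp_inj => j; rewrite !cmp_z4s !mulN1r opprK. Qed.

Lemma xspec_uu n ks (w : Z4 -> R[i]) (a : 'Z_J) :
 xspec n (fun x => uu [seq k <- ks | lev k == n] w (a, x)).
Proof.
exists [seq k <- ks | lev k == n], (fun k => w k * ez (- (dv (zk J k) (zk J k) * a))); split.
 by move=> k; rewrite mem_filter => /andP[/eqP].
by move=> x; apply: eq_bigr => k _; rewrite /ph /= ezD // [ez (dv _ _) * _]mulrC mulrA.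
Qed.

Lemma xspec_conj n F : xspec n F -> xspec n (fun x => ((F x)^*)%C).
Proof.
move=> [r [c [hr hF]]]; exists (map (z4s (-1)) r), (fun k => ((c (z4s (-1) k))^*)%C); split.
 by move=> k /mapP[k' kr ->]; rewrite lev_opp hr.
move=> x; rewrite hF conj_sum big_map; apply: eq_bigr => k _.
by rewrite conjM z4sK zk_opp dvNl ezN.
Qed.

(** Some coordinate of the top frequency is at least 2^n1, which is at least 4 * 2^(n2+1), while the
    three others stay below 2^(n2+1) each; so the sum is not 0, and J is large enough that it is not
    0 modulo J either. *)
Lemma xspec_vanish n1 n2 n3 n4 F1 F2 F3 F4 :
 xspec n1 F1 -> xspec n2 F2 -> xspec n3 F3 -> xspec n4 F4 ->
 (n2 + 3 <= n1)%N -> (n3 <= n2)%N -> (n4 <= n2)%N -> (2 ^ (n1 + 3) <= J)%N ->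
 \sum_x F1 x * F2 x * (F3 x * F4 x) = 0.
Proof.
move=> [r1 [c1 [h1 e1]]] [r2 [c2 [h2 e2]]] [r3 [c3 [h3 e3]]] [r4 [c4 [h4 e4]]] n12 n23 n24 nJ.
under eq_bigr do rewrite e1 e2 e3 e4 sum4.
rewrite exchange_big /= big1_seq // => k1 /andP[_ k1r].
rewrite exchange_big /= big1_seq // => k3 /andP[_ k3r].
rewrite exchange_big /= big1_seq // => k2 /andP[_ k2r].
rewrite exchange_big /= big1_seq // => k4 /andP[_ k4r].
rewrite (eq_bigr (fun x => c1 k1 * c2 k2 * c3 k3 * c4 k4 *
  ez (dv (zk J k1 + zk J k2 + zk J k3 + zk J k4) x))); last first.
 move=> x _; rewrite !dvDl !ezD //; ring.
rewrite -mulr_sumr sum_ez_dv //; case: eqP => [e|_]; last by rewrite mulr0.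
exfalso; have [j jE] := sup4_ex k1.
have := congr1 (fun x : V J => x j) e; rewrite !ffunE -!intrD => ej.
have b (k : Z4) (n : nat) (r : seq Z4) : (forall k, k \in r -> lev k = n) -> k \in r -> (n <= n2)%N ->
  (`|cmp k j| < 2 ^ n2.+1)%N.
 move=> hr kr nn; apply: leq_ltn_trans (cmp_le_sup k j) _.
 apply: leq_trans (sup4_lt_lev k) _; rewrite (hr _ kr) leq_exp2l //.
have b2 := b _ _ _ h2 k2r (leqnn _); have b3 := b _ _ _ h3 k3r n23.
have b4 := b _ _ _ h4 k4r n24.
have l1 : (2 ^ n1 <= `|cmp k1 j|)%N.
 by rewrite -jE -(h1 _ k1r) lev_sup4 // (h1 _ k1r); lia.
have u1 : (`|cmp k1 j| < 2 ^ n1.+1)%N.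
 by rewrite -jE -(h1 _ k1r) sup4_lt_lev.
have p1 : (4 * 2 ^ n2.+1 <= 2 ^ n1)%N.
 by rewrite (_ : 4 * 2 ^ n2.+1 = 2 ^ (2 + n2.+1))%N ?expnD // -expnD leq_exp2l //; lia.
have p2 : (2 ^ n1.+1 = 2 * 2 ^ n1)%N by rewrite expnS.
have p3 : (2 ^ (n1 + 3) = 2 ^ n1 * 8)%N by rewrite expnD.
have : cmp k1 j + cmp k2 j + cmp k3 j + cmp k4 j = 0.
 apply: (intZ_eq J1); first by rewrite ej.
 rewrite subr0.
 move: b2 b3 b4 u1 p1 p2 p3 nJ; clear; move: (2 ^ n1)%N (2 ^ n2.+1)%N => X Y; lia.
move: b2 b3 b4 l1 p1; clear; move: (2 ^ n1)%N (2 ^ n2.+1)%N => X Y; lia.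
Qed.

End Vanishing.

(** * Summation over quadruples of levels *)

Section SumOverQuadruples.
Context {R : realType}.

Lemma sorting_perm N (n : {ffun 'I_4 -> 'I_N}) : exists s : {perm 'I_4},
 [/\ (n (s o1) <= n (s o0))%N,
   (n (s o2) <= n (s o1))%N &
   (n (s o3) <= n (s o2))%N].
Proof.
pose t := [tuple (n i : nat) | i < 4]; pose r := sort geq t.
have szr : size r == 4 by rewrite size_sort size_tuple.
have /tuple_permP[s sE] : perm_eq (Tuple szr) t by rewrite /= perm_sort.
have so : sorted geq r.
 by apply: sort_sorted => x y; rewrite /geq /=; exact: leq_total.
exists s.
have nE i : nth 0%N r (val i) = n (s i).
 have := congr1 (fun q => nth 0%N q (val i)) sE => /= ->.
 rewrite (nth_map i) ?size_enum_ord // nth_ord_enum tnth_mktuple //.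
have tr : transitive geq by move=> x y z; rewrite /geq /= => h1 h2; exact: leq_trans h2 h1.
have h i j : (i < j < 4)%N -> (nth 0%N r j <= nth 0%N r i)%N.
 move=> /andP[ij j4]; apply: (sorted_ltn_nth tr 0%N so) => //; rewrite inE (eqP szr) //.
 exact: ltn_trans ij j4.
by rewrite -!nE /=; split; apply: h.
Qed.

Lemma sum_ffun4 N (s : {perm 'I_4}) (F : 'I_N -> 'I_N -> 'I_N -> 'I_N -> R) :
 \sum_(n : {ffun 'I_4 -> 'I_N}) F (n (s o0)) (n (s o1))
  (n (s o2)) (n (s o3)) =
 \sum_a \sum_b \sum_c \sum_d F a b c d.
Proof.
pose mk (p : 'I_N * ('I_N * ('I_N * 'I_N))) : {ffun 'I_4 -> 'I_N} :=
 [ffun i => tnth [tuple p.1; p.2.1; p.2.2.1; p.2.2.2] ((s^-1)%g i)].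
pose un (n : {ffun 'I_4 -> 'I_N}) := (n (s o0), (n (s o1),
  (n (s o2), n (s o3)))).
rewrite (reindex mk); last first.
 exists un => [p _|n _].
  case: p => a [b [c d]]; rewrite /un /mk !ffunE !permK.
  by rewrite !(tnth_nth a) /=.
 apply/ffunP => i; rewrite /mk ffunE -[in RHS](permKV s i).
 case: ((s^-1)%g i) => -[|[|[|[|//]]]] i4; rewrite (tnth_nth (n i)) /un /=;
  congr (n (s _)); exact: val_inj.
transitivity (\sum_(p : 'I_N * ('I_N * ('I_N * 'I_N))) F p.1 p.2.1 p.2.2.1 p.2.2.2).
 apply: eq_bigr => -[a [b [c d]]] _; rewrite /mk !ffunE !permK.
 by rewrite !(tnth_nth a) /=.
rewrite -(pair_bigA _ (fun a p => F a p.1 p.2.1 p.2.2)) /=; apply: eq_bigr => a _.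
rewrite -(pair_bigA _ (fun b p => F a b p.1 p.2)) /=; apply: eq_bigr => b _.
by rewrite -(pair_bigA _ (fun c d => F a b c d)).
Qed.

(** The two top levels differ by at most 2, so Cauchy-Schwarz uses both l^2 bounds, with 3
    neighbours for each level. The two lower levels are summed by the gains of the pairs (a, d) and
    (b, c), for which sup bounds on y3 and y4 suffice. *)
Lemma ordered_sum N (y1 y2 y3 y4 : nat -> R) (Y1 Y2 Y3 Y4 : R) :
 (forall n, 0 <= y1 n) -> (forall n, 0 <= y2 n) -> (forall n, 0 <= y3 n) -> (forall n, 0 <= y4 n) ->
 0 <= Y1 -> 0 <= Y2 -> 0 <= Y3 -> 0 <= Y4 ->
 \sum_(n < N) y1 n ^+ 2 <= Y1 ^+ 2 -> \sum_(n < N) y2 n ^+ 2 <= Y2 ^+ 2 ->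
 (forall n, (n < N)%N -> y3 n <= Y3) -> (forall n, (n < N)%N -> y4 n <= Y4) ->
 \sum_(a < N) \sum_(b < N) \sum_(c < N) \sum_(d < N)
  (if [&& (b <= a)%N, (c <= b)%N, (d <= c)%N & (a <= b + 2)%N] then
   gain (R := R) a d * gain (R := R) b c * (y1 a * y2 b * y3 c * y4 d) else 0) <=
 2 ^+ 26 * (Y1 * Y2 * Y3 * Y4).
Proof.
move=> y10 y20 y30 y40 Y10 Y20 Y30 Y40 h1 h2 h3 h4.
have [K [K0 KE]] : exists K : R, 0 <= K /\ K = 2 ^+ 12 by exists (2 ^+ 12); rewrite exprn_ge0.
pose ind (a b : nat) : R := if (b <= a)%N && (a <= b + 2)%N then 1 else 0.
have ind0 a b : 0 <= ind a b by rewrite /ind; case: ifP.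
have gs (n : nat) (Y : R) (y : nat -> R) : (n < N)%N -> 0 <= Y -> (forall m, (m < N)%N -> 0 <= y m <= Y) ->
  \sum_(m < N) (if (m <= n)%N then gain (R := R) n m * y m else 0) <= K * Y.
 move=> nN Yp hy.
 apply: (le_via ((\sum_(0 <= m < N | (m <= n)%N) gain n m) * Y)).
  rewrite big_mkord [leRHS]mulr_suml -[leLHS]big_mkcond /=; apply: ler_sum => m _.
  by rewrite ler_wpM2l ?gain_ge0 //; have /andP[] := hy m (ltn_ord m).
 by rewrite ler_wpM2r // KE gain_sum.
apply: (le_via (\sum_(a < N) \sum_(b < N) ind a b * (y1 a * y2 b) *
  ((K * Y3) * (K * Y4)))).
 apply: ler_sum => a _; apply: ler_sum => b _.
 have [/andP[ba ab]|nab] := boolP ((b <= a)%N && (a <= b + 2)%N); last first.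
  rewrite big1; first by rewrite !mulr_ge0.
  move=> c _; rewrite big1 // => d _.
  by rewrite (_ : [&& _, _, _ & _] = false) //; apply/negbTE; apply: contra nab => /and4P[-> _ _ ->].
 rewrite /ind ba ab /= mul1r.
 apply: (le_via (y1 a * y2 b * \sum_(c < N) \sum_(d < N)
   (if (c <= b)%N then gain (R := R) b c * y3 c else 0) *
   (if (d <= a)%N then gain (R := R) a d * y4 d else 0))).
  rewrite mulr_sumr; apply: ler_sum => c _; rewrite mulr_sumr; apply: ler_sum => d _.
  have p0 : 0 <= (if (c <= b)%N then gain (R := R) b c * y3 c else 0).
   by case: ifP => // _; rewrite mulr_ge0 ?gain_ge0.
  have p1 : 0 <= (if (d <= a)%N then gain (R := R) a d * y4 d else 0).
   by case: ifP => // _; rewrite mulr_ge0 ?gain_ge0.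
  case: and3P => [[cb dc _]|_]; last by rewrite !mulr_ge0.
  rewrite cb (leq_trans dc (leq_trans cb ba)); apply: le_of_eq; ring.
 rewrite ler_wpM2l ?mulr_ge0 //.
 under eq_bigr do rewrite -mulr_sumr.
 rewrite -mulr_suml; apply: ler_pM.
 - by apply: sumr_ge0 => c _; case: ifP => // _; rewrite mulr_ge0 ?gain_ge0.
 - by apply: sumr_ge0 => c _; case: ifP => // _; rewrite mulr_ge0 ?gain_ge0.
 - by apply: gs => // m mN; rewrite y30 h3.
 - by apply: gs => // m mN; rewrite y40 h4.
under eq_bigr do rewrite -mulr_suml.
rewrite -mulr_suml.
have key : \sum_(a < N) \sum_(b < N) ind a b * (y1 a * y2 b) <= 3 * (Y1 * Y2).
 set S := \sum_(a < N) _.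
 have S0 : 0 <= S by apply: sumr_ge0 => a _; apply: sumr_ge0 => b _; rewrite !mulr_ge0.
 have i1 a : \sum_(b < N) ind a b <= 3.
  rewrite -big_mkcond /= sum1_seq (ler_nat R _ 3) -size_filter.
  rewrite -(size_map (@nat_of_ord N)); apply: (@leq_trans (size (iota (a - 2) 3))); last by rewrite size_iota.
  apply: uniq_leq_size; first by rewrite map_inj_uniq ?filter_uniq ?index_enum_uniq //; exact: val_inj.
  by move=> x /mapP[j]; rewrite mem_filter => /andP[/andP[b1 b2] _] ->; rewrite mem_iota; lia.
 have i2 (b : nat) : \sum_(a < N) ind a b <= 3.
  rewrite -big_mkcond /= sum1_seq (ler_nat R _ 3) -size_filter.
  rewrite -(size_map (@nat_of_ord N)); apply: (@leq_trans (size (iota b 3))); last by rewrite size_iota.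
  apply: uniq_leq_size; first by rewrite map_inj_uniq ?filter_uniq ?index_enum_uniq //; exact: val_inj.
  by move=> x /mapP[j]; rewrite mem_filter => /andP[/andP[b1 b2] _] ->; rewrite mem_iota; lia.
 have : S ^+ 2 <= (3 * Y1 ^+ 2) * (3 * Y2 ^+ 2).
  rewrite /S pair_bigA /=.
  rewrite (eq_bigr (fun p : 'I_N * 'I_N => (ind p.1 p.2 * y1 p.1) * (ind p.1 p.2 * y2 p.2))); last first.
   by move=> p _; rewrite /ind; case: ifP => _; ring.
  apply: le_trans (CS_real _ _ _ _) _.
  have sq a b : ind a b ^+ 2 = ind a b by rewrite /ind; case: ifP => _; rewrite ?expr1n ?expr0n.
  apply: ler_pM.
  - exact: sumsq_ge0.
  - exact: sumsq_ge0.
  - rewrite -(pair_bigA _ (fun a b : 'I_N => (ind a b * y1 a) ^+ 2)) /=.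
   apply: (le_via (\sum_(a < N) 3 * y1 a ^+ 2)); last by rewrite -mulr_sumr ler_wpM2l.
   apply: ler_sum => a _; under eq_bigr do rewrite exprMn sq.
   by rewrite -mulr_suml ler_wpM2r ?sqr_ge0.
  - rewrite -(pair_bigA _ (fun a b : 'I_N => (ind a b * y2 b) ^+ 2)) /= exchange_big /=.
   apply: (le_via (\sum_(a < N) 3 * y2 a ^+ 2)); last by rewrite -mulr_sumr ler_wpM2l.
   apply: ler_sum => a _; under eq_bigr do rewrite exprMn sq.
   by rewrite -mulr_suml ler_wpM2r ?sqr_ge0.
 rewrite (_ : 3 * Y1 ^+ 2 * (3 * Y2 ^+ 2) = (3 * (Y1 * Y2)) ^+ 2); last by ring.
 by rewrite ler_sqr ?qualifE /= ?mulr_ge0.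
apply: (le_via (3 * (Y1 * Y2) * (K * Y3 * (K * Y4)))).
 by rewrite ler_wpM2r // !mulr_ge0.
have : 0 <= Y1 * Y2 * Y3 * Y4 by rewrite !mulr_ge0.
move=> h; rewrite [leLHS](_ : _ = 3 * K * K * (Y1 * Y2 * Y3 * Y4)); last by ring.
rewrite ler_wpM2r // (_ : 26 = 2 + 24)%N // exprD -mulrA; apply: ler_pM; rewrite ?mulr_ge0 //.
 by rewrite expr2; lra.
by rewrite KE -exprD.
Qed.

End SumOverQuadruples.

(** * The quadrilinear estimate on the grid *)

Section CoreEstimate.
Context {R : realType}.
Variable J : nat.
Hypothesis J1 : (1 < J)%N.

Definition cjif (b : bool) (x : R[i]) : R[i] := if b then (x^*)%C else x.

Lemma cabs_cjif b x : cabs (cjif b x) = cabs x.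
Proof. by case: b => //=; rewrite cabs_conj. Qed.

Lemma cjif_sum b (I : Type) (r : seq I) (P : pred I) (F : I -> R[i]) :
 cjif b (\sum_(i <- r | P i) F i) = \sum_(i <- r | P i) cjif b (F i).
Proof. by case: b => //=; rewrite conj_sum. Qed.

Lemma prod4 (T : comPzRingType) (F : 'I_4 -> T) : \prod_i F i = F o0 * F o1 * F o2 * F o3.
Proof.
rewrite !big_ord_recl big_ord0 mulr1 !mulrA.
by congr (F _ * F _ * F _ * F _); apply: val_inj.
Qed.

Lemma prod4_perm (T : comPzRingType) (s : {perm 'I_4}) (F : 'I_4 -> T) :
 \prod_i F i = F (s o0) * F (s o1) * F (s o2) * F (s o3).
Proof. by rewrite (reindex_inj (@perm_inj _ s)) prod4. Qed.

Lemma sum_lev (V' : nmodType) (ks : seq Z4) N (F : Z4 -> V') :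
 (forall k, k \in ks -> (lev k < N)%N) ->
 \sum_(k <- ks) F k = \sum_(n < N) \sum_(k <- [seq k <- ks | lev k == n]) F k.
Proof.
move=> hN; under [RHS]eq_bigr do rewrite big_filter big_mkcond.
rewrite exchange_big /=; apply: eq_big_seq => k kk.
by rewrite -big_mkcond (big_pred1 (Ordinal (hN _ kk))).
Qed.

Variables (ks : 'I_4 -> seq Z4) (w : 'I_4 -> nat -> Z4 -> R[i]) (a : 'I_4 -> Z4 -> R).
Variables (cj : 'I_4 -> bool) (N L : nat) (h : R) (p : 'I_4) (Y : 'I_4 -> R).
Hypothesis gJ : good (2 ^ (30 + 2 * N)) J.
Hypothesis uks : forall i, uniq (ks i).
Hypothesis lN : forall i k, k \in ks i -> (lev k < N)%N.
Hypothesis hw : forall i k, sctl ((w i)^~ k) (a i k).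
Hypothesis h0 : 0 <= h.
Hypothesis hp : 1 <= h \/ forall k, k \in ks p -> (L%:R / J%:R) ^+ 2 * 16 ^+ lev k <= h ^+ 14.

(** The last of the four functions is the dual one, measured with one negative derivative; the
    others carry one positive derivative. *)
Definition lw (i : 'I_4) (n : nat) : R := if i == o3 then (2 ^+ n)^-1 else 2 ^+ n.

Lemma lw_ge0 i n : 0 <= lw i n.
Proof. by rewrite /lw; case: ifP => _; rewrite ?invr_ge0 exprn_ge0. Qed.

Let kf i n := [seq k <- ks i | lev k == n].
Let sg i n : R := Num.sqrt (\sum_(k <- kf i n) a i k ^+ 2).
Let vv i n (z : grid J) : R[i] := cjif (cj i) (uw (kf i n) (w i) z).
Let hi (i : 'I_4) : R := if i == p then h else 1.

Let hi0 i : 0 <= hi i. Proof. by rewrite /hi; case: ifP. Qed.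
Let sg0 i n : 0 <= sg i n. Proof. exact: sqrtr_ge0. Qed.
Let sgE i n : sg i n ^+ 2 = \sum_(k <- kf i n) a i k ^+ 2.
Proof. by rewrite sqr_sqrtr //; exact: sumsq_ge0. Qed.

Lemma core_pair i j (n m : nat) : i != j -> (m <= n)%N -> (n < N)%N ->
 \sum_(z : grid J | (tm z < L)%N) cabs (vv i n z * vv j m z) ^+ 2 <=
  2 ^+ 80 * J%:R ^+ 5 * (hi i * hi j * 2 ^+ m * gain n m * (sg i n * sg j m)) ^+ 2.
Proof.
move=> ij mn nN; set rhs := leRHS.
have rhs0 : 0 <= rhs by rewrite /rhs mulr_ge0 ?sqr_ge0 // mulr_ge0 ?exprn_ge0.
have [e|ne] := boolP (nilp (kf i n)).
 rewrite big1 // => z _; rewrite cabsM cabs_cjif /uw /uu (nilP e) big_nil.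
 by rewrite cabs0 mul0r expr0n.
have [e'|ne'] := boolP (nilp (kf j m)).
 rewrite big1 // => z _; rewrite cabsM mulrC cabs_cjif /uw /uu (nilP e') big_nil.
 by rewrite cabs0 mul0r expr0n.
have lk i' n' k : k \in kf i' n' -> lev k = n' by rewrite mem_filter => /andP[/eqP].
have pos (r : seq Z4) : ~~ nilp r -> exists k, k \in r.
 by case: r => // k r _; exists k; rewrite inE eqxx.
(* If the distinguished factor [p] is the higher of the two, the hypothesis at its level implies the
   one at the lower level m. *)
have hh : 1 <= hi i * hi j \/ (L%:R / J%:R) ^+ 2 * 16 ^+ m <= (hi i * hi j) ^+ 14 :> R.
 rewrite /hi; have [ip|ip] := eqVneq i p.
  have -> : j == p = false by rewrite -ip eq_sym; apply/negbTE.
  rewrite mulr1; case: hp => [|hk]; [by left|right].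
  have [k kk] := pos _ ne; have := hk k; rewrite (lk _ _ _ kk) => hk'.
  apply: (le_trans _ (hk' _)); last by rewrite -ip; move: kk; rewrite mem_filter => /andP[].
  by rewrite ler_wpM2l ?sqr_ge0 // ler_weXn2l // ler1n.
 rewrite mul1r; have [jp|_] := eqVneq j p; last by left.
 case: hp => [|hk]; [by left|right].
 have [k kk] := pos _ ne'; have := hk k; rewrite (lk _ _ _ kk); apply.
 by rewrite -jp; move: kk; rewrite mem_filter => /andP[].
have gn : good (2 ^ (30 + 2 * n)) J.
 by apply: good_le gJ; rewrite leq_exp2l // leq_add2l leq_mul2l (ltnW nN).
have H := pair_bound J1 mn gn (filter_uniq _ (uks i)) (filter_uniq _ (uks j)) (lk i n) (lk j m)
 (hw i) (hw j) (mulr_ge0 (hi0 i) (hi0 j)) hh.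
rewrite (eq_bigr (fun z => cabs (uw (kf i n) (w i) z * uw (kf j m) (w j) z) ^+ 2)); last first.
 by move=> z _; rewrite !cabsM !cabs_cjif.
apply: (le_trans H); rewrite -!sgE /rhs /gain; apply: le_of_eq.
have e4 k : 4 ^+ k = (2 ^+ k) ^+ 2 :> R by rewrite exprAC; congr (_ ^+ _); lra.
rewrite !e4; field.
by rewrite expf_neq0 // pnatr_eq0.
Qed.

Let yy i n : R := lw i n * sg i n.

(** The critical case has the dual function at the top level: its negative weight is compensated by
    the second level, which is smaller by a factor of at most 4. *)
Lemma core_weights (s : {perm 'I_4}) (na nb nc nd : nat) :
 (nb <= na)%N -> (nc <= nb)%N -> (nd <= nc)%N -> (na <= nb + 2)%N ->
 2 ^+ nd * 2 ^+ nc <= 4 * (lw (s o0) na * lw (s o1) nb * lw (s o2) nc * lw (s o3) nd).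
Proof.
move=> ba cb dc ab.
have t2 k l : (k <= l)%N -> 2 ^+ k <= 2 ^+ l :> R by move=> kl; rewrite ler_eXn2l ?ltr1n.
have p2 k : 0 < 2 ^+ k :> R by rewrite exprn_gt0.
have e4 : 4 = 2 ^+ 2 :> R by rewrite expr2; lra.
have inj i j : i != j -> (s i == o3) && (s j == o3) = false.
 move=> ij; apply/negP => /andP[/eqP h1 /eqP h2]; move/negP: ij; apply.
 by rewrite -(inj_eq (@perm_inj _ s)) h1 h2.
have := inj o0 o1 isT; have := inj o0 o2 isT; have := inj o0 o3 isT.
have := inj o1 o2 isT; have := inj o1 o3 isT; have := inj o2 o3 isT.
have ex : [|| s o0 == o3, s o1 == o3, s o2 == o3 | s o3 == o3].
 have : exists i, s i = o3 by exists ((s^-1)%g o3); rewrite permKV.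
 case=> i e; have : i \in [:: o0; o1; o2; o3] by case: i {e} => -[|[|[|[|]]]].
 by rewrite !inE => /or4P[] /eqP ei; move: e; rewrite ei => ->; rewrite eqxx ?orbT.
rewrite /lw e4; move: ex.
case: (s o0 == o3) => /=; [|case: (s o1 == o3) => /=; [|case: (s o2 == o3) => /=; [|case: (s o3 == o3) => //=]]];
 do ?[case: (_ == _) => //=]; move=> *.
- rewrite [leRHS](_ : _ = 2 ^+ (2 + nb + nc + nd) / 2 ^+ na); last by rewrite !exprD; ring.
 by rewrite ler_pdivlMr // -!exprD t2 //; lia.
- rewrite [leRHS](_ : _ = 2 ^+ (2 + na + nc + nd) / 2 ^+ nb); last by rewrite !exprD; ring.
 by rewrite ler_pdivlMr // -!exprD t2 //; lia.
- rewrite [leRHS](_ : _ = 2 ^+ (2 + na + nb + nd) / 2 ^+ nc); last by rewrite !exprD; ring.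
 by rewrite ler_pdivlMr // -!exprD t2 //; lia.
- rewrite [leRHS](_ : _ = 2 ^+ (2 + na + nb + nc) / 2 ^+ nd); last by rewrite !exprD; ring.
 by rewrite ler_pdivlMr // -!exprD t2 //; lia.
Qed.

Lemma core_zero (s : {perm 'I_4}) (n : {ffun 'I_4 -> 'I_N}) :
 (n (s o1) + 3 <= n (s o0))%N -> (n (s o2) <= n (s o1))%N -> (n (s o3) <= n (s o1))%N ->
 \sum_(z : grid J | (tm z < L)%N) \prod_i vv i (n i) z = 0.
Proof.
move=> n1 n2 n3; rewrite big_mkcond sum_gridE big1 // => t _.
rewrite -big_mkcond /=; have [tL|tL] := boolP ((t : nat) < L)%N; last first.
 by rewrite big_pred0 // => x; apply/negbTE.
under eq_bigr do rewrite (prod4_perm s) -mulrA.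
have xs i (m : nat) : xspec m (fun x : V J => vv i m (t, x)).
 rewrite /vv /cjif; case: (cj i); [apply: (xspec_conj J1)|]; rewrite /uw /tm /=; exact: (xspec_uu J1).
apply: (xspec_vanish J1 (xs _ _) (xs _ _) (xs _ _) (xs _ _) n1 n2 n3).
apply: leq_trans gJ.1; rewrite leq_exp2l //; have := ltn_ord (n (s o0)); lia.
Qed.

(** Pair the highest level with the lowest and the two middle ones with each other, so that both
    pairs carry a gain; if the top level stands alone, the term is 0. Summing over all permutations
    on the right includes the sorting one without having to name it. *)
Lemma core_term (n : {ffun 'I_4 -> 'I_N}) :
 cabs (\sum_(z : grid J | (tm z < L)%N) \prod_i vv i (n i) z) <=
 2 ^+ 82 * h * J%:R ^+ 5 * \sum_(s : {perm 'I_4})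
  (if [&& (n (s o1) <= n (s o0))%N, (n (s o2) <= n (s o1))%N, (n (s o3) <= n (s o2))%N
    & (n (s o0) <= n (s o1) + 2)%N] then
   gain (n (s o0)) (n (s o3)) * gain (n (s o1)) (n (s o2)) *
   (yy (s o0) (n (s o0)) * yy (s o1) (n (s o1)) * yy (s o2) (n (s o2)) * yy (s o3) (n (s o3)))
   else 0).
Proof.
have yy0 i m : 0 <= yy i m by rewrite mulr_ge0 ?lw_ge0.
have K0 : 0 <= 2 ^+ 82 * h * J%:R ^+ 5 :> R by rewrite !mulr_ge0 ?exprn_ge0.
have [s [ba cb dc]] := sorting_perm n.
apply: (le_via (2 ^+ 82 * h * J%:R ^+ 5 *
  (if [&& (n (s o1) <= n (s o0))%N, (n (s o2) <= n (s o1))%N, (n (s o3) <= n (s o2))%N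
    & (n (s o0) <= n (s o1) + 2)%N] then
   gain (n (s o0)) (n (s o3)) * gain (n (s o1)) (n (s o2)) *
   (yy (s o0) (n (s o0)) * yy (s o1) (n (s o1)) * yy (s o2) (n (s o2)) * yy (s o3) (n (s o3)))
   else 0))); last first.
 rewrite ler_wpM2l // [leRHS](bigD1 s) //= lerDl; apply: sumr_ge0 => s' _.
 case: ifP => // _; apply: mulr_ge0; first by apply: mulr_ge0; exact: gain_ge0.
 by apply: mulr_ge0 => //; apply: mulr_ge0 => //; exact: mulr_ge0.
rewrite ba cb dc /=; case: leqP => ab; last first.
 by rewrite (core_zero (s := s)) ?cabs0 ?mulr0 // ?(leq_trans dc cb) //; move: ab; clear; lia.
rewrite (eq_bigr (fun z => (vv (s o0) (n (s o0)) z * vv (s o3) (n (s o3)) z) *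
  (vv (s o1) (n (s o1)) z * vv (s o2) (n (s o2)) z))); last first.
 by move=> z _; rewrite (prod4_perm s); ring.
set na := n (s o0); set nb := n (s o1); set nc := n (s o2); set nd := n (s o3).
have s03 : s o0 != s o3 by rewrite (inj_eq (@perm_inj _ s)).
have s12 : s o1 != s o2 by rewrite (inj_eq (@perm_inj _ s)).
have P1 := core_pair s03 (leq_trans dc (leq_trans cb ba)) (ltn_ord na).
have P2 := core_pair s12 cb (ltn_ord nb).
set q1 := hi (s o0) * hi (s o3) * 2 ^+ nd * gain na nd * (sg (s o0) na * sg (s o3) nd) in P1.
set q2 := hi (s o1) * hi (s o2) * 2 ^+ nc * gain nb nc * (sg (s o1) nb * sg (s o2) nc) in P2.
have q10 : 0 <= q1 by rewrite !mulr_ge0 ?exprn_ge0 ?gain_ge0 //.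
have q20 : 0 <= q2 by rewrite !mulr_ge0 ?exprn_ge0 ?gain_ge0 //.
have JJ : 0 <= J%:R ^+ 5 :> R by rewrite exprn_ge0.
have CS := le_trans (CS_cabs _ _ (fun z => vv (s o0) na z * vv (s o3) nd z)
  (fun z => vv (s o1) nb z * vv (s o2) nc z)) (ler_pM _ _ P1 P2).
have {}CS : cabs (\sum_(z : grid J | (tm z < L)%N) (vv (s o0) na z * vv (s o3) nd z) *
  (vv (s o1) nb z * vv (s o2) nc z)) <= 2 ^+ 80 * J%:R ^+ 5 * (q1 * q2).
 have X0 : 0 <= 2 ^+ 80 * J%:R ^+ 5 * (q1 * q2).
  apply: mulr_ge0; last exact: mulr_ge0.
  by rewrite mulr_ge0 ?exprn_ge0.
 rewrite -ler_sqr ?qualifE /= ?cabs_ge0 //.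
 apply: le_trans (CS _ _) _; try by exact: sumsq_ge0.
 by apply: le_of_eq; ring.
apply: (le_trans CS).
(* The factor [p] lies in exactly one of the two pairs, so [h] appears once. *)
have hE : hi (s o0) * hi (s o3) * (hi (s o1) * hi (s o2)) = h.
 transitivity (\prod_i hi i); first by rewrite (prod4_perm s); ring.
 rewrite (bigD1 p) //= big1 ?mulr1 /hi ?eqxx // => i /negbTE -> //.
have W := core_weights s ba cb dc ab.
set W1 := lw (s o0) na * lw (s o1) nb * lw (s o2) nc * lw (s o3) nd in W.
set SG := sg (s o0) na * sg (s o1) nb * sg (s o2) nc * sg (s o3) nd.
set GG := gain na nd * gain nb nc.
have -> : q1 * q2 = h * (2 ^+ nd * 2 ^+ nc) * (GG * SG) by rewrite /q1 /q2 -hE /GG /SG; ring.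
rewrite [leRHS](_ : _ = 2 ^+ 80 * J%:R ^+ 5 * (h * (4 * W1) * (GG * SG))); last first.
 rewrite (_ : 2 ^+ 82 = 2 ^+ 80 * 4 :> R); last by rewrite (exprD _ 80 2) expr2; congr (_ * _); lra.
 by rewrite /yy /W1 /SG /GG; ring.
have GS0 : 0 <= GG * SG.
 by apply: mulr_ge0; [apply: mulr_ge0; exact: gain_ge0|rewrite !mulr_ge0].
by rewrite ler_wpM2l ?mulr_ge0 ?exprn_ge0 // ler_wpM2r // ler_wpM2l.
Qed.

Hypothesis Y0 : forall i, 0 <= Y i.
Hypothesis hY : forall i, \sum_(k <- ks i) lw i (lev k) ^+ 2 * a i k ^+ 2 <= Y i ^+ 2.

Theorem core_estimate :
 cabs (\sum_(z : grid J | (tm z < L)%N) \prod_i cjif (cj i) (uw (ks i) (w i) z)) <=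
 2 ^+ 113 * h * J%:R ^+ 5 * \prod_i Y i.
Proof.
have yy0 i m : 0 <= yy i m by rewrite mulr_ge0 ?lw_ge0.
have K0 : 0 <= 2 ^+ 82 * h * J%:R ^+ 5 :> R by rewrite !mulr_ge0 ?exprn_ge0.
rewrite (eq_bigr (fun z => \sum_(n : {ffun 'I_4 -> 'I_N}) \prod_i vv i (n i) z)); last first.
 move=> z _; rewrite -(bigA_distr_bigA (fun i (n : 'I_N) => vv i n z)).
 apply: eq_bigr => i _; rewrite /vv -cjif_sum; congr cjif.
 by rewrite /uw /uu (sum_lev _ (lN (i := i))).
rewrite exchange_big /=; apply: le_trans (cabs_sum _ _ _) _.
apply: le_trans (ler_sum _ (fun n _ => core_term n)) _.
rewrite -mulr_sumr exchange_big /=.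
have sy i : \sum_(n < N) yy i n ^+ 2 <= Y i ^+ 2.
 apply: le_trans (hY i); rewrite (sum_lev _ (lN (i := i))); apply: ler_sum => n _.
 rewrite exprMn sgE mulr_sumr; apply: le_of_eq; apply: eq_big_seq => k.
 by rewrite mem_filter => /andP[/eqP ->].
have sy1 i n : (n < N)%N -> yy i n <= Y i.
 move=> nN; rewrite -ler_sqr ?qualifE //=; apply: le_trans (sy i).
 by rewrite (bigD1 (Ordinal nN)) //= lerDl; exact: sumsq_ge0.
apply: (le_via (2 ^+ 82 * h * J%:R ^+ 5 * \sum_(s : {perm 'I_4}) 2 ^+ 26 * \prod_i Y i)).
 rewrite ler_wpM2l //; apply: ler_sum => s _; rewrite (prod4_perm s).
 rewrite (sum_ffun4 s (fun na nb nc nd => if [&& (nb <= na)%N, (nc <= nb)%N, (nd <= nc)%N & (na <= nb + 2)%N]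
  then gain na nd * gain nb nc * (yy (s o0) na * yy (s o1) nb * yy (s o2) nc * yy (s o3) nd) else 0)).
 by apply: ordered_sum => // n nN; exact: sy1.
have P0 : 0 <= \prod_i Y i by apply: prodr_ge0.
(* The 24 permutations are rounded up to 2^5, and 113 = 82 + 5 + 26. *)
rewrite sumr_const card_Sn -[X in _ * X <= _]mulr_natl.
rewrite [leRHS](_ : _ = 2 ^+ 82 * h * J%:R ^+ 5 * (2 ^+ 5 * (2 ^+ 26 * \prod_i Y i))); last first.
 by rewrite (_ : 113 = 82 + (5 + 26))%N // !exprD; ring.
rewrite ler_wpM2l // ler_wpM2r ?mulr_ge0 ?exprn_ge0 // -natrX ler_nat //.
Qed.

End CoreEstimate.

(** * The L^6 estimate on the grid *)

Section DiscreteL6.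
Context {R : realType}.

Lemma weighted_CS (I : Type) (r : seq I) (w a : I -> R) : (forall i, 0 < w i) ->
 (\sum_(i <- r) a i) ^+ 2 <= (\sum_(i <- r) w i) * (\sum_(i <- r) (w i)^-1 * a i ^+ 2).
Proof.
move=> w0; have q i : Num.sqrt (w i) ^+ 2 = w i by rewrite sqr_sqrtr // ltW.
have q0 i : Num.sqrt (w i) != 0 by rewrite gt_eqF // sqrtr_gt0.
have := CS_real r predT (fun i => Num.sqrt (w i)) (fun i => (Num.sqrt (w i))^-1 * a i).
rewrite (eq_bigr a) => [|i _]; last by rewrite mulVKf.
rewrite [X in _ <= X * _ -> _](eq_bigr w) => [|i _]; last exact: q.
rewrite [X in _ <= _ * X -> _](eq_bigr (fun i => (w i)^-1 * a i ^+ 2)) // => i _.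
by rewrite exprMn exprVn q.
Qed.

Lemma sum_two_thirds N : \sum_(0 <= n < N) (2 / 3) ^+ n <= 3 :> R.
Proof.
have e : \sum_(0 <= n < N) (2 / 3) ^+ n = 3 - 3 * (2 / 3) ^+ N :> R.
 by elim: N => [|N ih]; [rewrite big_geq // expr0; lra|rewrite big_nat_recr //= ih exprS; lra].
have : 0 <= (2 / 3) ^+ N :> R by rewrite exprn_ge0 //; lra.
by rewrite e; lra.
Qed.

(** Weights (2/3)^n in place of 2^-n: after two applications of Cauchy-Schwarz they cost (27/8)^n,
    within the factor 4^n that the L^4 bounds can pay. *)
Lemma exp4_sum_geo4 N (a : nat -> R) :
 (\sum_(0 <= n < N) a n) ^+ 4 <= 27 * \sum_(0 <= n < N) 4 ^+ n * a n ^+ 4.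
Proof.
have w0 n : 0 < (2 / 3) ^+ n :> R by rewrite exprn_gt0 //; lra.
have step (b : nat -> R) :
  (\sum_(0 <= n < N) b n) ^+ 2 <= 3 * \sum_(0 <= n < N) ((2 / 3) ^+ n)^-1 * b n ^+ 2.
 apply: le_trans (weighted_CS _ _ w0) _; rewrite ler_wpM2r ?sum_two_thirds //.
 by apply: sumr_ge0 => n _; rewrite mulr_ge0 ?sqr_ge0 // invr_ge0 ltW.
have s0 : 0 <= \sum_(0 <= n < N) ((2 / 3) ^+ n)^-1 * a n ^+ 2.
 by apply: sumr_ge0 => n _; rewrite mulr_ge0 ?sqr_ge0 // invr_ge0 ltW.
rewrite (_ : 4 = 2 * 2)%N // exprM.
apply: (le_via ((3 * \sum_(0 <= n < N) ((2 / 3) ^+ n)^-1 * a n ^+ 2) ^+ 2)).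
 by rewrite ler_sqr ?qualifE /= ?sqr_ge0 ?mulr_ge0.
rewrite exprMn; apply: (le_via (9 * (3 * \sum_(0 <= n < N) 4 ^+ n * a n ^+ 4))); last by lra.
rewrite (_ : 3 ^+ 2 = 9 :> R); last by lra.
rewrite ler_wpM2l //; apply: le_trans (step _) _; rewrite ler_wpM2l //; apply: ler_sum => n _.
rewrite [leLHS](_ : _ = ((2 / 3) ^- n) ^+ 3 * a n ^+ 4); last by move: ((2 / 3) ^- n) => x; ring.
apply: ler_wpM2r; first by rewrite (exprM _ 2 2) sqr_ge0.
rewrite -exprVn exprAC; apply: lerXn2r; rewrite ?qualifE //=; last lra.
Qed.

(* Summing the pieces above the frequency 2^m at which the sup bounds reach the
  value S of the full sum. *)
Lemma exp6_sum_le N (b : nat -> R) (K : R) : 0 <= K ->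
 (forall n, (n < N)%N -> 0 <= b n <= K * 2 ^+ n) ->
 (\sum_(0 <= n < N) b n) ^+ 6 <= 2 ^+ 13 * K ^+ 2 * \sum_(0 <= n < N) 4 ^+ n * b n ^+ 4.
Proof.
move=> K0 hb; set S := \sum_(0 <= n < N) b n.
have b0 n : (n < N)%N -> 0 <= b n by move=> /hb/andP[].
have S0 : 0 <= S by rewrite /S big_nat_cond; apply: sumr_ge0 => n /andP[/andP[_ /b0]].
have geo m : (m <= N)%N -> \sum_(0 <= n < m) b n <= K * 2 ^+ m.
 elim: m => [|m ih] mN; first by rewrite big_geq // mulr_ge0 ?exprn_ge0.
 rewrite big_nat_recr //= exprS; have := ih (ltnW mN); have /andP[_] := hb _ mN; lra.
have ex : exists m, S <= 4 * K * 2 ^+ m.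
 exists N; apply: (le_trans (geo _ (leqnn _))); rewrite ler_wpM2r ?exprn_ge0 //; lra.
case: (ex_minnP ex) => m Sm mmin.
have mN : (m <= N)%N.
 by apply: mmin; apply: (le_trans (geo _ (leqnn _))); rewrite ler_wpM2r ?exprn_ge0 //; lra.
have S2 : S <= 2 * \sum_(m <= n < N) b n.
 have e : S = \sum_(0 <= n < m) b n + \sum_(m <= n < N) b n by rewrite -(@big_cat_nat _ _ _ m).
 have g := geo _ mN; move: mmin; case: m e g {Sm mN} => [|m] e g mmin.
  by rewrite e big_geq // add0r in S0 *; lra.
 have : 4 * K * 2 ^+ m < S by rewrite ltNge; apply/negP => /mmin; rewrite ltnn.
 by move: g; rewrite exprS; lra.
set Q := \sum_(0 <= n < N) _.
have p4 : (\sum_(m <= n < N) b n) ^+ 4 * 4 ^+ m <= 27 * Q.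
 rewrite -{1}(add0n m) big_addn; apply: (le_via (27 * (\sum_(0 <= n < N - m) 4 ^+ n * b (n + m)%N ^+ 4) * 4 ^+ m)).
  by rewrite ler_wpM2r ?exprn_ge0 // exp4_sum_geo4.
 rewrite -mulrA ler_wpM2l // mulr_suml /Q [leRHS](@big_cat_nat _ _ _ m) //=.
 rewrite [X in _ <= _ + X](_ : _ = \sum_(0 <= n < N - m) 4 ^+ (n + m) * b (n + m)%N ^+ 4); last first.
  by rewrite -{1}[m]add0n big_addn.
 rewrite (eq_bigr (fun n => 4 ^+ (n + m) * b (n + m)%N ^+ 4)); last by move=> n _; rewrite exprD; ring.
 rewrite lerDr big_nat_cond; apply: sumr_ge0 => n /andP[/andP[_ nm] _].
 by rewrite mulr_ge0 ?exprn_ge0 // b0 // (leq_trans nm).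
set tl := \sum_(m <= n < N) b n in S2 p4.
have t4 : S ^+ 4 <= 16 * tl ^+ 4.
 by rewrite (_ : 16 * tl ^+ 4 = (2 * tl) ^+ 4); [apply: lerXn2r; rewrite ?qualifE //=; lra|ring].
have t2 : S ^+ 2 <= 16 * K ^+ 2 * 4 ^+ m.
 have -> : 16 * K ^+ 2 * 4 ^+ m = (4 * K * 2 ^+ m) ^+ 2.
  by rewrite !exprMn exprAC (_ : 2 ^+ 2 = 4 :> R); [ring|lra].
 by rewrite ler_sqr ?qualifE /= ?mulr_ge0 ?exprn_ge0.
rewrite [S ^+ 6](exprD _ 2 4).
apply: (le_via ((16 * K ^+ 2 * 4 ^+ m) * (16 * tl ^+ 4))).
 by apply: ler_pM; rewrite ?exprn_ge0.
rewrite [leLHS](_ : _ = 256 * K ^+ 2 * (tl ^+ 4 * 4 ^+ m)); last by ring.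
apply: (le_via (256 * K ^+ 2 * (27 * Q))).
 by apply: ler_wpM2l p4; apply: mulr_ge0; [exact: ler0n|exact: sqr_ge0].
have : 0 <= K ^+ 2 * Q.
 rewrite mulr_ge0 ?sqr_ge0 // /Q big_nat_cond; apply: sumr_ge0 => n /andP[/andP[_ nN] _].
 by rewrite mulr_ge0 ?exprn_ge0 // b0.
move=> q0; rewrite -[_ * K ^+ 2 * Q]mulrA.
rewrite [leLHS](_ : _ = 256 * 27 * (K ^+ 2 * Q)); last by ring.
apply: ler_wpM2r => //.
by rewrite -natrM -natrX ler_nat.
Qed.

Variable J : nat.
Hypothesis J1 : (1 < J)%N.

Lemma level_L4 n ks (w : nat -> Z4 -> R[i]) (a : Z4 -> R) :
 good (2 ^ (30 + 2 * n)) J -> uniq ks -> (forall k, k \in ks -> lev k = n) ->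
 (forall k, sctl (w^~ k) (a k)) ->
 \sum_(z : grid J) cabs (uw ks w z) ^+ 4 <=
  2 ^+ 57 * 4 ^+ n * J%:R ^+ 5 * (\sum_(k <- ks) a k ^+ 2) ^+ 2 /\
 forall z : grid J, cabs (uw ks w z) ^+ 2 <= 256 * 16 ^+ n * \sum_(k <- ks) a k ^+ 2.
Proof.
move=> gJ uks lk hw.
have cub k : k \in ks -> in_cube (z4c (- (2 ^ n.+1)%:Z)) (2 ^ n.+2) k.
 move=> kks j; rewrite cmp_z4c; have := sup4_lt_lev k; have := cmp_le_sup k j.
 by rewrite (lk _ kks) [X in _ < _ + X](_ : _ = ((2 ^ n.+1)%:Z + (2 ^ n.+1)%:Z)) ?expnS; lia.
have J50 : 0 <= (J%:R : R) ^+ 5 by rewrite exprn_ge0.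
pose A := Num.sqrt (\sum_(k <- ks) a k ^+ 2).
have S0 : 0 <= \sum_(k <- ks) a k ^+ 2 by exact: sumsq_ge0.
have A2 : A ^+ 2 = \sum_(k <- ks) a k ^+ 2 by rewrite sqr_sqrtr.
split.
 pose B : R := 2 ^+ 16 * 4 ^+ n * J%:R ^+ 5.
 have B0 : 0 <= B by rewrite !mulr_ge0 ?exprn_ge0.
 have f4 : free4 (R := R) J ks B.
  move=> f; have := @strong_L4 R n.+2 J _ ks; move=> /(_ _ isT _ uks cub f) h.
  apply: (le_trans (h _)).
   apply: good_le gJ; rewrite (_ : 4 = 2 ^ 2)%N // -expnM -expnD leq_exp2l //.
   by clear; lia.
  rewrite ler_wpM2r ?sqr_ge0 // /B ler_wpM2r // (exprD _ 2 n) mulrA ler_wpM2r ?exprn_ge0 //.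
  by rewrite -natrX -natrM -natrX ler_nat.
 have T4 := transfer4 J1 f4 B0 (vctl_scalar ks hw); apply: (le_trans T4).
 rewrite -/A (_ : A ^+ 4 = (A ^+ 2) ^+ 2); last by rewrite -exprM.
 by rewrite A2 /B (_ : 57 = 41 + 16)%N // exprD !mulrA.
move=> z; apply: le_trans (sup_uu _ _ _) _; apply: ler_pM => //.
- exact: sumsq_ge0.
- have := @size_cube n.+2 _ ks isT uks cub; rewrite -(ler_nat R) => h; apply: (le_trans h).
 rewrite natrX (exprD _ 2 n) ler_wpM2r ?exprn_ge0 //.
 by rewrite -natrX ler_nat.
- by apply: ler_sum => k _; have [b0 [om [_ _ _ hb]]] := hw k; rewrite ler_sqr ?qualifE /= ?cabs_ge0.
Qed.

(** The L^6 bound at its scaling exponent, one derivative. In [exp6_sum_le] the sup bounds give K =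
    16 Y; each 4^n b_n^4 is bounded in the mean by the square of 4^n A n, one factor of which is at
    most W while the other is summed. *)
Theorem discrete_L6 N ks (w : nat -> Z4 -> R[i]) (a : Z4 -> R) :
 good (2 ^ (30 + 2 * N)) J -> uniq ks -> (forall k, k \in ks -> (lev k < N)%N) ->
 (forall k, sctl (w^~ k) (a k)) ->
 \sum_(z : grid J) cabs (uw ks w z) ^+ 6 <=
  2 ^+ 78 * J%:R ^+ 5 * (\sum_(k <- ks) 4 ^+ lev k * a k ^+ 2) ^+ 3.
Proof.
move=> gJ uks lN hw; set W := \sum_(k <- ks) _.
pose kf n := [seq k <- ks | lev k == n]; pose A n := \sum_(k <- kf n) a k ^+ 2.
have lk n k : k \in kf n -> lev k = n by rewrite mem_filter => /andP[/eqP].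
have A0 n : 0 <= A n by exact: sumsq_ge0.
have WE : W = \sum_(0 <= n < N) 4 ^+ n * A n.
 rewrite big_mkord /W (sum_lev _ lN); apply: eq_bigr => n _; rewrite mulr_sumr.
 by apply: eq_big_seq => k /lk ->.
have W0 : 0 <= W by rewrite WE; apply: sumr_ge0 => n _; rewrite mulr_ge0 ?exprn_ge0.
have AW n : (n < N)%N -> 4 ^+ n * A n <= W.
 move=> nN; rewrite WE big_mkord (bigD1 (Ordinal nN)) //= lerDl.
 by apply: sumr_ge0 => m _; rewrite mulr_ge0 ?exprn_ge0.
pose Y := Num.sqrt W; have Y2 : Y ^+ 2 = W by rewrite sqr_sqrtr.
have Y0 : 0 <= Y by exact: sqrtr_ge0.
have gn n : (n < N)%N -> good (2 ^ (30 + 2 * n)) J.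
 by move=> nN; apply: good_le gJ; rewrite leq_exp2l // leq_add2l leq_mul2l (ltnW nN).
have L n (nN : (n < N)%N) := level_L4 (gn _ nN) (filter_uniq _ uks) (lk n) hw.
pose b (z : grid J) n := cabs (uw (kf n) w z).
have bb z n : (n < N)%N -> 0 <= b z n <= (16 * Y) * 2 ^+ n.
 move=> nN; rewrite cabs_ge0 /= -ler_sqr ?qualifE /= ?cabs_ge0 ?mulr_ge0 ?exprn_ge0 //.
 apply: le_trans ((L _ nN).2 z) _; rewrite !exprMn Y2 exprAC (_ : 2 ^+ 2 = 4 :> R); last by lra.
 rewrite (_ : 16 ^+ n = 4 ^+ n * 4 ^+ n :> R); last by rewrite -exprMn; congr (_ ^+ _); lra.
 rewrite (_ : 16 ^+ 2 = 256 :> R); last by rewrite expr2 -natrM.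
 have : 0 <= 256 :> R by exact: ler0n.
 move: (256 : R) => c c0.
 have := AW _ nN; rewrite -/(A n); have : 0 <= 4 ^+ n :> R by rewrite exprn_ge0.
 move: (4 ^+ n) => x x0 h; rewrite [leLHS](_ : _ = c * x * (x * A n)); last by ring.
 by rewrite [leRHS](_ : _ = c * x * W); [apply: ler_wpM2l; [exact: mulr_ge0|exact: h]|ring].
apply: (le_via (\sum_(z : grid J) 2 ^+ 13 * (16 * Y) ^+ 2 * \sum_(0 <= n < N) 4 ^+ n * b z n ^+ 4)).
 apply: ler_sum => z _; apply: le_trans (exp6_sum_le _ (bb z)); last by rewrite mulr_ge0.
 apply: lerXn2r; rewrite ?qualifE /= ?cabs_ge0 //; first by apply: sumr_ge0 => n _; exact: cabs_ge0.
 by rewrite /uw /uu (sum_lev _ lN) big_mkord cabs_sum.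
rewrite -mulr_sumr exchange_big /=.
apply: (le_via (2 ^+ 13 * (16 * Y) ^+ 2 * (2 ^+ 57 * J%:R ^+ 5 * W * W))); last first.
 rewrite exprMn Y2 (_ : 16 ^+ 2 = 2 ^+ 8 :> R); last by rewrite (exprM _ 4 2); congr (_ ^+ _); lra.
 by rewrite (_ : 78 = 13 + 8 + 57)%N // !exprD; apply: le_of_eq; ring.
rewrite ler_wpM2l ?mulr_ge0 ?sqr_ge0 ?exprn_ge0 // {2}WE mulr_sumr big_nat_cond [leRHS]big_nat_cond.
apply: ler_sum => n /andP[/andP[_ nN] _]; rewrite -mulr_sumr.
apply: (le_via (4 ^+ n * (2 ^+ 57 * 4 ^+ n * J%:R ^+ 5 * A n ^+ 2))).
 by rewrite ler_wpM2l ?exprn_ge0 //; exact: (L _ nN).1.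
have J50 : 0 <= (J%:R : R) ^+ 5 by rewrite exprn_ge0.
rewrite [leLHS](_ : _ = 2 ^+ 57 * J%:R ^+ 5 * (4 ^+ n * A n) * (4 ^+ n * A n)); last by ring.
apply: ler_wpM2r; first by rewrite mulr_ge0 ?exprn_ge0.
by apply: ler_wpM2l; [rewrite mulr_ge0 ?exprn_ge0|exact: AW].
Qed.

End DiscreteL6.

(** * Integration and completeness of characters *)

Section ComplexMeasurability.
Context {R : realType} d (T : measurableType d).
Implicit Types (D : set T) (f g : T -> R[i]).

Lemma cmeas_cst D (c : R[i]) : cmeasurable D (fun=> c).
Proof. by split; exact: measurable_cst. Qed.

Lemma cmeasD D f g : cmeasurable D f -> cmeasurable D g -> cmeasurable D (fun x => f x + g x).
Proof.
move=> [f1 f2] [g1 g2]; split.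
 by under eq_fun do rewrite raddfD; exact: measurable_funD.
by under eq_fun do rewrite raddfD; exact: measurable_funD.
Qed.

Lemma ReM (z w : R[i]) : complex.Re (z * w) = complex.Re z * complex.Re w - complex.Im z * complex.Im w.
Proof. by case: z w => [a b] [c e]. Qed.

Lemma ImM (z w : R[i]) : complex.Im (z * w) = complex.Re z * complex.Im w + complex.Im z * complex.Re w.
Proof. by case: z w => [a b] [c e]. Qed.

Lemma cmeasM D f g : cmeasurable D f -> cmeasurable D g -> cmeasurable D (fun x => f x * g x).
Proof.
move=> [f1 f2] [g1 g2]; split.
 by under eq_fun do rewrite ReM; apply: measurable_funB; exact: measurable_funM.
by under eq_fun do rewrite ImM; apply: measurable_funD; exact: measurable_funM.
Qed.

Lemma cmeasN D f : cmeasurable D f -> cmeasurable D (fun x => - f x).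
Proof.
move=> mf; rewrite (_ : (fun x => - f x) = fun x => (-1) * f x).
 by apply: cmeasM => //; exact: cmeas_cst.
by apply/funext => x; rewrite mulN1r.
Qed.

Lemma cmeasB D f g : cmeasurable D f -> cmeasurable D g -> cmeasurable D (fun x => f x - g x).
Proof. by move=> mf mg; apply: cmeasD => //; exact: cmeasN. Qed.

Lemma cmeas_conj D f : cmeasurable D f -> cmeasurable D (fun x => ((f x)^*)%C).
Proof.
move=> [f1 f2]; split.
 by rewrite (_ : (fun x => _) = (fun x => complex.Re (f x))) //; apply/funext => x; case: (f x).
rewrite (_ : (fun x => _) = (fun x => - complex.Im (f x))); first exact: measurable_funN.
by apply/funext => x; case: (f x).
Qed.

Lemma cmeas_sum D (I : Type) (r : seq I) (F : I -> T -> R[i]) :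
 (forall i, cmeasurable D (F i)) -> cmeasurable D (fun x => \sum_(i <- r) F i x).
Proof.
move=> hF; elim: r => [|i r ih].
 by under eq_fun do rewrite big_nil; exact: cmeas_cst.
by under eq_fun do rewrite big_cons; exact: cmeasD.
Qed.

Lemma cmeas_real D (h : T -> R) : measurable_fun D h -> cmeasurable D (fun x => (h x)%:C).
Proof. by move=> mh; split => //=; exact: measurable_cst. Qed.

Lemma cmeas_cabs D f : cmeasurable D f -> measurable_fun D (fun x => cabs (f x)).
Proof.
move=> [f1 f2]; rewrite (_ : (fun x => _) =
  (fun x => Num.sqrt (complex.Re (f x) ^+ 2 + complex.Im (f x) ^+ 2))).
 apply: (@measurableT_comp _ _ _ _ _ _ (@Num.sqrt R)).
  by apply: nondecreasing_measurable => // x y xy; exact: ler_wsqrtr.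
 by apply: measurable_funD; exact: measurable_funX.
by apply/funext => x; case: (f x) => a b.
Qed.

Lemma cmeas_eq D f g : (forall x, D x -> f x = g x) -> cmeasurable D f -> cmeasurable D g.
Proof.
by move=> fg [f1 f2]; split; [apply: eq_measurable_fun f1|apply: eq_measurable_fun f2] => x;
 rewrite inE => /fg ->.
Qed.

Lemma cmeasS D E f : measurable E -> D `<=` E -> cmeasurable E f -> cmeasurable D f.
Proof. by move=> mE DE [f1 f2]; split; exact: (measurable_funS mE DE). Qed.

Lemma cmeas_lim (D : set T) (f_ : nat -> T -> R[i]) f : measurable D ->
 (forall n, cmeasurable D (f_ n)) -> (forall x, D x -> cabs (f_ n x - f x) @[n --> \oo] --> (0 : R)) ->
 cmeasurable D f.
Proof.
move=> mD mf lim.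
have part (P : R[i] -> R) : (forall z, `|P z| <= cabs z) -> (forall z w, P (z - w) = P z - P w) ->
  (forall n, measurable_fun D (P \o f_ n)) -> measurable_fun D (P \o f).
 move=> Ple PB m_; apply: (measurable_fun_cvg (h := fun n => P \o f_ n)) => //.
 move=> t It; apply/subr_cvg0; apply/norm_cvg0P.
 apply: (@squeeze_cvgr _ _ _ _ (fun=> 0) (fun n => cabs (f_ n t - f t))).
 - by near=> n; rewrite normr_ge0 /= -PB.
 - exact: cvg_cst.
 - exact: lim.
split; first exact: (part _ (@Re_le_cabs R) (fun z w => raddfB _ z w) (fun n => (mf n).1)).
exact: (part _ (@Im_le_cabs R) (fun z w => raddfB _ z w) (fun n => (mf n).2)).
Unshelve. all: by end_near. Qed.

End ComplexMeasurability.

Section ComplexIntegrals.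
Context {R : realType} d (T : measurableType d) (mu : {measure set T -> \bar R}).
Variables (D : set T) (mD : measurable D).
Implicit Types (f g : T -> R[i]).

Lemma cint_meas f : cintegrable mu D f -> cmeasurable D f.
Proof. by case=> [/measurable_int/measurable_EFinP f1 /measurable_int/measurable_EFinP f2]; split. Qed.

Lemma cintegrable_le f (h : T -> R) : cmeasurable D f -> (forall x, D x -> cabs (f x) <= h x) ->
 mu.-integrable D (EFin \o h) -> cintegrable mu D f.
Proof.
move=> [f1 f2] fh ih; split.
 apply: le_integrable ih => //; first exact/measurable_EFinP.
 move=> x Dx; rewrite !abse_EFin lee_fin.
 by apply: le_trans (Re_le_cabs _) (le_trans (fh _ Dx) (ler_norm _)).
apply: le_integrable ih => //; first exact/measurable_EFinP.
move=> x Dx; rewrite !abse_EFin lee_fin.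
by apply: le_trans (Im_le_cabs _) (le_trans (fh _ Dx) (ler_norm _)).
Qed.

Lemma cintegrable_cabs f : cintegrable mu D f -> mu.-integrable D (EFin \o (fun x => cabs (f x))).
Proof.
move=> fi; have [f1 f2] := fi; have mf := cint_meas fi.
have i1 := integrableD mD (integrable_norm f1) (integrable_norm f2).
apply: le_integrable i1 => //; first by apply/measurable_EFinP; exact: cmeas_cabs.
move=> x Dx; rewrite /= lee_fin ger0_norm ?cabs_ge0 // ger0_norm ?addr_ge0 //.
exact: cabs_le_ReIm.
Qed.

Lemma cintegrableD f g : cintegrable mu D f -> cintegrable mu D g ->
 cintegrable mu D (fun x => f x + g x).
Proof.
move=> [f1 f2] [g1 g2]; split.
 apply: eq_integrable (integrableD mD f1 g1) => // x _; by rewrite /= raddfD.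
apply: eq_integrable (integrableD mD f2 g2) => // x _; by rewrite /= raddfD.
Qed.

Lemma cintegrableM f g (K : R) : cintegrable mu D f -> cmeasurable D g ->
 (forall x, D x -> cabs (g x) <= K) -> cintegrable mu D (fun x => f x * g x).
Proof.
move=> fi mg gK; apply: (@cintegrable_le _ (fun x => K * cabs (f x))).
- by apply: cmeasM => //; exact: cint_meas.
- by move=> x Dx; rewrite cabsM mulrC ler_wpM2r ?cabs_ge0 ?gK.
- exact: integrableZl (cintegrable_cabs fi).
Qed.

Lemma cintegrableZ (c : R[i]) f : cintegrable mu D f -> cintegrable mu D (fun x => f x * c).
Proof. by move=> fi; apply: (@cintegrableM _ _ (cabs c)) => //; exact: cmeas_cst. Qed.

Lemma cintegrable_sum (I : Type) (r : seq I) (F : I -> T -> R[i]) :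
 (forall i, cintegrable mu D (F i)) -> cintegrable mu D (fun x => \sum_(i <- r) F i x).
Proof.
move=> hF; elim: r => [|i r ih].
 under eq_fun do rewrite big_nil; split; exact: integrable0.
by under eq_fun do rewrite big_cons; exact: cintegrableD.
Qed.

Lemma cintegrable_eq f g : (forall x, D x -> f x = g x) -> cintegrable mu D f -> cintegrable mu D g.
Proof.
move=> fg [f1 f2]; split; [apply: eq_integrable f1|apply: eq_integrable f2] => // x;
 by rewrite inE => /fg ->.
Qed.

Lemma eq_cintegral f g : (forall x, D x -> f x = g x) -> cintegral mu D f = cintegral mu D g.
Proof.
by move=> fg; rewrite /cintegral; congr (_ +i* _); apply: eq_Rintegral => x; rewrite inE => /fg ->.
Qed.

Lemma cintegralD f g : cintegrable mu D f -> cintegrable mu D g ->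
 cintegral mu D (fun x => f x + g x) = cintegral mu D f + cintegral mu D g.
Proof.
move=> [f1 f2] [g1 g2]; rewrite /cintegral.
under [X in X +i* _]eq_Rintegral do rewrite raddfD.
under [X in _ +i* X]eq_Rintegral do rewrite raddfD.
by rewrite /= !RintegralD.
Qed.

Lemma cintegralZ (c : R[i]) f : cintegrable mu D f ->
 cintegral mu D (fun x => f x * c) = cintegral mu D f * c.
Proof.
move=> [f1 f2]; rewrite /cintegral; case: c => a b.
under [X in X +i* _]eq_Rintegral do rewrite ReM /=.
under [X in _ +i* X]eq_Rintegral do rewrite ImM /=.
have z1 c : mu.-integrable D (EFin \o (fun x => complex.Re (f x) * c)) by exact: (integrableZr mD c f1).
have z2 c : mu.-integrable D (EFin \o (fun x => complex.Im (f x) * c)) by exact: (integrableZr mD c f2).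
by rewrite RintegralB // RintegralD // !RintegralZr.
Qed.

Lemma cintegral0 : cintegral mu D (fun=> 0) = 0.
Proof. by rewrite /cintegral Rintegral_cst // mul0r. Qed.

Lemma cintegral_sum (I : Type) (r : seq I) (F : I -> T -> R[i]) :
 (forall i, cintegrable mu D (F i)) ->
 cintegral mu D (fun x => \sum_(i <- r) F i x) = \sum_(i <- r) cintegral mu D (F i).
Proof.
move=> hF; elim: r => [|i r ih].
 by under eq_cintegral do rewrite big_nil; rewrite big_nil cintegral0.
under eq_cintegral do rewrite big_cons.
by rewrite cintegralD ?big_cons ?ih //; exact: cintegrable_sum.
Qed.

Lemma cdominated (f_ : nat -> T -> R[i]) f (h : T -> R) :
 (forall n, cmeasurable D (f_ n)) -> cmeasurable D f ->
 {ae mu, forall x, D x -> cabs (f_ n x - f x) @[n --> \oo] --> (0 : R)} ->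
 mu.-integrable D (EFin \o h) ->
 {ae mu, forall x n, D x -> cabs (f_ n x) <= h x} ->
 cintegrable mu D f /\ cabs (cintegral mu D (f_ n) - cintegral mu D f) @[n --> \oo] --> (0 : R).
Proof.
move=> mf_ mf fae hi hle.
have part (P : R[i] -> R) : (forall z, `|P z| <= cabs z) -> (forall z w, P (z - w) = P z - P w) ->
  (forall n, measurable_fun D (P \o f_ n)) -> measurable_fun D (P \o f) ->
  mu.-integrable D (EFin \o (P \o f)) /\
  (\int[mu]_(x in D) P (f_ n x)) @[n --> \oo] --> \int[mu]_(x in D) P (f x).
 move=> Ple PB m_ m.
 have [||||| i1 _ i2] := @dominated_convergence _ _ _ mu _ mD
  (fun n => EFin \o (P \o f_ n)) (EFin \o (P \o f)) (EFin \o h).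
 - by move=> n; exact/measurable_EFinP.
 - exact/measurable_EFinP.
 - apply: filterS fae => x hx Dx; apply: cvg_EFin; first by near=> n.
  apply/cvgrPdist_le => e e0; move/cvgrPdist_le: (hx Dx) => /(_ e e0).
  apply: filterS => n; rewrite sub0r normrN ger0_norm ?cabs_ge0 // => hn.
  by rewrite /= distrC -PB; apply: le_trans (Ple _) hn.
 - exact: hi.
 - apply: filterS hle => x hx n Dx; rewrite abse_EFin lee_fin.
  by apply: le_trans (Ple _) (hx _ Dx).
 split=> //; have fin := integrable_fin_num mD i1.
 by rewrite /Rintegral; apply: fine_cvg; rewrite fineK.
have [r1 r2] := part _ (@Re_le_cabs R) (fun z w => raddfB _ z w) (fun n => (mf_ n).1) mf.1.
have [s1 s2] := part _ (@Im_le_cabs R) (fun z w => raddfB _ z w) (fun n => (mf_ n).2) mf.2.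
split; first by split.
apply: (@squeeze_cvgr _ _ _ _ (fun=> 0)
 (fun n => `|\int[mu]_(x in D) complex.Re (f_ n x) - \int[mu]_(x in D) complex.Re (f x)| +
  `|\int[mu]_(x in D) complex.Im (f_ n x) - \int[mu]_(x in D) complex.Im (f x)|)).
- near=> n; rewrite cabs_ge0 /=; have := cabs_le_ReIm (cintegral mu D (f_ n) - cintegral mu D f).
 by rewrite !raddfB.
- exact: cvg_cst.
- rewrite -(addr0 0); apply: cvgD.
  by apply/norm_cvg0P/subr_cvg0.
 by apply/norm_cvg0P/subr_cvg0.
Unshelve. all: by end_near. Qed.

Lemma ae_eq_cintegral f g : cmeasurable D f -> cmeasurable D g ->
 {ae mu, forall x, D x -> f x = g x} -> cintegral mu D f = cintegral mu D g.
Proof.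
move=> [f1 f2] [g1 g2] fg; rewrite /cintegral /Rintegral; congr (fine _ +i* fine _).
 apply: ae_eq_integral => //; [exact/measurable_EFinP|exact/measurable_EFinP|].
 by apply: filterS fg => x hx Dx; rewrite hx.
apply: ae_eq_integral => //; [exact/measurable_EFinP|exact/measurable_EFinP|].
by apply: filterS fg => x hx Dx; rewrite hx.
Qed.

End ComplexIntegrals.

(** * Fubini on rectangles *)

Section ProductIntegrals.
Context {R : realType} d1 d2 (X : measurableType d1) (Y : measurableType d2).
Variables (m1 : {sigma_finite_measure set X -> \bar R}) (m2 : {sigma_finite_measure set Y -> \bar R}).
Variables (A : set X) (B : set Y) (mA : measurable A) (mB : measurable B).
Local Notation m12 := (m1 \x m2)%E.

Let mAB : measurable (A `*` B). Proof. exact: measurableX. Qed.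

Lemma restrict_section (g : X * Y -> \bar R) (y : Y) :
 (fun x => (g \_ (A `*` B)) (x, y)) = if y \in B then (fun x => g (x, y)) \_ A else cst 0%E.
Proof.
apply/funext => x; rewrite /patch in_setX /=; case: (y \in B); last by rewrite andbF.
by rewrite andbT.
Qed.

Lemma integral_section (g : X * Y -> \bar R) :
 (fun y => \int[m1]_x (g \_ (A `*` B)) (x, y))%E = (fun y => \int[m1]_(x in A) g (x, y))%E \_ B.
Proof.
apply/funext => y; rewrite restrict_section /patch; case: (y \in B).
 by rewrite [RHS]integral_mkcond.
by rewrite integral0.
Qed.

Lemma tonelli_set (h : X * Y -> R) : measurable_fun (A `*` B) h -> (forall z, 0 <= h z) ->
 (measurable_fun B (fun y => \int[m1]_(x in A) (h (x, y))%:E) /\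
 \int[m12]_(z in A `*` B) (h z)%:E = \int[m2]_(y in B) \int[m1]_(x in A) (h (x, y))%:E)%E.
Proof.
move=> mh h0; set g := EFin \o h.
have mg : measurable_fun setT (g \_ (A `*` B)).
 by apply/(measurable_restrictT _ mAB); exact/measurable_EFinP.
have g0 z : (0 <= (g \_ (A `*` B)) z)%E by apply: erestrict_ge0 => w _; rewrite lee_fin.
have T1 := @fubini_tonelli1 _ _ X Y R m1 m2 _ mg g0.
have T2 := @fubini_tonelli _ _ X Y R m1 m2 _ mg g0.
have M := @measurable_fun_fubini_tonelli_G _ _ X Y R m1 _ mg g0.
rewrite /fubini_G integral_section in M; split; first by move/(measurable_restrictT _ mB): M.
rewrite integral_mkcond T1 T2 /fubini_G integral_section -integral_mkcond //.
Qed.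

Lemma fubini_set_real (h : X * Y -> R) : m12.-integrable (A `*` B) (EFin \o h) ->
 [/\ {ae m2, forall y, B y -> m1.-integrable A (fun x => (h (x, y))%:E)},
   m2.-integrable B (fun y => (\int[m1]_(x in A) h (x, y))%:E) &
   \int[m12]_(z in A `*` B) h z = \int[m2]_(y in B) \int[m1]_(x in A) h (x, y)].
Proof.
set g := EFin \o h => ih.
have ig : m12.-integrable setT (g \_ (A `*` B)) by exact/(integrable_mkcond _ mAB).
have mg := measurable_int _ ig.
have M : measurable_fun setT (fubini_G m1 (g \_ (A `*` B))) by exact: (@measurable_fubini_G _ _ X Y R m1 m2).
have iG : m2.-integrable setT (fubini_G m1 (g \_ (A `*` B))).
 apply/integrableP; split => //; apply: le_lt_trans ((integrable21ltyP m1 m2 mg).1 ig).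
 apply: ge0_le_integral => //; first exact: measurableT_comp.
  apply: (@measurable_fun_fubini_tonelli_G _ _ X Y R m1 (abse \o (g \_ (A `*` B)))) => //=.
  exact: measurableT_comp.
 move=> y _; apply: le_abse_integral => //; exact: measurableT_comp mg _.
have ae : {ae m2, forall y, B y -> m1.-integrable A (fun x => (h (x, y))%:E)}.
 have := ae_integrable2 ig; apply: filterS => y hy By.
 by move: hy; rewrite restrict_section mem_set // => /(integrable_mkcond _ mA).
have iB : m2.-integrable B (fun y => \int[m1]_(x in A) (h (x, y))%:E)%E.
 by move: iG; rewrite /fubini_G integral_section => /(integrable_mkcond _ mB).
have aeE : ae_eq m2 B (fun y => \int[m1]_(x in A) (h (x, y))%:E)%E
  (fun y => (\int[m1]_(x in A) h (x, y))%:E).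
 apply: filterS ae => y hy By; have {}hy := hy By.
 by rewrite /Rintegral fineK //; exact: integrable_fin_num hy.
have mB2 : measurable_fun B (fun y => (\int[m1]_(x in A) h (x, y))%:E).
 by apply/measurable_EFinP; exact: (measurableT_comp (fine_measurable measurableT) (measurable_int _ iB)).
split=> //.
 have [_ fin] := integrableP _ _ _ iB; apply/integrableP; split => //.
 rewrite (ae_eq_integral (fun y => `|\int[m1]_(x in A) (h (x, y))%:E|)%E) //.
 - exact: measurableT_comp.
 - by apply: measurableT_comp => //; exact: measurable_int iB.
 - by apply: filterS aeE => y hy By; rewrite hy.
congr fine; rewrite -(@ae_eq_integral _ _ _ m2 B _ _ mB (measurable_int _ iB) mB2 aeE).
rewrite integral_mkcond -(integral21_prod_meas1 ig) /fubini_G integral_section.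
by rewrite -integral_mkcond.
Qed.

Lemma fubini_set (f : X * Y -> R[i]) : cintegrable m12 (A `*` B) f ->
 [/\ {ae m2, forall y, B y -> cintegrable m1 A (fun x => f (x, y))},
   cintegrable m2 B (fun y => cintegral m1 A (fun x => f (x, y))) &
   cintegral m12 (A `*` B) f = cintegral m2 B (fun y => cintegral m1 A (fun x => f (x, y)))].
Proof.
move=> [/fubini_set_real[a1 b1 c1] /fubini_set_real[a2 b2 c2]]; split.
- by apply: filterS2 a1 a2 => y h1 h2 By; split; [exact: h1|exact: h2].
- by split.
- by rewrite /cintegral c1 c2.
Qed.

(** Tonelli for the indicator of the exceptional set, whose slices are null. *)
Lemma ae_section (P : X * Y -> Prop) : measurable ((A `*` B) `&` [set z | ~ P z]) ->
 {ae m2, forall y, B y -> {ae m1, forall x, A x -> P (x, y)}} ->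
 {ae m12, forall z, (A `*` B) z -> P z}.
Proof.
set N := _ `&` _ => mN hP; exists N; split => //; last first.
 by move=> z /= /not_implyP[h1 h2].
have NAB : N `<=` A `*` B by move=> z [].
rewrite -(setIidl NAB) -integral_indic //.
have mi : measurable_fun setT (\1_N : X * Y -> R) by exact: measurable_indic.
have [mI ->] := @tonelli_set (\1_N) (measurable_funTS mi) (fun z => ltac:(by [])).
rewrite (ae_eq_integral (cst 0%E)) ?integral0 //.
apply: filterS hP => y hy By.
rewrite (ae_eq_integral (cst 0%E)) ?integral0 //.
 by apply: measurable_funTS; apply/measurable_EFinP; exact: measurableT_comp.
apply: filterS (hy By) => x hx Ax; rewrite indicE memNset // => -[_ /=]; apply; exact: hx.
Qed.

End ProductIntegrals.

(** * Complete systems and their products *)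

Section Completeness.
Context {R : realType}.

Definition complete_system d (T : measurableType d) (mu : {measure set T -> \bar R})
  (D : set T) (I : Type) (e : I -> T -> R[i]) : Prop :=
 forall f, cintegrable mu D f ->
  (forall i, cintegral mu D (fun x => f x * e i x) = 0) ->
  {ae mu, forall x, D x -> f x = 0}.

(** For fixed i the coefficient in x is an integrable function of y with vanishing coefficients, so
    it is 0 for almost every y. Countability of the index set gives one null set for all i, off
    which completeness in x applies to the slice. *)
Lemma complete_prod d1 d2 (X : measurableType d1) (Y : measurableType d2)
  (m1 : {sigma_finite_measure set X -> \bar R}) (m2 : {sigma_finite_measure set Y -> \bar R})
  (A : set X) (B : set Y) (I : countType) (K : Type)
  (e1 : I -> X -> R[i]) (e2 : K -> Y -> R[i]) :
 measurable A -> measurable B ->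
 (forall i, cmeasurable setT (e1 i)) -> (forall i x, cabs (e1 i x) = 1) ->
 (forall k, cmeasurable setT (e2 k)) -> (forall k y, cabs (e2 k y) = 1) ->
 complete_system m1 A e1 -> complete_system m2 B e2 ->
 complete_system (m1 \x m2)%E (A `*` B) (fun ik z => e1 ik.1 z.1 * e2 ik.2 z.2).
Proof.
move=> mA mB me1 n1 me2 n2 c1 c2 f fi h0.
have mAB : measurable (A `*` B) by exact: measurableX.
have me1' i : cmeasurable setT (fun z : X * Y => e1 i z.1).
 by have [r1 r2] := me1 i; split; [exact: (measurableT_comp r1)|exact: (measurableT_comp r2)].
have me2' k : cmeasurable setT (fun z : X * Y => e2 k z.2).
 by have [r1 r2] := me2 k; split; [exact: (measurableT_comp r1)|exact: (measurableT_comp r2)].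
have fe1 i : cintegrable (m1 \x m2)%E (A `*` B) (fun z => f z * e1 i z.1).
 apply: (cintegrableM mAB (K := 1) fi); first exact: cmeasS (me1' i).
 by move=> z _; rewrite n1.
have ae1 i : {ae m2, forall y, B y -> cintegral m1 A (fun x => f (x, y) * e1 i x) = 0}.
 have [_ iB _] := fubini_set mA mB (fe1 i).
 apply: (c2 (fun y => cintegral m1 A (fun x => f (x, y) * e1 i x)) iB) => k.
 have fe12 : cintegrable (m1 \x m2)%E (A `*` B) (fun z => f z * e1 i z.1 * e2 k z.2).
  apply: (cintegrableM mAB (K := 1) (fe1 i)); first exact: cmeasS (me2' k).
  by move=> z _; rewrite n2.
 have [_ _ E] := fubini_set mA mB fe12.
 have := h0 (i, k); rewrite (eq_cintegral _ (g := fun z => f z * e1 i z.1 * e2 k z.2)); last first.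
  by move=> z _ /=; rewrite mulrA.
 rewrite E => <-.
 have [aei _ _] := fubini_set mA mB (fe1 i).
 have [_ iB2 _] := fubini_set mA mB fe12.
 apply: (ae_eq_cintegral mB _ (cint_meas iB2)).
  by apply: cmeasM; [exact: cint_meas iB|exact: cmeasS (me2 k)].
 by apply: filterS aei => y hy By; rewrite -cintegralZ //; exact: hy.
have mf := cint_meas fi.
have mP : measurable ((A `*` B) `&` [set z | ~ f z = 0]).
 have := cmeas_cabs mf; move=> /(_ mAB [set~ 0]) /(_ ltac:(exact: measurableC)).
 congr (measurable _); apply/seteqP; split=> z /= [ABz h]; split => //.
  by move=> e; apply: h; rewrite e cabs0.
 by move=> e; apply: h; exact: cabs0_eq0.
apply: (ae_section mA mB mP).
have [aef _ _] := fubini_set mA mB fi.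
have aeI : {ae m2, forall y, forall i, B y -> cintegral m1 A (fun x => f (x, y) * e1 i x) = 0}.
 pose P (n : nat) (y : Y) := if unpickle n is Some i then
  B y -> cintegral m1 A (fun x => f (x, y) * e1 i x) = 0 else True.
 have : {ae m2, forall y, forall n, P n y}.
  apply/ae_foralln => n; rewrite /P; case: (unpickle n) => [i|]; first exact: ae1.
  exact: aeW.
 by apply: filterS => y hy i; have := hy (pickle i); rewrite /P pickleK.
by apply: filterS2 aef aeI => y h1 h2 By; apply: (c1 (fun x => f (x, y))) => [|i]; [exact: h1|exact: h2].
Qed.

End Completeness.

(** * Uniqueness of Fourier coefficients in one variable *)

Section OneDimension.
Context {R : realType}.
Local Notation leb := (@lebesgue_measure R).

Definition ch1 (k : int) (t : mR R) : R[i] := expi (t * k%:~R).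

Lemma cabs_ch1 k t : cabs (ch1 k t) = 1. Proof. exact: cabs_expi. Qed.

Lemma ch1D k l t : ch1 (k + l) t = ch1 k t * ch1 l t.
Proof. by rewrite /ch1 intrD mulrDr expiD. Qed.

Lemma ch1_0 t : ch1 0 t = 1.
Proof. by rewrite /ch1 mulr0 expi0. Qed.

Lemma cont_ch1 k : continuous (fun t : R => cos (t * k%:~R)) /\ continuous (fun t : R => sin (t * k%:~R)).
Proof.
by split=> t; apply: continuous_comp; try exact: mulrr_continuous;
 [exact: continuous_cos|exact: continuous_sin].
Qed.

Lemma cmeas_ch1 k : @cmeasurable R _ (mR R) setT (ch1 k).
Proof. by have [c1 c2] := cont_ch1 k; split; exact: continuous_measurable_fun. Qed.

Definition I2pi : set (mR R) := `[0, 2 * pi[%classic.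

Lemma pi2_gt0 : 0 < 2 * pi :> R. Proof. by rewrite mulr_gt0 ?pi_gt0. Qed.

Lemma leb_I2pi : leb I2pi = (2 * pi)%:E.
Proof. by rewrite /I2pi lebesgue_measure_itv /= lte_fin pi2_gt0 oppr0 adde0. Qed.

Lemma is_derive_scal (k t : R) : is_derive t 1 (fun t : R => t * k) k.
Proof.
have := @is_deriveZ R R R id k t 1 1 (is_derive_id t 1).
rewrite (_ : k \*: id = (fun t => t * k)); first by rewrite /GRing.scale /= mulr1.
by apply/funext => x; rewrite /GRing.scale /= mulrC.
Qed.

Lemma ftc_I2pi (f F : R -> R) : continuous f -> (forall t : R, is_derive (t : R) (1 : R) F (f t)) ->
 \int[leb]_(t in I2pi) f t = F (2 * pi) - F 0.
Proof.
move=> cf dF; rewrite /I2pi Rintegral_itv_bndo_bndc.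
 have dd x : derivable F x 1 by have [] := dF x.
 have cF x : {for x, continuous F} by apply: differentiable_continuous; exact/derivable1_diffP.
 rewrite /Rintegral (@continuous_FTC2 R f F) //; first exact: pi2_gt0.
 - exact: continuous_subspaceT.
 - by split=> //; [apply: cvg_at_right_filter; exact: cF|apply: cvg_at_left_filter; exact: cF].
 - by move=> x _; rewrite derive1E; have [] := dF x.
apply: (@integrableS _ (mR R) R leb `[0, 2 * pi]%classic) => //; first by move=> x /=; rewrite !in_itv /= => /andP[-> /ltW].
by apply: continuous_compact_integrable; [exact: segment_compact|exact: continuous_subspaceT].
Qed.

Lemma cintegral_ch1 k : cintegral leb I2pi (ch1 k) = if k == 0 then (2 * pi)%:C else 0.
Proof.
case: eqP => [->|/eqP k0].
 rewrite (eq_cintegral _ (g := fun=> 1)) => [|t _]; last exact: ch1_0.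
 rewrite /cintegral !Rintegral_cst; try exact: measurable_itv.
 by rewrite [X in fine X]leb_I2pi /= mul1r mul0r.
have kR : (k%:~R : R) != 0 by rewrite intr_eq0.
have [c1 c2] := cont_ch1 k.
have d1 (t : R) : is_derive (t : R) (1 : R) (fun t => sin (t * k%:~R) / k%:~R) (cos (t * k%:~R)).
 have h := @is_derive1_comp _ sin (fun t => t * k%:~R) t _ _ (is_derive_sin _) (is_derive_scal _ _).
 have := @is_deriveZ R R R _ (k%:~R)^-1 t 1 _ h.
 rewrite (_ : _ \*: _ = (fun t => sin (t * k%:~R) / k%:~R)); last by apply/funext => x; rewrite mulrC.
 by rewrite /GRing.scale /= mulrCA mulVf // mulr1.
have d2 (t : R) : is_derive (t : R) (1 : R) (fun t => - cos (t * k%:~R) / k%:~R) (sin (t * k%:~R)).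
 have h := @is_derive1_comp _ cos (fun t => t * k%:~R) t _ _ (is_derive_cos _) (is_derive_scal _ _).
 have := @is_deriveZ R R R _ (- (k%:~R)^-1) t 1 _ h.
 rewrite (_ : _ \*: _ = (fun t => - cos (t * k%:~R) / k%:~R)); last first.
  apply/funext => x; change (- (k%:~R)^-1 * cos (x * k%:~R) = - cos (x * k%:~R) / k%:~R); ring.
 by rewrite /GRing.scale /= !mulNr !mulrN opprK mulrCA mulVf // mulr1.
rewrite /cintegral /ch1 /expi /= (ftc_I2pi c1 d1) (ftc_I2pi c2 d2).
have := expi_2pi_int (R := R) k; rewrite /expi => -[-> ->].
by rewrite !mul0r sin0 cos0 !mul0r !subrr.
Qed.

Definition trigpoly (p : R -> R[i]) : Prop := exists r : seq (int * R[i]),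
 forall t, p t = \sum_(q <- r) q.2 * ch1 (- q.1) t.

Lemma trigpoly_cst c : trigpoly (fun=> c).
Proof. by exists [:: (0, c)] => t; rewrite big_seq1 oppr0 ch1_0 mulr1. Qed.

Lemma trigpolyD p q : trigpoly p -> trigpoly q -> trigpoly (fun t => p t + q t).
Proof. by move=> [r rE] [s sE]; exists (r ++ s) => t; rewrite big_cat rE sE. Qed.

Lemma trigpolyM p q : trigpoly p -> trigpoly q -> trigpoly (fun t => p t * q t).
Proof.
move=> [r rE] [s sE]; exists [seq (x.1 + y.1, x.2 * y.2) | x <- r, y <- s] => t.
rewrite big_allpairs_dep rE sE big_distrl /=; apply: eq_bigr => x _.
rewrite big_distrr /=; apply: eq_bigr => y _.
by rewrite opprD ch1D; ring.
Qed.

Lemma trigpolyX p n : trigpoly p -> trigpoly (fun t => p t ^+ n).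
Proof.
move=> hp; elim: n => [|n ih]; first exact: trigpoly_cst.
by under eq_fun do rewrite exprS; exact: trigpolyM.
Qed.

Lemma trigpolyB p q : trigpoly p -> trigpoly q -> trigpoly (fun t => p t - q t).
Proof.
move=> hp hq; apply: trigpolyD => //.
under eq_fun do rewrite -mulN1r; apply: trigpolyM => //; exact: trigpoly_cst.
Qed.

Lemma trigpoly_cos x0 : trigpoly (fun t => (cos (t - x0))%:C).
Proof.
exists [:: (-1, expi (- x0) / 2%:R); (1, expi x0 / 2%:R)] => t.
rewrite big_cons big_seq1 /= opprK /ch1 mulr1 mulrN1.
rewrite mulrAC -expiD mulrAC -expiD -mulrDl (_ : x0 + - t = - (t - x0)) ?(addrC (- x0)); last by ring.
by rewrite expiN; apply/eqP; rewrite eq_complex /expi /=; apply/andP; split; apply/eqP; field.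
Qed.

Lemma trigpoly_integral f p : cintegrable leb I2pi f -> trigpoly p ->
 (forall k, cintegral leb I2pi (fun t => f t * ch1 (- k) t) = 0) ->
 cintegral leb I2pi (fun t => f t * p t) = 0.
Proof.
move=> fi [r rE] h0; have mI : @measurable _ (mR R) I2pi by exact: measurable_itv.
move: f fi h0 => f fi h0.
have fk k : cintegrable leb I2pi (fun t => f t * ch1 k t).
 apply: (cintegrableM mI (K := 1) fi); first exact: cmeasS (cmeas_ch1 k).
 by move=> t _; rewrite cabs_ch1.
rewrite (eq_cintegral _ (g := fun t => \sum_(q <- r) f t * ch1 (- q.1) t * q.2)); last first.
 by move=> t _; rewrite rE big_distrr /=; apply: eq_bigr => q _; ring.
rewrite cintegral_sum // => [|q]; last exact: cintegrableZ.
by rewrite big1 // => q _; rewrite cintegralZ // h0 mul0r.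
Qed.

(* [step_approx z n] tends to 1 for z > 1/2 and to 0 for z < 1/2: both bounds
  are Bernoulli's inequality. *)
Definition step_approx (z : R) (n : nat) : R := 1 - (1 - z ^+ n) ^+ (2 ^ n).

Lemma step_approx_bounds (z : R) n : 0 <= z <= 1 ->
 1 - (2 * z) ^+ n <= (1 - z ^+ n) ^+ (2 ^ n) /\
 (1 - z ^+ n) ^+ (2 ^ n) * (1 + (2 * z) ^+ n) <= 1.
Proof.
move=> /andP[z0 z1]; set x := z ^+ n; have x0 : 0 <= x by rewrite exprn_ge0.
have x1 : x <= 1 by rewrite exprn_ile1.
have e : (2 * z) ^+ n = (2 ^ n)%:R * x by rewrite exprMn natrX.
have bern m : 1 - m%:R * x <= (1 - x) ^+ m.
 elim: m => [|m ih]; first by rewrite mul0r subr0 expr0.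
 rewrite exprS; apply: le_trans (ler_wpM2l _ ih); last by lra.
 rewrite -natr1; have : 0 <= m%:R * x * x by rewrite !mulr_ge0.
 lra.
have bern2 m : 1 + m%:R * x <= (1 + x) ^+ m.
 elim: m => [|m ih]; first by rewrite mul0r addr0 expr0.
 rewrite exprS; apply: le_trans (ler_wpM2l _ ih); last by lra.
 rewrite -natr1; have : 0 <= m%:R * x * x by rewrite !mulr_ge0.
 lra.
split; rewrite e; first exact: bern.
apply: (le_via ((1 - x) ^+ (2 ^ n) * (1 + x) ^+ (2 ^ n))).
 by rewrite ler_wpM2l ?bern2 // exprn_ge0; lra.
rewrite -exprMn exprn_ile1 //; last by nra.
by apply: mulr_ge0; lra.
Qed.

Lemma step_approx01 z n : 0 <= z <= 1 -> 0 <= step_approx z n <= 1.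
Proof.
move=> /andP[z0 z1]; have x0 : 0 <= z ^+ n by rewrite exprn_ge0.
have x1 : z ^+ n <= 1 by rewrite exprn_ile1.
have : 0 <= (1 - z ^+ n) ^+ (2 ^ n) by rewrite exprn_ge0; lra.
have : (1 - z ^+ n) ^+ (2 ^ n) <= 1 by rewrite exprn_ile1; lra.
by rewrite /step_approx => *; apply/andP; split; lra.
Qed.

Lemma step_approx_cvg z : 0 <= z <= 1 -> z != 2^-1 ->
 step_approx z n @[n --> \oo] --> ((2^-1 < z)%R%:R : R).
Proof.
move=> z01 zh; have [z0 z1] := andP z01.
have [hz|hz] := ltP 2^-1 z.
 have q1 : `|(2 * z)^-1| < 1.
  by rewrite ger0_norm ?invr_ge0 ?mulr_ge0 // invf_lt1; lra.
 have lim := cvg_expr q1.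
 apply: (@squeeze_cvgr _ _ _ _ (fun n => 1 - (2 * z)^-1 ^+ n) (fun=> 1)).
 - near=> n; have [_ h2] := step_approx_bounds n z01; have := step_approx01 n z01.
  move=> /andP[_ ->]; rewrite andbT /step_approx lerD2l lerN2 exprVn.
  have p : 0 < (2 * z) ^+ n by rewrite exprn_gt0 //; lra.
  rewrite -[leRHS]mul1r ler_pdivlMr //; apply: le_trans h2; apply: ler_wpM2l.
   rewrite exprn_ge0 // subr_ge0 exprn_ile1 //; lra.
  by lra.
 - by rewrite -[X in _ --> X]subr0; apply: cvgB => //; exact: cvg_cst.
 - exact: cvg_cst.
have {}hz : z < 2^-1 by rewrite lt_neqAle zh.
have q1 : `|2 * z| < 1 by rewrite ger0_norm; lra.
have lim := cvg_expr q1.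
apply: (@squeeze_cvgr _ _ _ _ (fun=> 0) (fun n => (2 * z) ^+ n)) => //; last exact: cvg_cst.
near=> n; have [h1 _] := step_approx_bounds n z01; have := step_approx01 n z01.
by move=> /andP[-> _]; rewrite /step_approx; lra.
Unshelve. all: by end_near. Qed.

(** Describes an arc of the circle through the cosine, so that its indicator can be approximated by
    polynomials in a cosine. *)
Lemma cos_arc (al s : R) : 0 < al < pi -> - al <= s < 2 * pi - al ->
 (cos al < cos s) = (s < al) && (- al < s) /\ (cos s = cos al -> s = al \/ s = - al).
Proof.
move=> /andP[a0 api] /andP[s1 s2].
have ain : al \in `[0, pi] by rewrite in_itv /= !ltW.
have key s' : s' \in `[0, pi] -> cos s' = cos s ->
  (cos al < cos s) = (s' < al) /\ (cos s = cos al -> s' = al).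
 by move=> h e; rewrite -e ltr_cos //; split=> // /cos_inj; exact.
have [s0|s0] := ltP s 0.
 have [] := key (- s); rewrite ?cosN ?in_itv //=; first by apply/andP; split; lra.
 move=> -> e; split; last by move=> /e; lra.
 by apply/idP/andP => [h|[h1 h2]]; [split; lra|lra].
have [sp|sp] := leP s pi.
 have [] := key s; rewrite ?in_itv //=; first by apply/andP; split; lra.
 move=> -> e; split; last by move=> /e; lra.
 by apply/idP/andP => [h|[h1 h2]]; [split; lra|lra].
have [] := key (2 * pi - s).
- by rewrite in_itv /=; apply/andP; split; lra.
- by rewrite -cosN opprB -(cosD2pi (s - 2 * pi)); congr cos; rewrite -mulr_natl; lra.
move=> -> e; split; last by move=> /e; lra.
by apply/idP/andP => [h|[h1 h2]]; [split; lra|lra].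
Qed.

Lemma ae_neq (x : mR R) : {ae leb, forall t, t <> x}.
Proof.
exists [set x]; split; first exact: measurable_set1.
 exact: lebesgue_measure_set1.
by move=> t /= /contrapT.
Qed.

(** The cosine centred at x/2 is rescaled to [z] in [0, 1] so that it exceeds 1/2 exactly on (0, x).
    Then [step_approx (z t) n] is a bounded sequence of trigonometric polynomials converging to the
    indicator of (0, x) off the two endpoints. *)
Lemma prefix_integral f x : cintegrable leb I2pi f ->
 (forall k, cintegral leb I2pi (fun t => f t * ch1 (- k) t) = 0) ->
 0 < x < 2 * pi ->
 cintegral leb I2pi (fun t => f t * ((0 < t < x)%R%:R)%:C) = 0.
Proof.
move=> fi h0 /andP[x0 x2]; have mI : @measurable _ (mR R) I2pi by exact: measurable_itv.
pose al := x / 2; have al0 : 0 < al < pi by apply/andP; split; rewrite /al; lra.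
pose z (t : R) := 2^-1 + (cos (t - al) - cos al) / 4.
have z01 t : 0 <= z t <= 1.
 have := cos_le1 (t - al); have := cos_geN1 (t - al).
 have := cos_le1 al; have := cos_geN1 al.
 by move=> *; apply/andP; split; rewrite /z; lra.
pose p n (t : mR R) : R[i] := (step_approx (z t) n)%:C.
have tp n : trigpoly (p n).
 have tz : trigpoly (fun t => (z t)%:C).
  rewrite (_ : (fun t => _) = (fun t => (2^-1 - cos al / 4)%:C + (cos (t - al))%:C * (4^-1)%:C)).
   apply: trigpolyD; first exact: trigpoly_cst.
   by apply: trigpolyM; [exact: trigpoly_cos|exact: trigpoly_cst].
  by apply/funext => t; rewrite -rmorphM -rmorphD /=; congr (_%:C); rewrite /z; lra.
 rewrite (_ : p n = fun t => 1 - (1 - (z t)%:C ^+ n) ^+ (2 ^ n)).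
  do 2?[apply: trigpolyB; first exact: trigpoly_cst]; apply: trigpolyX.
  by apply: trigpolyB; [exact: trigpoly_cst|exact: trigpolyX].
 by apply/funext => t; rewrite /p /step_approx rmorphB rmorph1 rmorphXn rmorphB rmorph1 rmorphXn.
have ip n : cintegral leb I2pi (fun t => f t * p n t) = 0 by exact: trigpoly_integral.
have mf := cint_meas fi.
have mz : @measurable_fun _ _ (mR R) R I2pi z.
 apply: measurable_funTS; apply: continuous_measurable_fun => t.
 apply: cvgD; first exact: cvg_cst.
 apply: cvgM; last exact: cvg_cst.
 apply: cvgB; last exact: cvg_cst.
 by apply: continuous_comp; [apply: cvgB; [exact: cvg_id|exact: cvg_cst]|exact: continuous_cos].
have mp n : cmeasurable I2pi (p n).
 apply: cmeas_real; rewrite /step_approx; apply: measurable_funB; first exact: measurable_cst.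
 by apply: measurable_funX; apply: measurable_funB; [exact: measurable_cst|exact: measurable_funX].
have mi : cmeasurable I2pi (fun t => ((0 < t < x)%R%:R)%:C : R[i]).
 apply: cmeas_real; rewrite (_ : (fun t => _) = \1_(`]0, x[%classic)).
  by apply: measurable_funTS; apply: measurable_indic; exact: measurable_itv.
 by apply/funext => t; rewrite indicE mem_setE in_itv.
have [||||| _] := @cdominated R _ _ leb I2pi mI (fun n t => f t * p n t)
  (fun t => f t * ((0 < t < x)%R%:R)%:C) (fun t => cabs (f t)).
- by move=> n; exact: cmeasM.
- exact: cmeasM.
- have := ae_neq 0; have := ae_neq x; apply: filterS2 => t tx t0 It.
 have /andP[t1 t2] : 0 <= t < 2 * pi by move: It; rewrite /I2pi /= in_itv.
 have [] := @cos_arc al (t - al) al0; first by apply/andP; split; rewrite /al; lra.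
 move=> c1 c2.
 have zh : z t != 2^-1.
  apply/eqP => e; have : cos (t - al) = cos al by move: e; rewrite /z; lra.
  by move=> /c2 []; rewrite /al => h; [apply: tx; lra|apply: t0; lra].
 have ez : (2^-1 < z t) = (0 < t < x).
  have -> : (2^-1 < z t) = (cos al < cos (t - al)) by rewrite /z; apply/idP/idP; lra.
  by rewrite c1; apply/andP/andP => -[h1 h2]; split; rewrite /al in h1 h2 *; lra.
 have lim := step_approx_cvg (z01 t) zh; rewrite ez in lim.
 rewrite (_ : (fun n => _) = (fun n => cabs (f t) * `|step_approx (z t) n - (0 < t < x)%R%:R|)); last first.
  by apply/funext => n; rewrite -mulrBr cabsM -rmorphB cabs_real.
 rewrite -[X in _ --> X](mulr0 (cabs (f t))); apply: cvgM; first exact: cvg_cst.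
 by apply/norm_cvg0P; apply/subr_cvg0.
- exact: cintegrable_cabs.
- apply: aeW => t n It; rewrite cabsM cabs_real.
 have /andP[a1 a2] := step_approx01 n (z01 t).
 by rewrite ger0_norm // ler_piMr ?cabs_ge0.
under eq_fun do rewrite ip sub0r cabsN.
move=> /(cvg_lim (@norm_hausdorff _ _)); rewrite lim_cst; last exact: norm_hausdorff.
exact: cabs0_eq0.
Qed.

(** All integrals over (0, x) vanish by [prefix_integral]; differentiating in x at Lebesgue points
    gives the function itself, for the real and imaginary parts separately. *)
Lemma complete1 : complete_system leb I2pi (fun (k : int) t => ch1 (- k) t).
Proof.
move=> f fi h0; have mI : @measurable _ (mR R) I2pi by exact: measurable_itv.
have part (P : R[i] -> R) : (forall z (b : bool), P (z * (b%:R)%:C) = P z * b%:R) ->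
  leb.-integrable I2pi (EFin \o (P \o f)) ->
  (forall x, 0 < x < 2 * pi -> \int[leb]_(t in I2pi) P (f t * ((0 < t < x)%R%:R)%:C) = 0) ->
  {ae leb, forall t, I2pi t -> P (f t) = 0}.
 move=> PM iP Pz; pose g := (P \o f) \_ I2pi.
 have ig : leb.-integrable setT (EFin \o g).
  by rewrite /g -restrict_EFin; exact/(integrable_mkcond _ mI).
 pose F y := \int[leb]_(t in [set` Interval (BLeft 0) (BRight y)]) g t.
 have F0 y : 0 < y < 2 * pi -> F y = 0.
  move=> /andP[y0 y2]; rewrite -(Pz y) ?y0 ?y2 //.
  have sub (A : set (mR R)) : measurable A -> leb.-integrable A (EFin \o g).
   by move=> mA; exact: integrableS ig.
  rewrite /F -Rintegral_itv_obnd_cbnd; last by apply: sub; exact: measurable_itv.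
  rewrite -Rintegral_itv_bndo_bndc; last by apply: sub; exact: measurable_itv.
  transitivity (\int[leb]_(t in I2pi) (g \_ (`]0, y[%classic)) t); last first.
   apply: eq_Rintegral => t; rewrite inE => It; rewrite PM /g /patch mem_setE in_itv /= mem_set //=.
   by case: ifP => _; rewrite ?mulr1 ?mulr0.
  rewrite -[RHS]Rintegral_mkcondr (_ : I2pi `&` _ = `]0, y[%classic) //; apply/seteqP; split=> t /=.
   by case.
  by rewrite /I2pi /= !in_itv /= => /andP[a b]; split; apply/andP; split; lra.
 have loc : locally_integrable [set: R] g by apply: open_integrable_locally => //; exact: openT.
 have := @FTC1 R g (BLeft 0) (fun y => _) loc; rewrite -/F => /(_ ltac:(by move=> y; exact: integrableS ig)).
 have := ae_neq 0; apply: filterS2 => t t0 ht It.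
 have /andP[t1 t2] : 0 <= t < 2 * pi by move: It; rewrite /I2pi /= in_itv.
 have tp : 0 < t by rewrite lt_neqAle t1 andbT; apply/eqP => e; apply: t0.
 have lt0 : ((0 : R)%:E < (t : R)%:E)%E by rewrite lte_fin.
 have [_] := ht lt0.
 rewrite derive1E (@near_eq_derive _ _ _ F (cst 0)).
  by rewrite derive_cst /g /patch mem_set.
 near=> s; apply: F0; apply/andP; split; near: s.
  exact: lt_nbhsr.
 exact: lt_nbhsl.
have z x (hx : 0 < x < 2 * pi) := prefix_integral fi h0 hx.
have [f1 f2] := fi.
have r1 := part (@complex.Re R) _ f1 (fun x hx => congr1 (@complex.Re R) (z x hx)).
have r2 := part (@complex.Im R) _ f2 (fun x hx => congr1 (@complex.Im R) (z x hx)).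
have {}r1 := r1 ltac:(by move=> [a b] c /=; rewrite mulr0 subr0).
have {}r2 := r2 ltac:(by move=> [a b] c /=; rewrite mulr0 add0r).
apply: filterS2 r1 r2 => t h1 h2 It; apply/eqP; rewrite eq_complex /=.
by rewrite h1 // h2 // !eqxx.
Unshelve. all: by end_near. Qed.

End OneDimension.

Lemma cmeas_comp (R : realType) d d' (X : measurableType d) (Y : measurableType d') (f : Y -> R[i]) (g : X -> Y) :
 measurable_fun setT g -> cmeasurable setT f -> cmeasurable setT (f \o g).
Proof. by move=> mg [f1 f2]; split; [exact: (measurableT_comp f1)|exact: (measurableT_comp f2)]. Qed.

Section ProductMeasure.
Context {R : realType} d1 d2 (X : measurableType d1) (Y : measurableType d2).
Variables (m1 : {sigma_finite_measure set X -> \bar R}) (m2 : {sigma_finite_measure set Y -> \bar R}).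

(* The product measure under a new name: the library's own sigma-finite
  instance for it is shadowed by the one for subprobabilities. *)
Definition prodm : set (X * Y) -> \bar R := (m1 \x m2)%E.

HB.instance Definition _ := Measure.copy prodm (m1 \x m2)%E.

Lemma prodm_sigma_finite : sigma_finite setT prodm.
Proof.
have /sigma_finiteP[F [FT ndF hF]] := sigma_finiteT m1.
have /sigma_finiteP[G [GT ndG hG]] := sigma_finiteT m2.
exists (fun n => F n `*` G n) => [|n]; last first.
 have [mF F1] := hF n; have [mG G1] := hG n.
 split; first exact: measurableX.
 by rewrite /prodm product_measure1E // lte_mul_pinfty // ge0_fin_numE.
apply/seteqP; split=> // -[x y] _.
have [n _ Fx] : (\bigcup_n F n) x by rewrite -FT.
have [k _ Gy] : (\bigcup_n G n) y by rewrite -GT.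
exists (maxn n k) => //; split => /=.
 by apply: (subsetPset _ _ (ndF _ _ (leq_maxl n k))).
by apply: (subsetPset _ _ (ndG _ _ (leq_maxr n k))).
Qed.

HB.instance Definition _ := Measure_isSigmaFinite.Build _ _ _ prodm prodm_sigma_finite.

Lemma cintegral_prod (A : set X) (B : set Y) (f : X -> R[i]) (g : Y -> R[i]) :
 measurable A -> measurable B -> (m1 A < +oo)%E -> (m2 B < +oo)%E ->
 cmeasurable setT f -> cmeasurable setT g -> (forall x, cabs (f x) <= 1) -> (forall y, cabs (g y) <= 1) ->
 cintegral (m1 \x m2)%E (A `*` B) (fun z => f z.1 * g z.2) = cintegral m1 A f * cintegral m2 B g.
Proof.
move=> mA mB A1 B1 mf mg f1 g1.
have mAB : measurable (A `*` B) by exact: measurableX.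
have AB1 : ((m1 \x m2)%E (A `*` B) < +oo)%E.
 by rewrite product_measure1E // lte_mul_pinfty // ge0_fin_numE.
have one d (T : measurableType d) (mu : {measure set T -> \bar R}) (D : set T) (h : T -> R[i]) :
  measurable D -> (mu D < +oo)%E -> cmeasurable setT h -> (forall x, cabs (h x) <= 1) -> cintegrable mu D h.
 move=> mD D1 mh h1; apply: (cintegrable_le mD (h := cst 1)) => //; first exact: cmeasS mh.
 apply: measurable_bounded_integrable => //.
 by exists 1; split => // M hM y _; rewrite /= normr1; exact: ltW.
have fi := one _ _ m1 A f mA A1 mf f1; have gi := one _ _ m2 B g mB B1 mg g1.
have fgi : cintegrable (m1 \x m2)%E (A `*` B) (fun z => f z.1 * g z.2).
 apply: one => //.
  apply: cmeasM; [exact: (cmeas_comp measurable_fst mf)|exact: (cmeas_comp measurable_snd mg)].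
 by move=> z; rewrite cabsM mulr_ile1 ?cabs_ge0.
have [_ _ ->] := fubini_set mA mB fgi.
rewrite (eq_cintegral _ (g := fun y => g y * cintegral m1 A f)); last first.
 by move=> y _ /=; rewrite cintegralZ // mulrC.
by rewrite cintegralZ // mulrC.
Qed.

Lemma fin_prodX (A : set X) (B : set Y) : measurable A -> measurable B ->
 (m1 A < +oo)%E -> (m2 B < +oo)%E -> ((m1 \x m2)%E (A `*` B) < +oo)%E.
Proof. by move=> mA mB A1 B1; rewrite product_measure1E // lte_mul_pinfty // ge0_fin_numE. Qed.

End ProductMeasure.

(** * Fourier series on the four-dimensional torus *)

Section TorusFourier.
Context {R : realType}.
Local Notation leb := (@lebesgue_measure R).
Local Notation I := (@I2pi R).

Definition mu1 : {sigma_finite_measure set (mR R) -> \bar R} := leb.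

Definition mu4 : {sigma_finite_measure set (pt4 R) -> \bar R} :=
 prodm (prodm (prodm mu1 mu1) mu1) mu1.

Lemma mI2pi : @measurable _ (mR R) I. Proof. exact: measurable_itv. Qed.

Lemma mbox : measurable (@box R).
Proof. by do 3?[apply: measurableX]; exact: mI2pi. Qed.

Definition ch4 (k : Z4) (x : pt4 R) : R[i] := expi (dot x k).

Lemma cabs_ch4 k x : cabs (ch4 k x) = 1. Proof. exact: cabs_expi. Qed.

Lemma ch4E k x : ch4 k x = ch1 k.1.1.1 x.1.1.1 * ch1 k.1.1.2 x.1.1.2 * ch1 k.1.2 x.1.2 * ch1 k.2 x.2.
Proof. by rewrite /ch4 /dot !expiD. Qed.

Lemma ch4D k l x : ch4 (k + l) x = ch4 k x * ch4 l x.
Proof. by rewrite !ch4E /= !ch1D; ring. Qed.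

Lemma ch4N k x : ch4 (- k) x = ((ch4 k x)^*)%C.
Proof. by rewrite /ch4 -expiN /dot /= !rmorphN /=; congr expi; ring. Qed.

Lemma ch4_0 x : ch4 0 x = 1.
Proof. by rewrite ch4E /= !ch1_0 !mul1r. Qed.

Lemma cmeas_ch4 k : cmeasurable setT (ch4 k).
Proof.
rewrite (_ : ch4 k = fun x => ch1 k.1.1.1 x.1.1.1 * ch1 k.1.1.2 x.1.1.2 * ch1 k.1.2 x.1.2 * ch1 k.2 x.2);
 last by apply/funext => x; exact: ch4E.
have p1 : measurable_fun setT (fun x : pt4 R => x.1.1.1).
 exact: (measurableT_comp measurable_fst (measurableT_comp measurable_fst measurable_fst)).
have p2 : measurable_fun setT (fun x : pt4 R => x.1.1.2).
 exact: (measurableT_comp measurable_snd (measurableT_comp measurable_fst measurable_fst)).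
have p3 : measurable_fun setT (fun x : pt4 R => x.1.2).
 exact: (measurableT_comp measurable_snd measurable_fst).
do 3?[apply: cmeasM].
- exact: (cmeas_comp p1 (cmeas_ch1 _)).
- exact: (cmeas_comp p2 (cmeas_ch1 _)).
- exact: (cmeas_comp p3 (cmeas_ch1 _)).
- exact: (cmeas_comp measurable_snd (cmeas_ch1 _)).
Qed.

Lemma cmeas_char k D : cmeasurable D (fun x : pt4 R => expi (- dot x k)).
Proof.
apply: (cmeas_eq (f := ch4 (- k))); first by move=> x _; rewrite ch4N /ch4 expiN.
exact: cmeasS (cmeas_ch4 _).
Qed.

Lemma fin_I2pi : (leb I < +oo)%E. Proof. by rewrite leb_I2pi ltry. Qed.

Lemma fin_box : (mu4 (@box R) < +oo)%E.
Proof. by do 3?[apply: fin_prodX; try exact: fin_I2pi; try exact: mI2pi]; do 2?[apply: measurableX]; exact: mI2pi. Qed.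

Lemma box_orth k : cintegral dx4 (@box R) (ch4 k) = if k == 0 then ((2 * pi) ^+ 4)%:C else 0.
Proof.
have c1 k' x : cabs (ch1 k' x) <= 1 :> R by rewrite cabs_ch1.
have m1 k' := @cmeas_ch1 R k'.
have p1 (k1 k2 : int) : cmeasurable setT (fun x : mR R * mR R => ch1 k1 x.1 * ch1 k2 x.2).
 by apply: cmeasM; [exact: (cmeas_comp measurable_fst (m1 _))|exact: (cmeas_comp measurable_snd (m1 _))].
have p2 (k1 k2 k3 : int) : cmeasurable setT
  (fun x : mR R * mR R * mR R => ch1 k1 x.1.1 * ch1 k2 x.1.2 * ch1 k3 x.2).
 by apply: cmeasM; [exact: (cmeas_comp measurable_fst (p1 _ _))|exact: (cmeas_comp measurable_snd (m1 _))].
have mI := mI2pi; have fI := fin_I2pi.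
have mI2 : measurable (I `*` I) by exact: measurableX.
have mI3 : measurable (I `*` I `*` I) by exact: measurableX.
have -> : cintegral dx4 (@box R) (ch4 k) = cintegral leb I (ch1 k.1.1.1) * cintegral leb I (ch1 k.1.1.2) *
  cintegral leb I (ch1 k.1.2) * cintegral leb I (ch1 k.2).
 rewrite (eq_cintegral _ (g := fun x => ch1 k.1.1.1 x.1.1.1 * ch1 k.1.1.2 x.1.1.2 * ch1 k.1.2 x.1.2 * ch1 k.2 x.2));
  last by move=> x _; exact: ch4E.
 rewrite -(cintegral_prod (m1 := mu1) (m2 := mu1)) // -(cintegral_prod (m1 := prodm mu1 mu1) (m2 := mu1)) //.
 - rewrite -(cintegral_prod (m1 := prodm (prodm mu1 mu1) mu1) (m2 := mu1)) //.
  + by do 2?[apply: fin_prodX].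
  + by move=> x; rewrite !cabsM !cabs_ch1 !mul1r.
 - exact: fin_prodX.
 - by move=> x; rewrite !cabsM !cabs_ch1 !mul1r.
have -> : (k == 0) = [&& k.1.1.1 == 0, k.1.1.2 == 0, k.1.2 == 0 & k.2 == 0].
 move: k => [[[a b] c] d] /=; apply/eqP/and4P => [[-> -> -> ->]|[/eqP -> /eqP -> /eqP -> /eqP ->] //].
 by rewrite eqxx.
rewrite !cintegral_ch1.
case: (_ == 0) => /=; last by rewrite !mul0r.
case: (_ == 0) => /=; last by rewrite mulr0 !mul0r.
case: (_ == 0) => /=; last by rewrite mulr0 mul0r.
case: (_ == 0) => /=; last by rewrite mulr0.
by rewrite rmorphXn /=; ring.
Qed.

Lemma box_complete (f : pt4 R -> R[i]) : cintegrable dx4 (@box R) f ->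
 (forall k, fourier f k = 0) -> {ae dx4, forall x, box x -> f x = 0}.
Proof.
move=> fi h0; have mI := mI2pi.
have c1 := @complete1 R; have m1 k := @cmeas_ch1 R (- k); have n1 k x := @cabs_ch1 R (- k) x.
have C2 := complete_prod (m1 := mu1) (m2 := mu1) mI mI m1 n1 m1 n1 c1 c1.
have n2 (i : int * int) (z : mR R * mR R) :
  cabs (ch1 (- i.1) z.1 * ch1 (- i.2) z.2) = 1 by rewrite cabsM !n1 mulr1.
have p2 (i : int * int) : cmeasurable setT
  (fun z : mR R * mR R => ch1 (- i.1) z.1 * ch1 (- i.2) z.2).
 by apply: cmeasM; [exact: (cmeas_comp measurable_fst (m1 _))|exact: (cmeas_comp measurable_snd (m1 _))].
have mI2 : measurable (I `*` I) by exact: measurableX.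
have C3 := complete_prod (m1 := prodm mu1 mu1) (m2 := mu1) mI2 mI p2 n2 m1 n1 C2 c1.
have mI3 : measurable (I `*` I `*` I) by exact: measurableX.
have n3 (i : int * int * int) (z : mR R * mR R * mR R) :
  cabs (ch1 (- i.1.1) z.1.1 * ch1 (- i.1.2) z.1.2 * ch1 (- i.2) z.2) = 1 by rewrite cabsM n2 n1 mulr1.
have p3 (i : int * int * int) : cmeasurable setT (fun z : mR R * mR R * mR R =>
  ch1 (- i.1.1) z.1.1 * ch1 (- i.1.2) z.1.2 * ch1 (- i.2) z.2).
 by apply: cmeasM; [exact: (cmeas_comp measurable_fst (p2 _))|exact: (cmeas_comp measurable_snd (m1 _))].
have C4 := complete_prod (m1 := prodm (prodm mu1 mu1) mu1) (m2 := mu1) mI3 mI p3 n3 m1 n1 C3 c1.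
apply: (C4 f fi) => k; have := h0 k; rewrite /fourier => /eqP; rewrite mulf_eq0 => /orP[|/eqP].
 by rewrite eq_complex /= eqxx andbT invr_eq0 expf_eq0 /= mulf_eq0 pnatr_eq0 /= gt_eqF ?pi_gt0.
move=> <-; apply: eq_cintegral => x _; congr (_ * _).
rewrite -[LHS]/(ch1 (- k.1.1.1) x.1.1.1 * ch1 (- k.1.1.2) x.1.1.2 * ch1 (- k.1.2) x.1.2 * ch1 (- k.2) x.2).
by rewrite -(ch4E (- k)) ch4N -expiN.
Qed.

End TorusFourier.

(** * Passage from grid sums to integrals *)

Section RightContinuous.
Context {R : realType}.
Implicit Types c : R -> R[i].
Local Notation leb := (@lebesgue_measure R).

Definition rcont c : Prop := forall t, cabs (c s - c t) @[s --> t^'+] --> (0 : R).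
Definition rb c : Prop := rcont c /\ exists K, forall t, cabs (c t) <= K.

Lemma rb_cst z : rb (fun=> z).
Proof.
split; last by exists (cabs z).
by move=> t; under eq_fun do rewrite subrr cabs0; exact: cvg_cst.
Qed.

Lemma rbM c c' : rb c -> rb c' -> rb (fun t => c t * c' t).
Proof.
move=> [h1 [K hK]] [h2 [K' hK']]; split; last first.
 by exists (K * K') => t; rewrite cabsM; apply: ler_pM; rewrite ?cabs_ge0.
move=> t; apply: (@squeeze_cvgr _ _ _ _ (fun=> 0)
  (fun s => cabs (c s - c t) * K' + cabs (c t) * cabs (c' s - c' t))).
- near=> s; rewrite cabs_ge0 /=.
 rewrite (_ : c s * c' s - c t * c' t = (c s - c t) * c' s + c t * (c' s - c' t)); last by ring.
 by apply: le_trans (cabsD _ _) _; rewrite !cabsM lerD2r ler_wpM2l ?cabs_ge0.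
- exact: cvg_cst.
- rewrite -(addr0 0); apply: cvgD.
  by rewrite -[X in _ --> X](mul0r K'); apply: cvgM => //; exact: cvg_cst.
 by rewrite -[X in _ --> X](mulr0 (cabs (c t))); apply: cvgM => //; exact: cvg_cst.
Unshelve. all: by end_near. Qed.

Lemma rb_conj c : rb c -> rb (fun t => ((c t)^*)%C).
Proof.
move=> [h1 [K hK]]; split; last by exists K => t; rewrite cabs_conj.
by move=> t; under eq_fun do rewrite -rmorphB cabs_conj; exact: h1.
Qed.

Lemma rb_expi (a : R) : rb (fun t => expi (t * a)).
Proof.
split; last by exists 1 => t; rewrite cabs_expi.
move=> t; suff lim : cabs (expi (s * a) - expi (t * a)) @[s --> t] --> (0 : R) by exact: cvg_at_right_filter.
have cc : {for t, continuous (fun s : R => cos (s * a))}.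
 by apply: continuous_comp; [exact: mulrr_continuous|exact: continuous_cos].
have cs : {for t, continuous (fun s : R => sin (s * a))}.
 by apply: continuous_comp; [exact: mulrr_continuous|exact: continuous_sin].
apply: (@squeeze_cvgr _ _ _ _ (fun=> 0)
  (fun s => `|cos (s * a) - cos (t * a)| + `|sin (s * a) - sin (t * a)|)).
- near=> s; rewrite cabs_ge0 /=; have := cabs_le_ReIm (expi (s * a) - expi (t * a)).
 by rewrite !raddfB.
- exact: cvg_cst.
- by rewrite -[X in _ --> X](addr0 0); apply: cvgD; apply/norm_cvg0P; apply/subr_cvg0.
Unshelve. all: by end_near. Qed.

Lemma leb_co (a b : R) : a <= b -> leb (`[a, b[%classic) = (b - a)%:E.
Proof.
move=> ab; rewrite lebesgue_measure_itv /= lte_fin EFinB; case: ltgtP ab => // -> _.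
by rewrite subee.
Qed.

Definition tpt (J l : nat) : R := 2 * pi * l%:R / J%:R.

Definition tcut (T : R) c (t : R) : R[i] := if t < T then c t else 0.

(** Each interval takes the value at its right endpoint: for a right-continuous profile these values
    converge at every point. *)
Definition riem (T : R) c (J : nat) (t : R) : R[i] :=
 \sum_(l < J) tcut T c (tpt J l.+1) * ((t \in `[tpt J l, tpt J l.+1[)%:R)%:C.

Lemma rcont_cut T c : rcont c -> rcont (tcut T c).
Proof.
move=> hc t; have [tT|tT] := ltP t T; last first.
 have E : \forall s \near t^'+, 0 = cabs (tcut T c s - tcut T c t).
  near=> s; have ts : t < s by near: s; exact: nbhs_right_gt.
  have c0 x : T <= x -> tcut T c x = 0 by rewrite /tcut ltNge => ->.
  by rewrite (c0 _ tT) (c0 _ (le_trans tT (ltW ts))) subrr cabs0.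
 by apply: cvg_trans (near_eq_cvg E) _; exact: cvg_cst.
have E : \forall s \near t^'+, cabs (c s - c t) = cabs (tcut T c s - tcut T c t).
 near=> s; have sT : s < T by near: s; exact: nbhs_right_lt.
 by rewrite /tcut sT tT.
exact: cvg_trans (near_eq_cvg E) (hc t).
Unshelve. all: by end_near. Qed.

Lemma tptS J l : (0 < J)%N -> tpt J l.+1 = tpt J l + 2 * pi / J%:R.
Proof. by move=> J0; rewrite /tpt -natr1; field; rewrite pnatr_eq0 -lt0n. Qed.

Lemma riem_at T c J t : (0 < J)%N -> 0 <= t < 2 * pi ->
 exists2 l, (l < J)%N & tpt J l <= t < tpt J l.+1 /\ riem T c J t = tcut T c (tpt J l.+1).
Proof.
move=> J0 /andP[t0 t2]; have JR : 0 < J%:R :> R by rewrite ltr0n.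
have p2 := @pi2_gt0 R; pose l := Num.truncn (t * J%:R / (2 * pi)).
have x0 : 0 <= t * J%:R / (2 * pi) by apply: divr_ge0; [exact: mulr_ge0|exact: ltW].
have /andP[l1 l2] := truncn_itv x0; rewrite -/l in l1 l2.
have lt1 : tpt J l <= t.
 by rewrite /tpt ler_pdivrMr // -ler_pdivlMl // mulrC.
have lt2 : t < tpt J l.+1.
 by rewrite /tpt ltr_pdivlMr // -ltr_pdivrMl // mulrC.
have lJ : (l < J)%N.
 rewrite -(ltr_nat R); apply: le_lt_trans l1 _; rewrite ltr_pdivrMr // mulrC ltr_pM2l //.
exists l => //; split; first by rewrite lt1 lt2.
rewrite /riem (bigD1 (Ordinal lJ)) //= in_itv /= lt1 lt2 mulr1 big1 ?addr0 // => i.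
have mono a b : (a <= b)%N -> tpt J a <= tpt J b.
 by move=> ab; rewrite /tpt ler_pM2r ?invr_gt0 // ler_pM2l // ler_nat.
rewrite -val_eqE /= => il; rewrite in_itv /=.
have [h|h|h] := ltngtP i l; last by rewrite h eqxx in il.
 by rewrite [t < _]ltNge (le_trans (mono _ _ h) lt1) andbF mulr0.
by rewrite leNgt (lt_le_trans lt2 (mono _ _ h)) mulr0.
Qed.

Lemma riem_cvg T c (J : nat -> nat) t : rcont c -> (forall n, (n < J n)%N) -> 0 <= t < 2 * pi ->
 cabs (riem T c (J n) t - tcut T c t) @[n --> \oo] --> (0 : R).
Proof.
move=> hc hJ ht.
have J0 n : (0 < J n)%N by apply: leq_ltn_trans (hJ n).
pose s n := sval (cid2 (riem_at T c (J0 n) ht)).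
have sP n : tpt (J n) (s n) <= t < tpt (J n) (s n).+1 /\ riem T c (J n) t = tcut T c (tpt (J n) (s n).+1).
 by rewrite /s; case: cid2.
under eq_fun do rewrite (sP _).2.
have := (cvg_at_rightP (fun s => cabs (tcut T c s - tcut T c t)) t 0).1 (rcont_cut T hc t).
move=> /(_ (fun n => tpt (J n) (s n).+1)); apply; split; first by move=> n; have [/andP[]] := sP n.
apply/cvgrPdist_le => e e0.
have : (2 * pi * n.+1%:R^-1 : R) @[n --> \oo] --> 0.
 rewrite -[X in _ --> X](mulr0 (2 * pi)); apply: cvgM; [exact: cvg_cst|exact: cvg_harmonic].
move=> /cvgrPdist_le /(_ e e0); apply: filterS => n.
have p0 : 0 <= 2 * pi * n.+1%:R^-1 :> R by rewrite mulr_ge0 ?invr_ge0 // ltW // pi2_gt0.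
rewrite sub0r normrN ger0_norm // => h; have [/andP[a b] _] := sP n.
rewrite ltr0_norm ?subr_lt0 // opprB lerBlDl; apply: (le_via (t + 2 * pi / (J n)%:R)).
 by rewrite tptS // lerD2r.
rewrite lerD2l; apply: le_trans h; rewrite ler_wpM2l ?(ltW pi2_gt0) // lef_pV2 ?posrE ?ltr0n //.
by rewrite ler_nat hJ.
Qed.

Lemma cmeas_riem T c J : @cmeasurable R _ (mR R) setT (riem T c J).
Proof.
apply: cmeas_sum => l; apply: cmeasM; first exact: cmeas_cst.
apply: cmeas_real; rewrite (_ : (fun t => _) = \1_(`[tpt J l, tpt J l.+1[%classic)).
 by apply: measurable_indic; exact: measurable_itv.
by apply/funext => t; rewrite indicE mem_setE.
Qed.

Lemma cmeas_cut T c : rcont c -> @cmeasurable R _ (mR R) I2pi (tcut T c).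
Proof.
move=> hc; apply: (@cmeas_lim R _ _ _ (fun n => riem T c n.+1)) => [|n|t It]; first exact: mI2pi.
 exact: cmeasS (cmeas_riem T c n.+1).
by apply: (riem_cvg T hc) => //; move: It; rewrite /I2pi /= in_itv.
Qed.

Lemma cabs_cut T c K t : (forall t, cabs (c t) <= K) -> cabs (tcut T c t) <= K.
Proof. by move=> hK; rewrite /tcut; case: ifP => // _; rewrite cabs0; apply: le_trans (hK t); exact: cabs_ge0. Qed.

(** Dominated convergence for [riem] over the full period; [tcut] restricts the limit to [0, T). *)
Lemma riemann T c (J : nat -> nat) : rb c -> (forall n, (n < J n)%N) -> T <= 2 * pi ->
 cabs (\sum_(l < J n) tcut T c (tpt (J n) l.+1) * (2 * pi / (J n)%:R)%:C -
   cintegral leb (`[0, T[%classic) c) @[n --> \oo] --> (0 : R).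
Proof.
move=> [hc [K hK]] hJ T2; have mI := @mI2pi R.
have cf (k : R) : leb.-integrable I2pi (EFin \o cst k).
 apply: measurable_bounded_integrable => //; first exact: fin_I2pi.
 by exists `|k|; split => // M hM y _; exact: ltW.
have J0 n : (0 < J n)%N by apply: leq_ltn_trans (hJ n).
have p2 := @pi2_gt0 R.
have [||||| ci lim] := @cdominated R _ _ leb I2pi mI (fun n => riem T c (J n)) (tcut T c) (fun=> K).
- by move=> n; exact: cmeasS (cmeas_riem T c (J n)).
- exact: cmeas_cut.
- by apply: aeW => t It; apply: riem_cvg => //; move: It; rewrite /I2pi /= in_itv.
- exact: cf.
- apply: aeW => t n It; have [|l _ [_ ->]] := @riem_at T c (J n) t (J0 n); last exact: cabs_cut.
 by move: It; rewrite /I2pi /= in_itv.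
have e1 n : cintegral leb I2pi (riem T c (J n)) =
  \sum_(l < J n) tcut T c (tpt (J n) l.+1) * (2 * pi / (J n)%:R)%:C.
 have fi (l : 'I_(J n)) : cintegrable leb I2pi (fun t => ((t \in `[tpt (J n) l, tpt (J n) l.+1[)%:R)%:C : R[i]).
  apply: (cintegrable_le mI (h := fun=> 1)) => //; last exact: cf.
   apply: cmeas_real; rewrite (_ : (fun t => _) = \1_(`[tpt (J n) l, tpt (J n) l.+1[%classic)).
    by apply: measurable_funTS; apply: measurable_indic; exact: measurable_itv.
   by apply/funext => t; rewrite indicE mem_setE.
  by move=> t _; rewrite cabs_real; case: (_ \in _); rewrite ?normr1 ?normr0.
 rewrite (eq_cintegral _ (g := fun t : mR R => \sum_(l < J n) ((t \in `[tpt (J n) l, tpt (J n) l.+1[)%:R)%:C *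
   tcut T c (tpt (J n) l.+1))); last by move=> t _; apply: eq_bigr => l _; rewrite mulrC.
 rewrite (cintegral_sum mI) => [|l]; last exact: cintegrableZ.
 apply: eq_bigr => l _; rewrite cintegralZ // mulrC; congr (_ * _).
 rewrite /cintegral /= Rintegral_cst // mul0r; congr (_%:C).
 transitivity (\int[leb]_(t in I2pi) ((((fun=> 1) : mR R -> R) \_
   (`[tpt (J n) l, tpt (J n) l.+1[%classic : set (mR R))) t)).
  by apply: eq_Rintegral => t _; rewrite /patch mem_setE; case: (_ \in _).
 rewrite -Rintegral_mkcondr setIidr.
  rewrite Rintegral_cst ?mul1r; last exact: measurable_itv.
  rewrite [X in fine X]leb_co; first by rewrite tptS // addrAC subrr add0r.
  by rewrite tptS // lerDl divr_ge0 // ltW.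
 move=> t /=; rewrite /I2pi /= !in_itv /= => /andP[a b]; apply/andP; split.
  by apply: le_trans a; rewrite /tpt divr_ge0 // mulr_ge0 // ltW.
 apply: (lt_le_trans b); rewrite /tpt ler_pdivrMr ?ltr0n // ler_pM2l // ler_nat.
 exact: ltn_ord.
have e2 : cintegral leb I2pi (tcut T c) = cintegral leb (`[0, T[%classic) c.
 have IT : I2pi `&` `]-oo, T[%classic = `[0, T[%classic :> set R.
  apply/seteqP; split=> t /=; rewrite /I2pi /= !in_itv /=.
   by move=> [/andP[-> _] ->].
  by move=> /andP[-> tT]; rewrite tT (lt_le_trans tT T2).
 rewrite /cintegral; congr (_ +i* _).
  rewrite -[in RHS]IT Rintegral_mkcondr; apply: eq_Rintegral => t _.
  by rewrite /patch /tcut mem_setE in_itv /=; case: ifP.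
 rewrite -[in RHS]IT Rintegral_mkcondr; apply: eq_Rintegral => t _.
 by rewrite /patch /tcut mem_setE in_itv /=; case: ifP.
by move: lim; rewrite e2; under eq_fun do rewrite e1.
Qed.

End RightContinuous.

(** * Trigonometric polynomials in space with right-continuous coefficients *)

Section TimeTrigPolynomials.
Context {R : realType}.
Local Notation leb := (@lebesgue_measure R).

Definition tp (P : R -> pt4 R -> R[i]) : Prop :=
 exists (I : finType) (k : I -> Z4) (c : I -> R -> R[i]), (forall i, rb (c i)) /\
  forall t x, P t x = \sum_i c i t * ch4 (k i) x.

Lemma tpM P Q : tp P -> tp Q -> tp (fun t x => P t x * Q t x).
Proof.
move=> [I [k [c [hc hP]]]] [I' [k' [c' [hc' hQ]]]].
exists (I * I')%type, (fun i => k i.1 + k' i.2), (fun i t => c i.1 t * c' i.2 t); split.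
 by move=> i; exact: rbM.
move=> t x; rewrite hP hQ big_distrlr pair_bigA /=; apply: eq_bigr => i _.
by rewrite ch4D; ring.
Qed.

Lemma tp_conj P : tp P -> tp (fun t x => ((P t x)^*)%C).
Proof.
move=> [I [k [c [hc hP]]]]; exists I, (fun i => - k i), (fun i t => ((c i t)^*)%C); split.
 by move=> i; exact: rb_conj.
by move=> t x; rewrite hP conj_sum; apply: eq_bigr => i _; rewrite conjM ch4N.
Qed.

Definition fsum (ks : seq Z4) (v : Z4 -> R -> R[i]) (t : R) (x : pt4 R) : R[i] :=
 \sum_(k <- ks) v k t * expi (dot x k - t * sqnorm k).

Lemma tp_fsum ks v : (forall k, rb (v k)) -> tp (fsum ks v).
Proof.
move=> hv; exists 'I_(size ks), (fun i : 'I_(size ks) => nth 0 ks i),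
 (fun (i : 'I_(size ks)) t => v (nth 0 ks i) t * expi (t * - sqnorm (nth 0 ks i))); split.
 by move=> i; apply: rbM => //; exact: rb_expi.
move=> t x; rewrite /fsum (big_nth 0) big_mkord; apply: eq_bigr => i _.
by rewrite expiD -mulrN /ch4 mulrAC mulrA.
Qed.

Lemma tp1 : tp (fun _ _ => 1).
Proof.
exists unit, (fun=> 0), (fun _ _ => 1); split; first by move=> _; exact: rb_cst.
by move=> t x; rewrite (big_pred1 tt) ?ch4_0 ?mulr1 // => -[].
Qed.

Lemma tpX P n : tp P -> tp (fun t x => P t x ^+ n).
Proof.
move=> hP; elim: n => [|n ih]; first exact: tp1.
by under eq_fun do under eq_fun do rewrite exprS; exact: tpM.
Qed.

Lemma tp_prod4 (P : 'I_4 -> R -> pt4 R -> R[i]) : (forall i, tp (P i)) -> tp (fun t x => \prod_i P i t x).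
Proof.
by move=> hP; under eq_fun do under eq_fun do rewrite prod4; do 3?[apply: tpM].
Qed.

Section Slab.
Variable T : R.
Hypothesis T2 : T <= 2 * pi.
Local Notation IT := (`[0, T[%classic : set (mR R)).

Lemma mIT : @measurable _ (mR R) IT. Proof. exact: measurable_itv. Qed.

Lemma mslab : measurable (@slab R T).
Proof. by apply: measurableX; [exact: mbox|exact: mIT]. Qed.

Lemma fin_IT : (mu1 IT < +oo)%E.
Proof. by rewrite /mu1 /= lebesgue_measure_itv /=; case: ifP; rewrite -?EFinB ltry. Qed.

Lemma fin_slab : (@dxdt R (slab T) < +oo)%E.
Proof. by apply: (@fin_prodX R _ _ _ _ mu4 mu1); [exact: mbox|exact: mIT|exact: fin_box|exact: fin_IT]. Qed.

Lemma subIT t : IT t -> I2pi t.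
Proof. by rewrite /I2pi /= !in_itv /= => /andP[-> tT]; exact: lt_le_trans tT T2. Qed.

Lemma cmeas_rcont c : rcont c -> cmeasurable IT c.
Proof.
move=> hc; apply: (@cmeas_eq R _ _ IT (tcut T c)).
 by move=> t; rewrite /= in_itv /= /tcut => /andP[_ ->].
by apply: cmeasS (cmeas_cut T hc); [exact: mI2pi|exact: subIT].
Qed.

Lemma cmeas_snd d d' (X : measurableType d) (Y : measurableType d') (A : set X) (B : set Y) (f : Y -> R[i]) :
 measurable A -> measurable B -> cmeasurable B f -> cmeasurable (A `*` B) (fun z => f z.2).
Proof.
move=> mA mB [f1 f2].
have part (h : Y -> R) : measurable_fun B h -> measurable_fun (A `*` B) (fun z => h z.2).
 move=> mh; have mh' := (measurable_restrictT h mB).1 mh.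
 apply: (eq_measurable_fun ((h \_ B) \o snd)).
  by move=> z; rewrite inE => -[_ Bz]; rewrite /= /patch mem_set.
 by apply: measurable_funTS; exact: (measurableT_comp mh').
by split; [exact: (part _ f1)|exact: (part _ f2)].
Qed.

Lemma cmeas_fst d d' (X : measurableType d) (Y : measurableType d') (A : set X) (B : set Y) (f : X -> R[i]) :
 measurable A -> measurable B -> cmeasurable setT f -> cmeasurable (A `*` B) (fun z => f z.1).
Proof.
move=> mA mB mf; apply: (cmeasS measurableT); first by [].
exact: (cmeas_comp measurable_fst mf).
Qed.

Lemma cintegrable_bounded d (X : measurableType d) (mu : {measure set X -> \bar R}) (D : set X) (f : X -> R[i]) (K : R) :
 measurable D -> (mu D < +oo)%E -> cmeasurable D f -> (forall x, D x -> cabs (f x) <= K) -> cintegrable mu D f.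
Proof.
move=> mD D1 mf fK; apply: (cintegrable_le mD (h := fun=> K)) => //.
apply: measurable_bounded_integrable => //.
by exists `|K|; split => // M hM y _; exact: ltW.
Qed.

Lemma cintegrable_meq d (X : measurableType d) (m m' : {measure set X -> \bar R}) (D : set X) (f : X -> R[i]) :
 (m : set X -> \bar R) = m' -> cintegrable m D f = cintegrable m' D f.
Proof. by rewrite /cintegrable => ->. Qed.

Lemma cintegral_meq d (X : measurableType d) (m m' : {measure set X -> \bar R}) (D : set X) (f : X -> R[i]) :
 (m : set X -> \bar R) = m' -> cintegral m D f = cintegral m' D f.
Proof. by rewrite /cintegral /Rintegral => ->. Qed.

Lemma dxdtE : (@dxdt R : set (pt5 R) -> \bar R) = (@mu4 R \x @mu1 R)%E.
Proof.
have e4 : (@dx4 R : set (pt4 R) -> \bar R) = mu4 by [].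
have -> : (@dxdt R : set (pt5 R) -> \bar R) = (@dx4 R \x leb)%E by [].
by rewrite /product_measure1 e4.
Qed.

Lemma fubini_slab (f : pt5 R -> R[i]) : cintegrable dxdt (slab T) f ->
 [/\ {ae leb, forall t, IT t -> cintegrable dx4 (@box R) (fun x => f (x, t))},
   cintegrable leb IT (fun t => cintegral dx4 (@box R) (fun x => f (x, t))) &
   cintegral dxdt (slab T) f = cintegral leb IT (fun t => cintegral dx4 (@box R) (fun x => f (x, t)))].
Proof.
have e4 : (@dx4 R : set (pt4 R) -> \bar R) = mu4 by [].
rewrite (cintegrable_meq _ _ dxdtE) (cintegral_meq _ _ dxdtE).
have E : (fun y => cintegral dx4 (@box R) (fun x => f (x, y))) = (fun y => cintegral mu4 (@box R) (fun x => f (x, y))).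
 by apply/funext => y; exact: cintegral_meq e4.
move=> /(@fubini_set R _ _ _ _ mu4 mu1 _ _ (@mbox R) mIT f)[a b c].
split; first by apply: filterS a => t h It; rewrite (cintegrable_meq _ _ e4); exact: h.
- by rewrite E.
- by rewrite E.
Qed.

Lemma tp_term k c : rb c -> cintegrable dxdt (slab T) (fun p => c p.2 * ch4 k p.1) /\
 cintegral dxdt (slab T) (fun p => c p.2 * ch4 k p.1) =
 (if k == 0 then ((2 * pi) ^+ 4)%:C else 0) * cintegral leb IT c.
Proof.
move=> [hc [K hK]]; have mb := @mbox R.
have fi : cintegrable dxdt (slab T) (fun p => c p.2 * ch4 k p.1).
 apply: (cintegrable_bounded (K := K)); [exact: mslab|exact: fin_slab| |].
  apply: cmeasM; first exact: (cmeas_snd mb mIT (cmeas_rcont hc)).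
  exact: (cmeas_fst mb mIT (cmeas_ch4 k)).
 by move=> z _; rewrite cabsM cabs_ch4 mulr1.
split=> //; have [_ _ ->] := fubini_slab fi.
have chi : cintegrable dx4 (@box R) (ch4 k).
 apply: (cintegrable_bounded (K := 1)) => //; first exact: fin_box.
  exact: cmeasS (cmeas_ch4 k).
 by move=> x _; rewrite cabs_ch4.
have ci : cintegrable leb IT c := cintegrable_bounded mIT fin_IT (cmeas_rcont hc) (fun x _ => hK x).
rewrite -(box_orth k) mulrC -(cintegralZ mIT _ ci); apply: eq_cintegral => t _ /=.
rewrite (eq_cintegral _ (g := fun x => ch4 k x * c t)); last by move=> x _; rewrite mulrC.
by rewrite (cintegralZ mb) // mulrC.
Qed.

Lemma tp_integrable P : tp P -> cintegrable dxdt (slab T) (fun p => P p.2 p.1).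
Proof.
move=> [I [k [c [hc hP]]]].
apply: (cintegrable_eq mslab (f := fun p : pt5 R => \sum_i c i p.2 * ch4 (k i) p.1)); first by move=> p _; rewrite hP.
by apply: (cintegrable_sum mslab) => i; exact: (tp_term (k i) (hc i)).1.
Qed.

Lemma tp_integral P (I : finType) (k : I -> Z4) (c : I -> R -> R[i]) : (forall i, rb (c i)) ->
 (forall t x, P t x = \sum_i c i t * ch4 (k i) x) ->
 cintegral dxdt (slab T) (fun p => P p.2 p.1) = ((2 * pi) ^+ 4)%:C * \sum_(i | k i == 0) cintegral leb IT (c i).
Proof.
move=> hc hP; rewrite (eq_cintegral _ (g := fun p : pt5 R => \sum_i c i p.2 * ch4 (k i) p.1)); last by move=> p _; rewrite hP.
rewrite (cintegral_sum mslab) => [|i]; last exact: (tp_term (k i) (hc i)).1.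
rewrite mulr_sumr [RHS]big_mkcond; apply: eq_bigr => i _; rewrite (tp_term (k i) (hc i)).2.
by case: ifP => _ //; rewrite mul0r.
Qed.

Definition xpt J (x : V J) : pt4 R :=
 (2 * pi * (x o0)%:R / J%:R, 2 * pi * (x o1)%:R / J%:R,
  2 * pi * (x o2)%:R / J%:R, 2 * pi * (x o3)%:R / J%:R).

Lemma ch4_xpt J k (x : V J) : (1 < J)%N -> ch4 k (xpt x) = ez (dv (zk J k) x).
Proof.
move=> J1; have J0 : J%:R != 0 :> R by rewrite pnatr_eq0; case: J J1 x.
have nz (y : 'Z_J) : ((y : nat)%:Z)%:~R = y :> 'Z_J by rewrite -pmulrn natr_Zp.
rewrite /dv (_ : \sum_j _ = (k.1.1.1 * (x o0 : nat)%:Z + k.1.1.2 * (x o1 : nat)%:Z +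
  k.1.2 * (x o2 : nat)%:Z + k.2 * (x o3 : nat)%:Z)%:~R); last first.
 rewrite !intrD !intrM !nz !big_ord_recl big_ord0 addr0 !ffunE /cmp /= !addrA.
 by congr (_ * x _ + _ * x _ + _ * x _ + _ * x _); exact: val_inj.
rewrite ez_int // /ch4 /dot /xpt /=; congr expi.
by rewrite !intrD !intrM -!pmulrn; field.
Qed.

(** Factorials are divisible by all primes below them, so the whole sequence of grids is eventually
    [good] for any bound. *)
Definition Jn (n : nat) : nat := (n.+2)`!.

Lemma Jn_gt n : (n.+1 < Jn n)%N.
Proof. by apply: (@leq_trans n.+2) => //; exact: fact_geq. Qed.

Lemma good_Jn N n : (N <= n)%N -> good N (Jn n).
Proof.
move=> Nn; split; first by apply: ltnW; apply: leq_ltn_trans (Jn_gt n); exact: leqW.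
move=> p pp pN; apply: dvdn_fact; rewrite prime_gt0 //=.
by apply: (leq_trans pN); apply: (leq_trans Nn); exact: leqW.
Qed.

(** L counts the sampling times before T. As these times are spaced by 2 pi / J, the bound L/J <= T
    gives away a factor 2 pi. *)
Lemma cut_index J : (0 < J)%N -> exists L : nat, (L%:R / J%:R <= Num.max 0 T :> R) /\
 forall l, (l < J)%N -> (tpt J l.+1 < T) = (l < L)%N.
Proof.
move=> J0; have JR : 0 < J%:R :> R by rewrite ltr0n.
have p2 := @pi2_gt0 R.
have mono a b : (a <= b)%N -> tpt J a <= tpt J b :> R.
 by move=> ab; rewrite /tpt ler_pM2r ?invr_gt0 // ler_pM2l // ler_nat.
have ex : exists l, ~~ (tpt J l.+1 < T).
 exists J; rewrite -leNgt; apply: (le_trans T2); rewrite /tpt ler_pdivlMr // ler_pM2l // ler_nat //.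
case: (ex_minnP ex) => L hL Lmin; exists L; split; last first.
 move=> l _; apply/idP/idP => [h|lL]; last first.
  by apply/negPn/negP => h; have := Lmin _ h; rewrite leqNgt lL.
 rewrite ltnNge; apply/negP => Ll; move/negP: hL; apply; apply: le_lt_trans h.
 exact: mono.
case: L hL Lmin => [|L] _ Lmin; first by rewrite mul0r le_max lexx.
have h : tpt J L.+1 < T by apply/negPn/negP => /Lmin; rewrite ltnn.
rewrite le_max; apply/orP; right; apply: le_trans (ltW h).
rewrite /tpt ler_pM2r ?invr_gt0 // ler_peMl //.
by have := @pi_ge2 R; lra.
Qed.

Lemma cut_sum J L (F : nat -> R -> R[i]) : (1 < J)%N ->
 (forall l, (l < J)%N -> (tpt J l.+1 < T) = (l < L)%N) ->
 \sum_(l < J) tcut T (F l) (tpt J l.+1) = \sum_(t : 'Z_J | (t < L)%N) F t (tpt J t.+1).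
Proof.
move=> J1 hL.
have e : J = (Zp_trunc J).+2 by rewrite Zp_cast.
rewrite -(big_mkord xpredT (fun l => tcut T (F l) (tpt J l.+1))) [X in \sum_(0 <= _ < X) _]e big_mkord [RHS]big_mkcond /=; apply: eq_bigr => l _.
by rewrite /tcut hL // {2}e.
Qed.

(** In space the grid sum is exact once J exceeds all frequencies, since a nonzero frequency is then
    nonzero modulo J. Only the sums in time are genuine Riemann sums. *)
Lemma slab_limit P : tp P -> exists L : nat -> nat,
 (forall n, (L n)%:R / (Jn n)%:R <= Num.max 0 T :> R) /\
 cabs ((((2 * pi) / (Jn n)%:R) ^+ 5)%:C *
   (\sum_(z : grid (Jn n) | (tm z < L n)%N) P (tpt (Jn n) (tm z).+1) (xpt z.2)) -
  cintegral dxdt (slab T) (fun p => P p.2 p.1)) @[n --> \oo] --> (0 : R).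
Proof.
move=> [I [k [c [hc hP]]]].
have J0 n : (0 < Jn n)%N by apply: leq_ltn_trans (Jn_gt n).
have J1 n : (1 < Jn n)%N by apply: leq_ltn_trans (Jn_gt n).
pose L n := sval (cid (cut_index (J0 n))).
have hL n : (L n)%:R / (Jn n)%:R <= Num.max 0 T :> R /\
  forall l, (l < Jn n)%N -> (tpt (Jn n) l.+1 < T) = (l < L n)%N by rewrite /L; case: cid.
exists L; split; first by move=> n; exact: (hL n).1.
pose M := (\max_(i : I) \max_(j < 4) `|cmp (k i) j|)%N.
have small n : (M <= n)%N -> forall i, (zk (Jn n) (k i) == 0) = (k i == 0).
 move=> Mn i; apply/eqP/eqP => [e|->]; last by apply/ffunP => j; rewrite !ffunE /cmp; case: j => -[|[|[|[|]]]].
 apply: cmp_inj => j; apply: (intZ_eq (J1 n)).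
  have := congr1 (fun x : V _ => x j) e; rewrite !ffunE => ->.
  by rewrite /cmp; case: j => -[|[|[|[|]]]].
 rewrite (_ : cmp 0 j = 0) ?subr0; last by rewrite /cmp; case: j => -[|[|[|[|]]]].
 have h1 : (`|cmp (k i) j| <= M)%N.
  apply: (@leq_trans (\max_(j < 4) `|cmp (k i) j|)%N); first exact: (bigop.leq_bigmax_cond (F := fun j => `|cmp (k i) j|%N)).
  exact: (bigop.leq_bigmax_cond (F := fun i => (\max_(j < 4) `|cmp (k i) j|)%N)).
 have := Jn_gt n; lia.
rewrite (tp_integral hc hP).
have grid_sum n : (M <= n)%N ->
  (((2 * pi) / (Jn n)%:R) ^+ 5)%:C *
   (\sum_(z : grid (Jn n) | (tm z < L n)%N) P (tpt (Jn n) (tm z).+1) (xpt z.2)) =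
  ((2 * pi) ^+ 4)%:C * \sum_(i | k i == 0)
   \sum_(l < Jn n) tcut T (c i) (tpt (Jn n) l.+1) * (2 * pi / (Jn n)%:R)%:C.
 move=> Mn; rewrite big_mkcond sum_gridE.
 have JR : (Jn n)%:R != 0 :> R by rewrite pnatr_eq0 -lt0n.
 have -> : \sum_(t : 'Z_(Jn n)) \sum_(x : V (Jn n)) (if (tm (t, x) < L n)%N then P (tpt (Jn n) (tm (t, x)).+1) (xpt x) else 0) =
   \sum_(i | k i == 0) \sum_(t : 'Z_(Jn n) | (t < L n)%N) c i (tpt (Jn n) t.+1) * ((Jn n)%:R ^+ 4)%:C.
  transitivity (\sum_(t : 'Z_(Jn n) | (t < L n)%N) \sum_(i | k i == 0) c i (tpt (Jn n) t.+1) * ((Jn n)%:R ^+ 4)%:C); last exact: exchange_big.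
  rewrite [RHS]big_mkcond /=; apply: eq_bigr => t _; rewrite /tm /=.
  case: ifP => _; last by rewrite big1.
  transitivity (\sum_(x : V (Jn n)) \sum_i c i (tpt (Jn n) t.+1) * ch4 (k i) (xpt x)).
   by apply: eq_bigr => x _; exact: hP.
  rewrite exchange_big /= [RHS]big_mkcond /=; apply: eq_bigr => i _.
  rewrite -mulr_sumr; under eq_bigr do rewrite ch4_xpt //.
  rewrite sum_ez_dv // small //; case: ifP => _; last by rewrite mulr0.
  by rewrite rmorphXn /= rmorph_nat.
 rewrite !mulr_sumr; apply: eq_bigr => i _.
 rewrite -!mulr_suml -(cut_sum (fun=> c i) (J1 n) (hL n).2).
 rewrite [RHS]mulrCA [LHS]mulrCA -!rmorphM /=; congr (_ * _%:C).
 by field.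
have E : \forall n \near \oo, cabs (((2 * pi) ^+ 4)%:C * \sum_(i | k i == 0)
   (\sum_(l < Jn n) tcut T (c i) (tpt (Jn n) l.+1) * (2 * pi / (Jn n)%:R)%:C - cintegral leb IT (c i))) =
  cabs (((2 * pi / (Jn n)%:R) ^+ 5)%:C *
   \sum_(z : grid (Jn n) | (tm z < L n)%N) P (tpt (Jn n) (tm z).+1) (xpt z.2) -
   ((2 * pi) ^+ 4)%:C * \sum_(i | k i == 0) cintegral leb IT (c i)).
 by exists M => // n /= Mn; rewrite grid_sum // -mulrBr; congr (cabs (_ * _)); rewrite sumrB.
apply: cvg_trans (near_eq_cvg E) _.
apply: (@squeeze_cvgr _ _ _ _ (fun=> 0) (fun n => (2 * pi) ^+ 4 * \sum_(i | k i == 0)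
  cabs (\sum_(l < Jn n) tcut T (c i) (tpt (Jn n) l.+1) * (2 * pi / (Jn n)%:R)%:C - cintegral leb IT (c i)))).
- near=> n; rewrite cabs_ge0 /= cabsM cabs_real ger0_norm ?exprn_ge0 ?(ltW (@pi2_gt0 R)) //.
 by rewrite ler_wpM2l ?exprn_ge0 ?(ltW (@pi2_gt0 R)) // cabs_sum.
- exact: cvg_cst.
- rewrite -[X in _ --> X](mulr0 ((2 * pi) ^+ 4)); apply: cvgM; first exact: cvg_cst.
 rewrite [X in _ --> X](_ : 0 = \sum_(i | k i == 0) 0 :> R); last by rewrite big1.
 apply: cvg_big; first exact: add_continuous.
 by move=> i _; apply: riemann => // n; apply: ltn_trans (Jn_gt n); exact: ltnSn.
Unshelve. all: by end_near. Qed.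

Lemma slab_bound P (B : R) (N : nat) : tp P ->
 (forall n L, (N <= n)%N -> L%:R / (Jn n)%:R <= Num.max 0 T :> R ->
  cabs (\sum_(z : grid (Jn n) | (tm z < L)%N) P (tpt (Jn n) (tm z).+1) (xpt z.2)) <= B * (Jn n)%:R ^+ 5) ->
 cabs (cintegral dxdt (slab T) (fun p => P p.2 p.1)) <= (2 * pi) ^+ 5 * B.
Proof.
move=> hP hB; have [L [hL lim]] := slab_limit hP.
apply/ler_addgt0Pr => e e0.
move/cvgrPdist_le: lim => /(_ e e0) [n0 _ hn].
have := hn (maxn n0 N) (leq_maxl _ _); set n := maxn n0 N.
rewrite sub0r normrN ger0_norm ?cabs_ge0 //=; set S := \sum_(z | _) _; set I := cintegral _ _ _ => h.
have J0 : 0 < (Jn n)%:R :> R by rewrite ltr0n; apply: leq_ltn_trans (Jn_gt n).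
have p0 : 0 <= (2 * pi / (Jn n)%:R) ^+ 5 :> R by apply: exprn_ge0; apply: divr_ge0; [exact: (ltW (@pi2_gt0 R))|exact: ltW].
have h1 : cabs ((((2 * pi) / (Jn n)%:R) ^+ 5)%:C * S) <= (2 * pi) ^+ 5 * B.
 rewrite cabsM cabs_real ger0_norm //; apply: le_trans (ler_wpM2l p0 (hB _ _ (leq_maxr _ _) (hL _))) _.
 rewrite -/n expr_div_n; apply: le_of_eq; field; exact: lt0r_neq0.
set X := _ * S in h h1; have h2 : cabs I <= cabs X + cabs (X - I).
 by have := cabsB X (X - I); rewrite subKr.
by apply: (le_trans h2); apply: lerD.
Qed.

End Slab.
End TimeTrigPolynomials.

(** * Continuous profiles and their grid samples *)

Section Bridge.
Context {R : realType}.
Local Notation leb := (@lebesgue_measure R).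

(** The continuous-time counterpart of [sctl], with the right continuity that the Riemann sums
    need. *)
Definition rctl (v : R -> R[i]) (A : R) : Prop :=
 [/\ 0 <= A, rcont v, forall t, cabs (v t) <= A & exists om : R -> R,
 [/\ forall s t, s <= t -> om s <= om t,
   forall t, 0 <= om t <= A ^+ 3 &
   forall s t, s <= t -> cabs (v t - v s) ^+ 3 <= om t - om s]].

Lemma rctl_rb v A : rctl v A -> rb v.
Proof. by move=> [_ h1 h2 _]; split => //; exists A. Qed.

Lemma rctl_cst z : rctl (fun=> z) (cabs z).
Proof.
split=> //; first exact: cabs_ge0; first exact: (rb_cst z).1.
exists (fun=> 0); split=> // [t|s t _]; first by rewrite lexx exprn_ge0 // cabs_ge0.
by rewrite !subrr cabs0 expr0n.
Qed.

Lemma rctlZ (c : R[i]) v A : rctl v A -> rctl (fun t => c * v t) (cabs c * A).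
Proof.
move=> [A0 rc vA [om [om1 om2 om3]]]; split.
- by rewrite mulr_ge0 ?cabs_ge0.
- by have [] := rbM (rb_cst c) (conj rc (ex_intro _ A vA)).
- by move=> t; rewrite cabsM ler_wpM2l ?cabs_ge0.
exists (fun t => cabs c ^+ 3 * om t); have c0 : 0 <= cabs c ^+ 3 by rewrite exprn_ge0 ?cabs_ge0.
split.
- by move=> s t /om1 h; rewrite ler_wpM2l.
- move=> t; have /andP[h1 h2] := om2 t; rewrite mulr_ge0 //= exprMn ler_wpM2l //.
- by move=> s t /om3 h; rewrite -mulrBr cabsM exprMn -mulrBr ler_wpM2l.
Qed.

(** Profiles are sampled at step l + 1, while the grid phase is taken at step l; the unimodular
    factor corrects this shift and, being constant in l, leaves the variation unchanged. *)
Definition gridw (J : nat) (v : Z4 -> R -> R[i]) (l : nat) (k : Z4) : R[i] :=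
 v k (tpt J l.+1) * expi (- (2 * pi / J%:R * sqnorm k)).

Lemma tpt_mono J a b : (a <= b)%N -> tpt J a <= tpt J b :> R.
Proof.
move=> ab; rewrite /tpt -!mulrA; apply: ler_wpM2l => //; apply: ler_wpM2l; first exact: pi_ge0.
by rewrite ler_wpM2r ?invr_ge0 // ler_nat.
Qed.

Lemma gridw_sctl J v k A : rctl (v k) A -> sctl ((gridw J v)^~ k) A.
Proof.
move=> [A0 _ vA [om [om1 om2 om3]]]; split=> //; exists (fun l => om (tpt J l.+1)); split=> //.
- by move=> s t st; apply: om1; exact: tpt_mono.
- by move=> s t st; rewrite /gridw -mulrBl cabsM cabs_expi mulr1 om3 // tpt_mono.
- by move=> t; rewrite /gridw cabsM cabs_expi mulr1.
Qed.

Lemma fsum_grid J ks v (z : grid J) : (1 < J)%N ->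
 fsum ks v (tpt J (tm z).+1) (xpt z.2) = uw ks (gridw J v) z.
Proof.
move=> J1; rewrite /fsum /uw /uu; apply: eq_bigr => k _; rewrite /gridw expiD -[expi (dot _ _)]/(ch4 k _) ch4_xpt //.
have J0 : J%:R != 0 :> R by rewrite pnatr_eq0; case: J J1 z.
rewrite -!mulrA; congr (_ * _); rewrite /ph ezD // [RHS]mulrCA; congr (_ * _).
rewrite ezN // (_ : dv (zk J k) (zk J k) * z.1 = ((k.1.1.1 ^+ 2 + k.1.1.2 ^+ 2 + k.1.2 ^+ 2 + k.2 ^+ 2) * (tm z)%:Z)%:~R); last first.
 rewrite intrM -pmulrn natr_Zp; congr (_ * _).
 by rewrite /dv !big_ord_recl big_ord0 addr0 !ffunE /cmp /= !intrD !addrA !expr2 !intrM.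
rewrite ez_int // -!expiN -expiD; congr expi; rewrite intrM -/(sqnorm k) -!pmulrn /tpt -natr1.
by field.
Qed.

Lemma levs_bounded (ks : seq Z4) : exists N, forall k, k \in ks -> (lev k < N)%N.
Proof.
exists (\max_(k <- ks) lev k).+1 => k kk; rewrite ltnS.
exact: (bigop.leq_bigmax_seq (F := lev)).
Qed.

Lemma int_real d (X : measurableType d) (mu : {measure set X -> \bar R}) (D : set X) (h : X -> R) :
 measurable D -> cintegrable mu D (fun x => (h x)%:C) ->
 (\int[mu]_(x in D) (h x)%:E)%E = (complex.Re (cintegral mu D (fun x => (h x)%:C)))%:E.
Proof.
by move=> mD [hi _]; rewrite /cintegral /= /Rintegral fineK //; exact: integrable_fin_num hi.
Qed.

Section Slab2.
Variable T : R.
Hypothesis T2 : T <= 2 * pi.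

(** The sixth power of the modulus is itself a trigonometric polynomial, so [slab_bound] applies; by
    positivity the full grid sum dominates the sum up to time T. *)
Lemma fsum_L6 ks v a : uniq ks -> (forall k, rctl (v k) (a k)) ->
 (\int[dxdt]_(p in slab T) (cabs (fsum ks v p.2 p.1) ^+ 6)%:E <=
  ((2 * pi) ^+ 5 * (2 ^+ 78 * (\sum_(k <- ks) 4 ^+ lev k * a k ^+ 2) ^+ 3))%:E)%E.
Proof.
move=> uks hv; have tf : tp (fsum ks v) by apply: tp_fsum => k; exact: rctl_rb (hv k).
pose P t x := fsum ks v t x ^+ 3 * ((fsum ks v t x ^+ 3)^*)%C.
have tP : tp P by apply: tpM; [exact: tpX|apply: tp_conj; exact: tpX].
have PE t x : P t x = (cabs (fsum ks v t x) ^+ 6)%:C.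
 by rewrite /P mul_conj cabsX -exprM.
have [N hN] := levs_bounded ks.
have b : cabs (cintegral dxdt (slab T) (fun p => P p.2 p.1)) <=
  (2 * pi) ^+ 5 * (2 ^+ 78 * (\sum_(k <- ks) 4 ^+ lev k * a k ^+ 2) ^+ 3).
 apply: (slab_bound T2 (N := 2 ^ (30 + 2 * N)) tP) => n L Nn _.
 have J1 : (1 < Jn n)%N by apply: leq_ltn_trans (Jn_gt n).
 have h := discrete_L6 J1 (good_Jn Nn) uks hN (fun k => gridw_sctl (Jn n) (hv k)).
 rewrite [leRHS](_ : _ = 2 ^+ 78 * (Jn n)%:R ^+ 5 * (\sum_(k <- ks) 4 ^+ lev k * a k ^+ 2) ^+ 3); last by ring.
 apply: le_trans h; apply: le_trans (cabs_sum _ _ _) _.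
 rewrite big_mkcond; apply: ler_sum => z _; rewrite PE cabs_real.
 rewrite ger0_norm ?exprn_ge0 ?cabs_ge0 // fsum_grid //.
 by case: ifP => // _; rewrite exprn_ge0 ?cabs_ge0.
have ci : cintegrable dxdt (slab T) (fun p : pt5 R => (cabs (fsum ks v p.2 p.1) ^+ 6)%:C).
 apply: (cintegrable_eq (@mslab R T) (f := fun p : pt5 R => P p.2 p.1)); first by move=> p _; exact: PE.
 exact: tp_integrable.
rewrite (int_real (@mslab R T) ci) lee_fin; apply: le_trans b.
apply: le_trans (ler_norm _) _; apply: le_trans (Re_le_cabs _) _.
by rewrite (eq_cintegral _ (g := fun p : pt5 R => P p.2 p.1)) // => p _; rewrite PE.
Qed.

Lemma fsum_prod4 (ks : 'I_4 -> seq Z4) (v : 'I_4 -> Z4 -> R -> R[i]) (a : 'I_4 -> Z4 -> R) (cj : 'I_4 -> bool)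
  (h : R) (p : 'I_4) (Y : 'I_4 -> R) : 0 <= T ->
 (forall i, uniq (ks i)) -> (forall i k, rctl (v i k) (a i k)) -> 0 <= h ->
 (1 <= h \/ forall k, k \in ks p -> T ^+ 2 * 16 ^+ lev k <= h ^+ 14) ->
 (forall i, 0 <= Y i) ->
 (forall i, \sum_(k <- ks i) lw i (lev k) ^+ 2 * a i k ^+ 2 <= Y i ^+ 2) ->
 cabs (cintegral dxdt (slab T) (fun z => \prod_i cjif (cj i) (fsum (ks i) (v i) z.2 z.1))) <=
 (2 * pi) ^+ 5 * (2 ^+ 113 * h * \prod_i Y i).
Proof.
move=> T0 uks hv h0 hp Y0 hY.
have tc i : tp (fun t x => cjif (cj i) (fsum (ks i) (v i) t x)).
 have tf : tp (fsum (ks i) (v i)) by apply: tp_fsum => k; exact: rctl_rb (hv i k).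
 by rewrite /cjif; case: (cj i) => //; exact: tp_conj.
have [N hN] : exists N, forall i k, k \in ks i -> (lev k < N)%N.
 pose N i := sval (cid (levs_bounded (ks i))).
 have hN i k : k \in ks i -> (lev k < N i)%N by rewrite /N; case: cid => n hn /hn.
 exists (\max_i N i)%N => i k kk; apply: (leq_trans (hN _ _ kk)).
 exact: (bigop.leq_bigmax_cond (F := N)).
apply: (slab_bound T2 (N := 2 ^ (30 + 2 * N)) (tp_prod4 tc)) => n L Nn hL.
have J1 : (1 < Jn n)%N by apply: leq_ltn_trans (Jn_gt n).
rewrite [leRHS](_ : _ = 2 ^+ 113 * h * (Jn n)%:R ^+ 5 * \prod_i Y i); last by ring.
rewrite (eq_bigr (fun z => \prod_i cjif (cj i) (uw (ks i) (gridw (Jn n) (v i)) z))); last first.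
 by move=> z _; apply: eq_bigr => i _; rewrite fsum_grid.
apply: (@core_estimate R (Jn n) J1 ks (fun i => gridw (Jn n) (v i)) a cj N L h p Y) => //.
- exact: good_Jn.
- by move=> i k; exact: gridw_sctl.
- case: hp => [h1|hk]; [by left|right => k /hk h1; apply: le_trans h1].
 rewrite ler_wpM2r ?exprn_ge0 // lerXn2r ?nnegrE ?divr_ge0 //.
 by move: hL; rewrite (max_idPr T0).
Qed.

Lemma fsum_L2 ks v : uniq ks -> (forall k, rb (v k)) ->
 (\int[dxdt]_(p in slab T) (cabs (fsum ks v p.2 p.1) ^+ 2)%:E =
  ((2 * pi) ^+ 4 * \sum_(k <- ks) \int[leb]_(t in `[0%R, T[) (cabs (v k t) ^+ 2))%:E)%E.
Proof.
move=> uks hv; have tf : tp (fsum ks v) by exact: tp_fsum.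
pose P t x := fsum ks v t x * ((fsum ks v t x)^*)%C.
have tP : tp P by apply: tpM => //; exact: tp_conj.
have PE t x : P t x = (cabs (fsum ks v t x) ^+ 2)%:C by rewrite /P mul_conj.
pose s := size ks; pose kk (i : 'I_s) := nth 0 ks i.
pose c (i : 'I_s) t := v (kk i) t * expi (t * - sqnorm (kk i)).
have hc i : rb (c i) by apply: rbM => //; exact: rb_expi.
have e t x : P t x = \sum_(p : 'I_s * 'I_s) (c p.1 t * ((c p.2 t)^*)%C) * ch4 (kk p.1 - kk p.2) x.
 have fE : fsum ks v t x = \sum_(i < s) c i t * ch4 (kk i) x.
  rewrite /fsum (big_nth 0) big_mkord; apply: eq_bigr => i _.
  by rewrite expiD -mulrN /ch4 mulrAC mulrA.
 rewrite /P fE conj_sum big_distrlr pair_bigA /=; apply: eq_bigr => -[i j] _ /=.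
 by rewrite conjM ch4D ch4N; ring.
have cP (p : 'I_s * 'I_s) : rb (fun t => c p.1 t * ((c p.2 t)^*)%C) by apply: rbM => //; exact: rb_conj.
have ci : cintegrable dxdt (slab T) (fun p : pt5 R => (cabs (fsum ks v p.2 p.1) ^+ 2)%:C).
 apply: (cintegrable_eq (@mslab R T) (f := fun p : pt5 R => P p.2 p.1)); first by move=> p _; exact: PE.
 exact: tp_integrable.
rewrite (int_real (@mslab R T) ci); congr EFin.
rewrite (eq_cintegral _ (g := fun p : pt5 R => P p.2 p.1)); last by move=> p _; rewrite PE.
rewrite (tp_integral T2 cP e).
have -> : \sum_(p : 'I_s * 'I_s | kk p.1 - kk p.2 == 0) cintegral leb `[0, T[%classic (fun t => c p.1 t * ((c p.2 t)^*)%C) =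
  \sum_(i < s) (\int[leb]_(t in `[0, T[) (cabs (v (kk i) t) ^+ 2))%:C.
 rewrite -(pair_big_dep xpredT (fun i j => kk i - kk j == 0) (fun i j => cintegral leb `[0, T[%classic (fun t => c i t * ((c j t)^*)%C))) /=.
 apply: eq_bigr => i _; rewrite (big_pred1 i).
  rewrite (eq_cintegral _ (g := fun t : mR R => (cabs (v (kk i) t) ^+ 2)%:C)); last first.
   by move=> t _; rewrite mul_conj cabsM cabs_expi mulr1.
  by rewrite /cintegral /= Rintegral_cst // mul0r.
 by move=> j; rewrite subr_eq0 nth_uniq // eq_sym.
by rewrite -raddf_sum -rmorphM /= /s [in RHS](big_nth 0) big_mkord.
Qed.

End Slab2.
End Bridge.

(** * Data of the Y and H norms *)

Section Variation.
Context {R : realType}.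

(* The witness at t is the supremum of the sums over the chains ending at t. *)
Lemma chain_variation (D : set R) (d : R -> R -> R) (B : R) : (forall s t, 0 <= d s t) ->
 (forall (K : nat) (x : nat -> R), (forall k, (k <= K)%N -> D (x k)) ->
   (forall k, (k < K)%N -> x k < x k.+1) -> \sum_(0 <= k < K) d (x k) (x k.+1) <= B) ->
 exists om : R -> R, (forall s t, D s -> D t -> s < t -> d s t <= om t - om s) /\
  forall t, D t -> 0 <= om t <= B.
Proof.
move=> d0 hB.
pose S t := [set r | exists (K : nat) (x : nat -> R), [/\ (forall k, (k <= K)%N -> D (x k)),
  (forall k, (k < K)%N -> x k < x k.+1), x K = t & r = \sum_(0 <= k < K) d (x k) (x k.+1)]].
have ubS t : ubound (S t) B by move=> _ [K [x [h1 h2 _ ->]]]; exact: hB.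
have S0 t : D t -> S t 0.
 by move=> Dt; exists 0%N, (fun=> t); split=> //; rewrite big_geq.
exists (fun t => sup (S t)); split=> [s t Ds Dt st|t Dt]; last first.
 apply/andP; split; first by apply: ub_le_sup; [exists B; exact: ubS|exact: S0].
 by apply: ge_sup; [exists 0; exact: S0|exact: ubS].
rewrite lerBrDr -lerBrDl; apply: ge_sup; first by exists 0; exact: S0.
move=> _ [K [x [h1 h2 h3 ->]]]; rewrite lerBrDl; apply: ub_le_sup; first by exists B; exact: ubS.
exists K.+1, (fun k => if (k <= K)%N then x k else t); split.
- by move=> k _; case: ifP => [/h1|].
- move=> k; rewrite ltnS => kK; rewrite kK; case: ltnP => [/h2//|Kk].
 by rewrite (_ : k = K) ?h3 //; apply/eqP; rewrite eqn_leq kK.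
- by rewrite ltnn.
rewrite big_nat_recr //= leqnn ltnn h3 addrC; congr (_ + _).
by apply: eq_big_nat => k /andP[_ kK]; rewrite (ltnW kK) kK.
Qed.

(** Increments are at most 2A, so their cubes are at most 2A times their squares, and a control
    function for the 2-variation becomes one for cubes. *)
Lemma rctl_of_variation (v : R -> R[i]) (d : R -> R -> R) (A B : R) : 0 <= A -> rcont v ->
 (forall t, cabs (v t) <= A) -> (forall s t, 0 <= d s t) -> 0 <= B -> 2 * A * B <= (2 * A) ^+ 3 ->
 (forall s t, d s t = cabs (v t - v s) ^+ 2) ->
 (forall (K : nat) (x : nat -> R), (forall k, (k < K)%N -> x k < x k.+1) -> \sum_(0 <= k < K) d (x k) (x k.+1) <= B) ->
 rctl v (2 * A).
Proof.
move=> A0 rc vA d0 B0 AB dE hB.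
have [|om [om1 om2]] := @chain_variation setT d B d0; first by move=> K x _; exact: hB.
have A20 : 0 <= 2 * A by lra.
split=> //; first by move=> t; apply: le_trans (vA t) _; lra.
exists (fun t => 2 * A * om t).
have inc s t : s <= t -> cabs (v t - v s) ^+ 2 <= om t - om s.
 rewrite le_eqVlt => /orP[/eqP ->|st]; first by rewrite !subrr cabs0 expr0n.
 by rewrite -dE; exact: om1.
split.
- move=> s t /inc h; rewrite ler_wpM2l // -subr_ge0; apply: le_trans h; exact: sqr_ge0.
- move=> t; have /andP[h1 h2] := om2 t I; rewrite mulr_ge0 //=.
 by apply: le_trans AB; rewrite ler_wpM2l.
- move=> s t /inc h; rewrite -mulrBr exprS; apply: ler_pM; rewrite ?cabs_ge0 ?sqr_ge0 //.
 apply: le_trans (cabsB _ _) _; have := vA t; have := vA s; lra.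
Qed.

Lemma V2_rctl (v : R -> R[i]) (N : R) : V2 v -> (V2_norm v <= N%:E)%E -> rctl v (2 * N).
Proof.
move=> [rc _ _] hN.
have ub (K : nat) (t : nat -> \bar R) : is_partition K t ->
  Num.sqrt (\sum_(0 <= k < K) cabs (ext_oo v (t k.+1) - ext_oo v (t k)) ^+ 2) <= N.
 by move=> ht; rewrite -lee_fin; apply: le_trans hN; apply: ereal_sup_ubound; exists K, t.
(* The partition with the points t and +oo, at which the function counts as 0, bounds the sup
   norm. *)
have vN t : cabs (v t) <= N.
 have := ub 1%N (fun k => if k is 0%N then t%:E else +oo%E); rewrite big_nat1 /= sub0r cabsN sqrtr_sqr.
 rewrite ger0_norm ?cabs_ge0 //; apply; split=> //; first exact: ltNyr.
 by move=> k; rewrite ltnS leqn0 => /eqP ->; exact: ltry.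
have N0 : 0 <= N by apply: le_trans (vN 0); exact: cabs_ge0.
apply: (@rctl_of_variation v (fun s t => cabs (v t - v s) ^+ 2) N (N ^+ 2)) => //.
- by move=> s t; exact: sqr_ge0.
- exact: sqr_ge0.
- rewrite exprMn -mulrA -exprS; have : 0 <= N ^+ 3 by exact: exprn_ge0.
 lra.
move=> [|K] x xm; first by rewrite big_geq // sqr_ge0.
have := ub K.+1 (fun k => (x k)%:E); rewrite /= => h.
have S0 : 0 <= \sum_(0 <= k < K.+1) cabs (v (x k.+1) - v (x k)) ^+ 2 by exact: sumsq_ge0.
rewrite -[leLHS]sqr_sqrtr // lerXn2r ?nnegrE ?sqrtr_ge0 //; apply: h; split=> //; first exact: ltNyr.
Qed.

Lemma V2_norm_ge0 (v : R -> R[i]) : (0 <= V2_norm v)%E.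
Proof.
apply: (le_via (Num.sqrt (\sum_(0 <= k < 1) cabs (ext_oo v k.+1%:R%:E - ext_oo v k%:R%:E) ^+ 2))%:E).
 by rewrite lee_fin sqrtr_ge0.
apply: ereal_sup_ubound; exists 1%N, (fun k => k%:R%:E); split=> //; split=> //; first exact: ltNyr.
by move=> k _; rewrite lte_fin ltr_nat.
Qed.

Lemma V2_norm_on_ge0 T (u : R -> R[i]) : (0 <= V2_norm_on T u)%E.
Proof. by apply: le_ereal_inf_tmp => _ [v _ <-]; exact: V2_norm_ge0. Qed.

(** The infimum over extensions may not be attained. If it is positive, an extension within a factor
    2 exists; if it is 0, the function vanishes on [0, T) and extends by 0. *)
Lemma V2_ext T (u : R -> R[i]) (N : R) : V2_norm_on T u = N%:E ->
 exists v, rctl v (4 * N) /\ forall t, 0 <= t < T -> v t = u t.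
Proof.
move=> e; have N0 : 0 <= N by rewrite -lee_fin -e; exact: V2_norm_on_ge0.
have near_ext (eps : R) : 0 < eps -> exists v, [/\ V2 v, forall t, 0 <= t < T -> v t = u t & (V2_norm v <= (N + eps)%:E)%E].
 move=> e0; have /ereal_inf_lt[_ [v [hv vu] <-] h] : (V2_norm_on T u < (N + eps)%:E)%E by rewrite e lte_fin ltrDl.
 by exists v; split => //; exact: ltW.
have [N00|Np] := leP N 0; last first.
 have [v [hv vu vN]] := near_ext _ Np; exists v; split=> //.
 by rewrite (_ : 4 * N = 2 * (N + N)); [exact: V2_rctl|ring].
have {}N00 : N = 0 by apply/eqP; rewrite eq_le N00.
exists (fun=> 0); split; first by rewrite N00 mulr0 -(cabs0 (R := R)); exact: rctl_cst.
move=> t tT; apply/esym/cabs0_eq0/eqP; rewrite eq_le cabs_ge0 andbT.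
apply/ler_addgt0Pr => eps e0; rewrite add0r.
have [v [hv vu vN]] := near_ext (eps / 2) ltac:(by rewrite divr_gt0).
by have [_ _ + _] := V2_rctl hv vN; move=> /(_ t); rewrite vu // N00 add0r mulrC divfK.
Qed.

Lemma V2_norm_on_scale T (c : R) (u : R -> R[i]) : 0 <= c <= 1 ->
 (V2_norm_on T (fun t => (c%:C * u t)%R) <= V2_norm_on T u)%E.
Proof.
move=> /andP[c0 c1]; apply: le_ereal_inf_tmp => _ [v [[v1 v2 v3] vu] <-].
have le (z w : R[i]) : cabs (c%:C * z - c%:C * w) <= cabs (z - w).
 by rewrite -mulrBr cabsM cabs_real ger0_norm // ler_piMl ?cabs_ge0.
have nle : (V2_norm (fun t => (c%:C * v t)%R) <= V2_norm v)%E.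
 apply: ge_ereal_sup => _ [K [t [ht ->]]].
 apply: (le_via (Num.sqrt (\sum_(0 <= k < K) cabs (ext_oo v (t k.+1) - ext_oo v (t k)) ^+ 2))%:E); last first.
  by apply: ereal_sup_ubound; exists K, t.
 rewrite lee_fin ler_wsqrtr //; apply: ler_sum => k _; rewrite lerXn2r ?nnegrE ?cabs_ge0 //.
 have E x : ext_oo (fun t => c%:C * v t) x = c%:C * ext_oo v x by case: x => //=; rewrite mulr0.
 by rewrite !E.
apply: (le_trans _ nle); apply: ereal_inf_lbound; exists (fun t => c%:C * v t) => //; split.
 split.
 - move=> t; apply: (@squeeze_cvgr _ _ _ _ (fun=> 0) (fun s => cabs (v s - v t))) => //; last exact: cvg_cst.
  by near=> s; rewrite cabs_ge0 le.
 - apply: (@squeeze_cvgr _ _ _ _ (fun=> 0) (fun s => cabs (v s))) => //; last exact: cvg_cst.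
  by near=> s; rewrite cabs_ge0 /=; have := le (v s) 0; rewrite mulr0 !subr0.
 - exact: le_lt_trans nle v3.
by move=> t /vu ->.
Unshelve. all: by end_near. Qed.

End Variation.

(** * Step functions and their variation *)

Section StepFunctions.
Context {R : realType}.

Definition stepf (K : nat) (x : nat -> R) (c : nat -> R[i]) (t : R) : R[i] :=
 \sum_(0 <= k < K) if x k <= t < x k.+1 then c k else 0.

Variables (K : nat) (x : nat -> R) (c : nat -> R[i]).
Hypothesis xm : forall k, (k < K)%N -> x k <= x k.+1.

Let xle i j : (i <= j <= K)%N -> x i <= x j.
Proof.
elim: j => [|j ih]; first by rewrite leqn0 => /andP[/eqP ->].
move=> /andP[]; rewrite leq_eqVlt => /orP[/eqP -> //|]; rewrite ltnS => ij jK.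
by apply: le_trans (xm jK); apply: ih; rewrite ij ltnW.
Qed.

Lemma stepf_piece k t : (k < K)%N -> x k <= t < x k.+1 -> stepf K x c t = c k.
Proof.
move=> kK /andP[a b]; rewrite /stepf big_mkord (bigD1 (Ordinal kK)) //= a b big1 ?addr0 // => j jk.
case: ifP => // /andP[a' b']; have := ltn_ord j; rewrite -val_eqE /= in jk.
case: (ltngtP j k) jk => // jk _ jK.
 by have := le_trans (@xle j.+1 k ltac:(by rewrite jk ltnW)) a; rewrite leNgt b'.
by have := le_trans (@xle k.+1 j ltac:(by rewrite jk ltnW)) a'; rewrite leNgt b.
Qed.

Lemma stepf_cases t : stepf K x c t = 0 \/ exists2 k, (k < K)%N & x k <= t < x k.+1 /\ stepf K x c t = c k.
Proof.
have [/existsP[k h]|/existsPn h] := boolP [exists k : 'I_K, x k <= t < x k.+1].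
 by right; exists k => //; split=> //; exact: stepf_piece.
by left; rewrite /stepf big_mkord big1 // => k _; rewrite (negbTE (h k)).
Qed.

Lemma stepf_rcont : rcont (stepf K x c).
Proof.
move=> t.
have E : \forall s \near t^'+, 0 = cabs (stepf K x c s - stepf K x c t).
 have H (k : nat) : \forall s \near t^'+, (x k <= s) = (x k <= t).
  have [kt|tk] := leP (x k) t.
   by near=> s; apply/ltW/(le_lt_trans kt); near: s; exact: nbhs_right_gt.
  by near=> s; apply/negbTE; rewrite -ltNge; near: s; exact: nbhs_right_lt.
 have H2 (n : nat) : \forall s \near t^'+, forall k, (k <= n)%N -> (x k <= s) = (x k <= t).
  elim: n => [|n ih]; first by apply: filterS (H 0%N) => s h k; rewrite leqn0 => /eqP ->.
  apply: filterS2 ih (H n.+1) => s h1 h2 k; rewrite leq_eqVlt => /orP[/eqP -> //|]; exact: h1.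
 apply: filterS (H2 K) => s h; rewrite (_ : stepf K x c s = stepf K x c t) ?subrr ?cabs0 //.
 apply: eq_big_nat => k /andP[_ kK]; rewrite (h k (ltnW kK)).
 by rewrite [s < _]ltNge (h k.+1 kK) -ltNge.
by apply: cvg_trans (near_eq_cvg E) _; exact: cvg_cst.
Unshelve. all: by end_near. Qed.

(** The cube of each value is charged at both ends of its interval by the Heaviside functions [m k]
    and [m k.+1]; the constant 4 is that of (p + q)^3 <= 4 (p^3 + q^3). *)
Lemma stepf_rctl (r : R) : 0 <= r -> r ^+ 3 = \sum_(0 <= k < K) cabs (c k) ^+ 3 ->
 rctl (stepf K x c) (2 * r).
Proof.
move=> r0 rE; set v := stepf K x c.
have c3 k : 0 <= cabs (c k) ^+ 3 by rewrite exprn_ge0 ?cabs_ge0.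
have cr k : (k < K)%N -> cabs (c k) <= r.
 move=> kK; rewrite -(@ler_pXn2r _ 3) ?nnegrE ?cabs_ge0 // rE big_mkord (bigD1 (Ordinal kK)) //= lerDl.
 by apply: sumr_ge0.
have vr t : cabs (v t) <= r.
 by rewrite /v; have [->|[k kK [_ ->]]] := stepf_cases t; [rewrite cabs0|exact: cr].
split; [lra|exact: stepf_rcont|by move=> t; have := vr t; lra|].
pose m k (t : R) : R := (x k <= t)%R%:R.
have mm k s t : s <= t -> m k s <= m k t.
 by move=> st; rewrite /m ler_nat; case: (leP (x k) s) => // /le_trans/(_ st) ->.
have m1 k t : 0 <= m k t <= 1 by rewrite /m; case: (x k <= t); rewrite ?lexx ?ler01.
exists (fun t => 4 * \sum_(0 <= k < K) cabs (c k) ^+ 3 * (m k t + m k.+1 t)); split.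
- move=> s t st; rewrite ler_wpM2l //; apply: ler_sum => k _; rewrite ler_wpM2l //.
 by apply: lerD; exact: mm.
- move=> t; apply/andP; split.
  rewrite mulr_ge0 //; apply: sumr_ge0 => k _; rewrite mulr_ge0 //.
  by have := m1 k t; have := m1 k.+1 t; lra.
 rewrite (_ : (2 * r) ^+ 3 = 4 * \sum_(0 <= k < K) cabs (c k) ^+ 3 * 2).
  rewrite ler_wpM2l //; apply: ler_sum => k _; rewrite ler_wpM2l //.
  by have := m1 k t; have := m1 k.+1 t; lra.
 by rewrite -mulr_suml -rE; ring.
move=> s t st; rewrite -mulrBr -[in leRHS]sumrB.
have nn : 0 <= 4 * \sum_(0 <= k < K) (cabs (c k) ^+ 3 * (m k t + m k.+1 t) - cabs (c k) ^+ 3 * (m k s + m k.+1 s)).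
 rewrite mulr_ge0 //; apply: sumr_ge0 => k _; rewrite -mulrBr mulr_ge0 //.
 by have := mm k _ _ st; have := mm k.+1 _ _ st; lra.
(* If the values differ, the interval containing t begins, and the one containing s ends, between s
   and t. *)
have [e|ne] := eqVneq (v t) (v s); first by rewrite e subrr cabs0 expr0n.
rewrite (eq_bigr (fun k => cabs (c k) ^+ 3 * (m k t - m k s) + cabs (c k) ^+ 3 * (m k.+1 t - m k.+1 s))); last by move=> k _; ring.
rewrite big_split /=.
have term k j : (k < K)%N -> 0 <= cabs (c k) ^+ 3 * (m j t - m j s) by move=> _; rewrite mulr_ge0 ?subr_ge0 ?mm.
have ht : cabs (v t) ^+ 3 <= \sum_(0 <= k < K) cabs (c k) ^+ 3 * (m k t - m k s).
 rewrite {1}/v; have [->|[k kK [/andP[a b] vE]]] := stepf_cases t.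
  by rewrite cabs0 expr0n /= big_mkord; apply: sumr_ge0 => k _; apply: term.
 rewrite big_mkord (bigD1 (Ordinal kK)) //=; rewrite vE; apply: (le_via (cabs (c k) ^+ 3 * (m k t - m k s))).
  rewrite /m a; have [ks|ks] := leP (x k) s; last by rewrite subr0 mulr1.
  by exfalso; move/eqP: ne; apply; rewrite /v vE (@stepf_piece k) // ks (le_lt_trans st b).
 by rewrite lerDl; apply: sumr_ge0 => j _; apply: term.
have hs : cabs (v s) ^+ 3 <= \sum_(0 <= k < K) cabs (c k) ^+ 3 * (m k.+1 t - m k.+1 s).
 rewrite {1}/v; have [->|[k kK [/andP[a b] vE]]] := stepf_cases s.
  by rewrite cabs0 expr0n /= big_mkord; apply: sumr_ge0 => k _; apply: term.
 rewrite big_mkord (bigD1 (Ordinal kK)) //=; rewrite vE; apply: (le_via (cabs (c k) ^+ 3 * (m k.+1 t - m k.+1 s))).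
  rewrite /m [x k.+1 <= s]leNgt b; have [ks|ks] := leP (x k.+1) t; first by rewrite subr0 mulr1.
  by exfalso; move/eqP: ne; apply; rewrite /v vE (@stepf_piece k) // (le_trans a st) ks.
 by rewrite lerDl; apply: sumr_ge0 => j _; apply: term.
apply: (le_via (4 * (cabs (v t) ^+ 3 + cabs (v s) ^+ 3))); last by rewrite ler_wpM2l // lerD.
apply: (le_via ((cabs (v t) + cabs (v s)) ^+ 3)).
 by rewrite lerXn2r ?nnegrE ?addr_ge0 ?cabs_ge0 // cabsB.
have := cabs_ge0 (v t); have := cabs_ge0 (v s); move: (cabs (v t)) (cabs (v s)) => p q q0 p0.
have : 0 <= (p + q) * (p - q) ^+ 2 by rewrite mulr_ge0 ?addr_ge0 ?sqr_ge0.
by nra.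
Qed.

End StepFunctions.

(** * Sobolev weights and extracted data *)

Section Data.
Context {R : realType}.

Lemma sqnormE k : sqnorm k = \sum_(j < 4) ((cmp k j)%:~R) ^+ 2 :> R.
Proof. by rewrite !big_ord_recl big_ord0 addr0 /cmp /= /sqnorm !addrA !intrD !rmorphXn. Qed.

Lemma sqnorm_ge0 k : 0 <= sqnorm k :> R.
Proof. by rewrite sqnormE; exact: sumsq_ge0. Qed.

Lemma intr_sqr (m : int) : (m%:~R : R) ^+ 2 = `|m|%N%:R ^+ 2.
Proof.
case: m => n; first by rewrite -pmulrn.
by rewrite NegzE mulrNz sqrrN abszN -pmulrn.
Qed.

Lemma lev_jap k : 4 ^+ lev k <= 1 + sqnorm k :> R.
Proof.
have [e|l0] := posnP (lev k); first by rewrite e expr0 lerDl sqnorm_ge0.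
have [j e] := sup4_ex k.
apply: (le_via (sqnorm k)); last by rewrite lerDr.
rewrite sqnormE (bigD1 j) //=; apply: (le_via ((cmp k j)%:~R ^+ 2)); last first.
 by rewrite lerDl; exact: sumsq_ge0.
rewrite intr_sqr -e (_ : 4 = 2 ^+ 2 :> R); last by ring.
rewrite -exprM mulnC exprM lerXn2r ?nnegrE ?exprn_ge0 //.
by rewrite -natrX ler_nat lev_sup4.
Qed.

Lemma jap_lev k : 1 + sqnorm k <= 17 * 4 ^+ lev k :> R.
Proof.
have h1 : 1 <= 4 ^+ lev k :> R by rewrite exprn_ege1 //; lra.
have h : sqnorm k <= \sum_(j < 4) 4 * 4 ^+ lev k :> R.
 rewrite sqnormE; apply: ler_sum => j _; rewrite intr_sqr (_ : 4 * 4 ^+ lev k = (2 ^+ (lev k).+1) ^+ 2 :> R); last first.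
  by rewrite -exprM mulnC exprM -exprS (_ : 2 ^+ 2 = 4 :> R) //; ring.
 rewrite lerXn2r ?nnegrE ?exprn_ge0 // -natrX ler_nat.
 by apply: leq_trans (cmp_le_sup k j) _; exact: ltnW (sup4_lt_lev k).
move: h; rewrite sumr_const card_ord => h; lra.
Qed.

(** The Sobolev exponent of factor i, negative for the dual function. *)
Definition sgn (i : 'I_4) : R := if i == o3 then -1 else 1.

Lemma jap2 k : japanese k ^+ 2 = 1 + sqnorm k :> R.
Proof. by rewrite sqr_sqrtr // addr_ge0 // sqnorm_ge0. Qed.

Lemma jap_gt0 k : 0 < japanese k :> R.
Proof. by rewrite sqrtr_gt0 ltr_pwDl // sqnorm_ge0. Qed.

Lemma powR_jap1 k : japanese k `^ (2 * 1) = 1 + sqnorm k :> R.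
Proof. by rewrite mulr1 powR_mulrn ?(ltW (jap_gt0 k)) // jap2. Qed.

Lemma powR_japN1 k : japanese k `^ (2 * -1) = (1 + sqnorm k)^-1 :> R.
Proof. by rewrite mulrN1 powRN powR_mulrn ?(ltW (jap_gt0 k)) // jap2. Qed.

Lemma lw_jap i k : lw i (lev k) ^+ 2 <= 17 * japanese k `^ (2 * sgn i) :> R.
Proof.
have q : (2 ^+ lev k) ^+ 2 = 4 ^+ lev k :> R by rewrite -exprM mulnC exprM (_ : 2 ^+ 2 = 4 :> R) //; ring.
have J0 : 0 < 1 + sqnorm k :> R by have := @sqnorm_ge0 k; lra.
have L0 : 0 < 4 ^+ lev k :> R by exact: exprn_gt0.
rewrite /lw /sgn; case: ifP => _.
 by rewrite powR_japN1 exprVn q ler_pdivlMr // mulrC ler_pdivrMr //; exact: jap_lev.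
by rewrite powR_jap1 q; have := lev_jap k; lra.
Qed.

(** [v k] extends to all times the profile of the k-th coefficient after the free flow is undone,
    [a k] controls it, and [rho] bounds the dyadic Sobolev norm of the [a k]. *)
Definition ldata (i : 'I_4) (T : R) (w : R -> Z4 -> R[i]) (v : Z4 -> R -> R[i]) (a : Z4 -> R) (rho : R) : Prop :=
 [/\ 0 <= rho, forall k, rctl (v k) (a k),
   forall t k, 0 <= t < T -> w t k = expi (- (t * sqnorm k)) * v k t &
   forall ks, uniq ks -> \sum_(k <- ks) lw i (lev k) ^+ 2 * a k ^+ 2 <= rho ^+ 2].

Lemma esum_half (f : Z4 -> \bar R) : (forall k, 0 <= f k)%E -> ((\esum_(k in [set: Z4]) f k) `^ 2^-1 < +oo)%E ->
 (forall k, f k < +oo)%E /\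
 forall ks, uniq ks -> \sum_(k <- ks) fine (f k) <= fine ((\esum_(k in [set: Z4]) f k) `^ 2^-1) ^+ 2.
Proof.
move=> f0; set E := esum _ _ => Eoo.
have E0 : (0 <= E)%E by apply: esum_ge0.
have Efin : E \is a fin_num by rewrite ge0_fin_numE //; apply: lty_poweRy Eoo; rewrite invr_eq0.
have Es ks : uniq ks -> (\sum_(k <- ks) f k <= E)%E.
 move=> uks; apply: esum_ge; exists [set` ks]; last by rewrite fsbig_seq.
 by split => //; exact: finite_seq.
have fy k : (f k < +oo)%E.
 by have := Es [:: k] isT; rewrite big_seq1 => /le_lt_trans; apply; rewrite ltey_eq Efin.
split=> // ks uks; rewrite fine_poweR powR12_sqrt ?fine_ge0 // sqr_sqrtr ?fine_ge0 //.
rewrite -lee_fin fineK // -sumEFin; apply: le_trans (Es _ uks); apply: lee_sum => k _.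
by rewrite fineK // ge0_fin_numE.
Qed.

(** The constant satisfies 20^2 >= 17 * 4^2: 17 compares dyadic with Japanese weights, and 4 comes
    from [V2_ext]. *)
Lemma Y_data i T (w : R -> Z4 -> R[i]) : (Y_norm (sgn i) T w < +oo)%E ->
 exists v a, ldata i T w v a (20 * fine (Y_norm (sgn i) T w)).
Proof.
set n := fun k => V2_norm_on T (fun t => schrodinger (- t) (w t) k).
move=> Yoo; have n0 k : (0 <= n k)%E by exact: V2_norm_on_ge0.
have j0 k : 0 < japanese k `^ (2 * sgn i) :> R by rewrite powR_gt0 // jap_gt0.
have f0 k : (0 <= (japanese k `^ (2 * sgn i))%:E * n k ^+ 2)%E.
 by rewrite mule_ge0 // ?lee_fin ?(ltW (j0 k)) // sqre_ge0.
have [fy fs] := esum_half f0 Yoo.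
have nfin k : n k \is a fin_num.
 rewrite ge0_fin_numE // ltNge; apply/negP; rewrite leye_eq => /eqP e.
 by have := fy k; rewrite e -[(_ ^+ 2)%E]/(+oo * +oo)%E mulyy mulry gtr0_sg // mul1e.
have ext k := V2_ext (esym (fineK (nfin k))).
pose v k := sval (cid (ext k)); pose a k := 4 * fine (n k).
have vP k : rctl (v k) (a k) /\ forall t, 0 <= t < T -> v k t = schrodinger (- t) (w t) k.
 by rewrite /v; case: cid.
exists v, a; split.
- by rewrite mulr_ge0 // fine_ge0 // poweR_ge0.
- by move=> k; exact: (vP k).1.
- move=> t k ht; rewrite (vP k).2 // /schrodinger mulrA -expiD mulNr opprK addNr expi0 mul1r //.
move=> ks uks; rewrite exprMn; apply: le_trans (ler_wpM2l _ (fs ks uks)); last by rewrite sqr_ge0.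
rewrite mulr_sumr; apply: ler_sum => k _.
have -> : fine ((japanese k `^ (2 * sgn i))%:E * n k ^+ 2)%E = japanese k `^ (2 * sgn i) * fine (n k) ^+ 2.
 by rewrite -[in LHS](fineK (nfin k)).
apply: (le_via (17 * japanese k `^ (2 * sgn i) * a k ^+ 2)).
 by rewrite ler_wpM2r ?sqr_ge0 // lw_jap.
rewrite /a; have : 0 <= japanese k `^ (2 * sgn i) * fine (n k) ^+ 2 by rewrite mulr_ge0 ?sqr_ge0 // ltW.
rewrite (_ : 17 * _ * _ = 272 * (japanese k `^ (2 * sgn i) * fine (n k) ^+ 2)); last by ring.
rewrite (_ : 20 ^+ 2 = 400 :> R); [lra|ring].
Qed.

Lemma H_data i T (w : R -> Z4 -> R[i]) f : (H_norm (sgn i) f < +oo)%E ->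
 (forall t, 0 <= t < T -> w t = schrodinger t f) ->
 exists v a, ldata i T w v a (20 * fine (H_norm (sgn i) f)).
Proof.
move=> Hoo hw; have j0 k : 0 < japanese k `^ (2 * sgn i) :> R by rewrite powR_gt0 // jap_gt0.
have f0 k : (0 <= (japanese k `^ (2 * sgn i))%:E * (cabs (f k) ^+ 2)%:E)%E.
 by rewrite mule_ge0 // lee_fin ?sqr_ge0 // ltW.
have [_ fs] := esum_half f0 Hoo.
exists (fun k _ => f k), (fun k => cabs (f k)); split.
- by rewrite mulr_ge0 // fine_ge0 // poweR_ge0.
- by move=> k; exact: rctl_cst.
- by move=> t k ht; rewrite hw.
move=> ks uks; rewrite exprMn; apply: le_trans (ler_wpM2l _ (fs ks uks)); last by rewrite sqr_ge0.
rewrite mulr_sumr; apply: ler_sum => k _ /=.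
apply: (le_via (17 * japanese k `^ (2 * sgn i) * cabs (f k) ^+ 2)).
 by rewrite ler_wpM2r ?sqr_ge0 // lw_jap.
rewrite -mulrA; have : 0 <= japanese k `^ (2 * sgn i) * cabs (f k) ^+ 2 by rewrite mulr_ge0 ?sqr_ge0 // ltW.
rewrite (_ : 20 ^+ 2 = 400 :> R); [lra|ring].
Qed.

(** Near-maximisers of the finite sums, accumulated so that the sets increase, and enlarged by the
    frequencies of small index so that they exhaust the lattice. Whatever lies outside a
    near-maximiser has a small sum. *)
Lemma exhaustion (b : Z4 -> R) (S : R) (eps : nat -> R) : (forall k, 0 <= b k) ->
 (forall ks, uniq ks -> \sum_(k <- ks) b k <= S) -> (forall n, 0 < eps n) ->
 exists ks : nat -> seq Z4, [/\ forall n, uniq (ks n), forall n k, (choice.pickle k < n)%N -> k \in ks n,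
  forall n, {subset ks n <= ks n.+1} &
  forall n ls, uniq ls -> (forall k, k \in ls -> k \notin ks n) -> \sum_(k <- ls) b k <= eps n].
Proof.
move=> b0 bS e0; pose E := [set x : R | exists2 ks : seq Z4, uniq ks & x = \sum_(k <- ks) b k].
have EU : has_ubound E by exists S => _ [ks uks ->]; exact: bS.
have E0 : has_sup E by split => //; exists 0; exists [::] => //; rewrite big_nil.
have ex n : exists ls : seq Z4, uniq ls /\ sup E - eps n < \sum_(k <- ls) b k.
 by have [_ [ls uls ->] h] := sup_adherent (e0 n) E0; exists ls.
pose l n := sval (cid (ex n)).
have lP n : uniq (l n) /\ sup E - eps n < \sum_(k <- l n) b k by rewrite /l; case: cid.
pose ks := fix ks n := if n is m.+1 then undup (ks m ++ l m.+1 ++ pmap choice.unpickle (iota 0 m.+1)) else l 0%N.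
have uks n : uniq (ks n) by case: n => [|n]; [exact: (lP 0%N).1|exact: undup_uniq].
have lk n : {subset l n <= ks n} by case: n => [//|n] k kl; rewrite mem_undup !mem_cat kl orbT.
exists ks; split=> //.
- case=> [//|n] k kn; rewrite -[ks n.+1]/(undup (ks n ++ l n.+1 ++ pmap choice.unpickle (iota 0 n.+1))).
 rewrite mem_undup !mem_cat mem_pmap; apply/orP; right; apply/orP; right.
 by apply/mapP; exists (choice.pickle k); [rewrite mem_iota|rewrite choice.pickleK].
- by move=> n k kk; rewrite /= mem_undup mem_cat kk.
move=> n ls uls dis.
have h : \sum_(k <- ls ++ l n) b k <= sup E.
 apply: (ub_le_sup EU); exists (ls ++ l n) => //; rewrite cat_uniq uls (lP n).1 andbT /=.
 by apply/hasPn => k /lk kk; apply/negP => /dis; rewrite kk.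
by move: h; rewrite big_cat /=; have := (lP n).2; lra.
Qed.

End Data.

(** * Reconstruction from Fourier coefficients *)

Section LimitTools.
Context {R : realType}.

Lemma geo_cvg0 (q B : R) : 1 < q -> B / q ^+ n @[n --> \oo] --> (0 : R).
Proof.
move=> q1; rewrite -[X in _ --> X](mulr0 B); apply: cvgM; first exact: cvg_cst.
by under eq_fun do rewrite -exprVn; apply: cvg_expr; rewrite ger0_norm ?invr_ge0 ?invf_lt1 //; lra.
Qed.

Lemma geo_cauchy (x : nat -> R) (B : R) : 0 <= B -> (forall n, `|x n.+1 - x n| <= B / 2 ^+ n) ->
 exists l : R, x n @[n --> \oo] --> l.
Proof.
move=> B0 h; pose g n : R := 2 * B / 2 ^+ n.
have g0 : g n @[n --> \oo] --> (0 : R) by apply: geo_cvg0; lra.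
have gS n : g n = g n.+1 + B / 2 ^+ n by rewrite /g exprS; field; exact: expf_neq0.
have nd : nondecreasing_seq (fun n => x n - g n).
 apply/nondecreasing_seqP => n; have := h n; rewrite ler_norml => /andP[h1 _].
 by have := gS n; lra.
have bd n : x n + g n <= x 0%N + g 0%N.
 elim: n => [//|n ih]; apply: le_trans ih; have := h n; rewrite ler_norml => /andP[_ h1].
 by have := gS n; lra.
have gp n : 0 <= g n by rewrite /g divr_ge0 ?mulr_ge0 ?exprn_ge0.
have /cvg_ex[l hl] : cvgn (fun n => x n - g n).
 apply: nondecreasing_is_cvgn => //; exists (x 0%N + g 0%N) => _ [n _ <-].
 by have := bd n; have := gp n; lra.
exists l; rewrite -(addr0 l); rewrite (_ : x = (fun n => (x n - g n) + g n)); first exact: cvgD.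
by apply/funext => n; rewrite subrK.
Qed.

Lemma cabs_cvg (z : nat -> R[i]) (l : R[i]) : complex.Re (z n) @[n --> \oo] --> complex.Re l ->
 complex.Im (z n) @[n --> \oo] --> complex.Im l -> cabs (z n - l) @[n --> \oo] --> (0 : R).
Proof.
move=> h1 h2; apply: (@squeeze_cvgr _ _ _ _ (fun=> 0)
  (fun n => `|complex.Re (z n) - complex.Re l| + `|complex.Im (z n) - complex.Im l|)).
- by near=> n; rewrite cabs_ge0 /=; have := cabs_le_ReIm (z n - l); rewrite !raddfB.
- exact: cvg_cst.
- by rewrite -[X in _ --> X](addr0 0); apply: cvgD; apply/norm_cvg0P/subr_cvg0.
Unshelve. all: by end_near. Qed.

Lemma cgeo_cauchy (z : nat -> R[i]) (B : R) : 0 <= B -> (forall n, cabs (z n.+1 - z n) <= B / 2 ^+ n) ->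
 exists l, cabs (z n - l) @[n --> \oo] --> (0 : R).
Proof.
move=> B0 h.
have [|a ha] := @geo_cauchy (fun n => complex.Re (z n)) B B0.
 by move=> n; apply: le_trans (h n); rewrite -raddfB; exact: Re_le_cabs.
have [|b hb] := @geo_cauchy (fun n => complex.Im (z n)) B B0.
 by move=> n; apply: le_trans (h n); rewrite -raddfB; exact: Im_le_cabs.
by exists (a +i* b); exact: cabs_cvg.
Qed.

Lemma cvg_const (z : nat -> R[i]) (l c : R[i]) : cabs (z n - l) @[n --> \oo] --> (0 : R) ->
 (\forall n \near \oo, z n = c) -> l = c.
Proof.
move=> h hc; apply/eqP; rewrite -subr_eq0; apply/eqP/cabs0_eq0.
have h2 : cabs (z n - l) @[n --> \oo] --> cabs (l - c).
 apply: cvg_trans (near_eq_cvg _) (cvg_cst (cabs (l - c))).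
 by apply: filterS hc => n ->; rewrite cabsBC.
exact: (cvg_unique _ h2 h).
Qed.

Lemma cmeas_slice d d' (X : measurableType d) (Y : measurableType d') (A : set X) (B : set Y) (F : X * Y -> R[i]) y :
 measurable A -> measurable B -> B y -> cmeasurable (A `*` B) F -> cmeasurable A (fun x => F (x, y)).
Proof.
move=> mA mB By; have mAB : measurable (A `*` B) by exact: measurableX.
have part (h : X * Y -> R) : measurable_fun (A `*` B) h -> measurable_fun A (fun x => h (x, y)).
 move=> mh; have mh' := (measurable_restrictT h mAB).1 mh.
 apply: (eq_measurable_fun (fun x => (h \_ (A `*` B)) (x, y))).
  by move=> x; rewrite inE => Ax; rewrite /patch mem_set.
 by apply: measurable_funTS; exact: measurableT_comp.
by move=> [h1 h2]; split; [exact: (part _ h1)|exact: (part _ h2)].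
Qed.

Lemma ae_meq d (X : measurableType d) (m m' : {measure set X -> \bar R}) (Q : X -> Prop) :
 (m : set X -> \bar R) = m' -> {ae m, forall x, Q x} -> {ae m', forall x, Q x}.
Proof. by move=> e [A [mA A0 s]]; exists A; split=> //; rewrite -e. Qed.

Lemma cneq_measurable d (X : measurableType d) (D : set X) (f g : X -> R[i]) : measurable D ->
 cmeasurable D f -> cmeasurable D g -> measurable (D `&` [set z | ~ (f z = g z)]).
Proof.
move=> mD mf mg; have mh := cmeas_cabs (cmeasB mf mg).
rewrite (_ : [set z | _] = (fun z => cabs (f z - g z)) @^-1` `]0, +oo[%classic).
 by apply: mh => //; exact: measurable_itv.
apply/seteqP; split=> z /=; rewrite in_itv /= andbT.
 move=> ne; rewrite lt_def cabs_ge0 andbT; apply/eqP => /cabs0_eq0/eqP; rewrite subr_eq0 => /eqP.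
 exact: ne.
by move=> h e; move: h; rewrite e subrr cabs0 ltxx.
Qed.

Lemma ae_section_rev d1 d2 (X : measurableType d1) (Y : measurableType d2)
  (m1 : {sigma_finite_measure set X -> \bar R}) (m2 : {sigma_finite_measure set Y -> \bar R})
  (A : set X) (B : set Y) (P : X * Y -> Prop) : measurable A -> measurable B ->
 measurable ((A `*` B) `&` [set z | ~ P z]) ->
 {ae (m1 \x m2)%E, forall z, (A `*` B) z -> P z} ->
 {ae m2, forall y, B y -> {ae m1, forall x, A x -> P (x, y)}}.
Proof.
move=> mA mB; set N := _ `&` _ => mN [N' [mN' N0 sN]].
have NN' : N `<=` N' by move=> z [h1 h2]; apply: sN => /= /(_ h1).
have mi : measurable_fun setT (\1_N : X * Y -> R) by exact: measurable_indic.
have [mI I0] := @tonelli_set R _ _ X Y m1 m2 A B mA mB (\1_N) (measurable_funTS mi) (fun z => ltac:(by [])).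
have NAB : N `<=` A `*` B by move=> z [].
have e0 : (m1 \x m2)%E N = 0%E by apply: subset_measure0 N0.
have {}I0 : (\int[m2]_(y in B) \int[m1]_(x in A) (\1_N (x, y))%:E = 0)%E.
 by rewrite -I0 integral_indic ?setIidl //; exact: measurableX.
have F0 y : (0 <= \int[m1]_(x in A) (\1_N (x, y))%:E)%E by apply: integral_ge0 => x _; rewrite lee_fin.
have := (ae_eq_integral_abs m2 mB mI).1.
under eq_integral do rewrite gee0_abs //.
move=> /(_ I0); apply: filterS => y hy By.
have my : measurable_fun A (EFin \o (fun x => \1_N (x, y) : R)).
 by apply: measurable_funTS; apply/measurable_EFinP; exact: measurableT_comp.
have := (ae_eq_integral_abs m1 mA my).1.
under eq_integral do rewrite /= ger0_norm //.
move=> /(_ (hy By)); apply: filterS => x hx Ax; apply: contrapT => nP.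
by have := hx Ax; rewrite /= indicE mem_set //= => -[] /eqP; rewrite oner_eq0.
Qed.

End LimitTools.

Section Recon.
Context {R : realType}.
Local Notation leb := (@lebesgue_measure R).
Variable T : R.
Hypothesis T2 : T <= 2 * pi.
Local Notation IT := (`[0, T[%classic : set (mR R)).
Local Notation dxt := (@dxdt R).
Local Notation SL := (@slab R T).

Lemma ae_slab (P : pt5 R -> Prop) : measurable (SL `&` [set z | ~ P z]) ->
 {ae leb, forall t, IT t -> {ae dx4, forall x, box x -> P (x, t)}} -> {ae dxt, forall z, SL z -> P z}.
Proof.
move=> mN h; apply: (ae_meq (esym dxdtE)).
by apply: (@ae_section R _ _ _ _ mu4 mu1 _ _ (@mbox R) (@mIT R T)).
Qed.

Lemma ae_slab_rev (P : pt5 R -> Prop) : measurable (SL `&` [set z | ~ P z]) ->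
 {ae dxt, forall z, SL z -> P z} -> {ae leb, forall t, IT t -> {ae dx4, forall x, box x -> P (x, t)}}.
Proof.
move=> mN /(ae_meq dxdtE) h.
exact: (@ae_section_rev R _ _ _ _ mu4 mu1 _ _ P (@mbox R) (@mIT R T) mN h).
Qed.

(** Almost everywhere approximation by partial sums with an integrable majorant of p-th powers, the
    input for dominated convergence of products. *)
Definition apx (p : nat) (f : R -> pt4 R -> R[i]) (v : Z4 -> R -> R[i]) (ks : nat -> seq Z4) : Prop :=
 [/\ forall n, uniq (ks n), cmeasurable SL (fun z => f z.2 z.1),
   {ae dxt, forall z, SL z -> cabs (fsum (ks n) v z.2 z.1 - f z.2 z.1) @[n --> \oo] --> (0 : R)} &
   exists H : pt5 R -> R, dxt.-integrable SL (EFin \o H) /\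
    {ae dxt, forall z, SL z -> forall n, cabs (fsum (ks n) v z.2 z.1) ^+ p <= H z}].

Lemma fsum_cmeas ks v : (forall k, rb (v k)) -> cmeasurable SL (fun z => fsum ks v z.2 z.1).
Proof. by move=> hv; apply: cint_meas; exact: (tp_integrable T2 (tp_fsum ks hv)). Qed.

Lemma expr_sum_le (x y : R) p : 0 <= x -> 0 <= y -> (x + y) ^+ p <= 2 ^+ p * (x ^+ p + y ^+ p).
Proof.
move=> x0 y0; have h (a b : R) : 0 <= a -> a <= b -> (a + b) ^+ p <= 2 ^+ p * (a ^+ p + b ^+ p).
 move=> a0 ab; have b0 := le_trans a0 ab; apply: (le_via ((2 * b) ^+ p)).
  by rewrite lerXn2r ?nnegrE ?addr_ge0 ?mulr_ge0 //; lra.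
 by rewrite exprMn ler_wpM2l ?exprn_ge0 // lerDr exprn_ge0.
by have [|/ltW] := leP x y; [exact: h|move=> yx; rewrite addrC [x ^+ p + _]addrC; exact: h].
Qed.

Lemma slice_coef ks (v : Z4 -> R -> R[i]) t k : uniq ks -> k \in ks ->
 cintegral dx4 (@box R) (fun x => fsum ks v t x * expi (- dot x k)) =
 ((2 * pi) ^+ 4)%:C * (expi (- (t * sqnorm k)) * v k t).
Proof.
move=> uks kk.
have E x : fsum ks v t x * expi (- dot x k) = \sum_(l <- ks) ch4 (l - k) x * (v l t * expi (- (t * sqnorm l))).
 by rewrite /fsum mulr_suml; apply: eq_bigr => l _; rewrite ch4D ch4N /ch4 expiN expiD; ring.
have ci l : cintegrable dx4 (@box R) (ch4 l).
 apply: (cintegrable_bounded (K := 1)); [exact: mbox|exact: fin_box|exact: cmeasS (cmeas_ch4 l)|].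
 by move=> x _; rewrite cabs_ch4.
rewrite (eq_cintegral _ (g := fun x => \sum_(l <- ks) ch4 (l - k) x * (v l t * expi (- (t * sqnorm l))))); last by move=> x _.
rewrite (cintegral_sum (@mbox R)) => [|l]; last by apply: (cintegrableZ (@mbox R)).
under eq_bigr do rewrite (cintegralZ (@mbox R)) // box_orth subr_eq0.
rewrite (bigD1_seq k) //= eqxx big1 ?addr0; first by rewrite [v k t * _]mulrC.
by move=> l /negbTE ->; rewrite mul0r.
Qed.

(** The sets of frequencies grow so fast that a weighted sum of p-th powers of the increments is
    integrable. This yields geometric convergence almost everywhere and the majorant. The limit is
    identified with f on almost every time slice by comparing Fourier coefficients and applying
    [box_complete]. *)
Lemma recon f v b (S C : R) (p r : nat) : (0 < p)%N -> (0 < r)%N -> 0 <= C -> spacetime_fun T f ->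
 (forall k, rb (v k)) -> (forall t k, 0 <= t < T -> hat f t k = expi (- (t * sqnorm k)) * v k t) ->
 (forall k, 0 <= b k) -> (forall ks, uniq ks -> \sum_(k <- ks) b k <= S) ->
 (forall ks, uniq ks -> (\int[dxdt]_(z in slab T) (cabs (fsum ks v z.2 z.1) ^+ p)%:E <= (C * (\sum_(k <- ks) b k) ^+ r)%:E)%E) ->
 exists ks, apx p f v ks.
Proof.
move=> p0 r0 C0 [mf fi] hv hf b0 bS hint.
have mS : measurable SL by exact: mslab.
(* The weights turn finiteness of [E] into increments at most B / 2^n, and [eps] is chosen to make
   the n-th integral at most C / 2^(n+1). *)
pose w n : R := 2 ^+ (n * p); pose eps n := (w n * (2 ^ n.+1)%:R)^-1.
have w0 n : 0 < w n by rewrite exprn_gt0.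
have tn0 n : 0 < (2 ^ n.+1)%:R :> R by rewrite ltr0n expn_gt0.
have e0 n : 0 < eps n by rewrite invr_gt0 mulr_gt0.
have e1 n : eps n <= 1.
 rewrite invf_le1 ?mulr_gt0 // mulr_ege1 //; first by rewrite exprn_ege1 // ler1n.
 by rewrite -[1]/(1%:R) ler_nat expn_gt0.
have [ks [uks kex knest ktail]] := exhaustion b0 bS e0.
pose ls n := [seq k <- ks n.+1 | k \notin ks n].
have uls n : uniq (ls n) by exact: filter_uniq.
have lb n : \sum_(k <- ls n) b k <= eps n by apply: ktail => // k; rewrite mem_filter => /andP[].
have dE n t x : fsum (ks n.+1) v t x = fsum (ks n) v t x + fsum (ls n) v t x.
 rewrite /fsum -big_cat; apply: perm_big; apply: uniq_perm => //.
  rewrite cat_uniq uks uls andbT /=; apply/hasPn => k; rewrite mem_filter => /andP[].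
  by [].
 move=> k; rewrite mem_cat mem_filter; case kn: (k \in ks n) => //=; exact: knest.
pose d n (z : pt5 R) := cabs (fsum (ls n) v z.2 z.1).
have md n : measurable_fun SL (d n) by apply: cmeas_cabs; exact: fsum_cmeas.
have d0 n z : 0 <= d n z by exact: cabs_ge0.
pose G n z : \bar R := (w n * d n z ^+ p)%:E; pose E z : \bar R := (\sum_(0 <= n <oo) G n z)%E.
have G0 n z : (0 <= G n z)%E by rewrite lee_fin mulr_ge0 ?exprn_ge0 ?(ltW (w0 n)).
have mG n : measurable_fun SL (G n).
 by apply/measurable_EFinP; apply: measurable_funM; [exact: measurable_cst|exact: measurable_funX].
have mE : measurable_fun SL E by apply: ge0_emeasurable_sum => [n z _ _|n _]; [exact: G0|exact: mG].
have E0 z : (0 <= E z)%E by apply: nneseries_ge0 => n _ _; exact: G0.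
have intE : (\int[dxt]_(z in SL) E z <= C%:E)%E.
 rewrite integral_nneseries //.
 apply: le_trans (epsilon_trick0 xpredT C0); apply: lee_nneseries => [n _ _|n _].
  by apply: integral_ge0 => z _; exact: G0.
 under eq_integral do rewrite /G EFinM.
 rewrite ge0_integralZl_EFin //; last 3 first.
 - by move=> z _; rewrite lee_fin exprn_ge0.
 - by apply/measurable_EFinP; exact: measurable_funX.
 - exact: ltW.
 apply: le_trans (lee_wpmul2l _ (hint _ (uls n))) _; first by rewrite lee_fin ltW.
 rewrite -EFinM lee_fin.
 have h : (\sum_(k <- ls n) b k) ^+ r <= eps n.
  have s0 : 0 <= \sum_(k <- ls n) b k by apply: sumr_ge0.
  apply: (le_via (eps n ^+ r)); first by rewrite lerXn2r ?nnegrE // ltW.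
  case: r r0 {hint} => [//|r] _; rewrite exprS ler_piMr ?(ltW (e0 n)) //.
  by rewrite exprn_ile1 // ltW.
 apply: (le_via (w n * (C * eps n))).
  by rewrite ler_wpM2l ?(ltW (w0 n)) // ler_wpM2l.
 apply: le_of_eq; rewrite /eps; field.
 by rewrite !lt0r_neq0.
have Ei : dxt.-integrable SL E.
 apply/integrableP; split=> //; under eq_integral do rewrite gee0_abs //.
 by apply: le_lt_trans intE _; exact: ltry.
have finE := integrable_ae mS Ei.
pose B z : R := fine (E z) `^ (p%:R^-1).
have B0 z : 0 <= B z by exact: powR_ge0.
have Bp z : B z ^+ p = fine (E z).
 rewrite -powR_mulrn // -powRrM mulVf ?powRr1 ?fine_ge0 //; by rewrite pnatr_eq0 -lt0n.
have key z n : E z \is a fin_num -> d n z <= B z / 2 ^+ n.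
 move=> Ez; rewrite ler_pdivlMr ?exprn_gt0 // -(ler_pXn2r p0) ?nnegrE ?mulr_ge0 ?exprn_ge0 // Bp.
 rewrite exprMn -exprM mulrC -lee_fin fineK //.
 apply: (le_via (\sum_(0 <= i < n.+1) G i z)%E).
  by rewrite big_nat_recr //= leeDr //; apply: sume_ge0.
 by apply: nneseries_lim_ge => i _ _; exact: G0.
pose s n (z : pt5 R) := fsum (ks n) v z.2 z.1.
have sd n z : cabs (s n.+1 z - s n z) = d n z by rewrite /s dE addrC addKr.
have sbd n z : E z \is a fin_num -> cabs (s n z) <= cabs (s 0%N z) + 2 * B z.
 move=> Ez; suff h : cabs (s n z) <= cabs (s 0%N z) + (2 * B z - 2 * B z / 2 ^+ n).
  apply: le_trans h _; rewrite lerD2l gerBl divr_ge0 ?exprn_ge0 ?mulr_ge0 //.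
 elim: n => [|n ih]; first by rewrite expr0 divr1 subrr addr0.
 have := cabsD (s n z) (s n.+1 z - s n z); rewrite addrC subrK sd => h; apply: le_trans h _.
 apply: le_trans (lerD ih (key z n Ez)) _; rewrite exprS; apply: le_of_eq; field.
 exact: expf_neq0.
pose H z := 2 ^+ p * (cabs (s 0%N z) ^+ p + 2 ^+ p * fine (E z)).
have Hbd n z : E z \is a fin_num -> cabs (s n z) ^+ p <= H z.
 move=> Ez; apply: (le_via ((cabs (s 0%N z) + 2 * B z) ^+ p)).
  by rewrite lerXn2r ?nnegrE ?addr_ge0 ?cabs_ge0 ?mulr_ge0 // sbd.
 by apply: le_trans (expr_sum_le _ _ _) _; rewrite ?cabs_ge0 ?mulr_ge0 // exprMn Bp.
have ms n : cmeasurable SL (s n) by exact: fsum_cmeas.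
have Hi : dxt.-integrable SL (EFin \o H).
 have i1 : dxt.-integrable SL (EFin \o (fun z => cabs (s 0%N z) ^+ p)).
  apply/integrableP; split; first by apply/measurable_EFinP; apply: measurable_funX; exact: cmeas_cabs.
  under eq_integral do rewrite /= ger0_norm ?exprn_ge0 ?cabs_ge0 //.
  by apply: le_lt_trans (hint _ (uks 0%N)) _; exact: ltry.
 have i2 : dxt.-integrable SL (EFin \o (fun z => fine (E z))).
  apply: (le_integrable mS _ _ Ei).
   by apply/measurable_EFinP; exact: (measurableT_comp (@fine_measurable _ _ measurableT)).
  by move=> z _ /=; case: (E z) => [x| |] //=; rewrite leey.
 have i3 := integrableZl mS (2 ^+ p) (integrableD mS i1 (integrableZl mS (2 ^+ p) i2)).
 by apply: eq_integrable i3 => // z _; rewrite /H /= EFinM EFinD EFinM.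
(* Replacing the partial sums by 0 where [E] is infinite makes the limit exist everywhere, hence
   measurable. *)
have conv z : exists l, cabs ((if E z \is a fin_num then s n z else 0) - l) @[n --> \oo] --> (0 : R).
 case: (boolP (E z \is a fin_num)) => Ez; last by exists 0; under eq_fun do rewrite subrr cabs0; exact: cvg_cst.
 by apply: (cgeo_cauchy (B0 z)) => n; rewrite sd; exact: key.
pose sl z := sval (cid (conv z)).
have slP z : cabs ((if E z \is a fin_num then s n z else 0) - sl z) @[n --> \oo] --> (0 : R) by rewrite /sl; case: cid.
have mfin : measurable (SL `&` [set z | E z \is a fin_num]) by exact: emeasurable_fin_num.
have ms' n : cmeasurable SL (fun z => if E z \is a fin_num then s n z else 0).
 apply: (cmeas_eq (f := fun z => s n z * ((\1_(SL `&` [set z | E z \is a fin_num]) z)%:C))).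
  move=> z Sz; rewrite indicE; case: ifP => Ez; first by rewrite mem_set // mulr1.
  by rewrite memNset ?mulr0 // => -[_ /=]; rewrite Ez.
 by apply: cmeasM => //; apply: cmeas_real; apply: measurable_funTS; exact: measurable_indic.
have msl : cmeasurable SL sl by apply: (cmeas_lim mS ms') => z _; exact: slP.
have mbadE : measurable (SL `&` [set z | ~ (E z \is a fin_num)]).
 rewrite (_ : SL `&` _ = SL `\` (SL `&` [set z | E z \is a fin_num])); first exact: measurableD.
 by apply/seteqP; split=> z /= [h1 h2]; split=> //; [case|move=> h; apply: h2].
have ident : {ae dxt, forall z, SL z -> sl z = f z.2 z.1}.
 apply: ae_slab; first exact: cneq_measurable.
 have Hc : cintegrable dxt SL (fun z => (H z)%:C) by split=> //; exact: integrable0.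
 have [Hae _ _] := fubini_slab Hc.
 apply: filterS2 Hae (ae_slab_rev mbadE finE) => t h1 h2 It.
 have Ht := (h1 It).1; have Et := h2 It.
 have tT : 0 <= t < T by move: It; rewrite /= in_itv.
 have dom k : cintegrable dx4 (@box R) (fun x => sl (x, t) * expi (- dot x k)) /\
   cabs (cintegral dx4 (@box R) (fun x => s n (x, t) * expi (- dot x k)) -
    cintegral dx4 (@box R) (fun x => sl (x, t) * expi (- dot x k))) @[n --> \oo] --> (0 : R).
  have mk := @cmeas_char R k (@box R).
  (* The majorant controls p-th powers; adding 1 makes it control the partial sums themselves. *)
  apply: (cdominated (@mbox R) (h := fun x => 1 + H (x, t))).
  - move=> n; apply: cmeasM => //.
   exact: (@cmeas_slice R _ _ _ _ (@box R) IT (s n) t (@mbox R) (@mIT R T) It).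
  - apply: cmeasM => //; exact: (@cmeas_slice R _ _ _ _ (@box R) IT sl t (@mbox R) (@mIT R T) It).
  - apply: filterS Et => x hx bx; have h := slP (x, t); rewrite (hx bx) in h.
   by under eq_fun do rewrite -mulrBl cabsM cabs_expi mulr1.
  - have i1 : (@dx4 R).-integrable (@box R) (EFin \o cst 1).
    apply: measurable_bounded_integrable; [exact: mbox|exact: fin_box|exact: measurable_cst|].
    by exists 1; split=> // M hM y _; rewrite /= normr1 ltW.
   by apply: eq_integrable (integrableD (@mbox R) i1 Ht) => //; exact: mbox.
  - apply: filterS Et => x hx n bx; rewrite cabsM cabs_expi mulr1.
   apply: le_trans (_ : 1 + cabs (s n (x, t)) ^+ p <= _); last by rewrite lerD2l Hbd // hx.
   have [c1|c1] := leP (cabs (s n (x, t))) 1; first by rewrite -[leLHS]addr0 lerD // exprn_ge0 ?cabs_ge0.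
   rewrite -[leLHS]add0r lerD // -[leLHS]expr1; apply: ler_weXn2l => //; exact: ltW.
 have fint k : cintegrable dx4 (@box R) (fun x => f t x * expi (- dot x k)).
  apply: (cintegrableM (@mbox R) (K := 1)) => //; first exact: fi.
   exact: cmeas_char.
  by move=> x _; rewrite cabs_expi.
 have coef k : cintegral dx4 (@box R) (fun x => sl (x, t) * expi (- dot x k)) =
   cintegral dx4 (@box R) (fun x => f t x * expi (- dot x k)).
  (* Once k has entered [ks n], the coefficient of the partial sum at k no longer changes. *)
  apply: (cvg_const (dom k).2); exists (choice.pickle k).+1 => // n /= kn.
  rewrite (slice_coef v t (uks n) (kex _ _ kn)) -(hf t k tT) /hat /fourier mulrA -rmorphM /= divff ?mul1r //.
  by rewrite expf_neq0 // gt_eqF // pi2_gt0.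
 have dint k : cintegrable dx4 (@box R) (fun x => (sl (x, t) - f t x) * expi (- dot x k)).
  apply: (cintegrable_eq (@mbox R) (f := fun x => sl (x, t) * expi (- dot x k) + f t x * expi (- dot x k) * (-1))).
   by move=> x _; ring.
  by apply: (cintegrableD (@mbox R)); [exact: (dom k).1|exact: (cintegrableZ (@mbox R))].
 have := @box_complete R (fun x => sl (x, t) - f t x).
 have e00 x : expi (- dot x 0) = 1 :> R[i] by rewrite expiN -/(ch4 0 x) ch4_0 conjc1.
 case.
 - by apply: (cintegrable_eq (@mbox R) (f := fun x => (sl (x, t) - f t x) * expi (- dot x 0))) => // x _; rewrite e00 mulr1.
 - move=> k; rewrite /fourier (eq_cintegral _ (g := fun x => sl (x, t) * expi (- dot x k) + f t x * expi (- dot x k) * (-1))); last by move=> x _; ring.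
  rewrite (cintegralD (@mbox R)); [|exact: (dom k).1|exact: (cintegrableZ (@mbox R))].
  by rewrite (cintegralZ (@mbox R)) // coef mulrN1 subrr mulr0.
 move=> N hN; exists N; case: hN => mN N0 sN; split=> // x /= h; apply: sN => /= h'; apply: h => bx.
 by apply/eqP; rewrite -subr_eq0; apply/eqP; exact: h'.
exists ks; split=> //.
- apply: filterS2 ident finE => z h1 h2 Sz; have := slP z; rewrite (h2 Sz) (h1 Sz); exact.
- by exists H; split=> //; apply: filterS finE => z h Sz n; apply: Hbd; exact: h.
Qed.

End Recon.

(** * The quadrilinear estimate for functions *)

Section FourFunctions.
Context {R : realType}.
Local Notation leb := (@lebesgue_measure R).

Lemma cvg_cmul (u w : nat -> R[i]) a b : cabs (u n - a) @[n --> \oo] --> (0 : R) ->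
 cabs (w n - b) @[n --> \oo] --> (0 : R) -> cabs (u n * w n - a * b) @[n --> \oo] --> (0 : R).
Proof.
move=> h1 h2; apply: (@squeeze_cvgr _ _ _ _ (fun=> 0)
 (fun n => cabs (u n - a) * cabs (w n - b) + cabs a * cabs (w n - b) + cabs b * cabs (u n - a))).
- near=> n; rewrite cabs_ge0 /=.
 rewrite (_ : u n * w n - a * b = (u n - a) * (w n - b) + a * (w n - b) + b * (u n - a)); last by ring.
 by apply: le_trans (cabsD _ _) _; rewrite -!cabsM lerD2r cabsD.
- exact: cvg_cst.
- rewrite (_ : 0 = 0 * 0 + cabs a * 0 + cabs b * 0 :> R); last by ring.
 apply: cvgD; [apply: cvgD|]; apply: cvgM => //; exact: cvg_cst.
Unshelve. all: by end_near. Qed.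

Lemma cvg_cle (u : nat -> R[i]) l (K : R) : cabs (u n - l) @[n --> \oo] --> (0 : R) ->
 (forall n, cabs (u n) <= K) -> cabs l <= K.
Proof.
move=> h hK; apply/ler_addgt0Pr => e e0; move/cvgrPdist_le: h => /(_ e e0) [n0 _ hn].
have := hn n0 (leqnn _); rewrite sub0r normrN ger0_norm ?cabs_ge0 // => h.
have := cabsB (u n0) (u n0 - l); rewrite subKr => h2; apply: le_trans h2 _; exact: lerD.
Qed.

(** The reciprocals of 6, 6, 6 and 2 sum to 1; the inequality supplies an integrable majorant for
    the product of four partial sums. *)
Lemma amgm4 (x y z g : R) : 0 <= x -> 0 <= y -> 0 <= z -> 0 <= g ->
 x * y * z * g <= x ^+ 6 + y ^+ 6 + z ^+ 6 + g ^+ 2.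
Proof.
move=> x0 y0 z0 g0.
have h1 : x * y * z * g <= (x * y * z) ^+ 2 + g ^+ 2.
 have : 0 <= (x * y * z - g) ^+ 2 by exact: sqr_ge0.
 have : 0 <= x * y * z * g by rewrite !mulr_ge0.
 by rewrite sqrrB; set P := x * y * z; lra.
apply: le_trans h1 _; rewrite lerD2r !exprMn !(@exprM _ _ 2 3).
have := sqr_ge0 x; have := sqr_ge0 y; have := sqr_ge0 z.
move: (x ^+ 2) (y ^+ 2) (z ^+ 2) => A B D D0 B0 A0.
have h : 0 <= (A + B + D) * ((A - B) ^+ 2 + (B - D) ^+ 2 + (D - A) ^+ 2).
 by rewrite mulr_ge0 ?addr_ge0 ?sqr_ge0.
have e : (A + B + D) * ((A - B) ^+ 2 + (B - D) ^+ 2 + (D - A) ^+ 2) = 2 * (A ^+ 3 + B ^+ 3 + D ^+ 3 - 3 * (A * B * D)) by ring.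
have : 0 <= A * B * D by rewrite !mulr_ge0.
by move: h; rewrite e; lra.
Qed.

Section Slab3.
Variable T : R.
Hypothesis T2 : T <= 2 * pi.
Local Notation IT := (`[0, T[%classic : set (mR R)).
Local Notation dxt := (@dxdt R).
Local Notation SL := (@slab R T).

(** The integrability in which partial sums are controlled: L^6 for the three factors with a
    derivative, L^2 for the dual function. *)
Definition pe (i : 'I_4) : nat := if i == o3 then 2%N else 6%N.

Definition cmain : R := (2 * pi) ^+ 5 * 2 ^+ 113.

Lemma cmain_ge0 : 0 <= cmain.
Proof. by apply: mulr_ge0; apply: exprn_ge0 => //; exact: ltW (@pi2_gt0 R). Qed.

Theorem four_functions (f : 'I_4 -> R -> pt4 R -> R[i]) (v : 'I_4 -> Z4 -> R -> R[i]) (a : 'I_4 -> Z4 -> R)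
  (ks : 'I_4 -> nat -> seq Z4) (cj : 'I_4 -> bool) (h : R) (p : 'I_4) (Y : 'I_4 -> R) : 0 <= T ->
 (forall i, apx T (pe i) (f i) (v i) (ks i)) -> (forall i k, rctl (v i k) (a i k)) -> 0 <= h ->
 (1 <= h \/ forall n k, k \in ks p n -> T ^+ 2 * 16 ^+ lev k <= h ^+ 14) ->
 (forall i, 0 <= Y i) ->
 (forall i ls, uniq ls -> \sum_(k <- ls) lw i (lev k) ^+ 2 * a i k ^+ 2 <= Y i ^+ 2) ->
 cintegrable dxt SL (fun z => \prod_i cjif (cj i) (f i z.2 z.1)) /\
 cabs (cintegral dxt SL (fun z => \prod_i cjif (cj i) (f i z.2 z.1))) <= cmain * h * \prod_i Y i.
Proof.
move=> T0 ap hv h0 hp Y0 hY; have mS := @mslab R T.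
have rbv i k : rb (v i k) by exact: rctl_rb (hv i k).
have mcj b (F : pt5 R -> R[i]) : cmeasurable SL F -> cmeasurable SL (fun z => cjif b (F z)).
 by move=> mF; case: b => //=; exact: cmeas_conj.
pose H i := sval (cid (let: And4 _ _ _ e := ap i in e)).
have [HP1 HP2] : (forall i, dxt.-integrable SL (EFin \o H i)) /\
  (forall i, {ae dxt, forall z, SL z -> forall n, cabs (fsum (ks i n) (v i) z.2 z.1) ^+ pe i <= H i z}).
 by split=> i; rewrite /H; case: cid => ? [].
have mprod (F : 'I_4 -> pt5 R -> R[i]) : (forall i, cmeasurable SL (F i)) ->
  cmeasurable SL (fun z => \prod_i F i z).
 by move=> mF; under eq_fun do rewrite prod4; do 3?[apply: cmeasM => //].
have [||||| ci lim] := @cdominated R _ _ dxt SL mS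
  (fun n z => \prod_i cjif (cj i) (fsum (ks i n) (v i) z.2 z.1)) (fun z => \prod_i cjif (cj i) (f i z.2 z.1))
  (fun z => H o0 z + H o1 z + H o2 z + H o3 z).
- by move=> n; apply: mprod => i; apply: mcj; exact: fsum_cmeas.
- by apply: mprod => i; apply: mcj; have [] := ap i.
- have A i : {ae dxt, forall z, SL z -> cabs (fsum (ks i n) (v i) z.2 z.1 - f i z.2 z.1) @[n --> \oo] --> (0 : R)}.
  by have [] := ap i.
 have cjc b (u : nat -> R[i]) l : cabs (u n - l) @[n --> \oo] --> (0 : R) -> cabs (cjif b (u n) - cjif b l) @[n --> \oo] --> (0 : R).
  by case: b => //= hu; under eq_fun do rewrite -rmorphB cabs_conj.
 apply: filterS2 (filterI (A o0) (A o1)) (filterI (A o2) (A o3)) => z [a0 a1] [a2 a3] Sz.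
 rewrite prod4; under eq_fun do rewrite prod4.
 by do 3?[apply: cvg_cmul; last by apply: cjc; auto]; apply: cjc; exact: a0.
- have := integrableD mS (integrableD mS (integrableD mS (HP1 o0) (HP1 o1)) (HP1 o2)) (HP1 o3).
 by move=> i1; apply: eq_integrable i1.
- apply: filterS2 (filterI (HP2 o0) (HP2 o1)) (filterI (HP2 o2) (HP2 o3)) => z [a0 a1] [a2 a3] n Sz.
 rewrite prod4 !cabsM !cabs_cjif.
 apply: le_trans (amgm4 _ _ _ _) _; rewrite ?cabs_ge0 //.
 by do 3?[apply: lerD]; [exact: (a0 Sz n)|exact: (a1 Sz n)|exact: (a2 Sz n)|exact: (a3 Sz n)].
split=> //; apply: (cvg_cle lim) => n.
rewrite (_ : cmain * h * \prod_i Y i = (2 * pi) ^+ 5 * (2 ^+ 113 * h * \prod_i Y i)); last by rewrite /cmain !mulrA.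
apply: (@fsum_prod4 R T T2 (fun i => ks i n) v a cj h p Y) => //.
- by move=> i; have [] := ap i.
- by case: hp => [|hk]; [left|right; exact: hk].
- by move=> i; apply: hY; have [] := ap i.
Qed.

Lemma apx_fin i f ks v (a : Z4 -> R) : uniq ks -> (forall k, rctl (v k) (a k)) ->
 (forall t x, 0 <= t < T -> f t x = fsum ks v t x) -> apx T (pe i) f v (fun=> ks).
Proof.
move=> uks hv hf; have mS := @mslab R T.
have Sz z : SL z -> 0 <= z.2 < T by move=> [_]; rewrite /= in_itv.
have mf : cmeasurable SL (fun z => fsum ks v z.2 z.1) by apply: fsum_cmeas => // k; exact: rctl_rb (hv k).
split=> //.
- by apply: cmeas_eq mf => z /Sz h; rewrite hf.
- apply: aeW => z /Sz h; under eq_fun do rewrite hf // subrr cabs0; exact: cvg_cst.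
exists (fun=> (\sum_(k <- ks) a k) ^+ pe i); split.
 apply: measurable_bounded_integrable => //; first exact: fin_slab.
 by exists `|(\sum_(k <- ks) a k) ^+ pe i|; split => // M hM y _; exact: ltW.
have a0 k : 0 <= a k by have [] := hv k.
apply: aeW => z _ n; rewrite lerXn2r ?nnegrE ?cabs_ge0 ?sumr_ge0 //.
apply: le_trans (cabs_sum _ _ _) _; apply: ler_sum => k _; rewrite cabsM cabs_expi mulr1.
by have [] := hv k.
Qed.

Lemma pairing_coef (G : R -> pt4 R -> R[i]) c k : rb c -> cintegrable dxt SL (fun z => G z.2 z.1) ->
 [/\ cintegrable dxt SL (fun z => G z.2 z.1 * (c z.2 * expi (- dot z.1 k))),
   cintegrable leb IT (fun t => c t * fourier (G t) k) &
   cintegral dxt SL (fun z => G z.2 z.1 * (c z.2 * expi (- dot z.1 k))) =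
   ((2 * pi) ^+ 4)%:C * cintegral leb IT (fun t => c t * fourier (G t) k)].
Proof.
move=> [rc [K hK]] Gi; have mS := @mslab R T; have mb := @mbox R; have mI := @mIT R T.
have mE := cmeas_char k (@box R).
have mE' : cmeasurable SL (fun z => expi (- dot z.1 k)) by exact: (cmeas_fst mb mI (cmeas_char k setT)).
have i1 : cintegrable dxt SL (fun z => G z.2 z.1 * (c z.2 * expi (- dot z.1 k))).
 apply: (cintegrableM mS (K := K)) => //; last by move=> z _; rewrite cabsM cabs_expi mulr1.
 by apply: cmeasM => //; exact: (cmeas_snd mb mI (cmeas_rcont T2 rc)).
have [a1 a2 a3] := fubini_slab i1; have [b1 b2 b3] := fubini_slab Gi.
pose q : R[i] := ((2 * pi) ^+ 4)%:C.
have q0 : (2 * pi) ^+ 4 != 0 :> R by rewrite expf_neq0 // gt_eqF // pi2_gt0.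
pose q' : R[i] := (((2 * pi) ^+ 4)^-1)%:C.
have qq' : q' * q = 1 by rewrite /q /q' -rmorphM /= mulVf.
have E : {ae leb, forall t, IT t -> cintegral dx4 (@box R) (fun x => G t x * (c t * expi (- dot x k))) =
  (c t * fourier (G t) k) * q}.
 apply: filterS b1 => t h It.
 have Gk : cintegrable dx4 (@box R) (fun x => G t x * expi (- dot x k)).
  by apply: (cintegrableM mb (K := 1)) => //; [exact: h|move=> x _; rewrite cabs_expi].
 rewrite (eq_cintegral _ (g := fun x => G t x * expi (- dot x k) * c t)); last by move=> x _; ring.
 rewrite (cintegralZ mb) // /fourier -/q'; set X := cintegral _ _ _.
 have gen (x y z w : R[i]) : x * (y * z) * w = z * x * (y * w) by ring.
 by rewrite gen qq' mulr1.
have mc : cmeasurable IT c by exact: cmeas_rcont.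
have [c1 c2 _] : [/\ {ae leb, forall t, IT t -> cintegrable dx4 (@box R) (fun x => G t x * expi (- dot x k))},
  cintegrable leb IT (fun t => cintegral dx4 (@box R) (fun x => G t x * expi (- dot x k))) & True].
 have i2 : cintegrable dxt SL (fun z => G z.2 z.1 * expi (- dot z.1 k)).
  by apply: (cintegrableM mS (K := 1)) => //; move=> z _; rewrite cabs_expi.
 by have [] := fubini_slab i2.
have i3 : cintegrable leb IT (fun t => c t * fourier (G t) k).
 apply: (cintegrable_eq mI (f := fun t : mR R => cintegral dx4 (@box R) (fun x => G t x * expi (- dot x k)) * (c t * q'))).
  by move=> t _; rewrite /fourier -/q'; ring.
 apply: (cintegrableM mI (K := K * cabs q')) => //; first by apply: cmeasM => //; exact: cmeas_cst.
 by move=> t _; rewrite cabsM ler_wpM2r ?cabs_ge0.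
split=> //; rewrite a3 -/q [RHS]mulrC -(cintegralZ mI) //.
apply: (ae_eq_cintegral mI); [exact: cint_meas a2|exact: cint_meas (cintegrableZ mI _ i3)|exact: E].
Qed.

Lemma apx_smooth i u v a rho : i != o3 -> spacetime_fun T u -> ldata i T (hat u) v a rho ->
 exists ks, apx T (pe i) u v ks.
Proof.
move=> i3 su [rho0 hv hu ha]; rewrite /pe (negbTE i3).
have lwE k : lw i (lev k) ^+ 2 = 4 ^+ lev k :> R.
 by rewrite /lw (negbTE i3) -exprM mulnC exprM (_ : 2 ^+ 2 = 4 :> R) //; ring.
apply: (@recon R T T2 u v (fun k => 4 ^+ lev k * a k ^+ 2) (rho ^+ 2) ((2 * pi) ^+ 5 * 2 ^+ 78) 6 3) => //.
- by apply: mulr_ge0; apply: exprn_ge0 => //; exact: ltW (@pi2_gt0 R).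
- by move=> k; exact: rctl_rb (hv k).
- by move=> k; rewrite mulr_ge0 ?sqr_ge0 ?exprn_ge0.
- by move=> ls uls; apply: le_trans (ha _ uls); apply: ler_sum => k _; rewrite lwE.
- by move=> ls uls; rewrite -mulrA; exact: fsum_L6.
Qed.

(** Bessel's inequality in space-time, read off from the nonnegative integral of |g - s|^2 for a
    partial sum s with the same profiles. *)
Lemma coef_bessel g v : spacetime_fun T g -> spacetime_L2 T g -> (forall k, rb (v k)) ->
 (forall t k, 0 <= t < T -> hat g t k = expi (- (t * sqnorm k)) * v k t) ->
 cintegrable dxt SL (fun z => g z.2 z.1) /\ exists S, forall ks, uniq ks ->
 \sum_(k <- ks) \int[leb]_(t in IT) (cabs (v k t) ^+ 2) <= S.
Proof.
move=> [mg _] g2 hv hg; have mS := @mslab R T; have mI := @mIT R T.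
have i1 : dxt.-integrable SL (EFin \o cst 1).
 apply: measurable_bounded_integrable; [exact: mS|exact: fin_slab|exact: measurable_cst|].
 by exists 1; split=> // M hM y _; rewrite /= normr1 ltW.
have gi : cintegrable dxt SL (fun z => g z.2 z.1).
 apply: (cintegrable_le mS (h := fun z => 1 + cabs (g z.2 z.1) ^+ 2)) => //.
  move=> z _; have := cabs_ge0 (g z.2 z.1); move: (cabs _) => q q0.
  have : 0 <= (q - 1) ^+ 2 by exact: sqr_ge0.
  by rewrite sqrrB; nra.
 by apply: eq_integrable (integrableD mS i1 g2).
split=> //; pose q : R := (2 * pi) ^+ 4.
have qp : 0 < q by rewrite exprn_gt0 // pi2_gt0.
pose I2 : R := fine (\int[dxt]_(z in SL) (cabs (g z.2 z.1) ^+ 2)%:E)%E.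
exists (I2 / q) => ks uks; rewrite ler_pdivlMr // mulrC.
set S := \sum_(k <- ks) _.
have cg2 : cintegrable dxt SL (fun z => (cabs (g z.2 z.1) ^+ 2)%:C) by split=> //; exact: integrable0.
have Ig2 : cintegral dxt SL (fun z => (cabs (g z.2 z.1) ^+ 2)%:C) = I2%:C.
 by rewrite /cintegral /= Rintegral_cst // mul0r.
pose s (z : pt5 R) := fsum ks v z.2 z.1.
have tf : tp (fsum ks v) by exact: tp_fsum.
have cs2 : cintegrable dxt SL (fun z => (cabs (s z) ^+ 2)%:C).
 apply: (cintegrable_eq mS (f := fun z : pt5 R => s z * ((s z)^*)%C)); first by move=> z _; rewrite mul_conj.
 by apply: (tp_integrable T2 (P := fun t x => fsum ks v t x * ((fsum ks v t x)^*)%C)); apply: tpM => //; exact: tp_conj.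
have Is2 : cintegral dxt SL (fun z => (cabs (s z) ^+ 2)%:C) = (q * S)%:C.
 have := int_real mS cs2; rewrite (fsum_L2 T2 uks hv) => -[] e.
 by rewrite /cintegral /= Rintegral_cst // mul0r; move: e; rewrite /cintegral /= => ->.
pose c k t : R[i] := ((v k t)^*)%C * expi (t * sqnorm k).
have hc k : rb (c k) by apply: rbM; [exact: rb_conj|exact: rb_expi].
have sc z : ((s z)^*)%C = \sum_(k <- ks) c k z.2 * expi (- dot z.1 k).
 rewrite /s /fsum conj_sum; apply: eq_bigr => k _; rewrite conjM -expiN /c -mulrA -expiD.
 by congr (_ * expi _); ring.
have PK k := @pairing_coef g (c k) k (hc k) gi.
have gsE z : g z.2 z.1 * ((s z)^*)%C = \sum_(k <- ks) g z.2 z.1 * (c k z.2 * expi (- dot z.1 k)).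
 by rewrite sc mulr_sumr.
have cgs : cintegrable dxt SL (fun z => g z.2 z.1 * ((s z)^*)%C).
 apply: (cintegrable_eq mS (f := fun z : pt5 R => \sum_(k <- ks) g z.2 z.1 * (c k z.2 * expi (- dot z.1 k)))) => //.
 by apply: (cintegrable_sum mS) => k; have [] := PK k.
have Igs : cintegral dxt SL (fun z => g z.2 z.1 * ((s z)^*)%C) = (q * S)%:C.
 rewrite (eq_cintegral _ (g := fun z : pt5 R => \sum_(k <- ks) g z.2 z.1 * (c k z.2 * expi (- dot z.1 k)))) //.
 rewrite (cintegral_sum mS) => [|k]; last by have [] := PK k.
 rewrite rmorphM /= rmorph_sum mulr_sumr; apply: eq_bigr => k _; have [_ _ ->] := PK k; congr (_ * _).
 rewrite (eq_cintegral _ (g := fun t : mR R => (cabs (v k t) ^+ 2)%:C)); last first.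
  move=> t It; rewrite -[fourier _ _]/(hat g t k) hg; last by move: It; rewrite /= in_itv.
  by rewrite /c -mul_conj [RHS]mulrC -[RHS]mulr1 -[in RHS](expi0 (R := R)) -(subrr (t * sqnorm k)) expiD; ring.
 by rewrite /cintegral /= Rintegral_cst // mul0r.
have Igs' : cintegral dxt SL (fun z => ((g z.2 z.1 * ((s z)^*)%C)^*)%C) = (q * S)%:C.
 have -> : cintegral dxt SL (fun z => ((g z.2 z.1 * ((s z)^*)%C)^*)%C) = ((cintegral dxt SL (fun z => g z.2 z.1 * ((s z)^*)%C))^*)%C.
  rewrite /cintegral /=; congr (_ +i* _); first by apply: eq_Rintegral => z _; case: (_ * _).
  rewrite -mulN1r -RintegralZl //; last exact: cgs.2.
  by apply: eq_Rintegral => z _; rewrite mulN1r; case: (_ * _).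
 by rewrite Igs conjc_real.
have cgs' : cintegrable dxt SL (fun z => ((g z.2 z.1 * ((s z)^*)%C)^*)%C).
 apply: (cintegrable_le mS (h := fun z => cabs (g z.2 z.1 * ((s z)^*)%C))).
 - by apply: cmeas_conj; exact: cint_meas cgs.
 - by move=> z _; rewrite cabs_conj.
 - exact: cintegrable_cabs.
have D z : (cabs (g z.2 z.1 - s z) ^+ 2)%:C = (cabs (g z.2 z.1) ^+ 2)%:C + (g z.2 z.1 * ((s z)^*)%C) * (-1) +
  (((g z.2 z.1 * ((s z)^*)%C)^*)%C * (-1) + (cabs (s z) ^+ 2)%:C).
 by rewrite -!mul_conj !conjM conjcK rmorphB /=; ring.
have tot : cintegral dxt SL (fun z => (cabs (g z.2 z.1 - s z) ^+ 2)%:C) = (I2 - q * S)%:C.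
 rewrite (eq_cintegral _ (g := fun z : pt5 R => (cabs (g z.2 z.1) ^+ 2)%:C + (g z.2 z.1 * ((s z)^*)%C) * (-1) +
  (((g z.2 z.1 * ((s z)^*)%C)^*)%C * (-1) + (cabs (s z) ^+ 2)%:C))) //.
 have z1 := cintegrableZ mS (-1) cgs; have z2 := cintegrableZ mS (-1) cgs'.
 rewrite (cintegralD mS (cintegrableD mS cg2 z1) (cintegrableD mS z2 cs2)).
 rewrite (cintegralD mS cg2 z1) (cintegralD mS z2 cs2) !(cintegralZ mS) // Ig2 Is2 Igs Igs'.
 by rewrite rmorphB /=; ring.
rewrite -subr_ge0; have := congr1 (@complex.Re R) tot; rewrite /= => <-.
by apply: Rintegral_ge0 => // z _; exact: sqr_ge0.
Qed.

Lemma apx_L2 g v a rho : spacetime_fun T g -> spacetime_L2 T g -> ldata o3 T (hat g) v a rho ->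
 exists ks, apx T (pe o3) g v ks.
Proof.
move=> sg g2 [rho0 hv hg ha]; have hr k := rctl_rb (hv k).
have [_ [S hS]] := coef_bessel sg g2 hr hg.
apply: (@recon R T T2 g v (fun k => \int[leb]_(t in IT) (cabs (v k t) ^+ 2)) S ((2 * pi) ^+ 4) 2 1) => //.
- by apply: exprn_ge0; exact: ltW (@pi2_gt0 R).
- by move=> k; apply: Rintegral_ge0 => // t _; exact: sqr_ge0.
- by move=> ls uls; rewrite expr1 (fsum_L2 T2 uls hr).
Qed.

End Slab3.
End FourFunctions.

(** * Frequency boxes and Littlewood-Paley multipliers *)

Section FrequencyBoxes.
Context {R : realType}.

Definition krange (N : nat) : seq int := [seq m%:Z - N%:Z | m <- iota 0 (2 * N).+1].

Definition kbox (N : nat) : seq Z4 :=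
 undup [seq (x, d) | x <- [seq (y, c) | y <- [seq (a, b) | a <- krange N, b <- krange N], c <- krange N], d <- krange N].

Lemma kbox_uniq N : uniq (kbox N). Proof. exact: undup_uniq. Qed.

Lemma kbox_mem N k : (k \in kbox N) = (sup4 k <= N)%N.
Proof.
have rP (m : int) : (m \in krange N) = (`|m| <= N)%N.
 apply/mapP/idP => [[j]|h]; first by rewrite mem_iota => h ->; lia.
 by exists (absz (m + N%:Z)); [rewrite mem_iota; lia|lia].
have supP : (sup4 k <= N)%N = [&& (`|k.1.1.1| <= N)%N, (`|k.1.1.2| <= N)%N, (`|k.1.2| <= N)%N & (`|k.2| <= N)%N].
 by rewrite /sup4 !big_ord_recl big_ord0 maxn0 /cmp /= !geq_max.
rewrite supP mem_undup -!rP; case: k {supP} => -[[a b] c] d; move: (krange N) {rP} => r /=.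
apply/allpairsP/idP => [[[x d'] /= [/allpairsP[[y c'] /= [/allpairsP[[a' b'] /= [ha hb ->]] hc ->]] hd [-> -> -> ->]]]|].
 by rewrite ha hb hc hd.
move=> /and4P[ha hb hc hd]; exists ((a, b, c), d); split=> //.
apply/allpairsP; exists ((a, b), c); split=> //.
by apply/allpairsP; exists (a, b).
Qed.

Lemma sup4_norm k : (sup4 k)%:R <= Num.sqrt (sqnorm k) :> R.
Proof.
rewrite -[leLHS]ger0_norm // -sqrtr_sqr ler_wsqrtr //; have [j ->] := sup4_ex k.
by rewrite -intr_sqr sqnormE (bigD1 j) //= lerDl; exact: sumsq_ge0.
Qed.

Definition psiM (psi : R -> R) (M : R) (k : Z4) : R := psi (Num.sqrt (sqnorm k) / M).

Variable psi : R -> R.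
Hypothesis hpsi : lp_profile psi.

Lemma psiM01 M k : 0 <= psiM psi M k <= 1.
Proof. by have [_ _ h _ _] := hpsi; exact: h. Qed.

Lemma psiM_low M k : 0 < M -> Num.sqrt (sqnorm k) <= M -> psiM psi M k = 1.
Proof.
move=> M0 h; have [_ _ _ p1 _] := hpsi; apply: p1.
by rewrite ger0_norm ?divr_ge0 ?sqrtr_ge0 ?(ltW M0) // ler_pdivrMr // mul1r.
Qed.

(** The profile vanishes from 2 on, so the multiplier at scale M is supported in the box of this
    radius. *)
Definition Nbox (M : R) : nat := (Num.truncn (2 * M)).+1.

Lemma psiM_high M k : 0 < M -> k \notin kbox (Nbox M) -> psiM psi M k = 0.
Proof.
move=> M0; rewrite kbox_mem -ltnNge => h; have [_ _ _ _ p2] := hpsi; apply: p2.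
rewrite ger0_norm ?divr_ge0 ?sqrtr_ge0 ?(ltW M0) // ler_pdivlMr //; apply: le_trans (sup4_norm k).
have /andP[_ h2] := truncn_itv (ltac:(lra) : 0 <= 2 * M).
by apply: le_trans (ltW h2) _; rewrite ler_nat ltnW.
Qed.

Lemma trig_fsum (W : Z4 -> R[i]) (ks : seq Z4) v t x : uniq ks -> (forall k, k \notin ks -> W k = 0) ->
 (forall k, W k = expi (- (t * sqnorm k)) * v k t) -> trig W x = fsum ks v t x.
Proof.
move=> uks h0 hW; rewrite /trig (@fsbigE _ _ _ _ [set: Z4] ks) //; last by move=> k _ /h0 ->; rewrite mul0r.
rewrite /fsum (eq_bigl xpredT) => [|k]; last by rewrite in_setT.
by apply: eq_bigr => k _; rewrite hW expiD; ring.
Qed.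

End FrequencyBoxes.

(** * Admissible factors and the dual bounds *)

Section Classes.
Context {R : realType}.
Variable T : R.
Hypothesis T2 : T <= 2 * pi.
Hypothesis T0 : 0 <= T.
Local Notation dxt := (@dxdt R).
Local Notation SL := (@slab R T).

(** Everything the quadrilinear estimate asks of factor i, whether it comes from a Y norm, from free
    data or from a finite sum. [h] is 1 except for the low frequency factor. *)
Definition class (i : 'I_4) (h : R) (f : R -> pt4 R -> R[i]) (Y : R) : Prop :=
 0 <= Y /\ exists v a ks, [/\ apx T (pe i) f v ks, forall k, rctl (v k) (a k),
  1 <= h \/ (forall n k, k \in ks n -> T ^+ 2 * 16 ^+ lev k <= h ^+ 14) &
  forall ls, uniq ls -> \sum_(k <- ls) lw i (lev k) ^+ 2 * a k ^+ 2 <= Y ^+ 2].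

Definition pick4 (A : Type) (a b c d : A) (i : 'I_4) : A :=
 if i == o0 then a else if i == o1 then b else if i == o2 then c else d.

Lemma ord4 (P : 'I_4 -> Prop) : P o0 -> P o1 -> P o2 -> P o3 -> forall i, P i.
Proof.
move=> p0 p1 p2 p3 i; have [->//|n0] := eqVneq i o0; have [->//|n1] := eqVneq i o1.
have [->//|n2] := eqVneq i o2; suff -> : i = o3 by [].
by apply/val_inj; case: i n0 n1 n2 => -[|[|[|[|]]]].
Qed.

Lemma four_classes f0 f1 f2 f3 (h Y0 Y1 Y2 Y3 : R) b : 0 <= h ->
 class o0 1 f0 Y0 -> class o1 h f1 Y1 -> class o2 1 f2 Y2 -> class o3 1 f3 Y3 ->
 cintegrable dxt SL (fun z => f0 z.2 z.1 * f1 z.2 z.1 * f2 z.2 z.1 * cjif b (f3 z.2 z.1)) /\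
 cabs (cintegral dxt SL (fun z => f0 z.2 z.1 * f1 z.2 z.1 * f2 z.2 z.1 * cjif b (f3 z.2 z.1))) <=
  cmain * h * (Y0 * Y1 * Y2 * Y3).
Proof.
move=> h0 [y0 [v0 [a0 [k0 [p0 c0 _ s0]]]]] [y1 [v1 [a1 [k1 [p1 c1 hh s1]]]]]
 [y2 [v2 [a2 [k2 [p2 c2 _ s2]]]]] [y3 [v3 [a3 [k3 [p3 c3 _ s3]]]]].
have := @four_functions R T T2 (pick4 f0 f1 f2 f3) (pick4 v0 v1 v2 v3) (pick4 a0 a1 a2 a3) (pick4 k0 k1 k2 k3)
 (pick4 false false false b) h o1 (pick4 Y0 Y1 Y2 Y3) T0.
have E (z : pt5 R) : \prod_i cjif (pick4 false false false b i) (pick4 f0 f1 f2 f3 i z.2 z.1) =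
 f0 z.2 z.1 * f1 z.2 z.1 * f2 z.2 z.1 * cjif b (f3 z.2 z.1) by rewrite prod4.
have P : \prod_i pick4 Y0 Y1 Y2 Y3 i = Y0 * Y1 * Y2 * Y3 by rewrite prod4.
case; [by apply: ord4|by apply: ord4|exact: h0|exact: hh|by apply: ord4|by apply: ord4|].
move=> i1; rewrite (eq_cintegral _ (fun z _ => E z)) P => i2; split=> //.
exact: (cintegrable_eq (@mslab R T) (fun z _ => E z) i1).
Qed.

Lemma class_fin i h f ks v a Y : 0 <= Y -> uniq ks -> (forall k, rctl (v k) (a k)) ->
 (forall t x, 0 <= t < T -> f t x = fsum ks v t x) ->
 1 <= h \/ (forall k, k \in ks -> T ^+ 2 * 16 ^+ lev k <= h ^+ 14) ->
 (forall ls, uniq ls -> \sum_(k <- ls) lw i (lev k) ^+ 2 * a k ^+ 2 <= Y ^+ 2) -> class i h f Y.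
Proof.
move=> Y0 uks hv hf hh ha; split=> //; exists v, a, (fun=> ks); split=> //; first exact: apx_fin.
by case: hh => [|hk]; [left|right=> _; exact: hk].
Qed.

Lemma class_smooth i u v a rho : i != o3 -> spacetime_fun T u -> ldata i T (hat u) v a rho -> class i 1 u rho.
Proof.
move=> i3 su d; have [ks hks] := apx_smooth T2 i3 su d; have [r0 hv _ ha] := d.
by split=> //; exists v, a, ks; split=> //; left.
Qed.

Lemma class_L2 g v a rho : spacetime_fun T g -> spacetime_L2 T g -> ldata o3 T (hat g) v a rho -> class o3 1 g rho.
Proof.
move=> sg g2 d; have [ks hks] := apx_L2 T2 sg g2 d; have [r0 hv _ ha] := d.
by split=> //; exists v, a, ks; split=> //; left.
Qed.

Variable psi : R -> R.
Hypothesis hpsi : lp_profile psi.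

Lemma class_mult i (g : R -> Z4 -> R[i]) v a rho (m : Z4 -> R) (W : R -> Z4 -> R[i]) (ks : seq Z4) (Y : R) :
 ldata i T g v a rho -> uniq ks -> (forall k, k \notin ks -> m k = 0) ->
 (forall t k, 0 <= t < T -> W t k = (m k)%:C * g t k) -> 0 <= Y ->
 (forall ls, uniq ls -> \sum_(k <- ls) lw i (lev k) ^+ 2 * (`|m k| * a k) ^+ 2 <= Y ^+ 2) ->
 class i 1 (fun t x => trig (W t) x) Y.
Proof.
move=> [r0 hv hg ha] uks m0 hW Y0 hY.
apply: (@class_fin i 1 _ ks (fun k t => (m k)%:C * v k t) (fun k => `|m k| * a k)) => //.
- by move=> k; rewrite -cabs_real; exact: rctlZ.
- move=> t x tT; apply: trig_fsum => // k; first by move=> /m0 e; rewrite hW // e mul0r.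
 by rewrite hW // hg // mulrCA.
- by left.
Qed.

(** A square integrable g is itself of the dual class. For a general g the truncations are finite
    sums, and the difference of two truncations beyond [mu n] has a multiplier vanishing on [ks n];
    its class norm is a tail of size at most 2^-n, so the pairings are Cauchy in M. *)
Lemma dual_bound_core f0 f1 f2 (h Y0 Y1 Y2 : R) : 0 <= h ->
 class o0 1 f0 Y0 -> class o1 h f1 Y1 -> class o2 1 f2 Y2 ->
 dual_bound psi T (mul3 f0 f1 f2) (20 * (cmain * h * (Y0 * Y1 * Y2)))%:E.
Proof.
move=> h0 c0 c1 c2; have mS := @mslab R T.
have y0 := c0.1; have y1 := c1.1; have y2 := c2.1.
pose Q : R := cmain * h * (Y0 * Y1 * Y2).
have Q0 : 0 <= Q.
 by apply: mulr_ge0; [apply: mulr_ge0 => //; exact: cmain_ge0|rewrite !mulr_ge0].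
pose F := mul3 f0 f1 f2.
have key f3 Y3 : class o3 1 f3 Y3 -> cintegrable dxt SL (fun z => F z.2 z.1 * f3 z.2 z.1) /\
  cabs (cintegral dxt SL (fun z => F z.2 z.1 * f3 z.2 z.1)) <= Q * Y3.
 move=> c3; have [i1 i2] := four_classes false h0 c0 c1 c2 c3; split=> //.
 by apply: le_trans i2 _; rewrite /Q -!mulrA.
split=> g; last first.
 move=> sg g2 Yg; have [v [a d]] := @Y_data R o3 T (hat g) Yg.
 have [i1 i2] := key _ _ (class_L2 sg g2 d).
 exists (spacetime_integral T (fun t x => F t x * g t x)) => //.
 have Yf : Y_norm (-1) T (hat g) \is a fin_num by rewrite ge0_fin_numE // poweR_ge0.
 rewrite -(fineK Yf) -EFinM lee_fin; apply: le_trans i2 _.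
 by apply: le_of_eq; rewrite -/Q /sgn eqxx; ring.
move=> Yg; have [v [a d]] := @Y_data R o3 T g Yg.
set rho := 20 * _ in d; have [r0 hv hg ha] := d.
have a0 k : 0 <= a k by have [] := hv k.
pose b k : R := lw o3 (lev k) ^+ 2 * a k ^+ 2.
have b0 k : 0 <= b k by rewrite mulr_ge0 ?sqr_ge0.
have [ks [uks _ knest ktail]] := @exhaustion R b (rho ^+ 2) (fun n => (2 ^+ n)^-1 ^+ 2) b0 ha
 (fun n => ltac:(by rewrite exprn_gt0 // invr_gt0 exprn_gt0)).
pose G M t x : R[i] := trig (Ple psi M (g t)) x.
have cG M : 0 < M -> class o3 1 (G M) rho.
 move=> M0; apply: (class_mult d (m := psiM psi M) (kbox_uniq (Nbox M))) => //.
  by move=> k; exact: psiM_high.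
 move=> ls uls; apply: le_trans (ha _ uls); apply: ler_sum => k _.
 have /andP[p0 p1] := psiM01 hpsi M k.
 rewrite ler_wpM2l ?sqr_ge0 // lerXn2r ?nnegrE ?mulr_ge0 // ger0_norm //.
 by rewrite ler_piMl.
(* For M >= [mu n] the multiplier is 1 on [ks n]. Summing over all earlier sets makes [mu]
   nondecreasing, and the 1 keeps it positive. *)
pose mu n : R := 1 + \sum_(i < n.+1) \sum_(k <- ks i) Num.sqrt (sqnorm k).
have mu1' n : 1 <= mu n.
 by rewrite /mu lerDl; apply: sumr_ge0 => i _; apply: sumr_ge0 => k _; exact: sqrtr_ge0.
have muS n : mu n <= mu n.+1.
 by rewrite /mu lerD2l [leRHS]big_ord_recr /= lerDl; apply: sumr_ge0 => k _; exact: sqrtr_ge0.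
have muk n k : k \in ks n -> Num.sqrt (sqnorm k) <= mu n.
 move=> kk; rewrite /mu big_ord_recr /= (bigD1_seq k) //=.
 have h1 : 0 <= \sum_(i < n) \sum_(l <- ks i) Num.sqrt (sqnorm l) :> R.
  by apply: sumr_ge0 => i _; apply: sumr_ge0 => l _; exact: sqrtr_ge0.
 have h2 : 0 <= \sum_(l <- ks n | l != k) Num.sqrt (sqnorm l) :> R by apply: sumr_ge0 => l _; exact: sqrtr_ge0.
 by have := @sqrtr_ge0 R (sqnorm k); lra.
pose In M : R[i] := spacetime_integral T (fun t x => F t x * G M t x).
have cauchy n M M' : mu n <= M -> mu n <= M' -> cabs (In M - In M') <= Q / 2 ^+ n.
 move=> h1 h2; have M0 : 0 < M by have := mu1' n; lra.
 have M0' : 0 < M' by have := mu1' n; lra.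
 pose m k := psiM psi M k - psiM psi M' k.
 have cD : class o3 1 (fun t x => trig (fun k => (m k)%:C * g t k) x) ((2 ^+ n)^-1).
  apply: (class_mult d (m := m) (ks := undup (kbox (Nbox M) ++ kbox (Nbox M')))) => //.
  - exact: undup_uniq.
  - by move=> k; rewrite mem_undup mem_cat negb_or => /andP[k1 k2]; rewrite /m !psiM_high // subrr.
  move=> ls uls; rewrite (bigID (fun k => k \in ks n)) /= big1 ?add0r; last first.
   move=> k /muk kk; rewrite /m !psiM_low //; [|exact: le_trans kk h2|exact: le_trans kk h1].
   by rewrite subrr normr0 mul0r expr0n mulr0.
  rewrite -big_filter; apply: le_trans (ktail n [seq k <- ls | k \notin ks n] (filter_uniq _ uls) _); last by move=> k; rewrite mem_filter => /andP[].
  apply: ler_sum => k _; rewrite /b ler_wpM2l ?sqr_ge0 // lerXn2r ?nnegrE ?mulr_ge0 // ler_piMl //.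
  have := psiM01 hpsi M k; have := psiM01 hpsi M' k; rewrite /m ler_norml.
  by move=> /andP[p1 p2] /andP[p3 p4]; apply/andP; split; lra.
 have tE t x : trig (fun k => (m k)%:C * g t k) x = G M t x - G M' t x.
  pose K := undup (kbox (Nbox M) ++ kbox (Nbox M')).
  have tr (w : Z4 -> R) : (forall k, k \notin K -> w k = 0) -> trig (fun k => (w k)%:C * g t k) x =
    \sum_(k <- K) (w k)%:C * g t k * expi (dot x k).
   move=> w0; rewrite /trig (@fsbigE _ _ _ _ [set: Z4] K) //; [|exact: undup_uniq|by move=> k _ /w0 ->; rewrite !mul0r].
   by apply: eq_bigl => k; rewrite in_setT.
  have KM k : k \notin K -> k \notin kbox (Nbox M) /\ k \notin kbox (Nbox M').
   by rewrite mem_undup mem_cat negb_or => /andP.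
  rewrite /G /Ple -/(psiM psi M _) tr; last by move=> k /KM[k1 k2]; rewrite /m !psiM_high // subrr.
  rewrite (tr (psiM psi M)); last by move=> k /KM[k1 _]; exact: psiM_high.
  rewrite (tr (psiM psi M')); last by move=> k /KM[_ k2]; exact: psiM_high.
  by rewrite -sumrB; apply: eq_bigr => k _; rewrite /m rmorphB /= !mulrBl.
 have [i1 i2] := key _ _ cD; have [j1 _] := key _ _ (cG _ M0); have [j2 _] := key _ _ (cG _ M0').
 move: i2; rewrite (eq_cintegral _ (g := fun z : pt5 R => F z.2 z.1 * G M z.2 z.1 + F z.2 z.1 * G M' z.2 z.1 * (-1))); last first.
  by move=> z _; rewrite tE; ring.
 rewrite (cintegralD mS j1 (cintegrableZ mS (-1) j2)) (cintegralZ mS) //.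
 by rewrite mulrN1.
have [l hl] : exists l, cabs (In (mu n) - l) @[n --> \oo] --> (0 : R).
 by apply: (cgeo_cauchy Q0) => n; apply: cauchy.
exists l; last first.
 have Yf : Y_norm (-1) T g \is a fin_num by rewrite ge0_fin_numE // poweR_ge0.
 rewrite -(fineK Yf) -EFinM lee_fin; apply: le_trans (_ : Q * rho <= _); last first.
  by apply: le_of_eq; rewrite /rho -/Q /sgn eqxx; ring.
 apply: (cvg_cle hl) => n; have [_] := key _ _ (cG (mu n) ltac:(by have := mu1' n; lra)); exact.
split.
 near=> M; have M0 : 0 < M by near: M; exact: nbhs_pinfty_gt.
 by have [i1 _] := key _ _ (cG M M0); exact: i1.
apply/cvgrPdist_le => e e0.
have g0 : Q / 2 ^+ n @[n --> \oo] --> (0 : R) by apply: geo_cvg0; lra.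
have e2 : 0 < e / 2 by lra.
move/cvgrPdist_le: g0 => /(_ _ e2) [n1 _ hn1]; move/cvgrPdist_le: hl => /(_ _ e2) [n2 _ hn2].
pose n := maxn n1 n2; have := hn1 n (leq_maxl _ _); have := hn2 n (leq_maxr _ _).
rewrite /= !sub0r !normrN ger0_norm ?cabs_ge0 // => q1.
rewrite ger0_norm ?divr_ge0 ?exprn_ge0 // => q2.
near=> M; rewrite sub0r normrN ger0_norm ?cabs_ge0 //.
have hM : mu n <= M by near: M; apply: nbhs_pinfty_ge; exact: num_real.
rewrite -/F -/(In M) (_ : In M - l = (In M - In (mu n)) + (In (mu n) - l)); last by rewrite addrA subrK.
apply: le_trans (cabsD _ _) _; have := cauchy n M (mu n) hM (lexx _); lra.
Unshelve. all: by end_near. Qed.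

End Classes.

(** * The Duhamel term *)

Section AtomicBound.
Context {R : realType}.

(** Atoms have strictly increasing partitions. Dropping empty intervals changes neither the function
    nor increases the sum of squares. *)
Lemma stepf_strict (K : nat) (x : nat -> R) (c : nat -> R[i]) : (forall k, (k < K)%N -> x k <= x k.+1) ->
 exists (K' : nat) (x' : nat -> R) (c' : nat -> R[i]), [/\ forall k, (k < K')%N -> x' k < x' k.+1, x' K' = x K,
  \sum_(0 <= k < K') cabs (c' k) ^+ 2 <= \sum_(0 <= k < K) cabs (c k) ^+ 2 &
  forall s, stepf K' x' c' s = stepf K x c s].
Proof.
elim: K => [|K ih] hx.
 by exists 0%N, (fun=> x 0%N), c; split=> // s; rewrite /stepf !big_geq.
have [k kK|K' [x' [c' [h1 h2 h3 h4]]]] := ih; first by apply: hx; exact: ltnW.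
have := hx K (ltnSn K); rewrite le_eqVlt => /orP[/eqP e|lt].
 exists K', x', c'; split=> //; first by rewrite h2 e.
  by apply: le_trans h3 _; rewrite big_nat_recr //= lerDl sqr_ge0.
 move=> s; rewrite h4 /stepf [RHS]big_nat_recr //= e.
 by case: ifP => [/andP[a b]|]; [have := le_lt_trans a b; rewrite ltxx|rewrite addr0].
exists K'.+1, (fun k => if (k <= K')%N then x' k else x K.+1), (fun k => if (k < K')%N then c' k else c K); split.
- move=> k; rewrite ltnS => kK; rewrite kK; case: ltnP => [/h1//|Kk].
 by rewrite (_ : k = K') ?h2 //; apply/eqP; rewrite eqn_leq kK.
- by rewrite ltnn.
- rewrite !big_nat_recr //= ltnn lerD2r; apply: le_trans h3.
 by apply: le_of_eq; apply: eq_big_nat => k /andP[_ ->].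
move=> s; rewrite /stepf !big_nat_recr //= ltnn leqnn h2; congr (_ + _).
rewrite -[RHS]h4; apply: eq_big_nat => k /andP[_ kK]; by rewrite (ltnW kK) kK.
Qed.

Lemma stepf_atom (K : nat) (x : nat -> R) (c : nat -> R[i]) (B : R) : (forall k, (k < K)%N -> x k <= x k.+1) ->
 0 <= B -> \sum_(0 <= k < K) cabs (c k) ^+ 2 <= B ^+ 2 ->
 exists (lam : R[i]) (a : R -> R[i]), [/\ U2_atom a, cabs lam <= B & forall s, stepf K x c s = lam * a s].
Proof.
move=> hx B0 hB; have [K' [x' [c' [h1 _ h3 h4]]]] := stepf_strict c hx.
pose S := \sum_(0 <= k < K') cabs (c' k) ^+ 2.
have S0 : 0 <= S by exact: sumsq_ge0.
have [e|Sn] := eqVneq S 0.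
 (* The zero function is represented by coefficient 0 times a fixed atom, as the coefficients of an
    atom have square sum 1. *)
 exists 0, (fun s => \sum_(0 <= k < 1) if ((k%:R%:E <= s%:E) && (s%:E < k.+1%:R%:E))%E then 1 else 0); split.
 - exists 1%N, (fun k => k%:R%:E), (fun=> 1); split=> //; last by rewrite big_nat1 cabs1 expr1n.
  split=> //; first exact: ltNyr.
  by move=> k _; rewrite lte_fin ltr_nat.
 - by rewrite cabs0.
 move=> s; rewrite mul0r -h4 /stepf big_nat_cond big1 // => k; rewrite andbT => /andP[_ kK].
 suff -> : c' k = 0 by case: ifP.
 apply: cabs0_eq0; apply/eqP; rewrite -sqrf_eq0 -/(GRing.zero) eq_le sqr_ge0 andbT -e /S big_mkord (bigD1 (Ordinal kK)) //= lerDl.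
 exact: sumsq_ge0.
have Sp : 0 < S by rewrite lt_def Sn.
have q0 : 0 < Num.sqrt S by rewrite sqrtr_gt0.
have lamE : cabs (Num.sqrt S)%:C = Num.sqrt S by rewrite cabs_real ger0_norm // ltW.
exists (Num.sqrt S)%:C, (fun s => \sum_(0 <= k < K') if (((x' k)%:E <= s%:E) && (s%:E < (x' k.+1)%:E))%E then ((Num.sqrt S)^-1)%:C * c' k else 0); split.
- exists K', (fun k => (x' k)%:E), (fun k => ((Num.sqrt S)^-1)%:C * c' k); split=> //.
  split; [|exact: ltNyr|by move=> k /h1; rewrite lte_fin].
  by rewrite lt0n; apply/eqP => K0; move: Sp; rewrite /S K0 big_geq // ltxx.
 under eq_bigr do rewrite cabsM cabs_real exprMn real_normK ?num_real //.
 by rewrite -mulr_sumr -/S exprVn sqr_sqrtr // mulVf.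
- by rewrite lamE -(ger0_norm B0) -sqrtr_sqr ler_wsqrtr //; apply: le_trans h3 hB.
move=> s; rewrite -h4 mulr_sumr; apply: eq_bigr => k _; rewrite lee_fin lte_fin; case: ifP => _; last by rewrite mulr0.
by rewrite mulrA -rmorphM /= divff ?mul1r // gt_eqF.
Qed.

Variables (T A : R) (Phi : R -> R[i]) (th : R -> R).
Hypothesis T0 : 0 < T.
Hypothesis A0 : 0 <= A.
Hypothesis th01 : forall t, 0 <= t < T -> 0 <= th t <= 1.
Hypothesis thm : forall s t, 0 <= s -> s < t -> t < T -> th s <= th t.
Hypothesis hvar : forall s t, 0 <= s -> s < t -> t < T -> cabs (Phi t - Phi s) ^+ 3 <= A ^+ 3 * (th t - th s) ^+ 2.
Hypothesis rc : forall t, 0 <= t < T -> cabs (Phi s - Phi t) @[s --> t^'+] --> (0 : R).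
Hypothesis PhiA : forall t, 0 <= t < T -> cabs (Phi t) <= A.

(** [tau n k] is the first time at which the control [th] reaches k / 64^n, and T if it never
    does. *)
Let St n k := [set t : R | (0 <= t < T) && (k%:R / 64 ^+ n <= th t)] `|` [set T].
Let tau n k : R := inf (St n k).

Let p64 n : 0 < 64 ^+ n :> R. Proof. exact: exprn_gt0. Qed.

Let St_lb n k : lbound (St n k) 0.
Proof. by move=> t [/andP[/andP[]]|->] //; exact: ltW. Qed.

Let hlb n k : has_lbound (St n k). Proof. by exists 0; exact: St_lb. Qed.

Let tau_ge0 n k : 0 <= tau n k.
Proof. by apply: lb_le_inf; [exists T; right|exact: St_lb]. Qed.

Let tau_leT n k : tau n k <= T. Proof. by apply: ge_inf => //; right. Qed.

Let tau_mono n k l : (k <= l)%N -> tau n k <= tau n l.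
Proof.
move=> kl; apply: lb_le_inf; first by exists T; right.
move=> t Ht; apply: ge_inf => //; case: Ht => [/andP[h1 h2]|->]; [left|by right].
by apply/andP; split=> //; apply: le_trans h2; rewrite ler_pM2r ?invr_gt0 // ler_nat.
Qed.

Let tau0 n : tau n 0 = 0.
Proof.
apply/eqP; rewrite eq_le tau_ge0 andbT; apply: ge_inf => //; left.
by rewrite /= lexx T0 mul0r; have := @th01 0; rewrite lexx T0 => /(_ isT)/andP[-> _].
Qed.

Let tauT n : tau n (64 ^ n).+1 = T.
Proof.
apply/eqP; rewrite eq_le tau_leT; apply: lb_le_inf; first by exists T; right.
move=> t [/andP[h1 h2]|->] //; exfalso; have /andP[_ h3] := th01 h1.
have := le_trans h2 h3; rewrite ler_pdivrMr // mul1r -natrX ler_nat ltnn //.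
Qed.

Let tau_fine n k : tau n.+1 (64 * k) = tau n k.
Proof.
congr inf; rewrite /St; congr (_ `|` _); apply/seteqP.
by split=> t /=; rewrite natrM exprS invfM mulrACA divff ?mul1r.
Qed.

Let lt_tau n k t : 0 <= t < T -> t < tau n k -> th t < k%:R / 64 ^+ n.
Proof.
move=> tT h; rewrite ltNge; apply/negP => h2; move: h; rewrite ltNge => /negP; apply.
by apply: ge_inf => //; left; rewrite /= tT.
Qed.

Let tau_lt n k t : tau n k < t -> t < T -> k%:R / 64 ^+ n <= th t.
Proof.
move=> h tT; rewrite leNgt; apply/negP => ht; move: h; rewrite ltNge => /negP; apply.
apply: lb_le_inf; first by exists T; right.
move=> s [/andP[/andP[s0 sT] hs]|->]; last exact: ltW.
rewrite leNgt; apply/negP => st.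
by have := le_trans hs (thm s0 st tT); rewrite leNgt ht.
Qed.

(** Inside a cell [th] moves by at most 64^-n, hence Phi by A 64^(-2n/3) = A / 16^n. At the left
    endpoint itself [th] may still be below its threshold, so the bound is taken at points slightly
    to the right, and right continuity of Phi closes the gap. *)
Let close n k t : 0 <= t < T -> tau n k <= t < tau n k.+1 -> cabs (Phi t - Phi (tau n k)) <= A / 16 ^+ n.
Proof.
move=> tT /andP[]; have /andP[t0 tT'] := tT; have B0 : 0 <= A / 16 ^+ n by rewrite divr_ge0 ?exprn_ge0.
rewrite le_eqVlt => /orP[/eqP ->|lt] h2; first by rewrite subrr cabs0.
have near_bd r : tau n k < r -> r <= t -> cabs (Phi t - Phi r) <= A / 16 ^+ n.
 move=> h3; rewrite le_eqVlt => /orP[/eqP ->|rt]; first by rewrite subrr cabs0.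
 have r0 : 0 <= r by apply: le_trans (tau_ge0 n k) (ltW h3).
 rewrite -(@ler_pXn2r _ 3) ?nnegrE ?cabs_ge0 //; apply: le_trans (hvar r0 rt tT') _.
 have a1 := lt_tau tT h2; have a2 := tau_lt h3 (lt_trans rt tT'); have a3 := thm r0 rt tT'.
 have a4 : th t - th r <= (64 ^+ n)^-1.
  by move: a1; rewrite -natr1 mulrDl mul1r => a1; lra.
 apply: (le_via (A ^+ 3 * ((64 ^+ n)^-1) ^+ 2)).
  by rewrite ler_wpM2l ?exprn_ge0 // lerXn2r ?nnegrE ?subr_ge0 ?invr_ge0 ?(ltW (p64 n)).
 apply: le_of_eq; rewrite exprMn !exprVn -!exprM; congr (_ * _^-1).
 rewrite (_ : 64 = 4 ^+ 3 :> R); last by ring.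
 rewrite (_ : 16 = 4 ^+ 2 :> R); last by ring.
 by rewrite -!exprM; congr (_ ^+ _); rewrite mulnCA [RHS]mulnCA.
have tk : 0 <= tau n k < T by rewrite tau_ge0 (lt_trans lt tT').
apply/ler_addgt0Pr => e e0; have := rc tk; move/cvgrPdist_le => /(_ e e0) hr.
have [r [r1 r2 r3]] : exists r, [/\ tau n k < r, r <= t & cabs (Phi r - Phi (tau n k)) <= e].
 near (tau n k)^'+ => r; exists r; split.
 - by near: r; exact: nbhs_right_gt.
 - by apply: ltW; near: r; exact: nbhs_right_lt.
 have : `|0 - cabs (Phi r - Phi (tau n k))| <= e by near: r.
 by rewrite sub0r normrN ger0_norm ?cabs_ge0.
have := cabsD (Phi t - Phi r) (Phi r - Phi (tau n k)); rewrite addrA subrK => h; apply: le_trans h _.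
by rewrite lerD // near_bd.
Unshelve. all: by end_near. Qed.

Let Kn n := (64 ^ n).+1.
Let cc n k : R[i] := if tau n k < T then Phi (tau n k) else 0.
Let g n := stepf (Kn n) (tau n) (cc n).

Let tm n k : (k < Kn n)%N -> tau n k <= tau n k.+1. Proof. by move=> _; exact: tau_mono. Qed.

Let locate n t : 0 <= t < T -> exists2 k, (k < Kn n)%N & tau n k <= t < tau n k.+1.
Proof.
move=> /andP[t0 tT].
have ex : exists k, (tau n k <= t)%R by exists 0%N; rewrite tau0.
have bd k : (tau n k <= t)%R -> (k <= 64 ^ n)%N.
 move=> h; rewrite leqNgt; apply/negP => h2; have := le_trans (tau_mono n h2) h.
 by rewrite tauT leNgt tT.
case: (ex_maxnP ex bd) => k hk kmax; exists k; first by rewrite ltnS; exact: bd.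
by rewrite hk ltNge; apply/negP => /kmax; rewrite ltnn.
Qed.

Let g_out n t : ~~ (0 <= t < T) -> g n t = 0.
Proof.
move=> h; rewrite /g; have [//|[k _ [/andP[h1 h2] _]]] := stepf_cases (cc n) (@tm n) t.
exfalso; move/negP: h; apply; rewrite (le_trans (tau_ge0 n k) h1).
by rewrite (lt_le_trans h2 (tau_leT _ _)).
Qed.

Let g_close n t : 0 <= t < T -> cabs (Phi t - g n t) <= A / 16 ^+ n.
Proof.
move=> tT; have [k kK hk] := locate n tT; rewrite /g (stepf_piece _ (@tm n) kK hk).
have /andP[h1 _] := hk; have /andP[_ h2] := tT; rewrite /cc (le_lt_trans h1 h2); exact: close.
Qed.

(** The correction on cell k of scale n + 1, whose parent at scale n has index k / 64; empty cells
    get 0. *)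
Let dphi n k : R[i] := if tau n.+1 k < tau n.+1 k.+1 then Phi (tau n.+1 k) - Phi (tau n (k %/ 64)) else 0.

Let coarse n k t : tau n.+1 k <= t < tau n.+1 k.+1 -> tau n (k %/ 64) <= t < tau n (k %/ 64).+1.
Proof.
have e1 := tau_fine n (k %/ 64); have e2 := tau_fine n (k %/ 64).+1.
move=> /andP[h1 h2]; rewrite -e1 -e2; apply/andP; split.
 by apply: le_trans (tau_mono _ _) h1; rewrite mulnC leq_divM.
apply: (lt_le_trans h2); apply: tau_mono; rewrite mulnC mulSn addnC.
by have := divn_eq k 64; have := ltn_pmod k (isT : 0 < 64)%N; lia.
Qed.

Let g_diff n t : g n.+1 t - g n t = stepf (Kn n.+1) (tau n.+1) (dphi n) t.
Proof.
have [tT|tT] := boolP (0 <= t < T); last first.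
 rewrite !g_out // subrr; have [//|[k _ [/andP[h1 h2] _]]] := stepf_cases (dphi n) (@tm n.+1) t.
 exfalso; move/negP: tT; apply; rewrite (le_trans (tau_ge0 _ k) h1).
 by rewrite (lt_le_trans h2 (tau_leT _ _)).
have [k kK hk] := locate n.+1 tT.
have qK : (k %/ 64 < Kn n)%N.
 by rewrite ltnS; move: kK; rewrite /Kn ltnS expnS => h; rewrite -(mulKn (64 ^ n) (isT : 0 < 64)%N) leq_div2r.
rewrite /g (stepf_piece _ (@tm n.+1) kK hk) (stepf_piece _ (@tm n) qK (coarse hk)) (stepf_piece _ (@tm n.+1) kK hk).
have /andP[h1 h2] := hk; have /andP[h3 _] := coarse hk; have /andP[_ h4] := tT.
by rewrite /dphi /cc (le_lt_trans h1 h2) (le_lt_trans h1 h4) (le_lt_trans h3 h4).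
Qed.

Let dphi_bd n k : cabs (dphi n k) <= A / 16 ^+ n.
Proof.
rewrite /dphi; case: ifP => h; last by rewrite cabs0 divr_ge0 ?exprn_ge0.
apply: close; first by rewrite tau_ge0 (lt_le_trans h (tau_leT _ _)).
by apply: coarse; rewrite lexx h.
Qed.

(** The embedding of 3/2-variation into U^2. The correction from scale n to n + 1 is a step function
    with at most 65 * 64^n pieces of height A / 16^n, so it is a multiple of an atom of size at most
    9A / 2^n. The geometric factor is 1/2 because the square root of 64 is 8 and the heights drop by
    16. *)
Lemma U2_of_variation : (U2_norm_on T Phi <= (36 * A)%:E)%E.
Proof.
pose F n : R -> R[i] := if n is m.+1 then stepf (Kn m.+1) (tau m.+1) (dphi m) else g 0.
have exat n : exists la : R[i] * (R -> R[i]), [/\ U2_atom la.2, cabs la.1 <= 18 * A / 2 ^+ n & forall s, F n s = la.1 * la.2 s].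
 have B0 : 0 <= 18 * A / 2 ^+ n by rewrite divr_ge0 ?mulr_ge0 ?exprn_ge0.
 suff [l [a h]] : exists (lam : R[i]) (a : R -> R[i]), [/\ U2_atom a, cabs lam <= 18 * A / 2 ^+ n & forall s, F n s = lam * a s] by exists (l, a).
 case: n B0 => [|n] B0; apply: stepf_atom => //; try by move=> k _; exact: tau_mono.
  rewrite expr0 divr1; apply: (le_via (\sum_(0 <= k < Kn 0) A ^+ 2)).
   rewrite big_nat_cond [leRHS]big_nat_cond; apply: ler_sum => k _.
   rewrite lerXn2r ?nnegrE ?cabs_ge0 // /cc; case: ifP => h; last by rewrite cabs0.
   by rewrite PhiA // tau_ge0.
  rewrite sumr_const_nat /Kn expn0 subn0 -[leLHS]mulr_natl exprMn ler_wpM2r ?sqr_ge0 //; lra.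
 apply: (le_via (\sum_(0 <= k < Kn n.+1) (A / 16 ^+ n) ^+ 2)).
  by apply: ler_sum => k _; rewrite lerXn2r ?nnegrE ?cabs_ge0 ?divr_ge0 ?exprn_ge0 // dphi_bd.
 rewrite sumr_const_nat subn0 -[leLHS]mulr_natl.
 have kb : (Kn n.+1)%:R <= 65 * 64 ^+ n :> R.
  rewrite /Kn -natr1 natrX exprS; have : 1 <= 64 ^+ n :> R by rewrite exprn_ege1 //; lra.
  by lra.
 apply: le_trans (ler_wpM2r (sqr_ge0 _) kb) _.
 have e1 : 65 * 64 ^+ n * (A / 16 ^+ n) ^+ 2 = 65 * A ^+ 2 / 4 ^+ n.
  rewrite (_ : 64 = 4 ^+ 3 :> R); last by ring.
  rewrite (_ : 16 = 4 ^+ 2 :> R); last by ring.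
  by rewrite -!exprM ![(_ * n)%N]mulnC !exprM; field; exact: expf_neq0.
 have e2 : (18 * A / 2 ^+ n.+1) ^+ 2 = 81 * A ^+ 2 / 4 ^+ n.
  have g4 : 4 ^+ n = (2 ^+ n) ^+ 2 :> R by rewrite -exprM mulnC exprM (_ : 2 ^+ 2 = 4 :> R) //; ring.
  have g2 : 2 ^+ n.+1 = 2 * 2 ^+ n :> R by exact: exprS.
  rewrite g2 g4; have : 2 ^+ n != 0 :> R by exact: expf_neq0.
  by move: (2 ^+ n) => X X0; field.
 by rewrite e1 e2 ler_pM2r ?invr_gt0 ?exprn_gt0 // ler_wpM2r ?sqr_ge0 //; lra.
pose la n := sval (cid (exat n)).
have laP n : [/\ U2_atom (la n).2, cabs (la n).1 <= 18 * A / 2 ^+ n & forall s, F n s = (la n).1 * (la n).2 s] by rewrite /la; case: cid.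
pose u s : R[i] := if 0 <= s < T then Phi s else 0.
apply: (le_via (U2_norm u)); first by apply: ereal_inf_lbound; exists u => // t tT; rewrite /u tT.
apply: (le_via (\sum_(0 <= j <oo) (cabs (la j).1)%:E)%E).
 apply: ereal_inf_lbound; exists (fun j => (la j).1), (fun j => (la j).2); split=> //; first by move=> j; have [] := laP j.
 move=> s; have part n : \sum_(0 <= j < n.+1) (la j).1 * (la j).2 s = g n s.
  elim: n => [|n ih]; first by rewrite big_nat1; have [_ _ <-] := laP 0%N.
  rewrite big_nat_recr //= ih; have [_ _ <-] := laP n.+1.
  by rewrite /F -g_diff addrC subrK.
 apply: (@squeeze_cvgr _ _ _ _ (fun=> 0) (fun n => 16 * A / 16 ^+ n)).
 - apply: nearW => n; rewrite cabs_ge0 /=; case: n => [|n].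
   rewrite big_geq // subr0 expr0 divr1 /u; case: ifP => [/PhiA h|_]; last by rewrite cabs0 mulr_ge0.
   by apply: le_trans h _; rewrite ler_peMl //; lra.
  rewrite part exprS invfM mulrACA divff ?mul1r // /u; case: ifP => [|/negbT] sT; first exact: g_close.
  by rewrite g_out // subrr cabs0 divr_ge0 ?exprn_ge0.
 - exact: cvg_cst.
 - by apply: geo_cvg0; lra.
have A36 : 0 <= 36 * A by rewrite mulr_ge0.
apply: le_trans (epsilon_trick0 xpredT A36); apply: lee_nneseries => [n _ _|n _]; first by rewrite lee_fin cabs_ge0.
rewrite lee_fin; have [_ h _] := laP n; apply: le_trans h _; rewrite natrX exprS; apply: le_of_eq.
by field; exact: expf_neq0.
Unshelve. all: by end_near. Qed.

End AtomicBound.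

(** * Variation of the Duhamel profiles by duality *)

Section DuhamelDuality.
Context {R : realType}.
Local Notation leb := (@lebesgue_measure R).
Variable T : R.
Hypothesis T2 : T <= 2 * pi.
Hypothesis T0 : 0 < T.
Local Notation IT := (`[0, T[%classic : set (mR R)).
Local Notation dxt := (@dxdt R).
Local Notation SL := (@slab R T).

Section Primitive.
Variable phi : R -> R[i].
Hypothesis phii : cintegrable leb IT phi.

Definition prim (t : R) : R[i] := cintegral leb (`[0, t[%classic : set (mR R)) phi.

Lemma cintegrable_sub (D : set (mR R)) : measurable D -> D `<=` IT -> cintegrable leb D phi.
Proof. by move=> mD DI; have [p1 p2] := phii; split; [apply: integrableS p1|apply: integrableS p2] => //; exact: mIT. Qed.

Lemma sub_co (s t : R) : 0 <= s -> t <= T -> `[s, t[%classic `<=` IT.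
Proof. by move=> s0 tT x /=; rewrite !in_itv /= => /andP[h1 h2]; rewrite (le_trans s0 h1) (lt_le_trans h2 tT). Qed.

Lemma prim_sub s t : 0 <= s -> s <= t -> t <= T ->
 prim t - prim s = cintegral leb (`[s, t[%classic : set (mR R)) phi.
Proof.
move=> s0 st tT; have mi (a b : R) : @measurable _ (mR R) `[a, b[%classic by exact: measurable_itv.
suff part (h : R -> R) : (forall D : set (mR R), measurable D -> D `<=` IT -> leb.-integrable D (EFin \o h)) ->
  \int[leb]_(x in `[0, t[) h x = \int[leb]_(x in `[0, s[) h x + \int[leb]_(x in `[s, t[) h x.
 rewrite /prim /cintegral part => [|D mD DI]; last exact: (cintegrable_sub mD DI).1.
 rewrite (part (fun x => complex.Im (phi x))) => [|D mD DI]; last exact: (cintegrable_sub mD DI).2.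
 by apply/eqP; rewrite eq_complex /= ![_ + _ - _]addrAC !subrr !add0r !eqxx.
move=> hi; have U : (`[0, t[%classic : set R) = `[0, s[%classic `|` `[s, t[%classic.
 apply/seteqP; split=> x /=; rewrite !in_itv /=.
  by move=> /andP[-> ->]; rewrite !andbT; have [|] := ltP x s; [left|right].
 move=> [/andP[-> xs]|/andP[sx ->]]; first by rewrite (lt_le_trans xs st).
 by rewrite (le_trans s0 sx).
rewrite U; apply: (Rintegral_setU (mi 0 s) (mi s t)).
 by rewrite -U; apply: hi; [exact: mi|exact: sub_co].
by apply/disj_setPS => x /= [] /=; rewrite !in_itv /= => /andP[_ xs] /andP[sx _]; move: (lt_le_trans xs sx); rewrite ltxx.
Qed.

Lemma prim_closed a t : 0 <= a -> a <= t -> t < T ->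
 cintegral leb (`[a, t]%classic : set (mR R)) phi = prim t - prim a.
Proof.
move=> a0 aT tT; rewrite prim_sub // ?(ltW tT) //.
have ci : cintegrable leb (`[a, t[%classic : set (mR R)) phi.
 by apply: cintegrable_sub; [exact: measurable_itv|apply: sub_co => //; exact: ltW].
by rewrite /cintegral; congr (_ +i* _); rewrite Rintegral_itv_bndo_bndc //; [exact: ci.1|exact: ci.2].
Qed.

Lemma prim_rcont t : 0 <= t < T -> cabs (prim s - prim t) @[s --> t^'+] --> (0 : R).
Proof.
move=> /andP[t0 tT]; have mI := @mIT R T.
apply/cvg_at_rightP => s [st scvg].
pose f_ n (x : mR R) : R[i] := if (t <= x) && (x < s n) then phi x else 0.
have sT : \forall n \near \oo, s n < T by move/cvgrPdist_lt: scvg => /(_ (T - t)) h; apply: filterS (h _) => [n|]; rewrite ?subr_gt0 // distrC ltr_norml => /andP[_]; rewrite ltrD2r.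
have mf n : cmeasurable IT (f_ n).
 apply: (cmeas_eq (f := fun x : mR R => phi x * (\1_(`[t, s n[%classic : set (mR R)) x)%:C)).
  by move=> x _; rewrite indicE mem_setE in_itv /= /f_; case: ifP; rewrite ?mulr1 ?mulr0.
 apply: cmeasM; first exact: cint_meas phii.
 by apply: cmeas_real; apply: measurable_funTS; apply: measurable_indic; exact: measurable_itv.
have fE : \forall n \near \oo, cabs (cintegral leb IT (f_ n) - cintegral leb IT (fun=> 0)) = cabs (prim (s n) - prim t).
 apply: filterS sT => n sn; rewrite (_ : cintegral leb IT (fun=> 0) = 0) ?subr0; last exact: cintegral0.
 rewrite prim_sub //; [|exact: ltW (st n)|exact: ltW].
 have IS : IT `&` `[t, s n[%classic = `[t, s n[%classic :> set R.
  by rewrite setIidr //; apply: sub_co => //; exact: ltW.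
 rewrite /cintegral -[in RHS]IS !Rintegral_mkcondr; congr (cabs (_ +i* _)).
  by apply: eq_Rintegral => x _; rewrite /patch /f_ mem_setE in_itv /=; case: ifP.
 by apply: eq_Rintegral => x _; rewrite /patch /f_ mem_setE in_itv /=; case: ifP.
apply: cvg_trans (near_eq_cvg fE) _.
have [||||| _ lim] := @cdominated R _ _ leb IT mI f_ (fun=> 0) (fun x => cabs (phi x)); [exact: mf|exact: cmeas_cst| | | |exact: lim].
- apply: filterS (ae_neq t) => x xt _; under eq_fun do rewrite subr0.
 have [tx|xt'] := ltP t x.
  have E : \forall n \near \oo, 0 = cabs (f_ n x).
   move/cvgrPdist_lt: scvg => /(_ (x - t)); rewrite subr_gt0 => /(_ tx); apply: filterS => n.
   rewrite distrC ltr_norml => /andP[_]; rewrite ltrD2r => h; rewrite /f_ [x < _]ltNge (ltW h) andbF cabs0 //.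
  by apply: cvg_trans (near_eq_cvg E) _; exact: cvg_cst.
 have xt2 : x < t by rewrite lt_neqAle xt' andbT; apply/eqP.
 have h : (t <= x) = false by rewrite leNgt xt2.
 have E n : f_ n x = 0 by rewrite /f_ h.
 by under eq_fun do rewrite E cabs0; exact: cvg_cst.
- exact: cintegrable_cabs.
- by apply: aeW => x n _; rewrite /f_; case: ifP => // _; rewrite cabs0 cabs_ge0.
Qed.

Lemma cintegral_stepf (K : nat) (x : nat -> R) (c : nat -> R[i]) : (forall k, (k <= K)%N -> 0 <= x k < T) ->
 (forall k, (k < K)%N -> x k < x k.+1) ->
 cintegral leb IT (fun t => stepf K x c t * phi t) = \sum_(0 <= k < K) c k * (prim (x k.+1) - prim (x k)).
Proof.
move=> hx xm; have mI := @mIT R T.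
have mi (a b : R) : @measurable _ (mR R) `[a, b[%classic by exact: measurable_itv.
pose chi k (t : mR R) : R[i] := (\1_(`[x k, x k.+1[%classic : set (mR R)) t)%:C.
have ci k : cintegrable leb IT (fun t => phi t * chi k t).
 apply: (cintegrableM mI (K := 1)) => //.
  by apply: cmeas_real; apply: measurable_funTS; apply: measurable_indic.
 by move=> t _; rewrite cabs_real indicE; case: (_ \in _); rewrite ?normr1 ?normr0.
rewrite (eq_cintegral _ (g := fun t : mR R => \sum_(0 <= k < K) phi t * chi k t * c k)); last first.
 move=> t _; rewrite /stepf mulr_suml; apply: eq_bigr => k _.
 by rewrite /chi indicE mem_setE in_itv /=; case: ifP => _; rewrite ?mulr1 ?mulr0 ?mul0r // mulrC.
rewrite (cintegral_sum mI) => [|k]; last exact: cintegrableZ.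
apply: eq_big_nat => k /andP[_ kK]; rewrite (cintegralZ mI) // mulrC; congr (_ * _).
have /andP[x0 _] := hx k (ltnW kK); have /andP[_ xT] := hx k.+1 kK.
rewrite prim_sub ?(ltW (xm k kK)) ?(ltW xT) //.
have IS : IT `&` `[x k, x k.+1[%classic = `[x k, x k.+1[%classic :> set R.
 by rewrite setIidr //; apply: sub_co => //; exact: ltW.
rewrite /cintegral -[in RHS]IS !Rintegral_mkcondr; congr (_ +i* _).
 by apply: eq_Rintegral => t _; rewrite /patch /chi indicE; case: (_ \in _); rewrite ?mulr1 ?mulr0.
by apply: eq_Rintegral => t _; rewrite /patch /chi indicE; case: (_ \in _); rewrite ?mulr1 ?mulr0.
Qed.

End Primitive.

Variables (F : R -> pt4 R -> R[i]) (Q : R).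
Hypothesis Q0 : 0 <= Q.
Hypothesis Fi : cintegrable dxt SL (fun z => F z.2 z.1).
Hypothesis FQ : forall g Y, class T o3 1 g Y ->
 cabs (cintegral dxt SL (fun z => F z.2 z.1 * ((g z.2 z.1)^*)%C)) <= Q * Y.

(** The k-th coefficient of F(t) with the free flow undone; the increments of its primitive are
    those of the Duhamel profile. *)
Definition phase_coef (k : Z4) (t : R) : R[i] := expi (t * sqnorm k) * fourier (F t) k.

Lemma phase_coef_int k : cintegrable leb IT (phase_coef k).
Proof. by have [_ i _] := pairing_coef T2 k (rb_expi (sqnorm k)) Fi. Qed.

Definition jump k s t : R := cabs (prim (phase_coef k) t - prim (phase_coef k) s).

(** The sum of the jumps to the power 3/2. If r^3 is this sum, then r^2 is the 3/2-variation along
    the chain. *)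
Definition chainsum k K (x : nat -> R) : R := \sum_(0 <= j < K) Num.sqrt (jump k (x j) (x j.+1)) ^+ 3.

Definition is_chain K (x : nat -> R) : Prop :=
 (forall j, (j <= K)%N -> 0 <= x j < T) /\ (forall j, (j < K)%N -> x j < x j.+1).

Lemma chainsum_ge0 k K x : 0 <= chainsum k K x.
Proof. by apply: sumr_ge0 => j _; rewrite exprn_ge0 // sqrtr_ge0. Qed.

(* Testing F against the step functions with values Delta / |Delta|^(1/2)
  recovers the 3/2-variation of its time primitives. *)
Lemma variation_duality (Xi : seq Z4) (K : Z4 -> nat) (x : Z4 -> nat -> R) (r : Z4 -> R) : uniq Xi ->
 (forall k, is_chain (K k) (x k)) -> (forall k, 0 <= r k) -> (forall k, r k ^+ 3 = chainsum k (K k) (x k)) ->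
 \sum_(k <- Xi) 4 ^+ lev k * r k ^+ 4 <= Q ^+ 2.
Proof.
move=> uXi hx r0 hr; set S := \sum_(k <- Xi) _.
have S0 : 0 <= S by apply: sumr_ge0 => k _; rewrite mulr_ge0 ?exprn_ge0.
pose D k j : R[i] := prim (phase_coef k) (x k j.+1) - prim (phase_coef k) (x k j).
pose c k j : R[i] := ((Num.sqrt (cabs (D k j)))^-1)%:C * D k j.
have sq k j : Num.sqrt (cabs (D k j)) ^+ 2 = cabs (D k j) by rewrite sqr_sqrtr ?cabs_ge0.
have cE k j : cabs (c k j) = Num.sqrt (cabs (D k j)).
 rewrite /c cabsM cabs_real ger0_norm ?invr_ge0 ?sqrtr_ge0 //.
 have [e|n] := eqVneq (Num.sqrt (cabs (D k j))) 0; first by rewrite e invr0 mul0r.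
 by rewrite -[X in _ * X]sq expr2 mulKf.
have cD k j : ((c k j)^*)%C * D k j = (Num.sqrt (cabs (D k j)) ^+ 3)%:C.
 rewrite /c conjM conjc_real -mulrA [_^*%C * _]mulrC mul_conj -rmorphM /=; congr (_%:C).
 have [e|n] := eqVneq (Num.sqrt (cabs (D k j))) 0; first by rewrite e invr0 mul0r expr0n.
 by rewrite -[X in _ * X ^+ 2]sq -exprM (exprS _ 3) mulKf.
(* With this weight the pairing evaluates to (2 pi)^4 S, while the class norm of the test function
   is at most 2 sqrt S. *)
pose b k : R := if k \in Xi then 4 ^+ lev k * r k else 0.
have b0 k : 0 <= b k by rewrite /b; case: ifP => // _; rewrite mulr_ge0 ?exprn_ge0.
pose v k t : R[i] := (b k)%:C * stepf (K k) (x k) (c k) t.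
have hv k : rctl (v k) (b k * (2 * r k)).
 rewrite -[X in X * _](ger0_norm (b0 k)) -cabs_real; apply: rctlZ; apply: stepf_rctl => //.
  by move=> j /(hx k).2/ltW.
 by rewrite hr; apply: eq_bigr => j _; rewrite cE.
have q4 n : (2 ^+ n) ^+ 2 = 4 ^+ n :> R by rewrite -exprM mulnC exprM (_ : 2 ^+ 2 = 4 :> R) //; ring.
have cls : class T o3 1 (fsum Xi v) (2 * Num.sqrt S).
 apply: (@class_fin R T T2 o3 1 (fsum Xi v) Xi v (fun k => b k * (2 * r k))) => //; first by left.
 move=> ls uls; rewrite exprMn sqr_sqrtr //.
 have e k : lw o3 (lev k) ^+ 2 * (b k * (2 * r k)) ^+ 2 = if k \in Xi then 4 * (4 ^+ lev k * r k ^+ 4) else 0.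
  rewrite /b; case: ifP => _; last by rewrite mul0r expr0n mulr0.
  rewrite /lw eqxx exprVn q4; have : 4 ^+ lev k != 0 :> R by exact: expf_neq0.
  by move=> h; field.
 rewrite (eq_bigr _ (fun k _ => e k)) -big_mkcond -big_filter.
 rewrite (_ : 2 ^+ 2 = 4 :> R); last by ring.
 rewrite /S [leRHS]mulr_sumr [leRHS](bigID (fun k => k \in ls)) /= -[X in _ <= X + _]big_filter.
 rewrite (perm_big [seq k <- Xi | k \in ls]) /=; last first.
  by apply: uniq_perm; rewrite ?filter_uniq // => k; rewrite !mem_filter andbC.
 by rewrite lerDl; apply: sumr_ge0 => k _; rewrite mulr_ge0 // mulr_ge0 ?exprn_ge0.
have := FQ cls.
have rbv k : rb (fun t => ((v k t)^*)%C * expi (t * sqnorm k)).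
 by apply: rbM; [apply: rb_conj; exact: rctl_rb (hv k)|exact: rb_expi].
have PK k := pairing_coef T2 k (rbv k) Fi.
have gE (z : pt5 R) : F z.2 z.1 * ((fsum Xi v z.2 z.1)^*)%C =
  \sum_(k <- Xi) F z.2 z.1 * ((((v k z.2)^*)%C * expi (z.2 * sqnorm k)) * expi (- dot z.1 k)).
 rewrite /fsum conj_sum mulr_sumr; apply: eq_bigr => k _; congr (_ * _).
 by rewrite conjM -expiN -mulrA -expiD; congr (_ * expi _); ring.
rewrite (eq_cintegral _ (fun z _ => gE z)) (cintegral_sum (@mslab R T)) => [|k]; last by have [] := PK k.
have -> : \sum_(k <- Xi) cintegral dxt SL (fun z => F z.2 z.1 * ((((v k z.2)^*)%C * expi (z.2 * sqnorm k)) * expi (- dot z.1 k))) =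
  ((2 * pi) ^+ 4 * S)%:C.
 rewrite rmorphM /= /S rmorph_sum mulr_sumr; apply: eq_big_seq => k kXi; have [_ _ ->] := PK k; congr (_ * _).
 rewrite (eq_cintegral _ (g := fun t : mR R => stepf (K k) (x k) (fun j => ((c k j)^*)%C) t * phase_coef k t * (b k)%:C)); last first.
  move=> t _; rewrite /v conjM conjc_real /phase_coef /stepf conj_sum.
  rewrite (eq_bigr (fun j => if x k j <= t < x k j.+1 then ((c k j)^*)%C else 0)); last by move=> j _; case: ifP => // _; rewrite conjc0.
  by ring.
 have mst : cmeasurable IT (stepf (K k) (x k) (fun j => ((c k j)^*)%C)) by apply: cmeas_rcont => //; exact: stepf_rcont.
 have si : cintegrable leb IT (fun t => stepf (K k) (x k) (fun j => ((c k j)^*)%C) t * phase_coef k t).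
  apply: (cintegrable_eq (@mIT R T) (f := fun t : mR R => phase_coef k t * stepf (K k) (x k) (fun j => ((c k j)^*)%C) t)).
   by move=> t _; rewrite mulrC.
  apply: (cintegrableM (@mIT R T) (K := \sum_(0 <= j < K k) cabs (c k j)) (phase_coef_int k)) => //.
  move=> t _; apply: le_trans (cabs_sum _ _ _) _; apply: ler_sum => j _.
  by case: ifP => _; rewrite ?cabs_conj // cabs0 cabs_ge0.
 rewrite (cintegralZ (@mIT R T)) // (cintegral_stepf (phase_coef_int k)); [|exact: (hx k).1|exact: (hx k).2].
 rewrite (eq_bigr (fun j => (Num.sqrt (cabs (D k j)) ^+ 3)%:C)); last by move=> j _; exact: cD.
 rewrite -rmorph_sum -rmorphM /=; congr (_%:C); rewrite -/(chainsum k (K k) (x k)) -hr /b kXi; ring.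
rewrite cabs_real ger0_norm; last by rewrite mulr_ge0 // exprn_ge0 // ltW // pi2_gt0.
move=> h.
(* The torus volume absorbs the constant 2 of [stepf_rctl]. *)
have p16 : 2 <= (2 * pi) ^+ 4 :> R.
 have h2 : 2 <= 2 * pi :> R by have := @pi_ge2 R; lra.
 apply: (le_via (2 ^+ 4)); first by rewrite ler_eXnr //; lra.
 by rewrite lerXn2r ?nnegrE //; lra.
have [e|Sn] := eqVneq S 0; first by rewrite e sqr_ge0.
have sp : 0 < Num.sqrt S by rewrite sqrtr_gt0 lt_def Sn.
have hs : Num.sqrt S <= Q.
 have h1 : 2 * S <= Q * (2 * Num.sqrt S) by apply: le_trans h; rewrite ler_wpM2r.
 have e : S = Num.sqrt S * Num.sqrt S by rewrite -expr2 sqr_sqrtr.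
 have h2 : 2 * (Num.sqrt S * Num.sqrt S) <= Q * (2 * Num.sqrt S) by rewrite -e.
 by rewrite -(ler_pM2r sp); lra.
by rewrite -(sqr_sqrtr S0) lerXn2r ?nnegrE ?sqrtr_ge0.
Qed.

End DuhamelDuality.

(** * The Duhamel term in X^1 *)

Section DuhamelBound.
Context {R : realType}.
Local Notation leb := (@lebesgue_measure R).

Lemma cbrt_ex (S : R) : 0 <= S -> {r : R | 0 <= r /\ r ^+ 3 = S}.
Proof.
move=> S0; exists (S `^ 3^-1); split; first exact: powR_ge0.
by rewrite -powR_mulrn ?powR_ge0 // -powRrM mulVf ?powRr1.
Qed.

Lemma U2_norm_on_ge0 T (u : R -> R[i]) : (0 <= U2_norm_on T u)%E.
Proof.
apply: le_ereal_inf_tmp => _ [v _ <-]; apply: le_ereal_inf_tmp => _ [l [a [_ _ ->]]].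
by apply: nneseries_ge0 => n _ _; rewrite lee_fin cabs_ge0.
Qed.

Lemma eq_U2_norm_on T (u w : R -> R[i]) : (forall t, 0 <= t < T -> u t = w t) -> U2_norm_on T u = U2_norm_on T w.
Proof.
move=> uw; rewrite /U2_norm_on; congr (ereal_inf (_ @` _)); apply/seteqP.
by split=> v hv t tT; rewrite hv // uw.
Qed.

Variables (T a : R) (F : R -> pt4 R -> R[i]) (Q : R).
Hypothesis T2 : T <= 2 * pi.
Hypothesis T0 : 0 < T.
Hypothesis aT : 0 <= a < T.
Hypothesis Q0 : 0 <= Q.
Hypothesis Fi : cintegrable dxdt (slab T) (fun z => F z.2 z.1).
Hypothesis FQ : forall g Y, class T o3 1 g Y ->
 cabs (cintegral dxdt (slab T) (fun z => F z.2 z.1 * ((g z.2 z.1)^*)%C)) <= Q * Y.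
Local Notation ph k := (phase_coef F k).

(** Undoing the flow removes t from the integrand; when t < a, the orientation of the integral
    supplies the sign. *)
Lemma duhamel_prim t k : 0 <= t < T ->
 schrodinger (- t) (duhamel a F t) k = prim (ph k) t - prim (ph k) a.
Proof.
move=> /andP[t0 tT]; have /andP[a0 aT'] := aT; have phi := phase_coef_int T2 Fi k.
have E (p q : R) : 0 <= p -> p <= q -> q < T ->
  cintegral leb (`[p, q]%classic : set (mR R)) (fun s => schrodinger (t - s) (hat F s) k) =
  (prim (ph k) q - prim (ph k) p) * expi (- (t * sqnorm k)).
 move=> p0 pq qT; rewrite -(prim_closed phi) //.
 have mD : @measurable _ (mR R) `[p, q]%classic by exact: measurable_itv.
 rewrite -(cintegralZ mD).
  apply: eq_cintegral => s _; rewrite /schrodinger /phase_coef /hat mulrAC -expiD.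
  by congr (expi _ * _); ring.
 apply: (cintegrable_sub phi) => // x /=; rewrite !in_itv /= => /andP[h1 h2].
 by rewrite (le_trans p0 h1) (le_lt_trans h2 qT).
have ee : expi (t * sqnorm k) * expi (- (t * sqnorm k)) = 1 :> R[i] by rewrite -expiD subrr expi0.
rewrite {1}/schrodinger mulNr opprK /duhamel /cintegral_from_to.
case: ifP => [le|/negbT]; first by rewrite E // mulrCA ee mulr1.
by rewrite -ltNge => lt; rewrite E ?(ltW lt) // -mulNr mulrCA ee mulr1 opprB.
Qed.

(** [variation_duality] at a single frequency. The crude bound only has to make the supremum over
    chains finite. *)
Lemma chainsum_bounded k K x : is_chain T K x -> chainsum F k K x <= (1 + Q ^+ 2) ^+ 3.
Proof.
move=> hx; pose r l := sval (cbrt_ex (chainsum_ge0 F l K x)).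
have rP l : 0 <= r l /\ r l ^+ 3 = chainsum F l K x by rewrite /r; case: cbrt_ex.
have := variation_duality T2 Q0 Fi FQ (Xi := [:: k]) (K := fun=> K) (x := fun=> x) (r := r).
move=> /(_ isT (fun=> hx) (fun l => (rP l).1) (fun l => (rP l).2)); rewrite big_seq1 => h.
have r0 := (rP k).1; rewrite -(rP k).2 lerXn2r ?nnegrE ?addr_ge0 ?sqr_ge0 //.
have [r1|r1] := leP (r k) 1; first by rewrite -[leLHS]addr0 lerD ?sqr_ge0.
apply: (le_via (r k ^+ 4)); first by rewrite ler_eXnr // ltW.
apply: (le_via (4 ^+ lev k * r k ^+ 4)); last by apply: le_trans h _; rewrite lerDr.
by rewrite ler_peMl ?exprn_ge0 // exprn_ege1 //; lra.
Qed.

Let E k := [set s | exists K x, is_chain T K x /\ s = chainsum F k K x].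
Let V k : R := sup (E k).

Let chain0 : is_chain T 0 (fun=> 0).
Proof. by split=> // j _; rewrite lexx T0. Qed.

Let E0 k : E k 0.
Proof. by exists 0%N, (fun=> 0); split; [exact: chain0|rewrite /chainsum big_geq]. Qed.

Let Eub k : has_ubound (E k).
Proof. by exists ((1 + Q ^+ 2) ^+ 3) => _ [K [x [hx ->]]]; exact: chainsum_bounded. Qed.

Let V0 k : 0 <= V k. Proof. by apply: ub_le_sup. Qed.

Let Vle k K x : is_chain T K x -> chainsum F k K x <= V k.
Proof. by move=> hx; apply: ub_le_sup => //; exists K, x. Qed.

(** The supremum over chains may not be attained; half of it is, and this gives the one chain per
    frequency on which duality is tested. *)
Let Vhalf k : {Kx : nat * (nat -> R) | is_chain T Kx.1 Kx.2 /\ V k <= 2 * chainsum F k Kx.1 Kx.2}.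
Proof.
apply: cid; have [e|n] := eqVneq (V k) 0.
 by exists (0%N, fun=> 0); split; [exact: chain0|rewrite e mulr_ge0 // chainsum_ge0].
have Vp : 0 < V k / 2 by rewrite divr_gt0 // lt_def n V0.
have [_ [K [x [hx ->]]] h] := sup_adherent Vp (conj (ex_intro _ 0 (E0 k)) (Eub k)).
by exists (K, x); split=> //=; move: h; rewrite -/(V k); lra.
Qed.

Let Rk k : R := sval (cbrt_ex (V0 k)).
Let RkP k : 0 <= Rk k /\ Rk k ^+ 3 = V k. Proof. by rewrite /Rk; case: cbrt_ex. Qed.

(** [chain_variation] turns the bound V k on chains into a control function; [U2_of_variation] then
    applies with A = (V k)^(2/3), which is [Rk k ^+ 2]. *)
Lemma U2_coef k : (U2_norm_on T (fun t => schrodinger (- t) (duhamel a F t) k) <= (36 * Rk k ^+ 2)%:E)%E.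
Proof.
rewrite (eq_U2_norm_on (w := fun t => prim (ph k) t - prim (ph k) a)); last by move=> t tT; exact: duhamel_prim.
have [r0 rV] := RkP k; have A3 : (Rk k ^+ 2) ^+ 3 = V k ^+ 2 by rewrite -rV -!exprM mulnC.
pose D := [set t : R | 0 <= t < T].
have [||om [om1 om2]] := @chain_variation R D (fun s t => Num.sqrt (jump F k s t) ^+ 3) (V k).
- by move=> s t; rewrite exprn_ge0 // sqrtr_ge0.
- by move=> K x h1 h2; apply: (@Vle k K x).
have sqj s t : Num.sqrt (jump F k s t) ^+ 2 = jump F k s t by rewrite sqr_sqrtr // cabs_ge0.
have omV t : D t -> om t = V k * (om t / V k).
 move=> Dt; have [e|n] := eqVneq (V k) 0; last by rewrite mulrC divfK.
 by have := om2 t Dt; rewrite e mul0r => h; apply/eqP; rewrite eq_le andbC.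
have jump3 s t : D s -> D t -> s < t -> jump F k s t ^+ 3 <= (om t - om s) ^+ 2.
 move=> Ds Dt st; have h := om1 s t Ds Dt st.
 have h0 : 0 <= Num.sqrt (jump F k s t) ^+ 3 by rewrite exprn_ge0 // sqrtr_ge0.
 rewrite -[X in X ^+ 3]sqj -exprM mulnC exprM lerXn2r ?nnegrE //; exact: le_trans h0 h.
have Din s t : 0 <= s -> s < t -> t < T -> D s /\ D t.
 by move=> s0 st tT; split; rewrite /D /= ?s0 ?(lt_trans st tT) ?tT ?andbT //; exact: ltW (le_lt_trans s0 st).
have inc s t : 0 <= s -> s < t -> t < T -> om s <= om t.
 move=> s0 st tT; have [Ds Dt] := Din _ _ s0 st tT; rewrite -subr_ge0; apply: le_trans (om1 s t Ds Dt st).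
 by rewrite exprn_ge0 // sqrtr_ge0.
apply: (@U2_of_variation R T (Rk k ^+ 2) _ (fun t => om t / V k)) => //; first exact: sqr_ge0.
- move=> t Dt; have /andP[h1 h2] := om2 t Dt; rewrite divr_ge0 //=.
 have [e|n] := eqVneq (V k) 0; first by rewrite e invr0 mulr0.
 by rewrite ler_pdivrMr ?mul1r // lt_def n V0.
- by move=> s t s0 st tT; rewrite ler_wpM2r ?invr_ge0 // inc.
- move=> s t s0 st tT; have [Ds Dt] := Din _ _ s0 st tT.
 rewrite (_ : prim (ph k) t - _ - _ = prim (ph k) t - prim (ph k) s); last by ring.
 rewrite A3 -exprMn mulrBr -!omV //; exact: jump3.
- move=> t tT; have := prim_rcont (phase_coef_int T2 Fi k) tT.
 apply: cvg_trans; apply: near_eq_cvg; near=> s; congr cabs; ring.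
move=> t tT; have j0 s u : 0 <= jump F k s u by exact: cabs_ge0.
have bd s u : D s -> D u -> s < u -> jump F k s u <= Rk k ^+ 2.
 move=> Ds Du su; rewrite -(@ler_pXn2r _ 3) ?nnegrE ?sqr_ge0 // A3; apply: le_trans (jump3 _ _ Ds Du su) _.
 have h0 : 0 <= om u - om s by apply: le_trans (om1 s u Ds Du su); rewrite exprn_ge0 // sqrtr_ge0.
 rewrite lerXn2r ?nnegrE //; have /andP[_ h1] := om2 u Du; have /andP[h2 _] := om2 s Ds; lra.
case: (ltgtP t a) => [ta|ta|->]; last by rewrite subrr cabs0 sqr_ge0.
 by rewrite cabsBC; exact: bd.
exact: bd.
Unshelve. all: by end_near. Qed.

Theorem duhamel_bound : (X_norm 1 T (duhamel a F) <= (2 ^+ 11 * Q)%:E)%E.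
Proof.
pose r k := sval (cbrt_ex (chainsum_ge0 F k (sval (Vhalf k)).1 (sval (Vhalf k)).2)).
have rP k : 0 <= r k /\ r k ^+ 3 = chainsum F k (sval (Vhalf k)).1 (sval (Vhalf k)).2 by rewrite /r; case: cbrt_ex.
have Rr k : Rk k <= 2 * r k.
 have [r0 rE] := rP k; have [R0 RE] := RkP k; have [_ h] := svalP (Vhalf k).
 rewrite -(@ler_pXn2r _ 3) ?nnegrE ?mulr_ge0 // RE; apply: le_trans h _; rewrite -rE exprMn.
 have := exprn_ge0 3 r0; have -> : 2 ^+ 3 = 8 :> R by ring.
 lra.
have C0 : 0 <= 2 ^+ 11 * Q by apply: mulr_ge0 Q0; exact: exprn_ge0.
suff h : (\esum_(k in [set: Z4]) ((japanese k `^ (2 * 1))%:E *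
  U2_norm_on T (fun t => schrodinger (- t) (duhamel a F t) k) ^+ 2) <= ((2 ^+ 11 * Q) ^+ 2)%:E)%E.
 have e0 : (0 <= \esum_(k in [set: Z4]) ((japanese k `^ (2 * 1))%:E *
  U2_norm_on T (fun t => schrodinger (- t) (duhamel a F t) k) ^+ 2))%E.
  by apply: esum_ge0 => k _; rewrite mule_ge0 ?sqre_ge0 // lee_fin powR_ge0.
 rewrite /X_norm; apply: le_trans (gt0_ler_poweR _ _ _ h) _ => //; rewrite ?in_itv /= ?e0 ?leey ?lee_fin ?sqr_ge0 //.
 by rewrite powR12_sqrt ?sqr_ge0 // sqrtr_sqr ger0_norm.
apply: ge_ereal_sup => _ [X [Xfin _] <-]; rewrite fsbig_finite //=.
pose Xi : seq Z4 := finmap.enum_fset (fset_set X); rewrite -/Xi.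
have uXi : uniq Xi by exact: finmap.fset_uniq.
have VD := variation_duality T2 Q0 Fi FQ uXi (fun k => (svalP (Vhalf k)).1) (fun k => (rP k).1) (fun k => (rP k).2).
apply: (le_via (\sum_(k <- Xi) ((2 ^+ 11) ^+ 2 * (4 ^+ lev k * r k ^+ 4))%:E)%E); last first.
 by rewrite sumEFin lee_fin -mulr_sumr [leRHS]exprMn; apply: ler_wpM2l => //; exact: sqr_ge0.
apply: lee_sum => k _.
have [r0 _] := rP k; have [R0 _] := RkP k; have U := U2_coef k; have U0 := U2_norm_on_ge0 T (fun t => schrodinger (- t) (duhamel a F t) k).
have L0 : 0 <= 4 ^+ lev k :> R by rewrite exprn_ge0.
have U4 : (U2_norm_on T (fun t => schrodinger (- t) (duhamel a F t) k) ^+ 2 <= ((36 * Rk k ^+ 2) ^+ 2)%:E)%E.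
 by rewrite EFin_expe lee_sqr // lee_fin mulr_ge0 // sqr_ge0.
apply: le_trans (lee_wpmul2l _ U4) _; first by rewrite lee_fin powR_ge0.
rewrite -EFinM lee_fin powR_jap1.
(* The constants 17 and 36 are rounded up to 2^5 and 2^6; the total 2^21 is below the square of
   2^11. *)
apply: (le_via (2 ^+ 5 * 4 ^+ lev k * (2 ^+ 6 * (2 * r k) ^+ 2) ^+ 2)).
 apply: ler_pM; rewrite ?sqr_ge0 //; first by rewrite addr_ge0 ?sqnorm_ge0.
  apply: le_trans (jap_lev k) _; rewrite ler_wpM2r //.
  have -> : 2 ^+ 5 = 32 :> R by ring.
  lra.
 rewrite lerXn2r ?nnegrE ?mulr_ge0 ?sqr_ge0 //; apply: ler_pM; rewrite ?sqr_ge0 //.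
  have -> : 2 ^+ 6 = 64 :> R by ring.
  lra.
 by rewrite lerXn2r ?nnegrE ?mulr_ge0 //; exact: Rr.
rewrite (_ : 2 ^+ 5 * _ * _ = 2 ^+ 21 * (4 ^+ lev k * r k ^+ 4)); last by ring.
rewrite ler_wpM2r //; first by apply: mulr_ge0 => //; exact: exprn_ge0.
by rewrite -exprM ler_weXn2l //; lra.
Qed.

End DuhamelBound.

(** * Constants and assembly *)

Section Assembly.
Context {R : realType}.

Lemma le_half_lty (f g : Z4 -> \bar R) : (forall k, 0 <= f k)%E -> (forall k, f k <= g k)%E ->
 ((\esum_(k in [set: Z4]) g k) `^ 2^-1 < +oo)%E -> ((\esum_(k in [set: Z4]) f k) `^ 2^-1 < +oo)%E.
Proof.
move=> f0 fg h; apply: poweR_lty; apply: le_lt_trans (lty_poweRy _ h); last by rewrite invr_eq0.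
by apply: le_esum => k _.
Qed.

Lemma size_ge0 T (u : R -> pt4 R -> R[i]) d P : (0 <= size_of T u d P)%E.
Proof. by case: d => [f|] /=; exact: poweR_ge0. Qed.

(** Treats the identity and both projections at once, as multipliers with values in [0, 1], and both
    ways of measuring a factor. *)
Lemma mult_data i T (u : R -> pt4 R -> R[i]) d (m : Z4 -> R) (P : (Z4 -> R[i]) -> Z4 -> R[i]) : i != o3 ->
 allowed T u d -> (forall k, 0 <= m k <= 1) -> (forall w k, P w k = (m k)%:C * w k) ->
 size_of T u d P \is a fin_num /\
 exists v a, ldata i T (fun t => P (hat u t)) v a (20 * fine (size_of T u d P)).
Proof.
move=> i3 hd m01 hP; have s1 : sgn i = 1 :> R by rewrite /sgn (negbTE i3).
have le1 k (z : R[i]) : cabs ((m k)%:C * z) <= cabs z.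
 have /andP[h1 h2] := m01 k; rewrite cabsM cabs_real ger0_norm // ler_piMl ?cabs_ge0 //.
have jap0 k : (0 <= (japanese k `^ (2 * 1))%:E :> \bar R)%E by rewrite lee_fin powR_ge0.
suff [h1 h2] : (size_of T u d P < +oo)%E /\ exists v a, ldata i T (fun t => P (hat u t)) v a (20 * fine (size_of T u d P)).
 by split=> //; rewrite ge0_fin_numE // size_ge0.
case: d hd => [f [fi Hf hu]|Yu] /=.
 have Hfin : (H_norm 1 (P (fourier f)) < +oo)%E.
  apply: le_half_lty Hf => k; first by rewrite mule_ge0 // lee_fin sqr_ge0.
  by rewrite lee_wpmul2l // lee_fin lerXn2r ?nnegrE ?cabs_ge0 // hP.
 split=> //; have := @H_data R i T (fun t => P (hat u t)) (P (fourier f)); rewrite s1; apply=> //.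
 move=> t tT; apply/funext => k; rewrite hP (hu t tT) /schrodinger hP; ring.
have Yfin : (Y_norm 1 T (fun t => P (hat u t)) < +oo)%E.
 apply: le_half_lty Yu => k; first by rewrite mule_ge0 // sqre_ge0.
 rewrite lee_wpmul2l // lee_sqr ?V2_norm_on_ge0 //.
 rewrite (_ : (fun t => schrodinger (- t) (P (hat u t)) k) = (fun t => (m k)%:C * schrodinger (- t) (hat u t) k)).
  exact: V2_norm_on_scale.
 by apply/funext => t; rewrite /schrodinger hP; ring.
by split=> //; have := @Y_data R i T (fun t => P (hat u t)); rewrite s1; exact.
Qed.

(** The constant 1 is an admissible dual function; pairing with it shows that the cubic product is
    integrable. *)
Lemma class_one T : T <= 2 * pi -> class T o3 1 (fun _ _ => 1 : R[i]) 1.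
Proof.
move=> T2; apply: (@class_fin R T T2 o3 1 _ [:: 0] (fun k _ => (k == 0)%:R) (fun k => cabs ((k == 0)%:R : R[i]))) => //.
- by move=> k; exact: rctl_cst.
- move=> t x _; rewrite /fsum big_seq1 eqxx mul1r expiD -/(ch4 0 x) ch4_0 mul1r.
 by rewrite /sqnorm /= expr0n mulr0 oppr0 expi0.
- by left.
move=> ls uls; rewrite expr1n; apply: (le_via (\sum_(k <- ls | k == 0) 1)).
 rewrite [leRHS]big_mkcond; apply: ler_sum => k _; case: eqP => _; last by rewrite cabs0 expr0n mulr0.
 rewrite cabs1 expr1n mulr1 /lw eqxx exprVn invf_le1 ?exprn_gt0 // -exprM exprn_ege1 //; lra.
have h : count (fun k => k == 0) ls = ((0 : Z4) \in ls) := count_uniq_mem 0 uls.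
by rewrite big_const_seq iter_addr addr0 h; case: (_ \in _); rewrite ?mulr1n ?mulr0n ?ler01 ?lexx.
Qed.

Lemma fourier_trig (W : Z4 -> R[i]) (ks : seq Z4) k : uniq ks -> (forall l, l \notin ks -> W l = 0) ->
 cintegrable dx4 (@box R) (trig W) /\ fourier (trig W) k = W k.
Proof.
move=> uks W0; pose K := undup (k :: ks); pose v l (_ : R) := W l.
have uK : uniq K by exact: undup_uniq.
have E x : trig W x = fsum K v 0 x.
 apply: trig_fsum => // l; first by rewrite mem_undup inE negb_or => /andP[_ /W0].
 by rewrite mul0r oppr0 expi0 mul1r.
have -> : trig W = fsum K v 0 by apply/funext.
split; last first.
 rewrite /fourier slice_coef //; last by rewrite mem_undup inE eqxx.
 rewrite mul0r oppr0 expi0 mul1r mulrA -rmorphM /= mulVf ?mul1r //.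
 by rewrite expf_neq0 // gt_eqF // pi2_gt0.
have mb := @mbox R; apply: (cintegrable_eq mb (f := fun x => \sum_(l <- K) ch4 l x * W l)).
 by move=> x _; apply: eq_bigr => l _; rewrite mul0r subr0 mulrC.
apply: (cintegrable_sum mb) => l; apply: (cintegrableZ mb).
apply: (cintegrable_bounded (K := 1)) => //; first exact: fin_box.
 exact: cmeasS (cmeas_ch4 l).
by move=> x _; rewrite cabs_ch4.
Qed.

(** In the support of the projection 2^lev <= 3 M0. After raising to the power 14 the claim becomes
    81 M0^4 <= 2^14 M0^(42/5). *)
Lemma c0_bound (T M0 : R) k : 0 < T <= 1 -> 1 <= M0 -> k \in kbox (Nbox M0) ->
 T ^+ 2 * 16 ^+ lev k <= (2 * (T `^ (1 / 7) * M0 `^ (3 / 5))) ^+ 14.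
Proof.
move=> /andP[T0 T1] M1; have M0p : 0 < M0 by lra.
rewrite kbox_mem => kN.
have N3 : (Nbox M0)%:R <= 3 * M0.
 rewrite /Nbox -natr1; have /andP[h _] := truncn_itv (ltac:(lra) : 0 <= 2 * M0); lra.
have l3 : 2 ^+ lev k <= 3 * M0.
 have [e|l0] := posnP (lev k); first by rewrite e expr0; lra.
 apply: le_trans N3; rewrite -natrX ler_nat; exact: leq_trans (lev_sup4 l0) kN.
have l16 : 16 ^+ lev k <= 81 * M0 ^+ 4.
 rewrite (_ : 16 = 2 ^+ 4 :> R); last by ring.
 rewrite -exprM mulnC exprM (_ : 81 * M0 ^+ 4 = (3 * M0) ^+ 4); last by ring.
 by rewrite lerXn2r ?nnegrE ?exprn_ge0 ?mulr_ge0 ?(ltW M0p).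
have e1 : (T `^ (1 / 7)) ^+ 14 = T ^+ 2.
 by rewrite -powR_mulrn ?powR_ge0 // -powRrM -powR_mulrn ?(ltW T0) //; congr powR; field.
have e2 : M0 ^+ 4 <= (M0 `^ (3 / 5)) ^+ 14.
 rewrite -[leRHS]powR_mulrn ?powR_ge0 // -powRrM -[leLHS]powR_mulrn ?(ltW M0p) //; apply: ler_powR => //; lra.
rewrite !exprMn e1 mulrCA ler_wpM2l ?sqr_ge0 //; apply: le_trans l16 _.
apply: ler_pM => //; first by rewrite exprn_ge0 // ltW.
have -> : 2 ^+ 14 = 2 ^+ 7 * 2 ^+ 7 :> R by rewrite -exprD.
have -> : 2 ^+ 7 = 128 :> R by ring.
lra.
Qed.

Lemma dual_bound_le psi T (F : R -> pt4 R -> R[i]) (B B' : \bar R) : (B <= B')%E ->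
 dual_bound psi T F B -> dual_bound psi T F B'.
Proof.
move=> BB [h1 h2]; split=> [g Yg|g sg g2 Yg].
 by have [l hl lb] := h1 g Yg; exists l => //; apply: le_trans lb _; rewrite lee_wpmul2r // poweR_ge0.
by have [l hl lb] := h2 g sg g2 Yg; exists l => //; apply: le_trans lb _; rewrite lee_wpmul2r // poweR_ge0.
Qed.

Lemma twenty_le n : 20 ^+ n <= (2 ^+ 5) ^+ n :> R.
Proof.
have h : 20 <= 2 ^+ 5 :> R by rewrite (_ : 2 ^+ 5 = 32 :> R); [lra|ring].
by rewrite lerXn2r ?nnegrE ?exprn_ge0.
Qed.

Lemma dual_const (c h a l b : R) : 0 <= c -> 0 <= h -> 0 <= a -> 0 <= l -> 0 <= b ->
 20 * (c * (2 * h) * (20 * a * (20 * l) * (20 * b))) <= 2 ^+ 27 * c * (h * a * l * b).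
Proof.
move=> c0 h0 a0 l0 b0; rewrite (_ : 20 * _ = 20 ^+ 4 * (2 * (c * (h * a * l * b)))); last by ring.
rewrite (_ : 2 ^+ 27 * c * _ = 2 ^+ 26 * (2 * (c * (h * a * l * b)))); last by ring.
rewrite ler_wpM2r ?mulr_ge0 //; apply: le_trans (twenty_le 4) _.
by rewrite -exprM ler_weXn2l //; lra.
Qed.

Lemma dual_const1 (c a l b : R) : 0 <= c -> 0 <= a -> 0 <= l -> 0 <= b ->
 20 * (c * 1 * (20 * a * (20 * l) * (20 * b))) <= 2 ^+ 27 * c * (a * l * b).
Proof.
move=> c0 a0 l0 b0; have h2 : 0 <= 1 / 2 :> R by lra.
have := dual_const c0 h2 a0 l0 b0; rewrite (_ : 2 * (1 / 2) = 1 :> R); last by field.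
move=> h; apply: le_trans h _; rewrite ler_wpM2l //; first by apply: mulr_ge0 => //; exact: exprn_ge0.
have p0 : 0 <= a * l * b by rewrite !mulr_ge0.
by rewrite (_ : 1 / 2 * a * l * b = 1 / 2 * (a * l * b)); [lra|ring].
Qed.

Lemma duhamel_const (c a l h b e : R) : 0 <= c -> 0 <= a -> 0 <= l -> 0 <= h -> 0 <= b -> 0 <= e ->
 2 ^+ 11 * (c * (2 * e) * (20 * a * (20 * l) * (20 * b)) + c * 1 * (20 * a * (20 * h) * (20 * b))) <=
 2 ^+ 27 * c * (a * (e * l + h) * b).
Proof.
move=> c0 a0 l0 h0 b0 e0.
rewrite (_ : 2 ^+ 11 * _ = 20 ^+ 3 * (2 ^+ 11 * (c * a * b * (2 * (e * l) + h)))); last by ring.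
rewrite (_ : 2 ^+ 27 * c * _ = 2 ^+ 16 * (2 ^+ 11 * (c * a * b * (e * l + h)))); last by ring.
have p0 : 0 <= c * a * b by rewrite !mulr_ge0.
have el : 0 <= e * l by rewrite mulr_ge0.
have q : 0 <= 2 ^+ 11 :> R by exact: exprn_ge0.
apply: (le_via ((2 ^+ 5) ^+ 3 * (2 ^+ 11 * (c * a * b * (2 * (e * l) + h))))).
 rewrite ler_wpM2r ?twenty_le //; apply: (mulr_ge0 q); apply: (mulr_ge0 p0); lra.
rewrite -exprM (_ : 2 ^+ 16 = 2 ^+ (5 * 3) * 2 :> R); last by rewrite -exprSr.
rewrite [leRHS](_ : _ = 2 ^+ (5 * 3) * (2 ^+ 11 * (c * a * b * (2 * (e * l + h))))); last by ring.
apply: ler_wpM2l; first exact: exprn_ge0.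
by apply: (ler_wpM2l q); apply: (ler_wpM2l p0); lra.
Qed.

Lemma cmain_gt0 : 0 < cmain :> R.
Proof. by apply: mulr_gt0; apply: exprn_gt0 => //; exact: pi2_gt0. Qed.

End Assembly.

Theorem lemma2p2 (R : realType) (psi : R -> R) (hpsi : lp_profile psi) :
  exists2 C : R, 0 < C &
  forall (T M0 a : R) (u1 u2 u3 : R -> pt4 R -> R[i]),
    0 < T <= 1 -> 1 <= M0 -> 0 <= a < T ->
    spacetime_fun T u1 -> spacetime_fun T u2 -> spacetime_fun T u3 ->
    let F := mul3 u1 u2 u3 in
    let low2 := fun t => Ple psi M0 (hat u2 t) in
    let high2 := fun t => Pgt psi M0 (hat u2 t) in
    let c0 := T `^ (1 / 7) * M0 `^ (3 / 5) in
    (* high frequency estimate *)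
    ((Y_norm 1 T (hat u1) < +oo)%E -> (Y_norm 1 T (hat u2) < +oo)%E ->
     (Y_norm 1 T (hat u3) < +oo)%E ->
     dual_bound psi T F
       (C%:E * (Y_norm 1 T (hat u1) * Y_norm 1 T (hat u2)
                * Y_norm 1 T (hat u3)))%E) /\
    (* low frequency estimate *)
    ((Y_norm 1 T (hat u1) < +oo)%E -> (Y_norm 1 T low2 < +oo)%E ->
     (Y_norm 1 T (hat u3) < +oo)%E ->
     dual_bound psi T (mul3 u1 (fun t => Ple_fun psi M0 (u2 t)) u3)
       (C%:E * (c0%:E * Y_norm 1 T (hat u1) * Y_norm 1 T low2
                * Y_norm 1 T (hat u3)))%E) /\
    (* Duhamel form *)
    ((Y_norm 1 T (hat u1) < +oo)%E -> (Y_norm 1 T (hat u2) < +oo)%E ->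
     (Y_norm 1 T (hat u3) < +oo)%E ->
     (X_norm 1 T (duhamel a F)
       <= C%:E * (Y_norm 1 T (hat u1)
                  * (c0%:E * Y_norm 1 T low2 + Y_norm 1 T high2)
                  * Y_norm 1 T (hat u3)))%E /\
     (X_norm 1 T (duhamel a F)
       <= C%:E * (Y_norm 1 T (hat u1) * Y_norm 1 T (hat u2)
                  * Y_norm 1 T (hat u3)))%E) /\
    (* any of the u_j that are free solutions may be measured by their data *)
    (forall d1 d2 d3 : option (pt4 R -> R[i]),
     allowed T u1 d1 -> allowed T u2 d2 -> allowed T u3 d3 ->
     (X_norm 1 T (duhamel a F)
       <= C%:E * (size_of T u1 d1 id
                  * (c0%:E * size_of T u2 d2 (Ple psi M0)
                     + size_of T u2 d2 (Pgt psi M0))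
                  * size_of T u3 d3 id))%E /\
     (X_norm 1 T (duhamel a F)
       <= C%:E * (size_of T u1 d1 id * size_of T u2 d2 id
                  * size_of T u3 d3 id))%E).
Proof.
exists (2 ^+ 27 * cmain); first by apply: mulr_gt0 cmain_gt0; exact: exprn_gt0.
move=> T M0 a u1 u2 u3 hT M1 aT s1 s2 s3 F low2 high2 c0.
have /andP[T0 T1] := hT; have M0p : 0 < M0 by lra.
have T2 : T <= 2 * pi by have := @pi_ge2 R; lra.
have cm := @cmain_ge0 R.
have c00 : 0 <= c0 by rewrite mulr_ge0 ?powR_ge0.
have id01 : forall k : Z4, 0 <= (fun=> 1 : R) k <= 1 by move=> k; rewrite ler01 lexx.
have idE (w : Z4 -> R[i]) k : id w k = (1 : R)%:C * w k by rewrite mul1r.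
have smooth i u d : i != o3 -> spacetime_fun T u -> allowed T u d ->
  size_of T u d id \is a fin_num /\ class T i 1 u (20 * fine (size_of T u d id)).
 move=> i3 su hd; have [fS [v [b D]]] := mult_data i3 hd id01 idE; split=> //.
 exact: (class_smooth T2 i3 su D).
(* The low part is a finite sum over a box, so it serves as its own approximation, and its bounded
   frequencies meet the condition with h = 2 c0. *)
have lowclass rho v b : ldata o1 T low2 v b rho ->
  class T o1 (2 * c0) (fun t x => Ple_fun psi M0 (u2 t) x) rho.
 move=> [r0 hv hw hb]; apply: (@class_fin R T T2 o1 (2 * c0) _ (kbox (Nbox M0)) v b) => //.
 - exact: kbox_uniq.
 - move=> t x tT; apply: trig_fsum; first exact: kbox_uniq.
   by move=> k kk; rewrite /Ple -/(psiM psi M0 k) psiM_high // mul0r.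
  by move=> k; exact: hw.
 - by right=> k kk; exact: c0_bound.
have dual_low Y1 Yl Y3 : class T o0 1 u1 (20 * Y1) -> class T o1 (2 * c0) (fun t x => Ple_fun psi M0 (u2 t) x) (20 * Yl) ->
  class T o2 1 u3 (20 * Y3) -> 0 <= Y1 -> 0 <= Yl -> 0 <= Y3 ->
  dual_bound psi T (mul3 u1 (fun t => Ple_fun psi M0 (u2 t)) u3) (2 ^+ 27 * cmain * (c0 * Y1 * Yl * Y3))%:E.
 move=> k1 kl k3 y1 yl y3; have h2c : 0 <= 2 * c0 by rewrite mulr_ge0.
 apply: dual_bound_le (dual_bound_core T2 (ltW T0) hpsi h2c k1 kl k3).
 by rewrite lee_fin dual_const.
(* Both ways of measuring are proved together; choosing [None] three times gives the plain Duhamel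
   form. *)
have est d1 d2 d3 : allowed T u1 d1 -> allowed T u2 d2 -> allowed T u3 d3 ->
  (X_norm 1 T (duhamel a F)
    <= (2 ^+ 27 * cmain)%:E * (size_of T u1 d1 id
         * (c0%:E * size_of T u2 d2 (Ple psi M0)
           + size_of T u2 d2 (Pgt psi M0))
         * size_of T u3 d3 id))%E /\
   (X_norm 1 T (duhamel a F)
    <= (2 ^+ 27 * cmain)%:E * (size_of T u1 d1 id * size_of T u2 d2 id
         * size_of T u3 d3 id))%E.
 move=> h1 h2 h3; have mS := @mslab R T.
 have [f1 k1] := smooth o0 u1 d1 isT s1 h1; have [f2 k2] := smooth o1 u2 d2 isT s2 h2.
 have [f3 k3] := smooth o2 u3 d3 isT s3 h3.
 have pgt01 k : 0 <= 1 - psiM psi M0 k <= 1 by have /andP[p1 p2] := psiM01 hpsi M0 k; rewrite subr_ge0 p2 gerBl p1.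
 have pgtE (w : Z4 -> R[i]) k : Pgt psi M0 w k = (1 - psiM psi M0 k)%:C * w k.
  by rewrite /Pgt /Ple -/(psiM psi M0 k) rmorphB /= mulrBl mul1r.
 have [fl [vl [bl Dl]]] := mult_data (isT : o1 != o3) h2 (psiM01 hpsi M0) (fun w k => erefl : Ple psi M0 w k = (psiM psi M0 k)%:C * w k).
 have [fh [vh [bh Dh]]] := mult_data (isT : o1 != o3) h2 pgt01 pgtE.
 have kl := lowclass _ _ _ Dl.
 (* The high part as a function: u2 minus a trigonometric polynomial, whose coefficients are then
    seen to be those of the high projection. *)
 pose uh t x := u2 t x - Ple_fun psi M0 (u2 t) x.
 have ple0 (w : Z4 -> R[i]) k : k \notin kbox (Nbox M0) -> Ple psi M0 w k = 0.
  by move=> kk; rewrite /Ple -/(psiM psi M0 k) psiM_high // mul0r.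
 have hatuh t k : 0 <= t < T -> cintegrable dx4 (@box R) (uh t) /\ hat uh t k = Pgt psi M0 (hat u2 t) k.
  move=> tT; have [g1 g2] := fourier_trig k (kbox_uniq (Nbox M0)) (ple0 (fourier (u2 t))).
  have ui := s2.2 t tT; have mb := @mbox R.
  have ch (w : pt4 R -> R[i]) : cintegrable dx4 (@box R) w -> cintegrable dx4 (@box R) (fun x => w x * expi (- dot x k)).
   move=> wi; apply: (cintegrableM mb (K := 1)) => //; last by move=> x _; rewrite cabs_expi.
   apply: (cmeas_eq (f := fun x => ch4 (- k) x)); first by move=> x _; rewrite ch4N /ch4 expiN.
   exact: cmeasS (cmeas_ch4 _).
  split.
   apply: (cintegrable_eq mb (f := fun x => u2 t x + Ple_fun psi M0 (u2 t) x * (-1))); first by move=> x _; rewrite /uh; ring.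
   by apply: (cintegrableD mb) => //; exact: (cintegrableZ mb).
  rewrite /Pgt /hat -[in RHS]g2 /fourier -mulrBr; congr (_ * _).
  rewrite (eq_cintegral _ (g := fun x => u2 t x * expi (- dot x k) + Ple_fun psi M0 (u2 t) x * expi (- dot x k) * (-1))); last first.
   by move=> x _; rewrite /uh; ring.
  rewrite (cintegralD mb (ch _ ui) (cintegrableZ mb (-1) (ch _ g1))) (cintegralZ mb _ (ch _ g1)).
  by rewrite mulrN1.
 have suh : spacetime_fun T uh.
  split; last by move=> t tT; exact: (hatuh t 0 tT).1.
  apply: cmeasB; first exact: s2.1.
  have [_ hvl hwl _] := Dl.
  apply: (cmeas_eq (f := fun z : pt5 R => fsum (kbox (Nbox M0)) vl z.2 z.1)).
   move=> z [_ zT]; symmetry; apply: trig_fsum; [exact: kbox_uniq|exact: ple0|].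
   by move=> k; apply: hwl; move: zT; rewrite /= in_itv.
  by apply: fsum_cmeas => // k; exact: rctl_rb (hvl k).
 have kh : class T o1 1 uh (20 * fine (size_of T u2 d2 (Pgt psi M0))).
  apply: (class_smooth T2 (isT : o1 != o3) suh (v := vh) (a := bh)); have [r0 hv hw hb] := Dh.
  by split=> // t k tT; rewrite (hatuh t k tT).2; exact: hw.
 have Fi : cintegrable dxdt (slab T) (fun z => F z.2 z.1).
  have [i1 _] := four_classes T2 (ltW T0) false ler01 k1 k2 k3 (class_one T2).
  by apply: (cintegrable_eq mS) i1 => z _; rewrite /cjif mulr1.
 pose S1 := fine (size_of T u1 d1 id); pose S2 := fine (size_of T u2 d2 id); pose S3 := fine (size_of T u3 d3 id).
 pose Sl := fine (size_of T u2 d2 (Ple psi M0)); pose Sh := fine (size_of T u2 d2 (Pgt psi M0)).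
 have fge (u : R -> pt4 R -> R[i]) d P : 0 <= fine (size_of T u d P) by rewrite fine_ge0 // size_ge0.
 have S10 : 0 <= S1 by exact: fge. have S20 : 0 <= S2 by exact: fge. have S30 : 0 <= S3 by exact: fge.
 have Sl0 : 0 <= Sl by exact: fge. have Sh0 : 0 <= Sh by exact: fge.
 have h2c : 0 <= 2 * c0 by rewrite mulr_ge0.
 have prod0 (c x y z : R) : 0 <= c -> 0 <= x -> 0 <= y -> 0 <= z -> 0 <= cmain * c * (20 * x * (20 * y) * (20 * z)).
  by move=> *; apply: mulr_ge0; [exact: mulr_ge0|rewrite !mulr_ge0].
 have regroup (c Y0 Y1 Y2 Y : R) : cmain * c * (Y0 * Y1 * Y2 * Y) = cmain * c * (Y0 * Y1 * Y2) * Y by rewrite !mulrA.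
 split.
  (* The product splits along u2 = low + high, and the two dual bounds add. *)
  pose Ql := cmain * (2 * c0) * (20 * S1 * (20 * Sl) * (20 * S3)); pose Qh := cmain * 1 * (20 * S1 * (20 * Sh) * (20 * S3)).
  have Q0 : 0 <= Ql + Qh by rewrite addr_ge0 // prod0.
  have FQ g Y : class T o3 1 g Y -> cabs (cintegral dxdt (slab T) (fun z => F z.2 z.1 * ((g z.2 z.1)^*)%C)) <= (Ql + Qh) * Y.
   move=> kg; have [i1 b1] := four_classes T2 (ltW T0) true h2c k1 kl k3 kg.
   have [i2 b2] := four_classes T2 (ltW T0) true ler01 k1 kh k3 kg.
   rewrite (eq_cintegral _ (g := fun z : pt5 R =>
    u1 z.2 z.1 * Ple_fun psi M0 (u2 z.2) z.1 * u3 z.2 z.1 * cjif true (g z.2 z.1) +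
    u1 z.2 z.1 * uh z.2 z.1 * u3 z.2 z.1 * cjif true (g z.2 z.1))); last by move=> z _; rewrite /F /mul3 /uh /cjif; ring.
   rewrite (cintegralD mS i1 i2); apply: le_trans (cabsD _ _) _; rewrite mulrDl.
   by apply: lerD; [rewrite /Ql -regroup|rewrite /Qh -regroup].
  apply: le_trans (duhamel_bound T2 T0 aT Q0 Fi FQ) _.
  rewrite -(fineK f1) -(fineK f3) -(fineK fl) -(fineK fh) -[leRHS]/((2 ^+ 27 * cmain * (S1 * (c0 * Sl + Sh) * S3))%:E) lee_fin.
  exact: duhamel_const.
 pose Q := cmain * 1 * (20 * S1 * (20 * S2) * (20 * S3)).
 have Q0 : 0 <= Q by exact: prod0.
 have FQ g Y : class T o3 1 g Y -> cabs (cintegral dxdt (slab T) (fun z => F z.2 z.1 * ((g z.2 z.1)^*)%C)) <= Q * Y.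
  by move=> kg; have [_ b1] := four_classes T2 (ltW T0) true ler01 k1 k2 k3 kg; rewrite /Q -regroup.
 apply: le_trans (duhamel_bound T2 T0 aT Q0 Fi FQ) _.
 rewrite -(fineK f1) -(fineK f2) -(fineK f3) -!EFinM lee_fin.
 (* The second bound follows from the numerical inequality of the first with the low part and its
    factor set to 0. *)
 have z0 : (0 : R) <= 0 by [].
 have h := @duhamel_const R cmain S1 0 S2 S3 0 cm S10 z0 S20 S30 z0.
 have e1 : cmain * (2 * 0) * (20 * S1 * (20 * 0) * (20 * S3)) + cmain * 1 * (20 * S1 * (20 * S2) * (20 * S3)) = Q.
  by rewrite [2 * 0]mulr0 mulr0 mul0r add0r.
 by move: h; rewrite e1 mul0r add0r.
split.
 move=> y1 y2 y3; have [f1 k1] := smooth o0 u1 None isT s1 y1; have [f2 k2] := smooth o1 u2 None isT s2 y2.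
 have [f3 k3] := smooth o2 u3 None isT s3 y3; rewrite /= in f1 k1 f2 k2 f3 k3.
 apply: dual_bound_le (dual_bound_core T2 (ltW T0) hpsi ler01 k1 k2 k3).
 rewrite -(fineK f1) -(fineK f2) -(fineK f3) -!EFinM lee_fin.
 have y0 (w : R -> Z4 -> R[i]) : 0 <= fine (Y_norm 1 T w) by rewrite fine_ge0 // poweR_ge0.
 by apply: dual_const1; [exact: cm|exact: y0|exact: y0|exact: y0].
split.
 move=> y1 yl y3; have [f1 k1] := smooth o0 u1 None isT s1 y1; have [f3 k3] := smooth o2 u3 None isT s3 y3.
 rewrite /= in f1 k1 f3 k3.
 have e1 : sgn o1 = 1 :> R by [].
 have [vl [bl Dl]] := @Y_data R o1 T low2 yl; rewrite e1 in Dl.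
 have fl : Y_norm 1 T low2 \is a fin_num by rewrite ge0_fin_numE // poweR_ge0.
 rewrite -(fineK f1) -(fineK fl) -(fineK f3) -!EFinM.
 have y0 (w : R -> Z4 -> R[i]) : 0 <= fine (Y_norm 1 T w) by rewrite fine_ge0 // poweR_ge0.
 exact: (dual_low _ _ _ k1 (lowclass _ _ _ Dl) k3 (y0 _) (y0 _) (y0 _)).
split; last exact: est.
by move=> y1 y2 y3; exact: (est None None None y1 y2 y3).
Qed.
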